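(* Let $j,\omega\in\mathbb C$ satisfy $j^4=1$ and $\omega^3=i^{n/2}j^{-1}$. The pre-quantum representation $\hat\rho_k$ of $SL(2,\mathbb Z)$ on $$\mathcal H^{(k)}\simeq\bigl(L^2(\mathfrak t)\otimes\mathbb C^{\mathcal Z_{(k)}}\bigr)^W=\bigl(L^2(F_0)\otimes\overline C_{(k)}\bigr)\oplus\bigl(L^2(F_0)\otimes C_{(k)}\bigr)$$ splits into the direct sum of two representations, induced by this decomposition, $$\hat\rho_k=(\hat\rho'_{k,0}\otimes\hat\rho''_{k,0})\oplus(\hat\rho'_{k,1}\otimes\hat\rho''_{k,1}),$$ where, for $\theta\in F_0$, $\alpha,\beta\in\overline I_k$ and $\alpha',\beta'\in I_k$, $$\hat\rho'_{k,0}(S)(f)(\theta)=j\int_{F_0}f(\tilde\theta)\sum_{w\in W}e^{2\pi i(w\theta,\tilde\theta)_k}\,d\mathrm{vol}_k(\tilde\theta),$$ $$\hat\rho'_{k,1}(S)(f)(\theta)=j\int_{F_0}f(\tilde\theta)\sum_{w\in W}\det(w)\,e^{2\pi i(w\theta,\tilde\theta)_k}\,d\mathrm{vol}_k(\tilde\theta),$$ $$\hat\rho'_{k,0}(T)(f)(\theta)=\hat\rho'_{k,1}(T)(f)(\theta)=\omega e^{-\pi i(\theta,\theta)_k}f(\theta),$$ $$\hat\rho''_{k,0}(S)_{\alpha,\beta}=\frac{j^{-1}}{\sqrt{|\mathcal Z_{(k)}|}}\sum_{w\in W}e^{2\pi i(w\alpha,\beta)_k},$$ $$\hat\rho''_{k,1}(S)_{\alpha',\beta'}=\frac{j^{-1}}{\sqrt{|\mathcal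 Z_{(k)}|}}\sum_{w\in W}\det(w)\,e^{2\pi i(w\alpha',\beta')_k},$$ $$\hat\rho''_{k,0}(T)_{\alpha,\beta}=\omega^{-1}e^{\pi i(\alpha,\alpha)_k}\delta_{\alpha,\beta},\qquad \hat\rho''_{k,1}(T)_{\alpha',\beta'}=\omega^{-1}e^{\pi i(\alpha',\alpha')_k}\delta_{\alpha',\beta'}.$$
   Context: Lie-theoretic setting: $G$ is a compact, simple, connected, simply connected Lie group of rank $n$, $\mathbb T\subset G$ a maximal torus with Lie algebra $\mathfrak t$, $W$ the Weyl group, $\det(w)$ its sign character. $(\cdot,\cdot)_1$ is the preferred invariant inner product on $\mathfrak t$ (a negative multiple of the trace form), normalized so that long roots have squared length $2$ under the induced identification $\mathfrak t\cong\mathfrak t^*$. $\Lambda^R\subset\mathfrak t$ is the coroot lattice, so $\mathbb T=\mathfrak t/\Lambda^R$. For an integer $k\ge1$, $(\cdot,\cdot)_k=k(\cdot,\cdot)_1$, $d\mathrm{vol}_k$ is the induced measure on $\mathfrak t$, $\Lambda^w_{(k)}=\{\gamma\in\mathfrak t:(\gamma,\lambda)_k\in\mathbb Z\ \forall\lambda\in\Lambda^R\}\supset\Lambda^R$, and $\mathcal Z_{(k)}=\Lambda^w_{(k)}/\Lambda^R$, a finite abelian group. Write $\langle x,y\rangle=e^{2\pi i(x,y)_k}$. With $\Delta_+$ a set of positive roots and $\Delta$ the simple roots, $F_0=\{x\in\mathfrak t:(x,\alpha)_1>0\ \forall\alpha\in\Delta\}$ is the fundamental Weyl chamber, $A=\{x\in\mathfrak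 t:0<(x,\alpha)_1<1\ \forall\alpha\in\Delta_+\}$ the fundamental alcove, $I_k=\Lambda^w_{(k)}\cap A$, $\overline I_k=\Lambda^w_{(k)}\cap\overline A$. In the space $\mathbb C^{\mathcal Z_{(k)}}$ of functions on $\mathcal Z_{(k)}$, with delta functions $\delta_\gamma$, $\overline C_{(k)}$ (resp. $C_{(k)}$) is the subspace of $W$-invariant (resp. $W$-anti-invariant, $x(w\gamma)=\det(w)x(\gamma)$) functions, with basis $e_\alpha=|W|^{-1/2}\sum_{w\in W}\delta_{w\alpha}$, $\alpha\in\overline I_k$ (resp. $\tilde e_\alpha=|W|^{-1/2}\sum_{w\in W}\det(w)\delta_{w\alpha}$, $\alpha\in I_k$). Indices $\alpha,\beta$ (resp. $\alpha',\beta'$) of matrix entries refer to these bases. $(L^2(\mathfrak t)\otimes\mathbb C^{\mathcal Z_{(k)}})^W$ is the space of invariants for the action $(\hat w\cdot f)(\theta,\gamma)=f(w\theta,w\gamma)$. In the stated decomposition, $L^2(F_0)$ stands in the first summand for the $W$-invariant functions in $L^2(\mathfrak t,d\mathrm{vol}_k)$, and in the second for the $W$-anti-invariant functions ($f(w\theta)=\det(w)f(\theta)$), each being isomorphic to $L^2(F_0)$ by restriction to the Weyl chamber $F_0$. Pre-quantum representation: sections of the level-$k$ Chern–Simons line bundle $\pi^*\mathcal L^k$ on $\mathbb T\times\mathbb T$ are functions $\psi$ on $\mathfrak t\oplus\mathfrak t$ with $\psi(\theta_1+\lambda_1,\theta_2+\lambda_2)=(-1)^{(\lambda_1,\lambda_2)_k}e^{-\pi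 i((\theta_1,\lambda_2)_k-(\lambda_1,\theta_2)_k)}\psi(\theta_1,\theta_2)$ for $\lambda_1,\lambda_2\in\Lambda^R$; $\mathcal H^{(k)}$, the space of sections of $\mathcal L^k$ over the moduli space $(\mathbb T\times\mathbb T)/W$ of flat $G$-connections on a genus one surface, consists of those invariant under the diagonal $W$-action. $SL(2,\mathbb Z)$ is generated by $S=\begin{pmatrix}0&-1\\1&0\end{pmatrix}$, $T=\begin{pmatrix}1&1\\0&1\end{pmatrix}$ with relations $S^2=(ST)^3$, $S^4=\mathrm{Id}$, and acts by $(\tilde S\psi)(\theta_1,\theta_2)=\psi(\theta_2,-\theta_1)$, $(\tilde T\psi)(\theta_1,\theta_2)=\psi(\theta_1,\theta_1+\theta_2)$. The Weil–Gel'fand–Zak transform $Z$, an isometry from $L^2(\mathfrak t)\otimes\mathbb C^{\mathcal Z_{(k)}}$ to $L^2$-sections of $\pi^*\mathcal L^k$, is (on Schwartz functions) $Z(f)(\theta_1,\theta_2)=|\mathcal Z_{(k)}|^{-1/2}\langle-\theta_1/2,\theta_2\rangle\sum_{\gamma\in\mathcal Z_{(k)}}\sum_{\lambda\in\Lambda^w_{(k)}}f_\gamma(\theta_1+\lambda)\langle-\lambda,\theta_2\rangle\langle-\lambda,\gamma\rangle$, and $\mathsf F(f)(\theta,\gamma)=|\mathcal Z_{(k)}|^{-1/2}\sum_{\hat\gamma\in\mathcal Z_{(k)}}f_{\hat\gamma}(\theta)\langle\gamma,\hat\gamma\rangle$. The operator $Z\circ\mathsf F$ is $W$-equivariant and gives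 the identification $\mathcal H^{(k)}\simeq(L^2(\mathfrak t)\otimes\mathbb C^{\mathcal Z_{(k)}})^W$. Then $\hat\rho_k(S)=(Z\circ\mathsf F)^{-1}\circ\tilde S\circ(Z\circ\mathsf F)$ and $\hat\rho_k(T)=(Z\circ\mathsf F)^{-1}\circ\tilde T\circ(Z\circ\mathsf F)$.
   Formalization: The S-kernel of ρ''_k has −2πi for +2πi; for ρ''_{k,0} it is divided by the order of the stabilizer of α's class in W; the splitting is of the W-invariants with values in \bar C_(k)⊕C_(k), not of all H^(k); the integral formulas are for f integrable on F_0. *)

(* Defs.v *)
From HB Require Import structures.
From mathcomp Require Import all_boot all_order all_algebra.
From mathcomp Require Import finmap complex.
From mathcomp Require Import all_classical all_reals all_analysis.
Set Implicit Arguments.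
Unset Strict Implicit.
Unset Printing Implicit Defensive.
Import Order.TTheory GRing.Theory Num.Theory.
Import numFieldNormedType.Exports.
Local Open Scope classical_set_scope.
Local Open Scope ring_scope.

(* Borel sigma-algebra and Lebesgue measure on the column vectors 'cV[R]_n.   *)

Definition cV_display : measure_display.
Proof. exact. Qed.

Section measurable_cV.
Context {R : realType} {n : nat}.
Let coord (i : 'I_n) (v : 'cV[R]_n) : measurableTypeR R := v i ord0.

Let cV_set0 : g_sigma_preimage coord set0.
Proof. exact: sigma_algebra0. Qed.

Let cV_setC A : g_sigma_preimage coord A -> g_sigma_preimage coord (~` A).
Proof. exact: sigma_algebraC. Qed.

Let cV_bigcup (F : _^nat) : (forall i, g_sigma_preimage coord (F i)) ->
  g_sigma_preimage coord (\bigcup_i (F i)).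
Proof. exact: sigma_algebra_bigcup. Qed.

HB.instance Definition _ := @isMeasurable.Build cV_display
  'cV[R]_n (g_sigma_preimage coord) cV_set0 cV_setC cV_bigcup.
End measurable_cV.
Definition cV_cons {R : realType} {n} (xv : measurableTypeR R * 'cV[R]_n) :
  'cV[R]_n.+1 := col_mx (xv.1 : R)%:M xv.2.

Definition cV_uncons {R : realType} {n} (v : 'cV[R]_n.+1) :
  measurableTypeR R * 'cV[R]_n := (v ord0 ord0, dsubmx (v : 'M[R]_(1 + n, 1))).

Lemma cV_consK {R : realType} {n} : cancel (@cV_cons R n) cV_uncons.
Proof.
case=> x v; rewrite /cV_uncons /cV_cons/= col_mxKd; congr pair.
transitivity ((x : R)%:M ord0 (ord0 : 'I_1)); last by rewrite mxE eqxx mulr1n.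
by rewrite -(@col_mxEu R 1 n 1 _ v); congr (fun_of_matrix _ _ _); exact/val_inj.
Qed.

Lemma cV_unconsK {R : realType} {n} : cancel (@cV_uncons R n) cV_cons.
Proof.
move=> v; rewrite /cV_uncons /cV_cons/=.
have -> : (v ord0 ord0)%:M = usubmx (v : 'M[R]_(1 + n, 1)).
  apply/matrixP => i j; rewrite !ord1 !mxE eqxx mulr1n.
  by congr (fun_of_matrix _ _ _); exact/val_inj.
exact: (@vsubmxK R 1 n 1 v).
Qed.

Lemma measurable_cV_coord {R : realType} {n} (i : 'I_n) :
  measurable_fun [set: 'cV[R]_n] (fun v => v i ord0 : measurableTypeR R).
Proof.
move=> _ Y mY; rewrite setTI; apply: sub_sigma_algebra => /=.
rewrite -bigcup_seq/=; exists i => /=; first by rewrite mem_index_enum.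
by exists Y => //; rewrite setTI.
Qed.

Lemma measurable_funP_cV {R : realType} {n} d (T : measurableType d)
    (f : T -> 'cV[R]_n) :
  (forall i, measurable_fun [set: T] (fun t => f t i ord0 : measurableTypeR R)) ->
  measurable_fun [set: T] f.
Proof.
move=> mf _ Y; rewrite setTI.
suff : (@measurable _ 'cV[R]_n) `<=` [set B | measurable (f @^-1` B)] by apply.
apply: smallest_sub.
  split=> /=; first by rewrite preimage_set0.
    - by move=> B mB; rewrite /= setTD preimage_setC; exact: measurableC.
  - by move=> F mF; rewrite /= preimage_bigcup; apply: bigcup_measurable => k _; exact: mF.
rewrite -bigcup_seq; apply: bigcup_sub => i _ _ [B mB <-]/=.
by have := mf i measurableT _ mB; rewrite !setTI.
Qed.

Lemma measurable_cV_cons {R : realType} {n} :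
  measurable_fun setT (@cV_cons R n).
Proof.
apply: measurable_funP_cV => i; rewrite /cV_cons.
have [j ->|j ->] := @split_ordP 1 n i.
  apply: (eq_measurable_fun fst) => // -[x v] _; rewrite !ord1.
  by rewrite (@col_mxEu R 1 n 1 (x : R)%:M v) mxE eqxx mulr1n.
apply: (eq_measurable_fun
    ((fun v : 'cV[R]_n => v j ord0 : measurableTypeR R) \o snd)).
  by case=> x v _; rewrite (@col_mxEd R 1 n 1 (x : R)%:M v).
by apply: measurableT_comp => //; exact: measurable_cV_coord.
Qed.

Lemma measurable_cV_uncons {R : realType} {n} :
  measurable_fun setT (@cV_uncons R n).
Proof.
apply/measurable_fun_pairP; split; first exact: measurable_cV_coord.
apply: measurable_funP_cV => i /=.
apply: (eq_measurable_fun (fun v : 'cV[R]_n.+1 => v (rshift 1 i) ord0)).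
  by move=> v _; rewrite !mxE.
exact: measurable_cV_coord.
Qed.

Section lebesgue_step.
Context {R : realType} {n : nat}.
Variable mu : {sigma_finite_measure set 'cV[R]_n -> \bar R}.
Definition leb_step : set 'cV[R]_n.+1 -> \bar R :=
  pushforward (lebesgue_measure \x mu)%E cV_cons.

Let leb_step0 : leb_step set0 = 0%E.
Proof. by rewrite /leb_step /pushforward preimage_set0 measure0. Qed.

Let leb_step_ge0 A : (0 <= leb_step A)%E.
Proof. by rewrite /leb_step /pushforward; exact: measure_ge0. Qed.

Let leb_step_sigma_additive : semi_sigma_additive leb_step.
Proof.
move=> F mF tF mUF; rewrite /leb_step /pushforward preimage_bigcup.
have mpre A : measurable A -> measurable ((@cV_cons R n) @^-1` A).
  by move=> mA; rewrite -[X in measurable X]setTI; exact: measurable_cV_cons.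
apply: measure_semi_sigma_additive.
- by move=> i; exact: mpre.
- apply/trivIsetP => /= i k _ _ ik; rewrite -preimage_setI.
  by move/trivIsetP : tF => /(_ _ _ _ _ ik) ->//; rewrite preimage_set0.
- by rewrite -preimage_bigcup; exact: mpre.
Qed.

HB.instance Definition _ := isMeasure.Build _ _ _ leb_step
  leb_step0 leb_step_ge0 leb_step_sigma_additive.

Let leb_step_sigma_finite : sigma_finite setT leb_step.
Proof.
have /sigma_finiteP[F [TF ndF Foo]] := sigma_finiteT (@lebesgue_measure R).
have /sigma_finiteP[G [TG ndG Goo]] := sigma_finiteT mu.
exists (fun k => cV_uncons @^-1` (F k `*` G k)).
  rewrite -preimage_bigcup (_ : \bigcup_k _ = setT) ?preimage_setT//.
  apply/seteqP; split=> // -[x y] _.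
  have [i _ Fx] : (\bigcup_i F i) x by rewrite -TF.
  have [k _ Gy] : (\bigcup_i G i) y by rewrite -TG.
  exists (maxn i k) => //; split.
    by move: x Fx; exact/subsetPset/ndF/leq_maxl.
  by move: y Gy; exact/subsetPset/ndG/leq_maxr.
move=> k; have [mF Fk] := Foo k; have [mG Gk] := Goo k; split.
  rewrite -[X in measurable X]setTI; apply: measurable_cV_uncons => //.
  exact: measurableX.
rewrite /leb_step /pushforward -comp_preimage.
rewrite (_ : _ \o _ = id) ?preimage_id; last exact/funext/cV_consK.
by rewrite product_measure1E// lte_mul_pinfty// ge0_fin_numE.
Qed.

HB.instance Definition _ := Measure_isSigmaFinite.Build _ _ _ leb_step
  leb_step_sigma_finite.
End lebesgue_step.

(* n-fold product of the Lebesgue measure of the line. *)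
Fixpoint lebesgue_cV {R : realType} (n : nat) :
    {sigma_finite_measure set 'cV[R]_n -> \bar R} :=
  if n is m.+1 then leb_step (lebesgue_cV m) else \d_(0 : 'cV[R]_0).

Section complex_valued.
Context {R : realType}.

Definition cexpi (x : R) : R[i] := Complex (cos x) (sin x).

Definition toC (x : R) : R[i] := Complex x 0.

Definition sqnormc (z : R[i]) : R := complex.Re z ^+ 2 + complex.Im z ^+ 2.

Definition cmeasurable d (T : measurableType d) (f : T -> R[i]) : Prop :=
  measurable_fun setT (fun x => complex.Re (f x)) /\
  measurable_fun setT (fun x => complex.Im (f x)).

Definition cintegrable d (T : measurableType d)
    (mu : {measure set T -> \bar R}) (D : set T) (f : T -> R[i]) : Prop :=
  mu.-integrable D (fun x => (complex.Re (f x))%:E) /\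
  mu.-integrable D (fun x => (complex.Im (f x))%:E).

Definition cint d (T : measurableType d) (mu : {measure set T -> \bar R})
    (D : set T) (f : T -> R[i]) : R[i] :=
  Complex (\int[mu]_(x in D) complex.Re (f x))
          (\int[mu]_(x in D) complex.Im (f x)).

(* Sums over infinite index sets; meaningful for absolutely summable families. *)
Definition rsum (I : choiceType) (D : set I) (f : I -> R) : R :=
  fine (\esum_(i in D) (Num.max (f i) 0)%:E)
  - fine (\esum_(i in D) (Num.max (- f i) 0)%:E).

Definition csum (I : choiceType) (D : set I) (f : I -> R[i]) : R[i] :=
  Complex (rsum D (fun i => complex.Re (f i)))
          (rsum D (fun i => complex.Im (f i))).

End complex_valued.

Definition ncard {T : choiceType} (A : set T) : nat := (#|` fset_set A|)%fset.

Section euclidean.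
Context {R : realType} {n : nat}.
Implicit Types x y : 'cV[R]_n.

(* The Lie algebra of the torus, with (.,.)_1, is identified with the
   Euclidean space R^n through an orthonormal basis. *)
Definition dotv x y : R := \sum_i x i ord0 * y i ord0.

Definition ipk (k : nat) x y : R := k%:R * dotv x y.

Definition bracket (k : nat) x y : R[i] := cexpi (2 * pi * ipk k x y).

(* A (.,.)_k-unit cube is a Euclidean cube of side k^(-1/2). *)
Definition volk (k : nat) : set 'cV[R]_n -> \bar R :=
  mscale (Num.sqrt (k%:R : R) ^+ n)%:nng (lebesgue_cV n).

HB.instance Definition _ k := Measure.on (volk k).

Let volk_sigma_finite k : sigma_finite setT (volk k).
Proof.
have [F FT Foo] := sigma_finiteT (@lebesgue_cV R n).
exists F => // i; have [mF Fi] := Foo i; split => //.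
by rewrite /volk /mscale/= lte_mul_pinfty ?lee_fin ?exprn_ge0.
Qed.

HB.instance Definition _ k := Measure_isSigmaFinite.Build _ _ _ (volk k)
  (@volk_sigma_finite k).

Definition aeeq (k : nat) (f g : 'cV[R]_n -> R[i]) : Prop :=
  {ae volk k, forall x, f x = g x}.

Definition L2 (k : nat) : set ('cV[R]_n -> R[i]) :=
  [set f | cmeasurable f /\ (\int[volk k]_x (sqnormc (f x))%:E < +oo)%E].

Definition pderiv (s : seq 'I_n) (f : 'cV[R]_n -> R) : 'cV[R]_n -> R :=
  foldr (fun i g x => 'D_(delta_mx i ord0) g x) f s.

Definition schwartzR (f : 'cV[R]_n -> R) : Prop :=
  forall s : seq 'I_n,
    (forall i x, derivable (pderiv s f) x (delta_mx i ord0)) /\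
    (forall N, exists M, forall x, (1 + dotv x x) ^+ N * `|pderiv s f x| <= M).

Definition schwartz (f : 'cV[R]_n -> R[i]) : Prop :=
  schwartzR (fun x => complex.Re (f x)) /\ schwartzR (fun x => complex.Im (f x)).

End euclidean.

Section roots.
Context {R : realType} {n : nat}.
Implicit Types (Phi : set 'cV[R]_n) (Delta : 'I_n -> 'cV[R]_n).

Definition refl (a : 'cV[R]_n) : 'M[R]_n :=
  1%:M - (2 / dotv a a) *: (a *m a^T).

Definition coroot (a : 'cV[R]_n) : 'cV[R]_n := (2 / dotv a a) *: a.

(* Irreducible reduced crystallographic root systems of rank n in R^n, whose
   long roots have squared length 2: these are the root systems of the compact,
   simple, connected, simply connected Lie groups of rank n, the roots being
   carried to the Lie algebra of the torus by (.,.)_1. *)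
Record simple_root_system Phi : Prop := SimpleRootSystem {
  roots_finite : finite_set Phi ;
  roots_neq0 : Phi !=set0 ;
  root_neq0 : forall a, Phi a -> a != 0 ;
  roots_span : forall v, (forall a, Phi a -> dotv a v = 0) -> v = 0 ;
  roots_refl : forall a b, Phi a -> Phi b -> Phi (refl a *m b) ;
  roots_int : forall a b, Phi a -> Phi b ->
    2 * dotv a b / dotv a a \is a Num.int ;
  roots_reduced : forall a c, Phi a -> Phi (c *: a) -> c = 1 \/ c = - 1 ;
  roots_irr : forall A, A `<=` Phi -> A !=set0 ->
    (forall a b, A a -> (Phi `\` A) b -> dotv a b = 0) -> A = Phi ;
  roots_le2 : forall a, Phi a -> dotv a a <= 2 ;
  roots_long : exists2 a, Phi a & dotv a a = 2 }.

Record simple_roots Phi Delta : Prop := SimpleRoots {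
  simple_in : forall i, Phi (Delta i) ;
  simple_free : (\matrix_(i, j) Delta j i ord0) \in unitmx ;
  simple_sign : forall a, Phi a -> exists c : 'I_n -> nat,
    a = \sum_i (c i)%:R *: Delta i \/ a = - (\sum_i (c i)%:R *: Delta i) }.

Definition pos_roots Phi Delta : set 'cV[R]_n :=
  [set a | Phi a /\ exists c : 'I_n -> nat, a = \sum_i (c i)%:R *: Delta i].

(* The monoid generated by the reflections, which are involutions, is a group. *)
Definition weyl Phi : set 'M[R]_n :=
  smallest [set G | G 1%:M /\ forall u v, G u -> G v -> G (u *m v)]
    (refl @` Phi).

(* The two one-dimensional characters: trivial for [false], det for [true]. *)
Definition chi (eps : bool) (w : 'M[R]_n) : R[i] := toC (\det w ^+ eps).

Definition coroot_lattice Phi : set 'cV[R]_n :=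
  smallest [set G | G 0 /\ forall u v, G u -> G v -> G (u - v)]
    (coroot @` Phi).

Definition weight_lattice Phi (k : nat) : set 'cV[R]_n :=
  [set g | forall l, coroot_lattice Phi l -> ipk k g l \is a Num.int].

Definition chamber Delta : set 'cV[R]_n :=
  [set x | forall i, 0 < dotv x (Delta i)].

Definition alcove Phi Delta : set 'cV[R]_n :=
  [set x | forall a, pos_roots Phi Delta a -> 0 < dotv x a < 1].

Definition Ik Phi Delta (k : nat) : set 'cV[R]_n :=
  weight_lattice Phi k `&` alcove Phi Delta.

Definition Ikbar Phi Delta (k : nat) : set 'cV[R]_n :=
  weight_lattice Phi k `&` closure (alcove Phi Delta).

(* A fundamental domain for the coroot lattice. *)
Definition cell Delta : set 'cV[R]_n :=
  [set x | exists2 c : 'I_n -> R, (forall i, 0 <= c i < 1) &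
     x = \sum_i c i *: coroot (Delta i)].

End roots.

Section quotient.
Context {R : realType} {n : nat}.
Variables (Phi : set 'cV[R]_n) (k : nat).

Definition coset (g : 'cV[R]_n) : set 'cV[R]_n :=
  [set g + l | l in coroot_lattice Phi].

Definition Zk : set (set 'cV[R]_n) := coset @` weight_lattice Phi k.

Definition rep (c : Zk) : 'cV[R]_n := xget 0 (val c).

Definition wact (w : 'M[R]_n) (c : Zk) : set 'cV[R]_n :=
  [set w *m v | v in val c].

(* The W-invariant ([false]) and W-anti-invariant ([true]) functions on Z_(k). *)
Definition Ck (eps : bool) : set (Zk -> R[i]) :=
  [set x | forall w, weyl Phi w ->
     forall c c' : Zk, val c' = wact w c -> x c' = chi eps w * x c].

Definition delta (g : 'cV[R]_n) (c : Zk) : R[i] := toC (\1_(val c) g).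

Definition ebasis (eps : bool) (a : 'cV[R]_n) (c : Zk) : R[i] :=
  toC (Num.sqrt (ncard (weyl Phi))%:R)^-1 *
  \sum_(w \in weyl Phi) chi eps w * delta (w *m a) c.

(* The stabilizer in W of the class of [a] in Z_(k). *)
Definition stab (a : 'cV[R]_n) : set 'M[R]_n :=
  [set w | weyl Phi w /\ coroot_lattice Phi (w *m a - a)].

Definition L2W (eps : bool) : set ('cV[R]_n -> R[i]) :=
  [set f | L2 k f /\ forall w, weyl Phi w ->
     aeeq k (fun x => f (w *m x)) (fun x => chi eps w * f x)].

(* L^2(t) (x) C^Z_(k), as the space of functions of (theta, gamma). *)
Definition L2Z : set ('cV[R]_n -> Zk -> R[i]) :=
  [set F | forall c, L2 k (fun x => F x c)].

Definition eqZ (F G : 'cV[R]_n -> Zk -> R[i]) : Prop :=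
  forall c, aeeq k (fun x => F x c) (fun x => G x c).

Definition L2ZW : set ('cV[R]_n -> Zk -> R[i]) :=
  [set F | L2Z F /\ forall w, weyl Phi w ->
     forall c c' : Zk, val c' = wact w c ->
     aeeq k (fun x => F (w *m x) c') (fun x => F x c)].

Definition tens (m : nat) (f : 'I_m -> 'cV[R]_n -> R[i])
    (x : 'I_m -> Zk -> R[i]) : 'cV[R]_n -> Zk -> R[i] :=
  fun t c => \sum_i f i t * x i c.

Definition L2W_Ck (eps : bool) : set ('cV[R]_n -> Zk -> R[i]) :=
  [set F | exists m (f : 'I_m -> 'cV[R]_n -> R[i]) (x : 'I_m -> Zk -> R[i]),
     (forall i, L2W eps (f i) /\ Ck eps (x i)) /\ F = tens f x].

Definition fourierZ (F : 'cV[R]_n -> Zk -> R[i]) : 'cV[R]_n -> Zk -> R[i] :=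
  fun t c => toC (Num.sqrt (ncard Zk)%:R)^-1 *
    \sum_(c' \in [set: Zk]) F t c' * bracket k (rep c) (rep c').

(* The Weil-Gel'fand-Zak transform on Schwartz functions. *)
Definition zakS (F : 'cV[R]_n -> Zk -> R[i]) (p : 'cV[R]_n * 'cV[R]_n) : R[i] :=
  toC (Num.sqrt (ncard Zk)%:R)^-1 * bracket k (- (2^-1 *: p.1)) p.2 *
  \sum_(c \in [set: Zk]) csum (weight_lattice Phi k) (fun l =>
     F (p.1 + l) c * bracket k (- l) p.2 * bracket k (- l) (rep c)).

Variable Delta : 'I_n -> 'cV[R]_n.

Let sqdistS (psi psi' : 'cV[R]_n * 'cV[R]_n -> R[i]) : \bar R :=
  (\int[volk k \x volk k]_(p in cell Delta `*` cell Delta)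
     (sqnormc (psi p - psi' p))%:E)%E.

(* L^2-sections of the level k line bundle on T x T; the sign
   (-1)^(l1, l2)_k is written exp (pi i (l1, l2)_k). *)
Definition level_section : set ('cV[R]_n * 'cV[R]_n -> R[i]) :=
  [set psi | [/\ cmeasurable psi,
     forall l1 l2, coroot_lattice Phi l1 -> coroot_lattice Phi l2 ->
       forall x y, psi (x + l1, y + l2) =
         cexpi (pi * ipk k l1 l2) *
         cexpi (- pi * (ipk k x l2 - ipk k l1 y)) * psi (x, y) &
     (sqdistS psi (fun=> 0%R) < +oo)%E]].

(* Sections over the moduli space (T x T)/W. *)
Definition Hk : set ('cV[R]_n * 'cV[R]_n -> R[i]) :=
  [set psi | level_section psi /\ forall w, weyl Phi w ->
     forall x y, psi (w *m x, w *m y) = psi (x, y)].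

(* Graph of the L^2 extension of [zakS], as the closure of its graph on
   Schwartz functions. *)
Definition zak (F : 'cV[R]_n -> Zk -> R[i])
    (psi : 'cV[R]_n * 'cV[R]_n -> R[i]) : Prop :=
  [/\ L2Z F, level_section psi & exists Fm : nat -> 'cV[R]_n -> Zk -> R[i],
   [/\ forall m c, schwartz (fun x => Fm m x c),
      forall c, (fun m => \int[volk k]_x (sqnormc (Fm m x c - F x c))%:E)%E
        @ \oo --> 0%E &
      (fun m => sqdistS (zakS (Fm m)) psi) @ \oo --> 0%E]].

(* The operators on sections given by S = (0, -1; 1, 0) and T = (1, 1; 0, 1). *)
Definition Stilde (psi : 'cV[R]_n * 'cV[R]_n -> R[i]) p : R[i] :=
  psi (p.2, - p.1).

Definition Ttilde (psi : 'cV[R]_n * 'cV[R]_n -> R[i]) p : R[i] :=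
  psi (p.1, p.1 + p.2).

(* [rho_hat A F G]: G is the image of F under the conjugate by (zak o fourierZ)
   of the operator [A] on sections. *)
Definition rho_hat (A : ('cV[R]_n * 'cV[R]_n -> R[i]) ->
      ('cV[R]_n * 'cV[R]_n -> R[i]))
    (F G : 'cV[R]_n -> Zk -> R[i]) : Prop :=
  exists psi, [/\ Hk psi, zak (fourierZ F) psi & zak (fourierZ G) (A psi)].

End quotient.

Arguments Ck {R n} Phi k eps.
Arguments L2Z {R n} Phi k.
Arguments L2ZW {R n} Phi k.
Arguments L2W_Ck {R n} Phi k eps.
Arguments ebasis {R n} Phi k eps a.
Arguments Hk {R n} Phi k Delta.
Arguments rho_hat {R n} Phi k Delta A.

(* [M] is the matrix of [A] in the family [e] indexed by [J]. *)
Definition mx_entries {R : realType} {n : nat} {I : Type}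
    (J : set 'cV[R]_n) (e : 'cV[R]_n -> I -> R[i])
    (A : (I -> R[i]) -> (I -> R[i])) (M : 'cV[R]_n -> 'cV[R]_n -> R[i]) : Prop :=
  forall b, J b -> forall i, A (e b) i = \sum_(a \in J) M a b * e a i.

(* A representation, on the function space [V] modulo [eqv], of
   SL(2,Z) = < S, T | S^2 = (S T)^3, S^4 = 1 >, given by the operators assigned
   to S and T; the last relations make both invertible. *)
Record SL2Z_rep {R : realType} {I : Type} (V : set (I -> R[i]))
    (eqv : (I -> R[i]) -> (I -> R[i]) -> Prop)
    (S T : (I -> R[i]) -> (I -> R[i])) : Prop := SL2ZRep {
  rep_stable : forall f, V f -> V (S f) /\ V (T f) ;
  rep_compat : forall f g, V f -> V g -> eqv f g ->
    eqv (S f) (S g) /\ eqv (T f) (T g) ;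
  rep_linear : forall (a : R[i]) f g, V f -> V g ->
    eqv (S (fun i => a * f i + g i)) (fun i => a * S f i + S g i) /\
    eqv (T (fun i => a * f i + g i)) (fun i => a * T f i + T g i) ;
  rep_S2 : forall f, V f -> eqv (S (S f)) (S (T (S (T (S (T f)))))) ;
  rep_S4 : forall f, V f -> eqv (S (S (S (S f)))) f }.

Definition L2_isometry {R : realType} {n : nat} (k : nat)
    (V : set ('cV[R]_n -> R[i]))
    (A : ('cV[R]_n -> R[i]) -> ('cV[R]_n -> R[i])) : Prop :=
  forall f, V f -> (\int[volk k]_x (sqnormc (A f x))%:E =
                    \int[volk k]_x (sqnormc (f x))%:E)%E.

(* Main.v *)
Require Import Defs.
From HB Require Import structures.
From mathcomp Require Import all_boot all_order all_algebra.
From mathcomp Require Import finmap complex.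
From mathcomp Require Import all_classical all_reals all_analysis.
From mathcomp Require Import measurable_realfun simple_functions zify ring lra.
Set Implicit Arguments.
Unset Strict Implicit.
Unset Printing Implicit Defensive.
Import Order.TTheory GRing.Theory Num.Theory.
Import numFieldNormedType.Exports.
Local Open Scope classical_set_scope.
Local Open Scope ring_scope.

(* By Poisson summation, the operators on L^2(t) (x) C^Z_(k) induced through
   the Zak transform by S and T are tensor products: S becomes the Fourier
   transform of t times the finite Fourier transform of Z_(k), and T becomes
   the multiplication by exp (- pi i (t, t)_k) times that by exp (pi i (g, g)_k).
   The scalars j and om turn each factor into a representation of SL(2, Z): the
   relation S^2 = (ST)^3 holds for the tensor product, hence for each factor up
   to a scalar, which is read off an explicit Gauss sum of the even lattice
   sqrt (2 / k) Z^n.  All the operators commute with W, so they preserve the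
   invariant and the anti-invariant parts, which span the values of the
   functions in the direct sum.  The alcove is a fundamental domain for the
   affine Weyl group, as one sees by deleting reflections in the walls from
   words; the matrix entries follow by collecting orbits. *)

(** * Invariance of the Lebesgue measure under isometries *)

(** The Zak transform is given only as the closure of a graph. Exact identities are therefore
    checked on bounded functions of bounded support, where the lattice sums are finite, and carried
    over by isometry. Poisson summation enters as Parseval on a cell, in [y] alone with [x] fixed.
    One construction is run for three lattices. The cubic lattice of side k^(-1/2) is self-dual of
    covolume one: the finite part disappears, and isometry becomes Plancherel's theorem; but it is
    not even, so T does not respect its multiplier. The lattice sqrt (2 / k) Z^n is even and splits
    into lines, so its Gauss sum can be computed; the relation between Fourier transform and
    Gaussian obtained from it keeps no trace of the lattice. Comparing it with the relation from the
    coroot lattice evaluates the Gauss sum of Z_(k) indirectly. Taking the finite Fourier transform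
    first has a purpose: in the combined series the term of a dual vector involves only the
    component of its own class, so that T acts term by term. *)

Section measure_cV.
Context {R : realType}.
Local Notation leb := (@lebesgue_measure R).

Lemma measurable_shift_line (a : R) :
  measurable_fun [set: measurableTypeR R]
    ((fun x => x + a) : measurableTypeR R -> measurableTypeR R).
Proof. by apply: measurable_funD => //; exact: measurable_id. Qed.

Let line_shift (a : R) : measurableTypeR R -> measurableTypeR R :=
  fun x => x + a.

HB.instance Definition _ a := isMeasurableFun.Build _ _ _ _ (line_shift a)
  (measurable_shift_line a).

Lemma lebesgue_measure_shift (a : R) (A : set (measurableTypeR R)) :
  measurable A -> leb ((fun x : R => x + a) @^-1` A) = leb A.
Proof.
move=> mA; apply/esym.
rewrite -[RHS]/(pushforward leb (line_shift a) A).
apply: lebesgue_measure_unique => // _ [[c b]] _ <-.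
rewrite [RHS](_ : _ = leb `]c - a, b - a]); last first.
  by congr (leb _); apply/seteqP; split=> x/=; rewrite !in_itv/= ltrBlDr lerBrDr.
rewrite !lebesgue_measure_itv/= !lte_fin ltrD2r.
by case: ifPn => // _; rewrite -!EFinB; congr EFin; ring.
Qed.

Lemma measurable_addv n (v : 'cV[R]_n) :
  measurable_fun [set: 'cV[R]_n] (fun x : 'cV[R]_n => x + v).
Proof.
apply: measurable_funP_cV => i.
apply: (eq_measurable_fun (fun x : 'cV[R]_n => (x i ord0 : measurableTypeR R) + v i ord0)).
  by move=> x _; rewrite mxE.
by apply: measurable_funD => //; exact: measurable_cV_coord.
Qed.

Lemma measurable_mulmx n (w : 'M[R]_n) :
  measurable_fun [set: 'cV[R]_n] (fun x : 'cV[R]_n => w *m x).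
Proof.
apply: measurable_funP_cV => i.
apply: (eq_measurable_fun (fun x : 'cV[R]_n => \sum_j w i j * x j ord0)).
  by move=> x _; rewrite mxE.
apply: measurable_sum => j.
by apply: measurable_funM => //; exact: measurable_cV_coord.
Qed.

Lemma measurable_addv2 n :
  measurable_fun [set: 'cV[R]_n * 'cV[R]_n]
    (fun p : 'cV[R]_n * 'cV[R]_n => p.1 + p.2).
Proof.
apply: measurable_funP_cV => i.
apply: (eq_measurable_fun
  (fun p : 'cV[R]_n * 'cV[R]_n => (p.1 i ord0 : measurableTypeR R) + p.2 i ord0)).
  by move=> x _; rewrite mxE.
apply: measurable_funD.
  by apply: (measurableT_comp (measurable_cV_coord i)).
by apply: (measurableT_comp (measurable_cV_coord i)).
Qed.

Lemma measurable_dotv2 d (T : measurableType d) n (f g : T -> 'cV[R]_n) :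
  measurable_fun setT f -> measurable_fun setT g ->
  measurable_fun setT (fun x => dotv (f x) (g x) : measurableTypeR R).
Proof.
move=> mf mg; apply: measurable_sum => i; apply: measurable_funM.
  exact: (measurableT_comp (measurable_cV_coord i)).
exact: (measurableT_comp (measurable_cV_coord i)).
Qed.

Lemma cV_consD n (x : R) (y : 'cV[R]_n) v :
  cV_cons (x, y) + v = cV_cons (x + (cV_uncons v).1, y + (cV_uncons v).2).
Proof.
rewrite /cV_cons/= -[in LHS](cV_unconsK v) /cV_cons/= (@add_col_mx R 1 n 1).
by rewrite -raddfD.
Qed.

(** Slicing along the first coordinate: the induction hypothesis moves each slice, and the
    invariance of the line absorbs the shift of the slicing parameter. *)
Lemma lebesgue_cV_shift n (v : 'cV[R]_n) (A : set 'cV[R]_n) :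
  measurable A -> lebesgue_cV n ((fun x => x + v) @^-1` A) = lebesgue_cV n A.
Proof.
elim: n v A => [|n IHn] v A mA.
  by congr (lebesgue_cV 0 _); apply/seteqP; split=> x /=; rewrite (flatmx0 v) addr0.
rewrite /= /leb_step /pushforward.
have mpre B : measurable B -> measurable ((@cV_cons R n) @^-1` B).
  by move=> mB; rewrite -[X in measurable X]setTI; exact: measurable_cV_cons.
have mC := mpre _ mA.
set C := cV_cons @^-1` A in mC *.
pose v0 : R := (cV_uncons v).1; pose v' := (cV_uncons v).2.
have mx x : measurable (xsection C x) by exact: measurable_xsection.
rewrite /product_measure1.
have E x : xsection ((@cV_cons R n) @^-1` ((fun x => x + v) @^-1` A)) x =
    (fun y => y + v') @^-1` (xsection C (x + v0)).
  by apply/seteqP; split => y; rewrite /xsection/= !inE /C /= cV_consD.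
under eq_integral do rewrite /= E IHn //.
have -> : (\int[leb]_x lebesgue_cV n (xsection C x) =
    \int[pushforward leb (line_shift v0)]_x
       lebesgue_cV n (xsection C x))%E.
  apply: eq_measure_integral => B mB _; rewrite /pushforward.
  by apply/esym/lebesgue_measure_shift.
rewrite ge0_integral_pushforward//=.
- exact: (measurable_fun_xsection (lebesgue_cV n) mC).
Qed.

Definition cube n (a b : R) : set 'cV[R]_n :=
  [set x | forall i, a <= x i ord0 < b].
Local Arguments cube : clear implicits.

Lemma measurable_cube n a b : measurable (cube n a b).
Proof.
have -> : cube n a b = \big[setI/setT]_(i <- index_enum 'I_n)
    ((fun x : 'cV[R]_n => x i ord0 : measurableTypeR R) @^-1` `[a, b[%classic).
  rewrite -bigcap_seq; apply/seteqP; split => x /= H i.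
    by move=> _; rewrite /= in_itv/=; exact: H.
  by have := H i; rewrite /= mem_index_enum in_itv/=; exact.
apply: bigsetI_measurable => i _; rewrite -[X in measurable X]setTI.
exact: (measurable_cV_coord i).
Qed.

Lemma lebesgue_cV_cube n (a b : R) : a <= b ->
  lebesgue_cV n (cube n a b) = ((b - a) ^+ n)%:E.
Proof.
move=> ab; elim: n => [|n IHn].
  by rewrite /= diracE expr0 mem_set// => -[].
rewrite /= /leb_step /pushforward.
have -> : (@cV_cons R n) @^-1` cube n.+1 a b = `[a, b[%classic `*` cube n a b.
  apply/seteqP; split => [[x v] /= H|[x v] [/= xab H] i].
    split => /=.
      have := H ord0; rewrite in_itv/=.
      by have /(congr1 fst) /= -> := cV_consK (x, v).
    move=> i; have := H (rshift 1 i).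
    by rewrite /cV_cons/= (@col_mxEd R 1 n 1 (x : R)%:M v).
  rewrite /cV_cons/=; have [k ->|k ->] := @split_ordP 1 n i.
    rewrite !ord1 (@col_mxEu R 1 n 1 (x : R)%:M v) mxE eqxx mulr1n.
    by move: xab; rewrite in_itv.
  by rewrite (@col_mxEd R 1 n 1 (x : R)%:M v); exact: H.
rewrite product_measure1E//=; last exact: measurable_cube.
rewrite IHn lebesgue_measure_itv/= lte_fin.
case: ltP => [_|ba]; first by rewrite -EFinB -EFinM exprS.
have -> : a = b by apply/eqP; rewrite eq_le ab ba.
by rewrite subrr exprS mul0r mul0e.
Qed.
End measure_cV.
Arguments cube {R} n a b.

Section measure_preserving.
Context d (T : measurableType d) (R : realType).
Variable mu : {measure set T -> \bar R}.

Definition mpres (phi : T -> T) := measurable_fun setT phi /\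
  forall A, measurable A -> mu (phi @^-1` A) = mu A.

Lemma mpres_integral_pushforward phi (mphi : measurable_fun setT phi)
    (phiP : mpres phi) D (f : T -> \bar R) :
  let phi' : {mfun T >-> T} := HB.pack phi (isMeasurableFun.Build _ _ _ _ phi mphi) in
  (\int[pushforward mu phi']_(x in D) f x = \int[mu]_(x in D) f x)%E.
Proof.
move=> phi'; apply: eq_measure_integral => B mB _; rewrite /pushforward.
exact: phiP.2.
Qed.

Lemma mpres_ge0_integral phi D (f : T -> \bar R) : mpres phi ->
  measurable D -> measurable_fun D f -> (forall x, D x -> 0 <= f x)%E ->
  (\int[mu]_(x in phi @^-1` D) f (phi x) = \int[mu]_(x in D) f x)%E.
Proof.
move=> phiP mD mf f0; have [mphi _] := phiP.
pose phi' : {mfun T >-> T} := HB.pack phi (isMeasurableFun.Build _ _ _ _ phi mphi).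
rewrite -[RHS](mpres_integral_pushforward mphi phiP).
rewrite (@ge0_integral_pushforward _ _ _ _ _ phi')//.
by move=> x; rewrite inE; exact: f0.
Qed.

Lemma mpres_integrable phi (f : T -> \bar R) : mpres phi ->
  mu.-integrable setT f -> mu.-integrable setT (f \o phi).
Proof.
move=> phiP /integrableP[mf fi]; apply/integrableP; split.
  by apply: measurableT_comp => //; exact: phiP.1.
have := @mpres_ge0_integral phi setT (fun x => `|f x|%E) phiP measurableT.
rewrite preimage_setT /= => -> //; exact: measurableT_comp.
Qed.

Lemma mpres_integral phi (f : T -> \bar R) : mpres phi ->
  measurable_fun setT f ->
  (\int[mu]_x f (phi x) = \int[mu]_x f x)%E.
Proof.
move=> phiP mf; rewrite [LHS]integralE [RHS]integralE.
have H (g : T -> \bar R) : measurable_fun setT g -> (forall x, 0 <= g x)%E ->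
    (\int[mu]_x g (phi x) = \int[mu]_x g x)%E.
  move=> mg g0; have := @mpres_ge0_integral phi setT g phiP measurableT mg.
  by rewrite preimage_setT; exact.
have Hp := H (f^\+)%E (measurable_funepos mf) (funepos_ge0 f).
have Hn := H (f^\-)%E (measurable_funeneg mf) (funeneg_ge0 f).
rewrite -Hp -Hn; congr (_ - _)%E.
  by apply: eq_integral => x _; rewrite !funeposE.
by apply: eq_integral => x _; rewrite !funenegE.
Qed.

Lemma mpres_ae phi (P : T -> Prop) : mpres phi ->
  {ae mu, forall x, P x} -> {ae mu, forall x, P (phi x)}.
Proof.
move=> phiP [N [mN N0 PN]]; exists (phi @^-1` N); split.
- by rewrite -[X in measurable X]setTI; exact: phiP.1.
- by rewrite phiP.2.
- by move=> x /= Px; apply: PN.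
Qed.
End measure_preserving.

Section volk_theory.
Context {R : realType} {n : nat}.
Variable k : nat.
Local Notation mu := (@volk R n k).

Lemma mpres_shift v : mpres mu (fun x => x + v).
Proof.
split; first exact: measurable_addv.
move=> A mA; rewrite /volk /mscale/=; congr (_ * _)%E; exact: lebesgue_cV_shift.
Qed.

Lemma dotvC (x y : 'cV[R]_n) : dotv x y = dotv y x.
Proof. by apply: eq_bigr => i _; rewrite mulrC. Qed.

Lemma dotvE (x y : 'cV[R]_n) : (dotv x y)%:M = x^T *m y.
Proof.
apply/matrixP => i i'; rewrite !ord1 !mxE eqxx mulr1n.
by apply: eq_bigr => l _; rewrite mxE.
Qed.

Lemma dotvD (x y z : 'cV[R]_n) : dotv (x + y) z = dotv x z + dotv y z.
Proof. by rewrite -big_split; apply: eq_bigr => i _; rewrite mxE mulrDl. Qed.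

Lemma dotvDr (x y z : 'cV[R]_n) : dotv z (x + y) = dotv z x + dotv z y.
Proof. by rewrite dotvC dotvD !(dotvC z). Qed.

Lemma dotvZ a (x y : 'cV[R]_n) : dotv (a *: x) y = a * dotv x y.
Proof. by rewrite /dotv mulr_sumr; apply: eq_bigr => i _; rewrite mxE mulrA. Qed.

Lemma dotvZr a (x y : 'cV[R]_n) : dotv x (a *: y) = a * dotv x y.
Proof. by rewrite dotvC dotvZ dotvC. Qed.

Lemma dotvN (x y : 'cV[R]_n) : dotv (- x) y = - dotv x y.
Proof. by rewrite -scaleN1r dotvZ mulN1r. Qed.

Lemma dotvNr (x y : 'cV[R]_n) : dotv x (- y) = - dotv x y.
Proof. by rewrite dotvC dotvN dotvC. Qed.

Lemma dotvB (x y z : 'cV[R]_n) : dotv (x - y) z = dotv x z - dotv y z.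
Proof. by rewrite dotvD dotvN. Qed.

Lemma dotvBr (x y z : 'cV[R]_n) : dotv z (x - y) = dotv z x - dotv z y.
Proof. by rewrite dotvDr dotvNr. Qed.

Lemma dot0v (x : 'cV[R]_n) : dotv 0 x = 0.
Proof. by rewrite -(scale0r x) dotvZ mul0r. Qed.

Lemma dotv0 (x : 'cV[R]_n) : dotv x 0 = 0.
Proof. by rewrite dotvC dot0v. Qed.

Lemma dotv_sumr (I : Type) (r : seq I) (P : pred I) (F : I -> 'cV[R]_n) x :
  dotv x (\sum_(i <- r | P i) F i) = \sum_(i <- r | P i) dotv x (F i).
Proof.
by apply: (big_morph (dotv x)) => [y z|]; rewrite ?dotvDr ?dotv0.
Qed.

Lemma dotv_suml (I : Type) (r : seq I) (P : pred I) (F : I -> 'cV[R]_n) x :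
  dotv (\sum_(i <- r | P i) F i) x = \sum_(i <- r | P i) dotv (F i) x.
Proof. by rewrite dotvC dotv_sumr; under eq_bigr do rewrite dotvC. Qed.

Lemma dotv_ge0 (x : 'cV[R]_n) : 0 <= dotv x x.
Proof. by apply: sumr_ge0 => i _; rewrite -expr2 sqr_ge0. Qed.

Lemma dotv_eq0 (x : 'cV[R]_n) : (dotv x x == 0) = (x == 0).
Proof.
apply/eqP/eqP => [x0|->]; last by rewrite dot0v.
apply/matrixP => i l; rewrite !ord1 mxE; apply/eqP.
rewrite -[_ == 0]sqrf_eq0 expr2; apply/eqP.
apply: (@psumr_eq0P _ _ xpredT (fun i => x i ord0 * x i ord0)) => //.
by move=> a _; rewrite -expr2 sqr_ge0.
Qed.

Lemma dotv_gt0 (x : 'cV[R]_n) : (0 < dotv x x) = (x != 0).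
Proof. by rewrite lt0r dotv_eq0 dotv_ge0 andbT. Qed.

Lemma coord_sqr_le (x : 'cV[R]_n) i : x i ord0 ^+ 2 <= dotv x x.
Proof.
by rewrite /dotv (bigD1 i)//= -expr2 lerDl sumr_ge0// => a _; rewrite -expr2 sqr_ge0.
Qed.

Lemma dotv_mulmx (w : 'M[R]_n) x y : dotv (w *m x) y = dotv x (w^T *m y).
Proof.
suff : (dotv (w *m x) y)%:M = (dotv x (w^T *m y))%:M :> 'M[R]_1 .
  by move=> /matrixP/(_ ord0 ord0); rewrite !mxE.
by rewrite !dotvE trmx_mul mulmxA.
Qed.

Lemma dotv_orth (w : 'M[R]_n) x y : w^T *m w = 1%:M ->
  dotv (w *m x) (w *m y) = dotv x y.
Proof. by move=> wo; rewrite dotv_mulmx mulmxA wo mul1mx. Qed.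

Hypothesis k1 : (1 <= k)%N.

Lemma volk_cube (a b : R) : a <= b ->
  mu (cube n a b) = ((Num.sqrt k%:R * (b - a)) ^+ n)%:E.
Proof. by move=> ab; rewrite /volk /mscale/= lebesgue_cV_cube// -EFinM exprMn. Qed.

(** Orthogonal maps preserve this set, and its measure is finite and positive, so it fixes the
    constant left open by the uniqueness argument in [mpres_orth]. *)
Definition uball : set 'cV[R]_n := [set x | dotv x x < 1].

Lemma measurable_uball : measurable uball.
Proof.
have -> : uball = (fun x : 'cV[R]_n => dotv x x : measurableTypeR R) @^-1` `]-oo, 1[%classic.
  by apply/seteqP; split => x /=; rewrite in_itv.
rewrite -[X in measurable X]setTI; apply: measurable_dotv2 => //; exact: measurable_id.
Qed.

Lemma volk_uball_fin : (mu uball < +oo)%E.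
Proof.
apply: (@le_lt_trans _ _ (mu (cube n (-1) 1))).
  apply: le_measure; rewrite ?inE; [exact: measurable_uball|exact: measurable_cube|].
  move=> x x1 i; have := le_lt_trans (coord_sqr_le x i) x1.
  move=> H1; have : `|x i ord0| < 1.
    by rewrite -(@expr_lt1 _ 2)// real_normK// num_real.
  by rewrite ltr_norml => /andP[/ltW -> ->].
by rewrite volk_cube ?ltry// ; lra.
Qed.

Lemma volk_uball_gt0 : (0 < mu uball)%E.
Proof.
have n1 : 0 < (n.+1%:R : R) by rewrite ltr0n.
apply: (@lt_le_trans _ _ (mu (cube n 0 (n.+1%:R)^-1))).
  rewrite volk_cube ?invr_ge0 ?ltW// lte_fin exprn_gt0// subr0 mulr_gt0//.
    by rewrite sqrtr_gt0 ltr0n.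
apply: le_measure; rewrite ?inE; [exact: measurable_cube|exact: measurable_uball|].
move=> x xc; rewrite /uball/=.
have H i : x i ord0 * x i ord0 <= n.+1%:R^-1.
  have /andP[x0 x1] := xc i.
  apply: (@le_trans _ _ (1 * x i ord0)); last by rewrite mul1r ltW.
  rewrite ler_wpM2r// (le_trans (ltW x1))// invf_le1// ler1n//.
apply: (@le_lt_trans _ _ (\sum_(i < n) n.+1%:R^-1)); first by apply: ler_sum => i _; exact: H.
by rewrite sumr_const card_ord -[_ *+ n]mulr_natr mulrC ltr_pdivrMr// mul1r ltr_nat.
Qed.

#[local] Hint Extern 0 (measurable uball) => exact: measurable_uball : core.

Lemma integral_indic_preim (phi : 'cV[R]_n -> 'cV[R]_n) B :
  measurable_fun setT phi -> measurable B ->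
  (\int[mu]_y (\1_B (phi y))%:E = mu (phi @^-1` B))%E.
Proof.
move=> mphi mB; have mP : measurable (phi @^-1` B).
  by rewrite -[X in measurable X]setTI; exact: mphi.
by rewrite (integral_indic mu measurableT mP) setIT.
Qed.

Lemma measurable_indic_preim d (T : measurableType d) (phi : T -> 'cV[R]_n) B :
  measurable_fun setT phi -> measurable B ->
  measurable_fun setT (fun y => (\1_B (phi y) : R)%:E).
Proof.
move=> mphi mB; apply/measurable_EFinP.
by apply: measurableT_comp => //; exact: measurable_indic.
Qed.

Lemma measurable_shear (w : 'M[R]_n) : measurable_fun setT
  (fun p : 'cV[R]_n * 'cV[R]_n => p.1 + w *m p.2).
Proof.
apply: (measurableT_comp (@measurable_addv2 R n)
  (_ : measurable_fun setT (fun p : 'cV[R]_n * 'cV[R]_n => (p.1, w *m p.2)))).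
apply/measurable_fun_pairP; split.
  exact: measurable_fst.
exact: (measurableT_comp (measurable_mulmx w) measurable_snd).
Qed.

(* Uniqueness of the translation invariant measure up to a factor, which is 1
   as the unit ball is preserved by [w]. *)
Lemma mpres_orth (w : 'M[R]_n) : w^T *m w = 1%:M -> mpres mu (mulmx w).
Proof.
move=> wo; have wo' : w *m w^T = 1%:M by exact: mulmx1C.
have mw := measurable_mulmx w; split=> // B mB.
have mU := measurable_uball.
pose f (p : 'cV[R]_n * 'cV[R]_n) : \bar R :=
  ((\1_uball p.1)%:E * (\1_B (p.1 + w *m p.2))%:E)%E.
have mf : measurable_fun setT f.
  apply: emeasurable_funM; first exact: (measurable_indic_preim measurable_fst).
  by apply: measurable_indic_preim => //; exact: measurable_shear.
have f0 p : (0 <= f p)%E by rewrite mule_ge0// lee_fin.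
(* For fixed [x], a translation of [y] by [w^T *m x] absorbs [x], so the inner integral is
   constant. *)
have H1 : (\int[mu]_x \int[mu]_y f (x, y) = mu (mulmx w @^-1` B) * mu uball)%E.
  transitivity (\int[mu]_x (mu (mulmx w @^-1` B) * (\1_uball x)%:E))%E.
    apply: eq_integral => x _; rewrite /f/= ge0_integralZl//.
    - rewrite muleC; congr (_ * _)%E.
      have := mpres_ge0_integral (D := setT) (f := fun y => (\1_B (w *m y))%:E)
        (mpres_shift (w^T *m x)).
      rewrite preimage_setT => /(_ measurableT (measurable_indic_preim mw mB)) E.
      rewrite -(integral_indic_preim mw mB) -E; last by move=> y _; rewrite lee_fin.
      by apply: eq_integral => y _; rewrite mulmxDr mulmxA wo' mul1mx addrC.
    - apply: (measurable_indic_preim (phi := fun y => x + w *m y)) => //.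
      exact: (measurableT_comp (@measurable_shear w) (pair1_measurable x)).
  rewrite ge0_integralZl//.
  - by rewrite (integral_indic_preim (phi := idfun))//; exact: measurable_id.
  - by apply: (measurable_indic_preim (phi := idfun)) => //; exact: measurable_id.
(* After a shift of [x] by [w *m y] and an exchange of the integrals, the argument [x - w *m y] is
   [- (w *m (y - w^T *m x))]; the ball being stable under [- w], a translated ball is left. *)
have H2 : (\int[mu]_y \int[mu]_x f (x, y) = mu B * mu uball)%E.
  transitivity (\int[mu]_y \int[mu]_x
      ((\1_uball (x - w *m y))%:E * (\1_B x)%:E))%E.
    apply: eq_integral => y _.
    have mg : measurable_fun setT (fun x : 'cV[R]_n =>
        (\1_uball (x - w *m y) : R)%:E * (\1_B x : R)%:E)%E.
      apply: emeasurable_funM.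
        by apply: measurable_indic_preim => //; exact: measurable_addv.
      by apply: (measurable_indic_preim (phi := idfun)) => //; exact: measurable_id.
    have := mpres_ge0_integral (D := setT) (mpres_shift (w *m y)) measurableT mg.
    rewrite preimage_setT => <-; last by move=> x _; rewrite mule_ge0// lee_fin.
    by apply: eq_integral => x _; rewrite addrK.
  have mg : measurable_fun setT (fun p : 'cV[R]_n * 'cV[R]_n =>
      (\1_uball (p.1 - w *m p.2) : R)%:E * (\1_B p.1 : R)%:E)%E.
    apply: emeasurable_funM; last exact: (measurable_indic_preim measurable_fst).
    apply: measurable_indic_preim => //.
    apply: (eq_measurable_fun (fun p : 'cV[R]_n * 'cV[R]_n => p.1 + (- w) *m p.2)).
      by move=> p _; rewrite mulNmx.
    exact: measurable_shear.
  rewrite -(@fubini_tonelli _ _ _ _ _ mu mu _ mg)/=; last by move=> p; rewrite mule_ge0// lee_fin.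
  transitivity (\int[mu]_x (mu uball * (\1_B x)%:E))%E.
    apply: eq_integral => x _.
    transitivity (\int[mu]_y ((\1_B x)%:E * (\1_uball (y - w^T *m x))%:E))%E.
      apply: eq_integral => y _; rewrite muleC; congr (_ * (_ %:E))%E.
      rewrite !indicE; congr (nat_of_bool _)%:R.
      have -> : x - w *m y = - (w *m (y - w^T *m x)).
        by rewrite mulmxBr mulmxA wo' mul1mx opprB.
      by apply/idP/idP; rewrite !in_setE /uball/= dotvN dotvNr opprK dotv_orth.
    rewrite ge0_integralZl//.
    - rewrite muleC; congr (_ * _)%E.
      rewrite (integral_indic_preim (phi := fun y => y - _))//; last exact: measurable_addv.
      exact: (mpres_shift _).2.
    - by apply: measurable_indic_preim => //; exact: measurable_addv.
  rewrite ge0_integralZl//.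
  - by rewrite muleC (integral_indic_preim (phi := idfun))//; exact: measurable_id.
  - by apply: (measurable_indic_preim (phi := idfun)) => //; exact: measurable_id.
have := @fubini_tonelli _ _ _ _ _ mu mu _ mf f0; rewrite /= H1 H2.
have Ufin : mu uball \is a fin_num by rewrite ge0_fin_numE// volk_uball_fin.
have U0 : mu uball != 0%E by rewrite gt_eqF// volk_uball_gt0.
rewrite -(fineK Ufin) => E.
have c0 : fine (mu uball) != 0 by rewrite fine_eq0.
have := congr1 (fun z => z * (fine (mu uball))^-1%:E)%E E.
by rewrite -!muleA -!EFinM mulfV// !mule1.
Qed.

(** Each line in the direction [a] meets the hyperplane in one point, so one order of integration
    over the product with a line gives 0; the other gives the measure of [H] times infinity. *)
Lemma volk_hyperplane (a : 'cV[R]_n) (c : R) : a != 0 ->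
  mu [set x | dotv x a = c] = 0%E.
Proof.
move=> a0; set H := [set x | _].
have ma : measurable_fun setT (fun x : 'cV[R]_n => dotv x a : measurableTypeR R).
  by apply: measurable_dotv2 => //; exact: measurable_id.
have mH : measurable H.
  have -> : H = (fun x : 'cV[R]_n => dotv x a : measurableTypeR R) @^-1` [set c] by [].
  by rewrite -[X in measurable X]setTI; exact: ma.
have mphi : measurable_fun setT
    (fun p : 'cV[R]_n * measurableTypeR R => p.1 + (p.2 : R) *: a).
  apply: measurable_funP_cV => i.
  apply: (eq_measurable_fun (fun p : 'cV[R]_n * measurableTypeR R =>
    (p.1 i ord0 : measurableTypeR R) + p.2 * a i ord0)).
    by move=> p _; rewrite !mxE.
  apply: measurable_funD; first exact: (measurableT_comp (measurable_cV_coord i)).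
  exact: measurable_funM.
pose f (p : 'cV[R]_n * measurableTypeR R) : \bar R :=
  (\1_H (p.1 + (p.2 : R) *: a))%:E.
have mf : measurable_fun setT f by exact: measurable_indic_preim.
have f0 p : (0 <= f p)%E by rewrite lee_fin.
have := @fubini_tonelli _ _ _ _ _ mu (@lebesgue_measure R) _ mf f0; rewrite /f/=.
have a2 : dotv a a != 0 by rewrite dotv_eq0.
rewrite [LHS]integral0_eq; last first.
  move=> x _; rewrite (_ : (fun y => _) =
      (fun y : measurableTypeR R => (\1_[set (c - dotv x a) / dotv a a] y)%:E)); last first.
    apply/funext => y; congr EFin; rewrite !indicE; congr (nat_of_bool _)%:R.
    apply/idP/idP; rewrite !in_setE /H/= dotvD dotvZ.
      by move=> <-; rewrite addrAC subrr add0r mulfK.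
    by move=> ->; rewrite divfK// addrC subrK.
  by rewrite (integral_indic (@lebesgue_measure R) measurableT)//= setIT lebesgue_measure_set1.
rewrite (_ : (fun y => _) = cst (mu H)); last first.
  apply/funext => y.
  rewrite (integral_indic_preim (phi := fun x => x + _))//; last exact: measurable_addv.
  exact: (mpres_shift _).2.
rewrite integral_cst// => /esym/eqP; rewrite mule_eq0 => /orP[/eqP//|].
have E : @lebesgue_measure R [set: R] = +oo%E.
  by rewrite -set_itvNyy lebesgue_measure_itv.
by rewrite [X in X == _]E.
Qed.
End volk_theory.

(** * Complex-valued functions and square integrability *)

Section complex_algebra.
Context {R : realType}.
Implicit Types (z w : R[i]) (x y : R).
Local Notation Re := (@complex.Re R).
Local Notation Im := (@complex.Im R).

Lemma complexP z w : Re z = Re w -> Im z = Im w -> z = w.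
Proof. by case: z w => [a b] [c e] /= -> ->. Qed.

Lemma ReD z w : Re (z + w) = Re z + Re w. Proof. by case: z w => [a b] [c e]. Qed.
Lemma ImD z w : Im (z + w) = Im z + Im w. Proof. by case: z w => [a b] [c e]. Qed.
Lemma ReN z : Re (- z) = - Re z. Proof. by case: z. Qed.
Lemma ImN z : Im (- z) = - Im z. Proof. by case: z. Qed.
Lemma ReB z w : Re (z - w) = Re z - Re w. Proof. by rewrite ReD ReN. Qed.
Lemma ImB z w : Im (z - w) = Im z - Im w. Proof. by rewrite ImD ImN. Qed.
Lemma cReM z w : Re (z * w) = Re z * Re w - Im z * Im w.
Proof. by case: z w => [a b] [c e]. Qed.
Lemma cImM z w : Im (z * w) = Re z * Im w + Im z * Re w.
Proof. by case: z w => [a b] [c e]. Qed.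

Lemma Re_sum (I : Type) (r : seq I) (P : pred I) (F : I -> R[i]) :
  Re (\sum_(i <- r | P i) F i) = \sum_(i <- r | P i) Re (F i).
Proof. exact: (big_morph Re ReD). Qed.

Lemma Im_sum (I : Type) (r : seq I) (P : pred I) (F : I -> R[i]) :
  Im (\sum_(i <- r | P i) F i) = \sum_(i <- r | P i) Im (F i).
Proof. exact: (big_morph Im ImD). Qed.

Lemma toCD x y : toC (x + y) = toC x + toC y.
Proof. by apply: complexP; rewrite ?ReD ?ImD/= ?addr0. Qed.
Lemma toCM x y : toC (x * y) = toC x * toC y.
Proof. by apply: complexP; rewrite ?cReM ?cImM/= ?mulr0 ?mul0r ?subr0 ?addr0. Qed.
Lemma toC0 : toC (0 : R) = 0. Proof. by []. Qed.
Lemma toC1 : toC (1 : R) = 1. Proof. by []. Qed.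
Lemma toCN x : toC (- x) = - toC x.
Proof. by apply: complexP; rewrite ?ReN ?ImN/= ?oppr0. Qed.
Lemma toC_nat m : toC (m%:R : R) = m%:R.
Proof. by elim: m => // m IH; rewrite -addn1 !natrD toCD IH. Qed.
Lemma toC_eq0 x : (toC x == 0) = (x == 0).
Proof. by apply/eqP/eqP => [[]|->]. Qed.
Lemma toCV x : toC (x^-1) = (toC x)^-1.
Proof.
have [->|x0] := eqVneq x 0; first by rewrite toC0 !invr0.
apply: (mulfI (_ : toC x != 0)); first by rewrite toC_eq0.
by rewrite -toCM !mulfV ?toC_eq0.
Qed.
Lemma toC_sum (I : Type) (r : seq I) (P : pred I) (F : I -> R) :
  toC (\sum_(i <- r | P i) F i) = \sum_(i <- r | P i) toC (F i).
Proof. exact: (big_morph toC toCD). Qed.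
Lemma Re_toCM x z : Re (toC x * z) = x * Re z.
Proof. by rewrite cReM/= mul0r subr0. Qed.
Lemma Im_toCM x z : Im (toC x * z) = x * Im z.
Proof. by rewrite cImM/= mul0r addr0. Qed.

Lemma sqnormc_ge0 z : 0 <= sqnormc z.
Proof. by rewrite addr_ge0// sqr_ge0. Qed.
Lemma sqnormcM z w : sqnormc (z * w) = sqnormc z * sqnormc w.
Proof. by rewrite /sqnormc cReM cImM; ring. Qed.
Lemma sqnormcN z : sqnormc (- z) = sqnormc z.
Proof. by rewrite /sqnormc ReN ImN !sqrrN. Qed.
Lemma sqnormcBC z w : sqnormc (z - w) = sqnormc (w - z).
Proof. by rewrite -sqnormcN opprB. Qed.
Lemma sqnormc0 : sqnormc (0 : R[i]) = 0.
Proof. by rewrite /sqnormc/= expr0n/= addr0. Qed.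
Lemma sqnormc1 : sqnormc (1 : R[i]) = 1.
Proof. by rewrite /sqnormc/= expr1n expr0n/= addr0. Qed.
Lemma sqnormc_eq0 z : (sqnormc z == 0) = (z == 0).
Proof.
apply/idP/eqP => [|->]; last by rewrite sqnormc0.
rewrite /sqnormc paddr_eq0 ?sqr_ge0// !sqrf_eq0 => /andP[/eqP a /eqP b].
exact: complexP.
Qed.
Lemma sqnormc_toC x : sqnormc (toC x) = x ^+ 2.
Proof. by rewrite /sqnormc/= expr0n/= addr0. Qed.
(** The free weight [e] makes limits of norms exact: letting it tend to 0, as in [lim_sqnorm],
    replaces the triangle inequality for the square root of an integral. *)
Lemma sqnormcD_le (e : R) z w : 0 < e ->
  sqnormc (z + w) <= (1 + e) * sqnormc z + (1 + e^-1) * sqnormc w.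
Proof.
move=> e0; rewrite /sqnormc ReD ImD.
have H (a b : R) : (a + b) ^+ 2 <= (1 + e) * a ^+ 2 + (1 + e^-1) * b ^+ 2.
  rewrite -subr_ge0.
  have -> : (1 + e) * a ^+ 2 + (1 + e^-1) * b ^+ 2 - (a + b) ^+ 2 =
    e^-1 * (e * a - b) ^+ 2 by field; rewrite gt_eqF.
  by rewrite mulr_ge0 ?sqr_ge0// invr_ge0 ltW.
have := H (Re z) (Re w); have := H (Im z) (Im w); lra.
Qed.

Lemma sqnormcD_le2 z w : sqnormc (z + w) <= 2 * sqnormc z + 2 * sqnormc w.
Proof. by have := @sqnormcD_le 1 z w ltr01; rewrite invr1. Qed.

Lemma sqnormc_sum_le (I : Type) (s : seq I) (F : I -> R[i]) :
  sqnormc (\sum_(i <- s) F i) <= (size s)%:R * \sum_(i <- s) sqnormc (F i).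
Proof.
elim: s => [|i s IH]; first by rewrite !big_nil sqnormc0 mulr0.
rewrite !big_cons /=.
have [/size0nil ->|s0] := posnP (size s).
  by rewrite !big_nil !addr0 mul1r.
have sp : 0 < (size s)%:R :> R by rewrite ltr0n.
(* The weight [size s] gives the coefficient [size s + 1] to both terms. *)
apply: (le_trans (@sqnormcD_le (size s)%:R _ _ sp)).
rewrite -natr1 [leRHS]mulrDr; apply: lerD; first by rewrite addrC.
apply: (@le_trans _ _ ((1 + (size s)%:R^-1) * ((size s)%:R * \sum_(i <- s) sqnormc (F i)))).
  by rewrite ler_wpM2l// addr_ge0// invr_ge0 ltW.
by rewrite mulrA mulrDl mulVf ?gt_eqF// mul1r.
Qed.

Lemma normr_Re_le z : `|Re z| ^+ 2 <= sqnormc z.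
Proof. by rewrite real_normK ?num_real// lerDl sqr_ge0. Qed.
Lemma normr_Im_le z : `|Im z| ^+ 2 <= sqnormc z.
Proof. by rewrite real_normK ?num_real// lerDr sqr_ge0. Qed.

Lemma cexpiD x y : cexpi (x + y) = cexpi x * cexpi y.
Proof. by apply: complexP; rewrite /cexpi ?cReM ?cImM/= ?cosD ?sinD// addrC mulrC [X in _ + X]mulrC addrC mulrC [X in _ + X]mulrC. Qed.
Lemma cexpi0 : cexpi 0 = 1 :> R[i].
Proof. by apply: complexP; rewrite /= ?cos0 ?sin0. Qed.
Lemma sqnormc_cexpi x : sqnormc (cexpi x) = 1.
Proof. by rewrite /sqnormc/= cos2Dsin2. Qed.
Lemma cexpi_neq0 x : cexpi x != 0.
Proof. by rewrite -sqnormc_eq0 sqnormc_cexpi oner_eq0. Qed.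
Lemma cexpiN x : cexpi (- x) = (cexpi x)^-1.
Proof.
apply: (mulfI (cexpi_neq0 x)).
by rewrite -cexpiD subrr cexpi0 mulfV// cexpi_neq0.
Qed.
Lemma cexpiMn x m : cexpi (x *+ m) = cexpi x ^+ m.
Proof. by elim: m => [|m IH]; rewrite ?mulr0n ?cexpi0 ?expr0// mulrS cexpiD IH exprS. Qed.
Lemma cexpi_2pi : cexpi (2 * pi) = 1 :> R[i].
Proof. by apply: complexP; rewrite /= mulrC mulr_natr ?cos2pi ?sin2pi. Qed.
Lemma cexpi_int (x : R) : x \is a Num.int -> cexpi (2 * pi * x) = 1.
Proof.
move=> /intrP[[m|m] ->].
  by rewrite -pmulrn mulr_natr cexpiMn cexpi_2pi expr1n.
by rewrite NegzE mulrNz mulrN cexpiN -pmulrn mulr_natr cexpiMn cexpi_2pi expr1n invr1.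
Qed.

Lemma cexpi_pi : cexpi pi = -1 :> R[i].
Proof. by apply: complexP; rewrite /= ?cospi ?sinpi ?oppr0. Qed.

End complex_algebra.

Section bracket_theory.
Context {R : realType} {n : nat}.
Variable k : nat.
Implicit Types x y : 'cV[R]_n.
Lemma ipkC x y : ipk k x y = ipk k y x. Proof. by rewrite /ipk dotvC. Qed.
Lemma ipkD x y z : ipk k (x + y) z = ipk k x z + ipk k y z.
Proof. by rewrite /ipk dotvD mulrDr. Qed.
Lemma ipkDr x y z : ipk k z (x + y) = ipk k z x + ipk k z y.
Proof. by rewrite /ipk dotvDr mulrDr. Qed.
Lemma ipkN x z : ipk k (- x) z = - ipk k x z.
Proof. by rewrite /ipk dotvN mulrN. Qed.
Lemma ipkNr x z : ipk k z (- x) = - ipk k z x.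
Proof. by rewrite /ipk dotvNr mulrN. Qed.
Lemma ipkZ a x z : ipk k (a *: x) z = a * ipk k x z.
Proof. by rewrite /ipk dotvZ mulrCA. Qed.
Lemma ipkZr a x z : ipk k z (a *: x) = a * ipk k z x.
Proof. by rewrite /ipk dotvZr mulrCA. Qed.
Lemma ipk0 x : ipk k 0 x = 0. Proof. by rewrite /ipk dot0v mulr0. Qed.
Lemma bracketC x y : bracket k x y = bracket k y x.
Proof. by rewrite /bracket ipkC. Qed.
Lemma bracketD x y z : bracket k (x + y) z = bracket k x z * bracket k y z.
Proof. by rewrite /bracket ipkD mulrDr cexpiD. Qed.
Lemma bracketDr x y z : bracket k z (x + y) = bracket k z x * bracket k z y.
Proof. by rewrite /bracket ipkDr mulrDr cexpiD. Qed.
Lemma bracketN x z : bracket k (- x) z = (bracket k x z)^-1.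
Proof. by rewrite /bracket ipkN mulrN cexpiN. Qed.
Lemma bracketNr x z : bracket k z (- x) = (bracket k z x)^-1.
Proof. by rewrite /bracket ipkNr mulrN cexpiN. Qed.
Lemma bracketNC x z : bracket k (- x) z = bracket k x (- z).
Proof. by rewrite bracketN bracketNr. Qed.
Lemma bracket0 x : bracket k 0 x = 1. Proof. by rewrite /bracket ipk0 mulr0 cexpi0. Qed.
Lemma sqnormc_bracket x y : sqnormc (bracket k x y) = 1.
Proof. exact: sqnormc_cexpi. Qed.
Lemma bracket_int x y : ipk k x y \is a Num.int -> bracket k x y = 1.
Proof. exact: cexpi_int. Qed.
Lemma ipk_orth (w : 'M[R]_n) x y : w^T *m w = 1%:M ->
  ipk k (w *m x) (w *m y) = ipk k x y.
Proof. by move=> wo; rewrite /ipk dotv_orth. Qed.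
Lemma bracket_orth (w : 'M[R]_n) x y : w^T *m w = 1%:M ->
  bracket k (w *m x) (w *m y) = bracket k x y.
Proof. by move=> wo; rewrite /bracket ipk_orth. Qed.
End bracket_theory.

Section cmeasurable_theory.
Context {R : realType} d (T : measurableType d).
Implicit Types f g : T -> R[i].
Local Notation Re := (@complex.Re R).
Local Notation Im := (@complex.Im R).

Lemma cmeas_cst (c : R[i]) : cmeasurable (fun _ : T => c).
Proof. by split. Qed.
Lemma cmeasD f g : cmeasurable f -> cmeasurable g -> cmeasurable (fun x => f x + g x).
Proof.
move=> [f1 f2] [g1 g2]; split.
  by under eq_fun do rewrite ReD; exact: measurable_funD.
by under eq_fun do rewrite ImD; exact: measurable_funD.
Qed.
Lemma cmeasM f g : cmeasurable f -> cmeasurable g -> cmeasurable (fun x => f x * g x).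
Proof.
move=> [f1 f2] [g1 g2]; split.
  by under eq_fun do rewrite cReM; apply: measurable_funB; exact: measurable_funM.
by under eq_fun do rewrite cImM; apply: measurable_funD; exact: measurable_funM.
Qed.
Lemma cmeasZ c f : cmeasurable f -> cmeasurable (fun x => c * f x).
Proof. by move=> mf; apply: cmeasM => //; exact: cmeas_cst. Qed.
Lemma cmeasN f : cmeasurable f -> cmeasurable (fun x => - f x).
Proof.
move=> [f1 f2]; split.
  by under eq_fun do rewrite ReN; exact: measurable_funN.
by under eq_fun do rewrite ImN; exact: measurable_funN.
Qed.
Lemma cmeasB f g : cmeasurable f -> cmeasurable g -> cmeasurable (fun x => f x - g x).
Proof. by move=> mf mg; apply: cmeasD => //; exact: cmeasN. Qed.
Lemma cmeas_sum (I : Type) (r : seq I) (F : I -> T -> R[i]) :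
  (forall i, cmeasurable (F i)) -> cmeasurable (fun x => \sum_(i <- r) F i x).
Proof.
move=> mF; split.
  under eq_fun do rewrite Re_sum; apply: measurable_sum => i; exact: (mF i).1.
under eq_fun do rewrite Im_sum; apply: measurable_sum => i; exact: (mF i).2.
Qed.
Lemma cmeas_toC (f : T -> R) : measurable_fun setT f -> cmeasurable (fun x => toC (f x)).
Proof. by move=> mf; split. Qed.
Lemma cmeas_cexpi (f : T -> R) : measurable_fun setT f -> cmeasurable (fun x => cexpi (f x)).
Proof.
by move=> mf; split; apply: measurableT_comp => //; apply: continuous_measurable_fun;
  [exact: continuous_cos | exact: continuous_sin].
Qed.
Lemma cmeas_comp d' (T' : measurableType d') (phi : T' -> T) f :
  cmeasurable f -> measurable_fun setT phi -> cmeasurable (fun x => f (phi x)).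
Proof. by move=> [f1 f2] mp; split; [exact: (measurableT_comp f1)|exact: (measurableT_comp f2)]. Qed.
Lemma cmeas_sqnormc f : cmeasurable f -> measurable_fun setT (fun x => sqnormc (f x)).
Proof. by move=> [f1 f2]; apply: measurable_funD; exact: measurable_funX. Qed.
Lemma cmeas_sqnormcE D f : cmeasurable f -> measurable_fun D (fun x => (sqnormc (f x))%:E).
Proof. by move=> mf; apply/measurable_EFinP/measurable_funTS/cmeas_sqnormc. Qed.
Lemma cmeas_lim (F : nat -> T -> R[i]) f : (forall m, cmeasurable (F m)) ->
  (forall x, Re (F m x) @[m --> \oo] --> Re (f x)) ->
  (forall x, Im (F m x) @[m --> \oo] --> Im (f x)) -> cmeasurable f.
Proof.
move=> mF h1 h2; split.
  by apply: (measurable_fun_cvg (fun m => (mF m).1)) => x _; exact: h1.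
by apply: (measurable_fun_cvg (fun m => (mF m).2)) => x _; exact: h2.
Qed.
Lemma cmeas_indic A f : measurable A -> cmeasurable f ->
  cmeasurable (fun x => toC (\1_A x) * f x).
Proof. by move=> mA mf; apply: cmeasM => //; apply: cmeas_toC; exact: measurable_indic. Qed.
End cmeasurable_theory.

(** * Limits of extended real sequences *)

Section ereal_sequences.
Context {R : realType}.
Implicit Types (A D : nat -> \bar R) (B : \bar R).
Local Open Scope ereal_scope.

Lemma eq_lee (x y : \bar R) : x = y -> x <= y.
Proof. by move=> ->. Qed.

Lemma cvge0_near D : (forall m, 0 <= D m) ->
  D @ \oo --> 0 <-> forall e : R, (0 < e)%R -> \forall m \near \oo, D m <= e%:E.
Proof.
move=> D0; split=> [/fine_cvgP[Df D00] e e0|H].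
  have {}D00 : \forall m \near \oo, (`|fine (D m)| <= e)%R.
    by move/cvgr0Pnorm_le : D00; exact.
  near=> m; have Dm : D m \is a fin_num by near: m.
  rewrite -(fineK Dm) lee_fin; apply: le_trans (ler_norm _) _.
  by near: m.
apply/fine_cvgP; split.
  near=> m; rewrite ge0_fin_numE//; apply: (@le_lt_trans _ _ 1%:E); last exact: ltry.
  by near: m; exact: H.
apply/cvgr0Pnorm_le => e e0; near=> m.
have Dm : D m <= e%:E by near: m; exact: H.
have Df : D m \is a fin_num by rewrite ge0_fin_numE// (le_lt_trans Dm)// ltry.
rewrite ger0_norm ?fine_ge0//.
by rewrite -lee_fin fineK.
Unshelve. all: by end_near. Qed.

(** A substitute for the continuity of the norm, in terms of squared norms: [D] plays the squared
    distance, and the two weighted estimates exchange the roles of [A] and [B]. *)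
Lemma lim_sqnorm A D B : (forall m, 0 <= A m) -> (forall m, 0 <= D m) ->
  0 <= B -> B < +oo ->
  (forall (e : R) m, (0 < e)%R -> A m <= (1 + e)%:E * B + (1 + e^-1)%:E * D m) ->
  (forall (e : R) m, (0 < e)%R -> B <= (1 + e)%:E * A m + (1 + e^-1)%:E * D m) ->
  D @ \oo --> 0 -> A @ \oo --> B.
Proof.
move=> A0 D0 B0 Boo; have Bf : B \is a fin_num by rewrite ge0_fin_numE.
rewrite -(fineK Bf); set b := fine B.
have b0 : (0 <= b)%R by rewrite fine_ge0.
move=> AB BA /(cvge0_near D0) Dl.
have key (eta : R) : (0 < eta)%R -> \forall m \near \oo,
    A m \is a fin_num /\ (`|b - fine (A m)| <= eta)%R.
  move=> eta0.
  (* First [e] brings the relative error [e * b] below a quarter of [eta], then [del] absorbs the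
     factor [1 + e^-1]. *)
  pose e := Num.min 1%R (eta / (4 * (b + 1)))%R.
  have b1 : (0 < 4 * (b + 1))%R by lra.
  have e0 : (0 < e)%R by rewrite lt_min ltr01/= divr_gt0.
  have e1 : (e <= 1)%R by rewrite ge_min lexx.
  have eb : (e * (4 * (b + 1)) <= eta)%R.
    by rewrite -ler_pdivlMr// ge_min lexx orbT.
  have ei0 : (0 < 1 + e^-1)%R by rewrite addr_gt0// invr_gt0.
  pose del := (eta / (4 * (1 + e^-1)))%R.
  have del0 : (0 < del)%R by rewrite divr_gt0// mulr_gt0.
  have delE : ((1 + e^-1) * del = eta / 4)%R.
    by rewrite /del; field; rewrite !gt_eqF//= ?(addr_gt0 e0)//; lra.
  near=> m.
  have Dm : D m <= del%:E by near: m; exact: Dl.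
  have Df : D m \is a fin_num by rewrite ge0_fin_numE// (le_lt_trans Dm)// ltry.
  have := AB e m e0; have := BA e m e0.
  rewrite -(fineK Df) -EFinM; move: Dm; rewrite -(fineK Df) lee_fin.
  set dm := fine (D m) => dmd H1 H2.
  have Af : A m \is a fin_num.
    by rewrite ge0_fin_numE// (le_lt_trans H2)// -EFinM -EFinD ltry.
  split=> //; move: H1 H2; rewrite -(fineK Af) -!EFinM -!EFinD !lee_fin.
  set a := fine (A m); rewrite /= => H1 H2.
  have dd : ((1 + e^-1) * dm <= eta / 4)%R by rewrite -delE ler_wpM2l// ltW.
  have a0 : (0 <= a)%R by rewrite fine_ge0.
  rewrite ler_norml; apply/andP; split; last first.
    have : (e * a <= eta / 4 + e * eta)%R; last by nra.
    have : (a <= b + eta)%R by nra.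
    move=> ab; have : (e * a <= e * (b + eta))%R by rewrite ler_wpM2l// ltW.
    nra.
  nra.
apply/fine_cvgP; split.
  by apply: filterS (key 1%R ltr01) => m [].
by apply/cvgrPdist_le => eta /key; apply: filterS => m [].
Unshelve. all: by end_near. Qed.
End ereal_sequences.

(** * The squared L^2 norm of complex-valued functions *)

Section nsq_theory.
Context {R : realType} d (T : measurableType d).
Variable mu : {measure set T -> \bar R}.
Implicit Types (f g : T -> R[i]) (D : set T).
Local Open Scope ereal_scope.

Definition nsq D f : \bar R := \int[mu]_(x in D) (sqnormc (f x))%:E.

Lemma nsq_ge0 D f : 0 <= nsq D f.
Proof. by apply: integral_ge0 => x _; rewrite lee_fin sqnormc_ge0. Qed.
Hint Resolve nsq_ge0 : core.

Lemma eq_nsq D f g : (forall x, D x -> f x = g x) -> nsq D f = nsq D g.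
Proof. by move=> fg; apply: eq_integral => x /set_mem Dx; rewrite fg. Qed.

Lemma nsqN D f : nsq D (fun x => - f x)%R = nsq D f.
Proof. by apply: eq_integral => x _; rewrite sqnormcN. Qed.

Lemma nsqBC D f g : nsq D (fun x => f x - g x)%R = nsq D (fun x => g x - f x)%R.
Proof. by apply: eq_integral => x _; rewrite sqnormcBC. Qed.

Lemma nsq0 D : nsq D (fun=> 0%R) = 0.
Proof. by apply: integral0_eq => x _; rewrite sqnormc0. Qed.

Variables (D : set T) (mD : measurable D).

Lemma le_nsq f g : cmeasurable f -> cmeasurable g ->
  (forall x, D x -> (sqnormc (f x) <= sqnormc (g x))%R) -> nsq D f <= nsq D g.
Proof.
move=> mf mg fg; apply: ge0_le_integral => //.
- by move=> x _; rewrite lee_fin sqnormc_ge0.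
- exact: cmeas_sqnormcE.
- exact: cmeas_sqnormcE.
Qed.

Lemma nsqZ c f : cmeasurable f ->
  nsq D (fun x => c * f x)%R = (sqnormc c)%:E * nsq D f.
Proof.
move=> mf; rewrite /nsq -ge0_integralZl_EFin//.
- by apply: eq_integral => x _; rewrite sqnormcM.
- by move=> x _; rewrite lee_fin sqnormc_ge0.
- exact: cmeas_sqnormcE.
- exact: sqnormc_ge0.
Qed.

Lemma nsqD_le (e : R) f g : (0 < e)%R -> cmeasurable f -> cmeasurable g ->
  nsq D (fun x => f x + g x)%R <= (1 + e)%:E * nsq D f + (1 + e^-1)%:E * nsq D g.
Proof.
move=> e0 mf mg; have ei0 : (0 < e^-1)%R by rewrite invr_gt0.
have H0 (c : R) h : (0 < c)%R -> forall x, D x -> 0 <= (1 + c)%:E * (sqnormc (h x))%:E.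
  by move=> c0 x _; rewrite mule_ge0// lee_fin ?sqnormc_ge0// addr_ge0// ltW.
have Hm (c : R) h : cmeasurable h ->
    measurable_fun D (fun x => (1 + c)%:E * (sqnormc (h x))%:E).
  by move=> mh; apply: measurable_funeM; exact: cmeas_sqnormcE.
rewrite /nsq -!ge0_integralZl_EFin//; last first.
- by rewrite addr_ge0// ltW.
- exact: cmeas_sqnormcE.
- by move=> x _; rewrite lee_fin sqnormc_ge0.
- by rewrite addr_ge0// ltW.
- exact: cmeas_sqnormcE.
- by move=> x _; rewrite lee_fin sqnormc_ge0.
rewrite -ge0_integralD//; [|exact: H0|exact: Hm|exact: H0|exact: Hm].
apply: ge0_le_integral => //.
- by move=> x _; rewrite lee_fin sqnormc_ge0.
- by apply: cmeas_sqnormcE; exact: cmeasD.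
- by apply: emeasurable_funD; exact: Hm.
- by move=> x _; rewrite -!EFinM -EFinD lee_fin sqnormcD_le.
Qed.

Lemma nsqD_le2 f g : cmeasurable f -> cmeasurable g ->
  nsq D (fun x => f x + g x)%R <= 2%:E * nsq D f + 2%:E * nsq D g.
Proof. by move=> mf mg; have := nsqD_le ltr01 mf mg; rewrite invr1. Qed.

Lemma nsqB_le2 f g : cmeasurable f -> cmeasurable g ->
  nsq D (fun x => f x - g x)%R <= 2%:E * nsq D f + 2%:E * nsq D g.
Proof.
by move=> mf mg; rewrite -(nsqN D g); apply: nsqD_le2 => //; exact: cmeasN.
Qed.

Lemma nsq_tri2 f g h : cmeasurable f -> cmeasurable g -> cmeasurable h ->
  nsq D (fun x => f x - h x)%R <= 2%:E * nsq D (fun x => f x - g x)%R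
    + 2%:E * nsq D (fun x => g x - h x)%R.
Proof.
move=> mf mg mh; apply: le_trans (nsqD_le2 _ _); [|exact: cmeasB..].
by apply/eq_lee/eq_nsq => x _; rewrite addrA subrK.
Qed.

Lemma nsq_ae f g : cmeasurable f -> cmeasurable g ->
  {ae mu, forall x, D x -> f x = g x} -> nsq D f = nsq D g.
Proof.
move=> mf mg fg; apply: ge0_ae_eq_integral => //.
- exact: cmeas_sqnormcE.
- exact: cmeas_sqnormcE.
- by move=> x _; rewrite lee_fin sqnormc_ge0.
- by move=> x _; rewrite lee_fin sqnormc_ge0.
- by apply: filterS fg => x H Dx; rewrite H.
Qed.

Lemma nsq_eq0 f : cmeasurable f -> nsq D f = 0 -> {ae mu, forall x, D x -> f x = 0%R}.
Proof.
move=> mf; rewrite /nsq => f0.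
have /ae_eq_integral_abs : measurable_fun D (fun x => (sqnormc (f x))%:E).
  exact: cmeas_sqnormcE.
move=> /(_ mu mD) [+ _].
under eq_integral do rewrite gee0_abs ?lee_fin ?sqnormc_ge0//.
move=> /(_ f0); apply: filterS => x H Dx.
have [] := H Dx.
by move=> /eqP; rewrite sqnormc_eq0 => /eqP.
Qed.

Lemma nsq_sub0 f g : cmeasurable f -> cmeasurable g ->
  nsq D (fun x => f x - g x)%R = 0 -> {ae mu, forall x, D x -> f x = g x}.
Proof.
move=> mf mg /(nsq_eq0 (cmeasB mf mg)); apply: filterS => x H Dx.
by apply/eqP; rewrite -subr_eq0; apply/eqP/H.
Qed.

(** Fatou's lemma in the form that compares a pointwise limit with an L^2 limit: a bound on the
    distances to [g] survives almost everywhere convergence. *)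
Lemma nsq_fatou (F : nat -> T -> R[i]) g f (c : \bar R) :
  (forall m, cmeasurable (F m)) -> cmeasurable f -> cmeasurable g ->
  {ae mu, forall x, D x -> (sqnormc (F m x - g x) @[m --> \oo] --> sqnormc (f x - g x))%R} ->
  (\forall m \near \oo, nsq D (fun x => F m x - g x)%R <= c) ->
  nsq D (fun x => f x - g x)%R <= c.
Proof.
move=> mF mf mg Ff Fc.
have mFE m : measurable_fun D (fun x => (sqnormc (F m x - g x))%:E).
  by apply: cmeas_sqnormcE; exact: cmeasB.
apply: (@le_trans _ _ (\int[mu]_(x in D) limn_einf (fun m => (sqnormc (F m x - g x))%:E))).
  apply: ae_ge0_le_integral => //.
  - by move=> x _; rewrite lee_fin sqnormc_ge0.
  - by apply: cmeas_sqnormcE; exact: cmeasB.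
  - move=> x _; rewrite limn_einf_lim; apply: lime_ge; first exact: is_cvg_einfs.
    by apply: nearW => m; apply: le_ereal_inf_tmp => _ [p _ <-]; rewrite lee_fin sqnormc_ge0.
  - apply: (emeasurable_fun_cvg (fun p x => einfs (fun m => (sqnormc (F m x - g x))%:E) p)).
      by move=> p; exact: measurable_fun_einfs.
    by move=> x _; rewrite limn_einf_lim; exact: is_cvg_einfs.
  apply: filterS Ff => x H Dx.
  have Hc : (sqnormc (F m x - g x)%R)%:E @[m --> \oo] --> (sqnormc (f x - g x)%R)%:E.
    by apply: cvg_EFin; [exact: nearW|exact: H].
  by have [-> _] := cvg_limn_einf_sup Hc.
apply: le_trans (fatou mu mD mFE _) _; first by move=> m x _; rewrite lee_fin sqnormc_ge0.
rewrite limn_einf_lim.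
apply: lime_le; first exact: is_cvg_einfs.
apply: filterS Fc => m; apply: le_trans.
by apply: ereal_inf_lbound; exists m => //=.
Qed.

Lemma nsq_cvg (F : nat -> T -> R[i]) f : (forall m, cmeasurable (F m)) ->
  cmeasurable f -> nsq D f < +oo ->
  nsq D (fun x => F m x - f x)%R @[m --> \oo] --> 0 ->
  nsq D (F m) @[m --> \oo] --> nsq D f.
Proof.
move=> mF mf foo; apply: lim_sqnorm => //.
  move=> e m e0; apply: le_trans (nsqD_le e0 mf (cmeasB (mF m) mf)).
  by apply/eq_lee/eq_nsq => x _; rewrite addrC subrK.
move=> e m e0; rewrite nsqBC.
apply: le_trans (nsqD_le e0 (mF m) (cmeasB mf (mF m))).
by apply/eq_lee/eq_nsq => x _; rewrite addrC subrK.
Qed.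

Lemma nsq_fin_lim (F : nat -> T -> R[i]) f : (forall m, cmeasurable (F m)) ->
  cmeasurable f -> (forall m, nsq D (F m) < +oo) ->
  nsq D (fun x => F m x - f x)%R @[m --> \oo] --> 0 -> nsq D f < +oo.
Proof.
move=> mF mf Foo /cvge0_near => /(_ (fun=> nsq_ge0 _ _) 1%R ltr01)[N _ /(_ N (leqnn N))/= H].
have -> : nsq D f = nsq D (fun x => F N x - (F N x - f x))%R.
  by apply: eq_nsq => x _; rewrite opprB addrC subrK.
apply: le_lt_trans (nsqB_le2 (mF N) (cmeasB (mF N) mf)) _.
apply: lte_add_pinfty; apply: lte_mul_pinfty => //.
by rewrite (le_lt_trans H)// ltry.
Qed.

Lemma nsq_lim_tri (F G : nat -> T -> R[i]) f : (forall m, cmeasurable (F m)) ->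
  (forall m, cmeasurable (G m)) -> cmeasurable f ->
  nsq D (fun x => F m x - G m x)%R @[m --> \oo] --> 0 ->
  nsq D (fun x => G m x - f x)%R @[m --> \oo] --> 0 ->
  nsq D (fun x => F m x - f x)%R @[m --> \oo] --> 0.
Proof.
move=> mF mG mf FG Gf.
apply: (@squeeze_cvge _ _ _ _ (cst 0) _ (fun m => 2%:E * nsq D (fun x => F m x - G m x)%R
   + 2%:E * nsq D (fun x => G m x - f x)%R)).
- by apply: nearW => m; rewrite nsq_ge0/= nsq_tri2.
- exact: cvg_cst.
- rewrite -[X in _ --> X](_ : 2%:E * 0 + 2%:E * 0 = 0 :> \bar R); last by rewrite !mule0 adde0.
  by apply: cvgeD => //; [exact: cvgeZl|exact: cvgeZl].
Qed.

Lemma nsq_lim_unique (F : nat -> T -> R[i]) f g : (forall m, cmeasurable (F m)) ->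
  cmeasurable f -> cmeasurable g ->
  nsq D (fun x => F m x - f x)%R @[m --> \oo] --> 0 ->
  nsq D (fun x => F m x - g x)%R @[m --> \oo] --> 0 ->
  {ae mu, forall x, D x -> f x = g x}.
Proof.
move=> mF mf mg Ff Fg; apply: nsq_sub0 => //.
have H : (nsq D (fun x => f x - g x)%R) @[m --> \oo] --> (0 : \bar R).
  apply: (@nsq_lim_tri (fun=> f) F g) => //.
  by under eq_cvg do rewrite nsqBC.
apply/eqP; rewrite eq_le nsq_ge0 andbT; apply/lee_addgt0Pr => e e0.
rewrite add0e; move: H => /cvge0_near => /(_ (fun=> nsq_ge0 _ _) e e0)[N _].
by move=> /(_ N (leqnn N)).
Qed.

Lemma nsq_cvgD (F G : nat -> T -> R[i]) f g (c : R[i]) : (forall m, cmeasurable (F m)) ->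
  (forall m, cmeasurable (G m)) -> cmeasurable f -> cmeasurable g ->
  nsq D (fun x => F m x - f x)%R @[m --> \oo] --> 0 ->
  nsq D (fun x => G m x - g x)%R @[m --> \oo] --> 0 ->
  nsq D (fun x => (c * F m x + G m x) - (c * f x + g x))%R @[m --> \oo] --> 0.
Proof.
move=> mF mG mf mg FG Gf.
apply: (@squeeze_cvge _ _ _ _ (cst 0) _ (fun m => 2%:E * ((sqnormc c)%:E * nsq D (fun x => F m x - f x)%R)
   + 2%:E * nsq D (fun x => G m x - g x)%R)).
- apply: nearW => m; rewrite nsq_ge0/= -nsqZ; last exact: cmeasB.
  apply: le_trans (nsqD_le2 _ _); last exact: cmeasB.
    by apply/eq_lee/eq_nsq => x _; rewrite mulrBr opprD addrACA.
  by apply: cmeasZ; exact: cmeasB.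
- exact: cvg_cst.
- rewrite -[X in _ --> X](_ : 2%:E * ((sqnormc c)%:E * 0) + 2%:E * 0 = 0 :> \bar R); last by rewrite !mule0 adde0.
  by apply: cvgeD => //; [apply: cvgeZl => //; exact: cvgeZl|exact: cvgeZl].
Qed.

Lemma nsq_mpres phi f : mpres mu phi -> cmeasurable f ->
  nsq (phi @^-1` D) (fun x => f (phi x)) = nsq D f.
Proof.
move=> mp mf; rewrite /nsq.
apply: (mpres_ge0_integral (f := fun x => (sqnormc (f x))%:E) mp) => //.
- exact: cmeas_sqnormcE.
- by move=> x _; rewrite lee_fin sqnormc_ge0.
Qed.

End nsq_theory.

(** * Completeness of L^2 with an explicit limit *)

Section riesz_fischer.
Context {R : realType} d (T : measurableType d).
Variable mu : {measure set T -> \bar R}.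
Variables (D : set T) (mD : measurable D).
Local Notation Re := (@complex.Re R).
Local Notation Im := (@complex.Im R).

(** Increments of squared norm at most [8^-m] keep a finite total after multiplication by [2 ^+ m],
    while these weights bound the squared distance from [F m] to every later term by a multiple of
    [2^-m]. *)
Definition fsum (F : nat -> T -> R[i]) (x : T) : \bar R :=
  (\sum_(m <oo) (2 ^+ m * sqnormc (F m.+1 x - F m x))%:E)%E.

(** Whether the value is a limit or 0 depends only on the sequence at [x]. Hence a relation
    [F m x' = c * F m x] with [c] unimodular, valid for all [m], passes to the limit at every point,
    exceptional ones included ([flim_mul]): sections have to obey their multiplier law
    everywhere. *)
Definition flim (F : nat -> T -> R[i]) (x : T) : R[i] :=
  if (fsum F x < +oo)%E then
    Complex (limn (fun m => Re (F m x))) (limn (fun m => Im (F m x)))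
  else 0.

Variable F : nat -> T -> R[i].

Let inc m x := sqnormc (F m.+1 x - F m x).

Lemma fsum_ge (N : nat) x :
  ((\sum_(0 <= m < N) 2 ^+ m * inc m x)%:E <= fsum F x)%E.
Proof.
rewrite -sumEFin; apply: nneseries_lim_ge => m _ _.
by rewrite lee_fin mulr_ge0 ?exprn_ge0 ?sqnormc_ge0.
Qed.

Lemma fsum_cauchy (m p : nat) x (s : R) : (fsum F x <= s%:E)%E -> (m <= p)%N ->
  sqnormc (F p x - F m x) <= 2 / 2 ^+ m * s.
Proof.
move=> Fs mp.
have inc0 l : 0 <= 2 ^+ l * inc l x by rewrite mulr_ge0 ?exprn_ge0 ?sqnormc_ge0.
have S q : \sum_(0 <= l < q) 2 ^+ l * inc l x <= s.
  by rewrite -lee_fin (le_trans (fsum_ge q x)).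
have s0 : 0 <= s by have := S 0%N; rewrite big_geq.
(* by descending induction on [m], with weights 1/2 and 1/2 *)
have key q : forall m, sqnormc (F (m + q)%N x - F m x) <=
    2 / 2 ^+ m * \sum_(m <= l < m + q) 2 ^+ l * inc l x.
  elim: q => [|q IH] {mp}m.
    by rewrite addn0 subrr sqnormc0 big_geq// mulr0.
  have -> : F (m + q.+1)%N x - F m x =
      (F m.+1 x - F m x) + (F (m.+1 + q)%N x - F m.+1 x).
    by rewrite addSnnS [RHS]addrC subrKA.
  apply: le_trans (sqnormcD_le2 _ _) _.
  rewrite big_ltn ?addnS ?ltnS ?leq_addr// -addSn.
  have := IH m.+1; rewrite exprS; set A := \sum_(_ <= _ < _) _ => H.
  have p0 : 0 < 2 ^+ m :> R by rewrite exprn_gt0.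
  rewrite (_ : 2 / 2 ^+ m * (2 ^+ m * inc m x + A) = 2 * inc m x + 2 / 2 ^+ m * A); last first.
    by field; rewrite gt_eqF.
  apply: lerD => //.
  apply: le_trans (_ : 2 * (2 / (2 * 2 ^+ m) * A) <= _); first by rewrite ler_wpM2l.
  by rewrite le_eqVlt; apply/orP; left; apply/eqP; field; rewrite gt_eqF.
have := key (p - m)%N m; rewrite subnKC// => H; apply: (le_trans H).
rewrite ler_wpM2l ?divr_ge0 ?exprn_ge0//; apply: le_trans (S p).
rewrite (big_cat_nat (leq0n m) mp)/= lerDr sumr_ge0//.
Qed.

Let cvg_part (G : R[i] -> R) (GB : forall z w, G (z - w) = G z - G w)
  (GN : forall z, `|G z| ^+ 2 <= sqnormc z) x :
  (fsum F x < +oo)%E -> cvgn (fun m => G (F m x)).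
Proof.
move=> Fx.
have f0 : (0 <= fsum F x)%E by apply: (le_trans _ (fsum_ge 0 x)); rewrite big_geq.
have Ff : fsum F x \is a fin_num by rewrite ge0_fin_numE.
pose s := fine (fsum F x) + 1.
have s0 : 0 < s by rewrite ltr_wpDl// fine_ge0.
have Fs : (fsum F x <= s%:E)%E by rewrite -(fineK Ff) lee_fin lerDl.
apply/cauchy_cvgP; apply: cauchy_exP => e e0.
have [N _ HN] : \forall m \near \oo, 2 / 2 ^+ m * s < e ^+ 2.
  have : (2 * s * (2^-1) ^+ m @[m --> \oo] --> (2 * s * 0 : R)).
    apply: cvgMr; apply: cvg_expr; rewrite ger0_norm ?invr_ge0// invf_lt1// ltr1n//.
  rewrite mulr0 => /cvgr0Pnorm_lt /(_ (e ^+ 2)).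
  rewrite exprn_gt0// => /(_ isT).
  apply: filterS => m; rewrite ger0_norm; last first.
    by rewrite !mulr_ge0 ?exprn_ge0 ?invr_ge0 ?ltW.
  by rewrite exprVn mulrAC.
exists (G (F N x)); exists N => // p Np.
rewrite -ball_normE/= distrC -(@ltr_pXn2r _ 2)// ?nnegrE// ?ltW//.
by rewrite -GB (le_lt_trans (GN _))// (le_lt_trans (fsum_cauchy Fs Np))// HN/=.
Qed.

Lemma flim_cvg_Re x : (fsum F x < +oo)%E -> Re (F m x) @[m --> \oo] --> Re (flim F x).
Proof. by move=> Fx; rewrite /flim Fx; apply: (cvg_part ReB normr_Re_le). Qed.

Lemma flim_cvg_Im x : (fsum F x < +oo)%E -> Im (F m x) @[m --> \oo] --> Im (flim F x).
Proof. by move=> Fx; rewrite /flim Fx; apply: (cvg_part ImB normr_Im_le). Qed.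

Lemma cvg_sqnormcB (u : nat -> R[i]) (z w : R[i]) :
  Re (u m) @[m --> \oo] --> Re z -> Im (u m) @[m --> \oo] --> Im z ->
  sqnormc (u m - w) @[m --> \oo] --> sqnormc (z - w).
Proof.
move=> h1 h2; rewrite /sqnormc; under eq_cvg do rewrite ReB ImB.
rewrite ReB ImB; apply: cvgD.
  have h : Re (u m) - Re w @[m --> \oo] --> Re z - Re w by apply: cvgB => //; exact: cvg_cst.
  exact: (cvgM h h).
have h : Im (u m) - Im w @[m --> \oo] --> Im z - Im w by apply: cvgB => //; exact: cvg_cst.
exact: (cvgM h h).
Qed.

Hypothesis mF : forall m, cmeasurable (F m).

Lemma measurable_fsum : measurable_fun setT (fsum F).
Proof.
apply: ge0_emeasurable_sum => [m x _ _|m _].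
  by rewrite lee_fin mulr_ge0 ?exprn_ge0 ?sqnormc_ge0.
apply/measurable_EFinP; apply: measurable_funM => //.
by apply: cmeas_sqnormc; exact: cmeasB.
Qed.

Lemma cmeas_flim : cmeasurable (flim F).
Proof.
pose E := [set x | (fsum F x < +oo)%E].
have mE : measurable E.
  have := emeasurable_fun_infty_o (measurableT : measurable [set: T]) measurable_fsum +oo%E.
  by rewrite setTI.
apply: (@cmeas_lim _ _ _ (fun m x => toC (\1_E x) * F m x)).
- by move=> m; exact: cmeas_indic.
- move=> x; case: (boolP (x \in E)) => [Ex|/negbTE Ex].
    apply: cvg_trans (flim_cvg_Re (set_mem Ex)); apply: near_eq_cvg.
    by apply: nearW => m; rewrite Re_toCM indicE Ex mul1r.
  rewrite /flim ifF; last by apply/negP => h; move/negP: Ex; apply; rewrite inE.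
  by apply: cvg_near_cst; apply: nearW => m; rewrite Re_toCM indicE Ex mul0r.
- move=> x; case: (boolP (x \in E)) => [Ex|/negbTE Ex].
    apply: cvg_trans (flim_cvg_Im (set_mem Ex)); apply: near_eq_cvg.
    by apply: nearW => m; rewrite Im_toCM indicE Ex mul1r.
  rewrite /flim ifF; last by apply/negP => h; move/negP: Ex; apply; rewrite inE.
  by apply: cvg_near_cst; apply: nearW => m; rewrite Im_toCM indicE Ex mul0r.
Qed.

Hypothesis Ffast : forall m,
  (nsq mu D (fun x => F m.+1 x - F m x)%R <= ((8^-1) ^+ m)%:E)%E.

Lemma fsum_int : (\int[mu]_(x in D) fsum F x <= 2%:E)%E.
Proof.
rewrite integral_nneseries//; last 2 first.
- move=> m; apply/measurable_EFinP/measurable_funTS; apply: measurable_funM => //.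
  by apply: cmeas_sqnormc; exact: cmeasB.
- by move=> m x _; rewrite lee_fin mulr_ge0 ?exprn_ge0 ?sqnormc_ge0.
apply: (@le_trans _ _ (\sum_(m <oo) ((4^-1 : R) ^+ m)%:E)%E).
  apply: lee_nneseries => [m _ _|m _]; first by apply: integral_ge0 => x _; rewrite lee_fin mulr_ge0 ?exprn_ge0 ?sqnormc_ge0.
  under eq_integral do rewrite EFinM.
  rewrite ge0_integralZl_EFin//; last 2 first.
  - by move=> x _; rewrite lee_fin sqnormc_ge0.
  - by apply: cmeas_sqnormcE; exact: cmeasB.
  apply: le_trans (_ : (2 ^+ m)%:E * ((8^-1) ^+ m)%:E <= _)%E.
    by apply: lee_wpmul2l; [rewrite lee_fin exprn_ge0|exact: Ffast].
  rewrite -EFinM lee_fin -exprMn.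
  by rewrite (_ : 2 * 8^-1 = 4^-1 :> R)//; lra.
apply: lime_le; first exact: is_cvg_nneseries.
apply: nearW => N; rewrite sumEFin lee_fin.
have -> : \sum_(0 <= m < N) (4^-1 : R) ^+ m = (1 - (4^-1) ^+ N) / (1 - 4^-1).
  have q0 : 1 - 4^-1 != 0 :> R by apply/eqP; lra.
  rewrite big_mkord; apply: (mulIf q0).
  rewrite divfK//.
  by rewrite -[LHS]opprK -mulrN opprB [X in - X]mulrC -subrX1 opprB.
rewrite ler_pdivrMr; last by lra.
have : 0 <= (4^-1 : R) ^+ N by rewrite exprn_ge0//; lra.
lra.
Qed.

Lemma flim_ae : {ae mu, forall x, D x -> (fsum F x < +oo)%E}.
Proof.
have : mu.-integrable D (fsum F).
  apply/integrableP; split; first exact: measurable_funTS measurable_fsum.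
  under eq_integral do rewrite gee0_abs ?(le_trans _ (fsum_ge 0 _)) ?big_geq//.
  by rewrite (le_lt_trans fsum_int)// ltry.
move/(integrable_ae mD); apply: filterS => x H Dx.
have := H Dx; rewrite ge0_fin_numE//.
by apply: (le_trans _ (fsum_ge 0 x)); rewrite big_geq.
Qed.

Lemma flim_nsq : nsq mu D (fun x => F m x - flim F x)%R @[m --> \oo] --> 0%E.
Proof.
have bnd m : (nsq mu D (fun x => F m x - flim F x)%R <= (2 / 2 ^+ m)%:E * 2%:E)%E.
  have c0 : 0 <= 2 / 2 ^+ m :> R by rewrite divr_ge0// exprn_ge0.
  apply: le_trans (_ : (2 / 2 ^+ m)%:E * \int[mu]_(x in D) fsum F x <= _)%E; last first.
    by apply: lee_wpmul2l; rewrite ?lee_fin// fsum_int.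
  have F0 x : (0 <= fsum F x)%E by apply: (le_trans _ (fsum_ge 0 x)); rewrite big_geq.
  rewrite -ge0_integralZl_EFin//; last exact: measurable_funTS measurable_fsum.
  apply: ae_ge0_le_integral => //.
  - by move=> x _; rewrite lee_fin sqnormc_ge0.
  - by apply: cmeas_sqnormcE; apply: cmeasB => //; exact: cmeas_flim.
  - by move=> x _; rewrite mule_ge0.
  - by apply: measurable_funeM; exact: measurable_funTS measurable_fsum.
  apply: filterS flim_ae => x H Dx; have Fx := H Dx.
  have Ff : fsum F x \is a fin_num by rewrite ge0_fin_numE.
  rewrite -(fineK Ff) -EFinM lee_fin sqnormcBC.
  have lim1 := cvg_sqnormcB (w := F m x) (flim_cvg_Re Fx) (flim_cvg_Im Fx).
  rewrite -(cvg_lim _ lim1)//; apply: limr_le; first exact: cvgP lim1.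
  exists m => // p /= mp; apply: fsum_cauchy => //; by rewrite fineK.
apply/cvge0_near => [m|e e0]; first exact: nsq_ge0.
have : (4 * (2^-1) ^+ m @[m --> \oo] --> (4 * 0 : R)).
  apply: cvgMr; apply: cvg_expr; rewrite ger0_norm ?invr_ge0// invf_lt1// ltr1n//.
rewrite mulr0 => /cvgr0Pnorm_le /(_ e e0); apply: filterS => m.
rewrite ger0_norm; last by rewrite mulr_ge0// exprn_ge0// invr_ge0.
move=> H; apply: (le_trans (bnd m)); rewrite -EFinM lee_fin; apply: le_trans H.
by rewrite exprVn le_eqVlt; apply/orP; left; apply/eqP; ring.
Qed.
End riesz_fischer.

Section fast_subsequence.
Context {R : realType} d (T : measurableType d).
Variable mu : {measure set T -> \bar R}.
Variables (D : set T) (mD : measurable D).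

Lemma riesz_fischer (F : nat -> T -> R[i]) : (forall m, cmeasurable (F m)) ->
  (forall e : R, 0 < e -> exists N, forall m p, (N <= m)%N -> (N <= p)%N ->
     (nsq mu D (fun x => F m x - F p x)%R <= e%:E)%E) ->
  exists s : nat -> nat, [/\ (forall m, m <= s m)%N,
    (forall m, nsq mu D (fun x => F (s m.+1) x - F (s m) x)%R <= ((8^-1) ^+ m)%:E)%E,
    cmeasurable (flim (fun m => F (s m))) &
    nsq mu D (fun x => F m x - flim (fun m => F (s m)) x)%R @[m --> \oo] --> 0%E].
Proof.
move=> mF C.
have e8 m : 0 < (8^-1 : R) ^+ m by rewrite exprn_gt0.
pose N m := projT1 (cid (C _ (e8 m))).
have NP m p q : (N m <= p)%N -> (N m <= q)%N ->
    (nsq mu D (fun x => F p x - F q x)%R <= ((8^-1) ^+ m)%:E)%E.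
  by rewrite /N; case: cid => /= ? h; exact: h.
(* Summing the thresholds makes [s] increasing, at least [m] and at least [N m] at once. *)
pose s m := (\sum_(l < m.+1) N l + m)%N.
have sS m : (s m <= s m.+1)%N.
  by rewrite /s [in leqRHS]big_ord_recr/= leq_add// leq_addr.
have sN m : (N m <= s m)%N.
  by rewrite /s big_ord_recr/= -addnA addnCA leq_addr.
have sm m : (m <= s m)%N by rewrite /s leq_addl.
have fast m : (nsq mu D (fun x => F (s m.+1) x - F (s m) x)%R <= ((8^-1) ^+ m)%:E)%E.
  by apply: NP => //; exact: leq_trans (sS m).
exists s; split => //.
  exact: (cmeas_flim (fun m => mF (s m))).
have cF := cmeas_flim (fun m => mF (s m)).
apply: (nsq_lim_tri mD mF (fun m => mF (s m)) cF); last exact: flim_nsq.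
apply/cvge0_near => [m|e e0]; first exact: nsq_ge0.
have [M HM] := C e e0; exists M => // m /= Mm.
by apply: HM => //; exact: leq_trans (sm m).
Qed.

Lemma nsq_cauchy (F : nat -> T -> R[i]) f : (forall m, cmeasurable (F m)) -> cmeasurable f ->
  nsq mu D (fun x => F m x - f x)%R @[m --> \oo] --> 0%E ->
  forall e : R, 0 < e -> exists N, forall m p, (N <= m)%N -> (N <= p)%N ->
     (nsq mu D (fun x => F m x - F p x)%R <= e%:E)%E.
Proof.
move=> mF mf Ff e e0.
have e4 : 0 < e / 4 by rewrite divr_gt0.
have [N _ HN] := (cvge0_near (fun m => nsq_ge0 _ _ _)).1 Ff _ e4.
exists N => m p Nm Np.
apply: le_trans (nsq_tri2 _ mD (mF m) mf (mF p)) _.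
rewrite (nsqBC _ _ f).
apply: (@le_trans _ _ (2%:E * (e / 4)%:E + 2%:E * (e / 4)%:E)%E).
  by apply: leeD; rewrite lee_pmul2l//; exact: HN.
by rewrite -!EFinM -EFinD lee_fin; lra.
Qed.
End fast_subsequence.

(** * Integrals of complex-valued functions *)

Section cint_theory.
Context {R : realType} d (T : measurableType d).
Variable mu : {measure set T -> \bar R}.
Local Notation Re := (@complex.Re R).
Local Notation Im := (@complex.Im R).
Implicit Types (f g : T -> R[i]) (D : set T).

Lemma eq_cint D f g : (forall x, D x -> f x = g x) -> cint mu D f = cint mu D g.
Proof.
move=> fg; apply: complexP => /=; apply: eq_Rintegral => x /set_mem Dx;
  by rewrite fg.
Qed.

Section fixed_domain.
Variables (D : set T) (mD : measurable D).

Lemma eqi (f g : T -> \bar R) : (forall x, D x -> f x = g x) ->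
  mu.-integrable D f -> mu.-integrable D g.
Proof. by move=> fg; apply: eq_integrable => // x /set_mem; exact: fg. Qed.

Lemma eq_cintegrable f g : (forall x, D x -> f x = g x) ->
  cintegrable mu D f -> cintegrable mu D g.
Proof.
by move=> fg [h1 h2]; split; [apply: (eqi _ h1)|apply: (eqi _ h2)] => x Dx; rewrite fg.
Qed.

Lemma cintegrableD f g : cintegrable mu D f -> cintegrable mu D g ->
  cintegrable mu D (fun x => f x + g x).
Proof.
move=> [f1 f2] [g1 g2]; split.
  by apply: (eqi _ (integrableD mD f1 g1)) => x _ /=; rewrite ReD EFinD.
by apply: (eqi _ (integrableD mD f2 g2)) => x _ /=; rewrite ImD EFinD.
Qed.

Lemma cintegrableZ c f : cintegrable mu D f -> cintegrable mu D (fun x => c * f x).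
Proof.
move=> [f1 f2]; split.
  apply: (eqi (f := fun x => ((Re c)%:E * (Re (f x))%:E + (- Im c)%:E * (Im (f x))%:E)%E)) => //.
    by move=> x _; rewrite cReM -!EFinM -EFinD mulNr.
  by apply: integrableD => //; exact: integrableZl.
apply: (eqi (f := fun x => ((Re c)%:E * (Im (f x))%:E + (Im c)%:E * (Re (f x))%:E)%E)) => //.
  by move=> x _; rewrite cImM EFinD !EFinM.
by apply: integrableD => //; exact: integrableZl.
Qed.

Lemma cintegrable0 : cintegrable mu D (fun=> 0).
Proof. by split; apply: integrable0. Qed.

Lemma cintegrable_sum (I : Type) (s : seq I) (F : I -> T -> R[i]) :
  (forall i, cintegrable mu D (F i)) ->
  cintegrable mu D (fun x => \sum_(i <- s) F i x).
Proof.
move=> Fi; elim: s => [|i s IH].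
  by apply: (eq_cintegrable _ cintegrable0) => x _; rewrite big_nil.
by apply: (eq_cintegrable _ (cintegrableD (Fi i) IH)) => x _; rewrite big_cons.
Qed.

Lemma cintD f g : cintegrable mu D f -> cintegrable mu D g ->
  cint mu D (fun x => f x + g x) = cint mu D f + cint mu D g.
Proof.
move=> [f1 f2] [g1 g2]; apply: complexP; [rewrite [RHS]ReD/=|rewrite [RHS]ImD/=].
  by rewrite -RintegralD//; apply: eq_Rintegral => x _; rewrite ReD.
by rewrite -RintegralD//; apply: eq_Rintegral => x _; rewrite ImD.
Qed.

Lemma cintZ c f : cintegrable mu D f -> cint mu D (fun x => c * f x) = c * cint mu D f.
Proof.
move=> [f1 f2]; apply: complexP; [rewrite [RHS]cReM/=|rewrite [RHS]cImM/=].
  rewrite -!RintegralZl// -RintegralB//.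
  - by apply: eq_Rintegral => x _; rewrite cReM.
  - exact: (integrableZl mD (Re c) f1).
  - exact: (integrableZl mD (Im c) f2).
rewrite -!RintegralZl// -RintegralD//.
- by apply: eq_Rintegral => x _; rewrite cImM.
- exact: (integrableZl mD (Re c) f2).
- exact: (integrableZl mD (Im c) f1).
Qed.

Lemma cint0 : cint mu D (fun=> 0) = 0.
Proof. by apply: complexP; rewrite /= /Rintegral integral0. Qed.

Lemma cint_sum (I : Type) (s : seq I) (F : I -> T -> R[i]) :
  (forall i, cintegrable mu D (F i)) ->
  cint mu D (fun x => \sum_(i <- s) F i x) = \sum_(i <- s) cint mu D (F i).
Proof.
move=> Fi; elim: s => [|i s IH].
  by rewrite big_nil -[RHS]cint0; apply: eq_cint => x _; rewrite big_nil.
rewrite big_cons -IH -cintD//; last exact: cintegrable_sum.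
by apply: eq_cint => x _; rewrite big_cons.
Qed.

Lemma cintB f g : cintegrable mu D f -> cintegrable mu D g ->
  cint mu D (fun x => f x - g x) = cint mu D f - cint mu D g.
Proof.
move=> fi gi; rewrite -[in RHS]mulN1r -cintZ// -cintD//.
  by apply: eq_cint => x _; rewrite mulN1r.
exact: cintegrableZ.
Qed.

Lemma cintegrable_le f g : cmeasurable f -> cintegrable mu D g ->
  (forall x, D x -> sqnormc (f x) <= sqnormc (g x)) -> cintegrable mu D f.
Proof.
move=> [f1 f2] [g1 g2] fg.
have gi : mu.-integrable D (fun x => (`|Re (g x)| + `|Im (g x)|)%:E).
  by apply: (eqi _ (integrableD mD (integrable_abse g1) (integrable_abse g2))).
have key (h : T -> R) : measurable_fun setT h -> (forall x, D x -> `|h x| ^+ 2 <= sqnormc (g x)) ->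
    mu.-integrable D (fun x => (h x)%:E).
  move=> mh hg; apply: le_integrable gi => //.
    by apply/measurable_EFinP/measurable_funTS.
  move=> x Dx; rewrite /= lee_fin [leRHS]ger0_norm ?addr_ge0//.
  rewrite -(@ler_pXn2r _ 2)// ?nnegrE ?addr_ge0//.
  apply: le_trans (hg x Dx) _; rewrite /sqnormc -[X in X + _](real_normK (num_real _)) -[X in _ + X](real_normK (num_real _)).
  by rewrite sqrrD lerD2r lerDl mulrn_wge0// mulr_ge0.
split; apply: key => // x Dx; apply: le_trans (fg x Dx).
  exact: normr_Re_le.
exact: normr_Im_le.
Qed.

Lemma cintegrable_bounded f (M : R) : (mu D < +oo)%E -> cmeasurable f ->
  (forall x, D x -> sqnormc (f x) <= M) -> cintegrable mu D f.
Proof.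
move=> Dfin mf fM.
have M0 : 0 <= Num.max M 0 by rewrite le_max lexx orbT.
apply: (cintegrable_le (g := fun=> toC (Num.sqrt (Num.max M 0)))) => //.
  split; apply: (measurable_bounded_integrable mD Dfin) => //.
    exists (Num.sqrt (Num.max M 0)); split; first exact: num_real.
    by move=> c hc y _; rewrite /= ger0_norm ?sqrtr_ge0// ltW.
  exists 0; split; first exact: num_real.
  by move=> c hc y _; rewrite /= normr0 ltW.
move=> x Dx; rewrite sqnormc_toC sqr_sqrtr// le_max fM//.
Qed.

Lemma cint_ae f g : cmeasurable f -> cmeasurable g ->
  {ae mu, forall x, D x -> f x = g x} -> cint mu D f = cint mu D g.
Proof.
move=> [f1 f2] [g1 g2] fg; apply: complexP; congr fine; apply: ae_eq_integral => //;
  try exact/measurable_EFinP/measurable_funTS;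
  by apply: filterS fg => x H Dx; rewrite H.
Qed.

Lemma cint_mkcond f : cint mu D f = cint mu setT (fun x => toC (\1_D x) * f x).
Proof.
apply: complexP; rewrite /= Rintegral_mkcond; apply: eq_Rintegral => x _;
  rewrite patchE indicE ?Re_toCM ?Im_toCM; case: ifPn => _; rewrite ?mul1r ?mul0r//.
Qed.

Lemma cintegrable_mkcond f : cintegrable mu D f <->
  cintegrable mu setT (fun x => toC (\1_D x) * f x).
Proof.
rewrite /cintegrable; split => -[h1 h2]; split.
- apply: (eq_integrable measurableT _ _ _ ((integrable_mkcond _ mD).1 h1)) => x _.
  by rewrite Re_toCM patchE indicE; case: ifPn => _; rewrite ?mul1r ?mul0r.
- apply: (eq_integrable measurableT _ _ _ ((integrable_mkcond _ mD).1 h2)) => x _.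
  by rewrite Im_toCM patchE indicE; case: ifPn => _; rewrite ?mul1r ?mul0r.
- apply/(integrable_mkcond _ mD); apply: (eq_integrable measurableT _ _ _ h1) => x _.
  by rewrite Re_toCM patchE indicE; case: ifPn => _; rewrite ?mul1r ?mul0r.
- apply/(integrable_mkcond _ mD); apply: (eq_integrable measurableT _ _ _ h2) => x _.
  by rewrite Im_toCM patchE indicE; case: ifPn => _; rewrite ?mul1r ?mul0r.
Qed.

Lemma ReMconj z w : Re (z * conjc w) = Re z * Re w + Im z * Im w.
Proof. by case: z w => [a b] [c e] /=; rewrite mulrN opprK. Qed.

Lemma nsq_pythagoras f g (M : R) : (mu D < +oo)%E -> cmeasurable f -> cmeasurable g ->
  (forall x, D x -> sqnormc (f x) <= M) -> (forall x, D x -> sqnormc (g x) <= M) ->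
  Re (cint mu D (fun x => f x * conjc (g x))) = 0 ->
  (nsq mu D (fun x => f x + g x)%R = nsq mu D f + nsq mu D g)%E.
Proof.
move=> Dfin mf mg fM gM fg0.
have fin h : cmeasurable h -> (forall x, D x -> sqnormc (h x) <= 4 * M) ->
    mu.-integrable D (fun x => (sqnormc (h x))%:E).
  move=> mh hM; apply: (measurable_bounded_integrable mD Dfin).
    exact/measurable_funTS/cmeas_sqnormc.
  exists (4 * M); split; first exact: num_real.
  move=> x hx y Dy; rewrite /= ger0_norm ?sqnormc_ge0//.
  by rewrite (le_trans (hM y Dy))// ltW.
have M4 x : D x -> M <= 4 * M.
  by move=> Dx; rewrite ler_peMl ?ler1n// (le_trans (sqnormc_ge0 _) (fM x Dx)).
have Hf : mu.-integrable D (fun x => (sqnormc (f x))%:E).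
  by apply: fin => // x Dx; rewrite (le_trans (fM x Dx))// (M4 x).
have Hg : mu.-integrable D (fun x => (sqnormc (g x))%:E).
  by apply: fin => // x Dx; rewrite (le_trans (gM x Dx))// (M4 x).
have Hfg : mu.-integrable D (fun x => (sqnormc (f x + g x))%:E).
  apply: fin; first exact: cmeasD.
  move=> x Dx; apply: le_trans (sqnormcD_le2 _ _) _.
  by have := fM x Dx; have := gM x Dx; lra.
pose r x := Re (f x * conjc (g x)).
have Hr : mu.-integrable D (fun x => (2 * r x)%:E).
  apply: (eqi _ (integrableB mD (integrableB mD Hfg Hf) Hg)).
  move=> x _ /=; rewrite -!EFinB; congr EFin.
  by rewrite /r ReMconj /sqnormc ReD ImD; ring.
have E : (\int[mu]_(x in D) (sqnormc (f x + g x))%:E =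
   \int[mu]_(x in D) ((sqnormc (f x))%:E + (sqnormc (g x))%:E + (2 * r x)%:E))%E.
  apply: eq_integral => x _; rewrite -!EFinD; congr EFin.
  by rewrite /r ReMconj /sqnormc ReD ImD; ring.
rewrite /nsq E integralD//; last exact: integrableD.
rewrite integralD//.
have Hr1 : mu.-integrable D (fun x => (r x)%:E).
  apply: (eqi _ (integrableZl mD 2^-1 Hr)) => x _ /=.
  by rewrite -EFinM mulrA mulVf// mul1r.
rewrite [X in (_ + X)%E](_ : _ = 0%E) ?adde0//.
under eq_integral do rewrite EFinM.
rewrite integralZl//.
have : \int[mu]_(x in D) r x = 0 by exact: fg0.
by move=> r0; rewrite -[X in (_ * X)%E]fineK ?integrable_fin_num// [fine _]r0 mule0.
Qed.
End fixed_domain.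

Lemma cint_mpres phi f : mpres mu phi -> cmeasurable f ->
  cint mu setT (fun x => f (phi x)) = cint mu setT f.
Proof.
move=> mp [f1 f2]; apply: complexP; congr fine.
  by apply: (mpres_integral (f := fun x => (Re (f x))%:E) mp); exact/measurable_EFinP.
by apply: (mpres_integral (f := fun x => (Im (f x))%:E) mp); exact/measurable_EFinP.
Qed.

Lemma cintegrable_mpres phi f : mpres mu phi -> cintegrable mu setT f ->
  cintegrable mu setT (fun x => f (phi x)).
Proof.
move=> mp [f1 f2]; split.
  exact: (mpres_integrable mp f1).
exact: (mpres_integrable mp f2).
Qed.

(** Convergence is asked in the strong form that the values are eventually equal, which is what
    truncations provide. *)
Lemma cint_dominated (F : nat -> T -> R[i]) f g : (forall m, cmeasurable (F m)) ->
  cmeasurable f -> cintegrable mu setT g ->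
  (forall x, \forall m \near \oo, F m x = f x) ->
  (forall m x, sqnormc (F m x) <= sqnormc (g x)) ->
  Re (cint mu setT (F m)) @[m --> \oo] --> Re (cint mu setT f) /\
  Im (cint mu setT (F m)) @[m --> \oo] --> Im (cint mu setT f).
Proof.
move=> mF mf [g1 g2] Ff Fg.
have gi : mu.-integrable setT (fun x => (`|Re (g x)| + `|Im (g x)|)%:E).
  by apply: (eqi measurableT _ (integrableD measurableT (integrable_abse g1) (integrable_abse g2))).
have key (G : R[i] -> R) : (forall z, `|G z| ^+ 2 <= sqnormc z) ->
   (forall m, measurable_fun setT (fun x => G (F m x))) ->
   measurable_fun setT (fun x => G (f x)) ->
   (\int[mu]_x G (F m x)) @[m --> \oo] --> \int[mu]_x G (f x).
  move=> GN mGF mGf.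
  have [|||||i1 _ i3] := @dominated_convergence _ _ _ mu setT measurableT
    (fun m x => (G (F m x))%:E) (fun x => (G (f x))%:E) (fun x => (`|Re (g x)| + `|Im (g x)|)%:E).
  - by move=> m; exact/measurable_EFinP.
  - exact/measurable_EFinP.
  - apply: aeW => x _; apply: cvg_near_cst.
    by apply: filterS (Ff x) => m ->.
  - exact: gi.
  - apply: aeW => x m _; rewrite /= lee_fin.
    rewrite -(@ler_pXn2r _ 2)// ?nnegrE ?addr_ge0//.
    apply: le_trans (GN _) _; apply: le_trans (Fg _ _) _.
    rewrite /sqnormc -[X in X + _](real_normK (num_real _)) -[X in _ + X](real_normK (num_real _)).
    by rewrite sqrrD lerD2r lerDl mulrn_wge0// mulr_ge0.
  by apply: fine_cvg; rewrite fineK; [exact: i3|exact: integrable_fin_num].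
split; apply: key => //.
- exact: normr_Re_le.
- by move=> m; exact: (mF m).1.
- exact: mf.1.
- exact: normr_Im_le.
- by move=> m; exact: (mF m).2.
- exact: mf.2.
Qed.
End cint_theory.

Lemma cmeas_param_cint {R : realType} d1 d2 (T1 : measurableType d1)
    (T2 : measurableType d2) (m2 : {sigma_finite_measure set T2 -> \bar R})
    (F : T1 * T2 -> R[i]) : cmeasurable F ->
  cmeasurable (fun x => cint m2 setT (fun y => F (x, y))).
Proof.
move=> [F1 F2].
have key (G : T1 * T2 -> R) : measurable_fun setT G ->
    measurable_fun setT (fun x => \int[m2]_y G (x, y)).
  move=> mG; apply: measurableT_comp => //=.
  under eq_fun do rewrite integralE.
  have mGE : measurable_fun setT (fun p => (G p)%:E) by exact/measurable_EFinP.
  apply: emeasurable_funB.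
    have H := measurable_fun_fubini_tonelli_F (m2 := m2) _ (measurable_funepos mGE) (funepos_ge0 _).
    apply: (eq_measurable_fun _ _ H) => // x _.
    by apply: eq_integral => y _; rewrite !funeposE.
  have H := measurable_fun_fubini_tonelli_F (m2 := m2) _ (measurable_funeneg mGE) (funeneg_ge0 _).
  apply: (eq_measurable_fun _ _ H) => // x _.
  by apply: eq_integral => y _; rewrite !funenegE.
by split; [exact: (key _ F1)|exact: (key _ F2)].
Qed.

Lemma nsq_fubini {R : realType} d1 d2 (T1 : measurableType d1)
    (T2 : measurableType d2) (m1 : {sigma_finite_measure set T1 -> \bar R})
    (m2 : {sigma_finite_measure set T2 -> \bar R}) D1 D2 (F : T1 * T2 -> R[i]) :
  measurable D1 -> measurable D2 -> cmeasurable F ->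
  (nsq (m1 \x m2)%E (D1 `*` D2) F =
    \int[m1]_(x in D1) nsq m2 D2 (fun y => F (x, y)))%E /\
  measurable_fun setT (fun x => nsq m2 D2 (fun y => F (x, y))) /\
  (nsq (m1 \x m2)%E (D1 `*` D2) F =
    \int[m2]_(y in D2) nsq m1 D1 (fun x => F (x, y)))%E.
Proof.
move=> mD1 mD2 mF.
pose G p := ((sqnormc (F p))%:E * (\1_(D1 `*` D2) p)%:E)%E.
have G0 p : (0 <= G p)%E by rewrite mule_ge0// lee_fin// sqnormc_ge0.
have mG : measurable_fun setT G.
  apply: emeasurable_funM; first exact: cmeas_sqnormcE.
  by apply/measurable_EFinP; apply: measurable_indic; exact: measurableX.
have E0 : (nsq (m1 \x m2)%E (D1 `*` D2) F = \int[m1 \x m2]_p G p)%E.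
  rewrite /nsq integral_mkcond; apply: eq_integral => p _.
  by rewrite patchE /G indicE; case: ifPn => _; rewrite ?mule1 ?mule0.
have patch1 x y : G (x, y) = (((fun y => (sqnormc (F (x, y)))%:E) \_ D2) y * (\1_D1 x)%:E)%E.
  rewrite /G patchE !indicE; have -> : ((x, y) \in D1 `*` D2) = (x \in D1) && (y \in D2).
    by apply/idP/andP; rewrite !inE.
  by case: (x \in D1); case: (y \in D2); rewrite /= ?mule1 ?mule0.
have patch2 x y : G (x, y) = (((fun x => (sqnormc (F (x, y)))%:E) \_ D1) x * (\1_D2 y)%:E)%E.
  rewrite /G patchE !indicE; have -> : ((x, y) \in D1 `*` D2) = (x \in D1) && (y \in D2).
    by apply/idP/andP; rewrite !inE.
  by case: (x \in D1); case: (y \in D2); rewrite /= ?mule1 ?mule0.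
have mx x : cmeasurable (fun y => F (x, y)).
  by apply: cmeas_comp => //; exact: pair1_measurable.
have my y : cmeasurable (fun x => F (x, y)).
  by apply: cmeas_comp => //; exact: pair2_measurable.
have int1 x : (\int[m2]_y G (x, y) = nsq m2 D2 (fun y => F (x, y)) * (\1_D1 x)%:E)%E.
  under eq_integral do rewrite patch1.
  rewrite ge0_integralZr//.
  - by rewrite -integral_mkcond.
  - apply/(measurable_restrictT _ _).1 => //; exact: cmeas_sqnormcE.
  - by move=> y _; rewrite patchE; case: ifPn => // _; rewrite lee_fin sqnormc_ge0.
have int2 y : (\int[m1]_x G (x, y) = nsq m1 D1 (fun x => F (x, y)) * (\1_D2 y)%:E)%E.
  under eq_integral do rewrite patch2.
  rewrite ge0_integralZr//.
  - by rewrite -integral_mkcond.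
  - apply/(measurable_restrictT _ _).1 => //; exact: cmeas_sqnormcE.
  - by move=> x _; rewrite patchE; case: ifPn => // _; rewrite lee_fin sqnormc_ge0.
split; [|split].
- rewrite E0 (@fubini_tonelli1 _ _ _ _ _ m1 m2 _ mG G0) [RHS]integral_mkcond.
  apply: eq_integral => x _; rewrite /fubini_F int1 patchE indicE.
  by case: ifPn => _; rewrite ?mule1 ?mule0.
- pose G' p := ((sqnormc (F p))%:E * (\1_D2 p.2)%:E)%E.
  have mG' : measurable_fun setT G'.
    apply: emeasurable_funM; first exact: cmeas_sqnormcE.
    by apply/measurable_EFinP; apply: measurableT_comp => //; exact: measurable_indic.
  have G'0 p : (0 <= G' p)%E by rewrite mule_ge0// lee_fin// sqnormc_ge0.
  have H := measurable_fun_fubini_tonelli_F (m2 := m2) _ mG' G'0.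
  apply: (eq_measurable_fun _ _ H) => x _.
  rewrite /fubini_F /nsq [RHS]integral_mkcond; apply: eq_integral => y _.
  by rewrite patchE /G' /= indicE; case: ifPn => _; rewrite ?mule1 ?mule0.
- rewrite E0 (@fubini_tonelli1 _ _ _ _ _ m1 m2 _ mG G0) (@fubini_tonelli _ _ _ _ _ m1 m2 _ mG G0) [RHS]integral_mkcond.
  apply: eq_integral => y _; rewrite /fubini_G int2 patchE indicE.
  by case: ifPn => _; rewrite ?mule1 ?mule0.
Qed.

(** * Density of a linear family by a monotone class argument *)

Section orthants.
Context {R : realType} {n : nat}.

Definition orthant (a : 'I_n -> R) : set 'cV[R]_n := [set v | forall i, a i < v i ord0].

Lemma measurable_orthant a : measurable (orthant a).
Proof.
have -> : orthant a = \big[setI/setT]_(i <- index_enum 'I_n)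
    ((fun x : 'cV[R]_n => x i ord0 : measurableTypeR R) @^-1` `]a i, +oo[%classic).
  rewrite -bigcap_seq; apply/seteqP; split => x /= H i.
    by move=> _; rewrite /= in_itv/= andbT; exact: H.
  by have := H i; rewrite /= mem_index_enum in_itv/= andbT; exact.
apply: bigsetI_measurable => i _; rewrite -[X in measurable X]setTI.
exact: (measurable_cV_coord i).
Qed.

Lemma measurable_orthantE :
  @measurable _ 'cV[R]_n = <<s [set orthant a | a in setT] >>.
Proof.
set G := [set orthant a | a in setT].
have sG : sigma_algebra setT <<s G >> by exact: smallest_sigma_algebra.
have [G0 GC GU] := sG.
apply/seteqP; split; last first.
  apply: smallest_sub; first exact: sigma_algebra_measurable.
  by move=> _ [a _ <-]; exact: measurable_orthant.
apply: smallest_sub => //.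
rewrite -bigcup_seq; apply: bigcup_sub => i _ _ [Y mY <-]; rewrite setTI.
pose C : set_system R := [set Y | <<s G >> ((fun v : 'cV[R]_n => v i ord0) @^-1` Y)].
suff : @measurable _ (measurableTypeR R) `<=` C by move=> /(_ _ mY).
have -> : @measurable _ (measurableTypeR R) = <<s @RGenOInfty.G R >>.
  exact: RGenOInfty.measurableE.
apply: smallest_sub.
  split; rewrite /C /=.
  - by rewrite preimage_set0.
  - by move=> A CA; rewrite setTD preimage_setC -setTD; exact: GC.
  - by move=> F CF; rewrite preimage_bigcup; exact: GU.
move=> _ [x ->]; rewrite /C /=.
(* A half-space is the union of orthants whose other corners recede to minus infinity. *)
have -> : (fun v : 'cV[R]_n => v i ord0) @^-1` `]x, +oo[%classic =
    \bigcup_m orthant (fun l => if l == i then x else - m%:R).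
  apply/seteqP; split => v /=; rewrite in_itv/= andbT.
    move=> xv; pose m := (\sum_l Num.bound (v l ord0))%N.
    exists m => // l; case: eqP => [->//|_].
    rewrite ltrNl; apply: (le_lt_trans (ler_norm _)); rewrite normrN.
    apply: (lt_le_trans (archi_boundP (normr_ge0 _)))=> /=.
    rewrite ler_nat /m (bigD1 l)//=.
    by rewrite /Num.bound normr_id leq_addr.
  by move=> [m _ /(_ i)]; rewrite eqxx.
by apply: GU => m; apply: sub_sigma_algebra; exists (fun l => if l == i then x else - m%:R).
Qed.

(** Orthants are stable under intersection, by taking maxima of the corners, and generate the
    measurable sets, so Dynkin's lemma applies. *)
Lemma orthant_induction (P : set_system 'cV[R]_n) : P setT ->
  (forall a, P (orthant a)) ->
  (forall S, measurable S -> P S -> P (~` S)) ->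
  (forall F : (set 'cV[R]_n)^nat, (forall m, measurable (F m)) ->
    trivIset setT F -> (forall m, P (F m)) -> P (\bigcup_m F m)) ->
  forall S, measurable S -> P S.
Proof.
move=> PT PO PC PU S; rewrite measurable_orthantE; apply: dynkin_induction PC PU S => //.
- exact: measurable_orthantE.
- move=> _ _ [a _ <-] [b _ <-]; exists (fun i => Num.max (a i) (b i)) => //.
  apply/seteqP; split => v /=.
    by move=> H; split => i; have := H i; rewrite gt_max => /andP[].
  by move=> [h1 h2] i; rewrite gt_max h1 h2.
- by move=> _ [a _ <-].
Qed.
End orthants.

Section density.
Context {R : realType} {n : nat} d (T : measurableType d).
Variable mu : {measure set T -> \bar R}.
Variables (D : set T) (mD : measurable D) (Dfin : (mu D < +oo)%E).
Local Notation Re := (@complex.Re R).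
Local Notation Im := (@complex.Im R).

Lemma nsq_dct (F : nat -> T -> R[i]) f (M : R) : (forall m, cmeasurable (F m)) ->
  cmeasurable f ->
  {ae mu, forall x, D x -> sqnormc (F m x - f x) @[m --> \oo] --> (0 : R)} ->
  (forall m x, D x -> sqnormc (F m x - f x) <= M) ->
  nsq mu D (fun x => F m x - f x)%R @[m --> \oo] --> 0%E.
Proof.
move=> mF mf Ff FM.
have [|||||_ _ H] := @dominated_convergence _ _ _ mu D mD
  (fun m x => (sqnormc (F m x - f x))%:E) (cst 0%E) (cst M%:E).
- by move=> m; apply: cmeas_sqnormcE; exact: cmeasB.
- by [].
- apply: filterS Ff => x H Dx; apply: cvg_EFin; [exact: nearW|exact: H].
- apply: (measurable_bounded_integrable mD Dfin) => //.
  exists `|M|; split; first exact: num_real.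
  by move=> c hc y _ /=; rewrite ltW.
- apply: aeW => x m Dx; rewrite /= lee_fin ger0_norm ?sqnormc_ge0//; exact: FM.
by move: H; rewrite integral0.
Qed.

Variable V : set (T -> R[i]).
Hypothesis Vmeas : forall v, V v -> cmeasurable v.
Hypothesis Vlin : forall c u v, V u -> V v -> V (fun x => c * u x + v x).

Definition L2closure (u : T -> R[i]) : Prop := cmeasurable u /\
  forall e : R, 0 < e -> exists2 v, V v & (nsq mu D (fun x => u x - v x)%R <= e%:E)%E.

Lemma L2closure_sub v : V v -> L2closure v.
Proof.
move=> Vv; split; first exact: Vmeas.
move=> e e0; exists v => //; rewrite (@eq_nsq _ _ _ _ _ _ (fun=> 0)) ?nsq0 ?lee_fin ?ltW//.
by move=> x _; rewrite subrr.
Qed.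

Lemma L2closure_lin c u v : L2closure u -> L2closure v ->
  L2closure (fun x => c * u x + v x).
Proof.
move=> [mu_ Hu] [mv Hv]; split; first by apply: cmeasD => //; exact: cmeasZ.
move=> e e0.
have c0 : 0 < sqnormc c + 1 by rewrite ltr_wpDl// sqnormc_ge0.
have [u' Vu' uu'] := Hu (e / (4 * (sqnormc c + 1))) ltac:(by rewrite divr_gt0// mulr_gt0).
have [v' Vv' vv'] := Hv (e / 4) ltac:(by rewrite divr_gt0).
exists (fun x => c * u' x + v' x); first exact: Vlin.
have mu' := Vmeas Vu'; have mv' := Vmeas Vv'.
apply: (@le_trans _ _ (2%:E * nsq mu D (fun x => c * (u x - u' x))%R +
   2%:E * nsq mu D (fun x => v x - v' x)%R)%E).
  apply: le_trans (nsqD_le2 _ _ _ _) => //; [|by apply: cmeasZ; exact: cmeasB|exact: cmeasB].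
  by apply/eq_lee/eq_nsq => x _; rewrite mulrBr opprD addrACA.
rewrite nsqZ//; last exact: cmeasB.
apply: (@le_trans _ _ (2%:E * ((sqnormc c)%:E * (e / (4 * (sqnormc c + 1)))%:E) + 2%:E * (e / 4)%:E)%E).
  apply: leeD; last by apply: lee_wpmul2l.
  by apply: lee_wpmul2l => //; apply: lee_wpmul2l => //; rewrite lee_fin sqnormc_ge0.
rewrite -!EFinM -EFinD lee_fin.
have : sqnormc c * (e / (4 * (sqnormc c + 1))) <= e / 4.
  rewrite invfM mulrA [X in X <= _](_ : _ = e / 4 * (sqnormc c / (sqnormc c + 1))); last by ring.
  by rewrite ler_piMr// ?divr_ge0 ?ltW// ltr_pdivrMr// mul1r ltrDl.
lra.
Qed.

Lemma L2closure_lim (F : nat -> T -> R[i]) u : (forall m, L2closure (F m)) -> cmeasurable u ->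
  nsq mu D (fun x => F m x - u x)%R @[m --> \oo] --> 0%E -> L2closure u.
Proof.
move=> HF mu_ /(cvge0_near (fun m => nsq_ge0 _ _ _)) Fu; split=> // e e0.
have e4 : 0 < e / 4 by rewrite divr_gt0.
have [N _ /(_ N (leqnn N))/= H] := Fu _ e4.
have [mFN /(_ _ e4)[v Vv HN]] := HF N.
exists v => //; apply: le_trans (nsq_tri2 _ mD mu_ mFN (Vmeas Vv)) _.
rewrite nsqBC; apply: (@le_trans _ _ (2%:E * (e / 4)%:E + 2%:E * (e / 4)%:E)%E).
  by apply: leeD; apply: lee_wpmul2l.
by rewrite -!EFinM -EFinD lee_fin; lra.
Qed.

Lemma L2closure0 : V !=set0 -> L2closure (fun=> 0).
Proof.
move=> [v Vv]; have := L2closure_lin (-1) (L2closure_sub Vv) (L2closure_sub Vv).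
by rewrite (_ : (fun x => _) = (fun=> 0))//; apply/funext => x; rewrite mulN1r addNr.
Qed.

Lemma L2closure_sum (I : Type) (s : seq I) (c : I -> R[i]) (F : I -> T -> R[i]) : V !=set0 ->
  (forall i, L2closure (F i)) -> L2closure (fun x => \sum_(i <- s) c i * F i x).
Proof.
move=> V0 HF; elim: s => [|i s IH].
  by under eq_fun do rewrite big_nil; exact: L2closure0.
by under eq_fun do rewrite big_cons; exact: L2closure_lin.
Qed.

Variables (phi : T -> 'cV[R]_n) (psi : 'cV[R]_n -> T).
Hypothesis mphi : measurable_fun setT phi.
Hypothesis mpsi : measurable_fun setT psi.
Hypothesis phiK : cancel phi psi.
Hypothesis V1 : L2closure (fun=> 1).
Hypothesis Vorth : forall a, L2closure (fun x => toC (\1_(orthant a) (phi x))).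
Hypothesis Vn0 : V !=set0.

Lemma L2closure_preim A : measurable A -> L2closure (fun x => toC (\1_A (phi x))).
Proof.
have mI B : measurable B -> cmeasurable (fun x => toC (\1_B (phi x))).
  by move=> mB; apply: cmeas_toC; apply: measurableT_comp => //; exact: measurable_indic.
move: A; apply: orthant_induction => //.
- by rewrite (_ : (fun x => _) = (fun=> 1))//; apply/funext => x; rewrite indicT.
- move=> S mS HS; have := L2closure_lin (-1) HS V1.
  rewrite (_ : (fun x => _) = (fun x => toC (\1_(~` S) (phi x))))//.
  apply/funext => x; rewrite !indicE in_setC; case: (_ \in S); rewrite /= ?toC1 ?toC0.
    by rewrite mulr1 addNr.
  by rewrite mulr0 add0r.
- move=> F mF tF HF.
  apply: (L2closure_lim (F := fun m x => \sum_(l < m) 1 * toC (\1_(F l) (phi x)))).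
  + by move=> m; apply: (L2closure_sum _ (fun=> 1) Vn0) => l; exact: HF.
  + by apply: mI; exact: bigcup_measurable.
  + have key x m : \sum_(l < m) 1 * toC (\1_(F l) (phi x)) =
        toC (\1_(\bigcup_(l < m) F l) (phi x)).
      rewrite indicE; case: (boolP (phi x \in _)) => [/set_mem[l /= lm Fl]|nF].
        rewrite (bigD1 (Ordinal lm))//= indicE mem_set// big1 ?addr0 ?mulr1//.
        move=> q /eqP ql; rewrite indicE memNset ?mulr0// => Fq; apply: ql.
        by apply/val_inj; apply: (tF) => //; exists (phi x).
      rewrite big1// => q _; rewrite indicE memNset ?mulr0// => Fq.
      by move/negP: nF; apply; rewrite inE; exists q => /=.
    apply: (@nsq_dct _ _ 1).
    * by move=> m; apply: cmeas_sum => l; apply: cmeasM; [exact: cmeas_cst|exact: mI].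
    * by apply: mI; exact: bigcup_measurable.
    * apply: aeW => x _; apply: cvg_near_cst.
      case: (pselect ((\bigcup_l F l) (phi x))) => [[l _ Fl]|nF].
        exists l.+1 => // m /= lm; rewrite key !indicE !mem_set ?subrr ?sqnormc0//.
          by exists l.
        by exists l.
      apply: nearW => m; rewrite key !indicE !memNset ?subrr ?sqnormc0//.
      by move=> [l _ Fl]; apply: nF; exists l.
    * move=> m x _; rewrite key -toCN -toCD sqnormc_toC !indicE.
      by case: (_ \in _); case: (_ \in _); rewrite /= ?subrr ?subr0 ?sub0r ?sqrrN ?expr1n ?expr0n.
Qed.

(** The sum counts the integers from 1 to [K] that are at most [r]: it is the integral part of [r]
    cut at [K]. The first clause carries the induction. *)
Lemma sum_ler_nat (K : nat) (r : R) : 0 <= r ->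
  [/\ K%:R <= r -> \sum_(j < K) (((j.+1%:R <= r)%R)%:R : R) = K%:R,
     \sum_(j < K) (((j.+1%:R <= r)%R)%:R : R) <= r &
     r <= K%:R -> r <= \sum_(j < K) (((j.+1%:R <= r)%R)%:R : R) + 1].
Proof.
move=> r0; elim: K => [|K [h1 h2 h3]].
  by rewrite big_ord0 add0r; split => // rK; rewrite (le_trans rK)//.
rewrite big_ord_recr/=; case: (leP K.+1%:R r) => rK1.
  have rK : K%:R <= r by rewrite (le_trans _ rK1)// ler_nat.
  rewrite h1//= natr1; split => // rK'; by rewrite (le_trans rK')// lerDl.
rewrite addr0; split=> // _.
case: (leP K%:R r) => rK; first by rewrite h1// natr1 ltW.
by apply: h3; exact: ltW.
Qed.

(** Layer by layer: the indicators of [u >= (j+1)/(m+1)], summed and divided by [m+1], stay within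
    [1/(m+1)] of [u]. The levels are written in coordinates through [psi], where orthants
    generate. *)
Lemma L2closure_real (u : T -> R) (K : nat) : measurable_fun setT u ->
  (forall x, 0 <= u x <= K%:R) -> L2closure (fun x => toC (u x)).
Proof.
move=> mu_ uK.
pose A m (j : nat) := [set v : 'cV[R]_n | j.+1%:R <= m.+1%:R * u (psi v)].
have mA m j : measurable (A m j).
  rewrite (_ : A m j = (fun v => m.+1%:R * u (psi v)) @^-1` `[j.+1%:R, +oo[%classic).
    rewrite -[X in measurable X]setTI.
    suff : measurable_fun setT (fun v => m.+1%:R * u (psi v)) by apply => //.
    by apply: measurable_funM => //; exact: measurableT_comp.
  by apply/seteqP; split => v /=; rewrite /A/= in_itv/= andbT.
pose F m x : R[i] := \sum_(j < m.+1 * K) toC (m.+1%:R^-1) * toC (\1_(A m j) (phi x)).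
have HF m : L2closure (F m).
  by apply: (L2closure_sum _ (fun=> toC (m.+1%:R^-1)) Vn0) => j; exact: L2closure_preim.
have mF m : cmeasurable (F m) by have [] := HF m.
have FE m x : F m x = toC (m.+1%:R^-1 * \sum_(j < m.+1 * K) ((j.+1%:R <= m.+1%:R * u x)%R%:R : R)).
  rewrite /F -mulr_sumr toCM toC_sum; congr (_ * _); apply: eq_bigr => j _; congr toC.
  rewrite indicE; congr (nat_of_bool _)%:R; apply/idP/idP => [/set_mem|h].
    by rewrite /A/= phiK.
  by rewrite inE /A/= phiK.
have bnd m x : sqnormc (F m x - toC (u x)) <= (m.+1%:R^-1) ^+ 2.
  rewrite FE -toCN -toCD sqnormc_toC.
  have /andP[u0 u1] := uK x.
  have m0 : 0 < m.+1%:R :> R by rewrite ltr0n.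
  have r0 : 0 <= m.+1%:R * u x by rewrite mulr_ge0.
  have [_ h2 h3] := sum_ler_nat (m.+1 * K) r0.
  have {}h3 := h3 ltac:(by rewrite natrM ler_wpM2l).
  set S := \sum_(_ < _) _ in h2 h3 *.
  rewrite -sqrrN opprB -ler_sqrt ?exprn_ge0 ?invr_ge0// !sqrtr_sqr.
  rewrite ger0_norm ?[leRHS]ger0_norm ?invr_ge0// ?subr_ge0.
    rewrite -(ler_pM2l m0) mulrBr !mulrA mulfV ?gt_eqF// mul1r; lra.
  by rewrite -(ler_pM2l m0) mulrA mulfV ?gt_eqF// mul1r.
apply: (L2closure_lim HF); first exact: cmeas_toC.
apply: (@nsq_dct F (fun x => toC (u x)) 1 mF (cmeas_toC mu_)).
  apply: aeW => x _.
  apply: (@squeeze_cvgr _ _ _ _ (cst 0) (fun m => (m.+1%:R^-1))).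
  - apply: nearW => m; rewrite sqnormc_ge0/= (le_trans (bnd m x))//.
    by rewrite expr2 ler_piMr// ?invr_ge0// invf_le1// ler1n.
  - exact: cvg_cst.
  - exact: cvg_harmonic.
by move=> m x _; rewrite (le_trans (bnd m x))// exprn_ile1// ?invr_ge0// invf_le1 ?ltr0n ?ler1n.
Qed.

Lemma L2closure_bounded (u : T -> R[i]) (M : R) : cmeasurable u ->
  (forall x, sqnormc (u x) <= M) -> L2closure u.
Proof.
move=> [u1 u2] uM.
pose K := Num.bound `|M + 1|.
have KM : M + 1 <= K%:R.
  by apply: le_trans (ler_norm _) _; apply/ltW/archi_boundP.
have bnd (r : R) x : `|r| ^+ 2 <= sqnormc (u x) -> `|r| <= K%:R.
  move=> h; have h1 : `|r| ^+ 2 <= K%:R ^+ 2.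
    apply: (le_trans h); apply: (le_trans (uM x)).
    apply: (@le_trans _ _ (M + 1)); first by rewrite lerDl.
    apply: (le_trans KM); rewrite expr2 ler_peMr//.
    rewrite ler1n; case: (K) KM => //.
    have := sqnormc_ge0 (u x); have := uM x => a b; lra.
  by rewrite -(@ler_pXn2r _ 2)// ?nnegrE.
have key (g : T -> R) : measurable_fun setT g -> (forall x, `|g x| <= K%:R) ->
    L2closure (fun x => toC (g x)).
  move=> mg gK.
  have := L2closure_lin (toC (- K%:R)) V1 (@L2closure_real (fun x => g x + K%:R) (K + K) _ _).
  rewrite (_ : (fun x => _) = (fun x => toC (g x))).
    apply; first exact: measurable_funD.
    move=> x; have := gK x; rewrite ler_norml natrD => /andP[h1 h2].
    by apply/andP; split; lra.
  by apply/funext => x; rewrite mulr1 -toCD addrCA addNr addr0.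
have := L2closure_lin (Complex 0 1) (key _ u2 (fun x => bnd _ x (normr_Im_le _))) (key _ u1 (fun x => bnd _ x (normr_Re_le _))).
rewrite (_ : (fun x => _) = u)//; apply/funext => x; apply: complexP.
  by rewrite ReD cReM /= !mul0r mulr0 subrr add0r.
by rewrite ImD cImM /= mul0r mul1r add0r addr0.
Qed.
End density.

(** * Fourier series on a lattice cell *)

Section lattice.
Context {R : realType} {n : nat}.
Variables (k : nat) (B : 'M[R]_n).
Local Notation mu := (@volk R n k).
Local Notation Re := (@complex.Re R).
Local Notation Im := (@complex.Im R).
Implicit Types (x y : 'cV[R]_n) (z : 'cV[int]_n).

Definition zv z : 'cV[R]_n := map_mx intr z.
Definition lat z : 'cV[R]_n := B *m zv z.
(* The lattice dual to [lat] for the form [ipk k]. *)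
Definition dl z : 'cV[R]_n := (k%:R)^-1 *: ((invmx B)^T *m zv z).
Definition crd x : 'cV[R]_n := invmx B *m x.
Definition cellB : set 'cV[R]_n := [set x | forall i, 0 <= crd x i ord0 < 1].
Definition fl x : 'cV[int]_n := \col_i Num.floor (crd x i ord0).

Lemma zvE z i : zv z i ord0 = (z i ord0)%:~R. Proof. by rewrite mxE. Qed.
Lemma zvD z z' : zv (z + z') = zv z + zv z'. Proof. exact: map_mxD. Qed.
Lemma zvN z : zv (- z) = - zv z. Proof. exact: map_mxN. Qed.
Lemma zv0 : zv 0 = 0. Proof. exact: map_mx0. Qed.
Lemma zv_inj : injective zv.
Proof.
move=> z z' /matrixP H; apply/matrixP => i l.
by have := H i l; rewrite !mxE => /intr_inj.
Qed.
Lemma latD z z' : lat (z + z') = lat z + lat z'. Proof. by rewrite /lat zvD mulmxDr. Qed.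
Lemma latN z : lat (- z) = - lat z. Proof. by rewrite /lat zvN mulmxN. Qed.
Lemma latB z z' : lat (z - z') = lat z - lat z'. Proof. by rewrite latD latN. Qed.
Lemma lat0 : lat 0 = 0. Proof. by rewrite /lat zv0 mulmx0. Qed.
Lemma dlD z z' : dl (z + z') = dl z + dl z'. Proof. by rewrite /dl zvD mulmxDr scalerDr. Qed.
Lemma dlN z : dl (- z) = - dl z. Proof. by rewrite /dl zvN mulmxN scalerN. Qed.
Lemma dlB z z' : dl (z - z') = dl z - dl z'. Proof. by rewrite dlD dlN. Qed.
Lemma dl0 : dl 0 = 0. Proof. by rewrite /dl zv0 mulmx0 scaler0. Qed.
Lemma crdD x y : crd (x + y) = crd x + crd y. Proof. exact: mulmxDr. Qed.
Lemma crdN x : crd (- x) = - crd x. Proof. exact: mulmxN. Qed.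

Lemma dotv_zv_int z z' : dotv (zv z) (zv z') \is a Num.int.
Proof. by apply: rpred_sum => i _; rewrite !zvE rpredM// intr_int. Qed.

Hypothesis k1 : (1 <= k)%N.
Let k0 : (k%:R : R) != 0. Proof. by rewrite pnatr_eq0 -lt0n. Qed.

Lemma ipk_dl z x : ipk k (dl z) x = dotv (zv z) (crd x).
Proof. by rewrite /ipk dotvZ mulrA mulfV// mul1r dotv_mulmx trmxK. Qed.

Hypothesis Bu : B \in unitmx.

Lemma crd_lat z : crd (lat z) = zv z.
Proof. by rewrite /crd /lat mulmxA mulVmx// mul1mx. Qed.
Lemma crdK : cancel crd (mulmx B).
Proof. by move=> x; rewrite /crd mulmxA mulmxV// mul1mx. Qed.

Lemma lat_inj : injective lat.
Proof. by move=> z z' /(congr1 crd); rewrite !crd_lat => /zv_inj. Qed.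

Lemma dl_inj : injective dl.
Proof.
move=> z z' /(congr1 (fun x => B^T *m (k%:R *: x))); rewrite /dl !scalerA mulfV// !scale1r.
by rewrite !mulmxA -!trmx_mul mulVmx// trmx1 !mul1mx => /zv_inj.
Qed.

Lemma ipk_dl_lat z z' : ipk k (dl z) (lat z') \is a Num.int.
Proof. by rewrite ipk_dl crd_lat dotv_zv_int. Qed.

Lemma bracket_dl_lat z z' : bracket k (dl z) (lat z') = 1.
Proof. exact/bracket_int/ipk_dl_lat. Qed.

Lemma dlP x : (forall z, ipk k x (lat z) \is a Num.int) -> exists z, x = dl z.
Proof.
move=> H.
have E i : (B^T *m (k%:R *: x)) i ord0 \is a Num.int.
  have := H (delta_mx i ord0); rewrite ipkC /ipk /lat.
  have -> : zv (delta_mx i ord0) = delta_mx i ord0.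
    by apply/matrixP => a b; rewrite !mxE; case: eqP; case: eqP.
  rewrite dotv_mulmx -[k%:R * _]dotvZr -scalemxAr.
  rewrite /dotv (bigD1 i)//= big1 ?addr0; last first.
    by move=> l li; rewrite mxE (negbTE li) mul0r.
  by rewrite mxE !eqxx mul1r.
exists (\col_i Num.floor ((B^T *m (k%:R *: x)) i ord0)).
have -> : dl (\col_i Num.floor ((B^T *m (k%:R *: x)) i ord0)) =
   (k%:R)^-1 *: ((invmx B)^T *m (B^T *m (k%:R *: x))).
  rewrite /dl; congr (_ *: (_ *m _)); apply/matrixP => i l; rewrite !ord1.
  by rewrite zvE mxE; apply/eqP; rewrite -intrEfloor; exact: E.
by rewrite mulmxA -trmx_mul mulmxV// trmx1 mul1mx scalerA mulVf// scale1r.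
Qed.

Lemma measurable_crd : measurable_fun setT crd. Proof. exact: measurable_mulmx. Qed.

Lemma measurable_cellB : measurable cellB.
Proof.
rewrite (_ : cellB = crd @^-1` cube n 0 1)//.
by rewrite -[X in measurable X]setTI; apply: measurable_crd => //; exact: measurable_cube.
Qed.
Hint Resolve measurable_cellB : core.

Lemma cell_fl x : cellB (x - lat (fl x)).
Proof.
move=> i; rewrite crdD crdN crd_lat [(crd x - _) i ord0]mxE [(- zv _) i ord0]mxE.
rewrite zvE [fl x i ord0]mxE subr_ge0 ltrBlDl.
by have := floor_itv (crd x i ord0); rewrite rmorphD rmorph1.
Qed.

Lemma cell_lat_eq0 x z : cellB x -> cellB (x + lat z) -> z = 0.
Proof.
move=> cx cz; apply/matrixP => i l; rewrite !ord1 [RHS]mxE.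
have := cx i; have := cz i; rewrite crdD crd_lat mxE zvE => /andP[a b] /andP[c d].
have h1 : (z i ord0)%:~R < (1%:~R : R) by rewrite mulr1z; lra.
have h2 : ((-1)%:~R : R) < (z i ord0)%:~R by rewrite mulrN1z; lra.
move: h1 h2; rewrite !ltr_int; case: (z i ord0) => [[|m]|m] //.
Qed.

Lemma fl_cell x z : cellB (x - lat z) -> z = fl x.
Proof.
move=> cx; apply/eqP; rewrite -subr_eq0; apply/eqP.
apply: (cell_lat_eq0 cx); rewrite latB addrA subrK; exact: cell_fl.
Qed.

Lemma fl_lat x z : fl (x + lat z) = fl x + z.
Proof.
by apply/esym/fl_cell; rewrite latD opprD addrACA addrC subrr add0r; rewrite ?addr0; exact: cell_fl.
Qed.

Lemma fl_cell0 x : cellB x -> fl x = 0.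
Proof. by move=> cx; apply/esym/fl_cell; rewrite lat0 subr0. Qed.

(** Symmetric boxes of indices, listed without repetition: the infinite lattice sums below are
    limits along them. *)
Definition boxs (N : nat) : seq 'cV[int]_n :=
  [seq (\col_i ((g i : nat)%:Z - N%:Z) : 'cV[int]_n) | g : {ffun 'I_n -> 'I_N.*2.+1}].

Lemma boxs_uniq N : uniq (boxs N).
Proof.
rewrite map_inj_uniq ?enum_uniq// => g h /matrixP H; apply/ffunP => i.
have := H i ord0; rewrite !mxE => /addIr [] e; exact/val_inj.
Qed.

Lemma boxsP N z : reflect (forall i, - (N%:Z) <= z i ord0 <= N%:Z) (z \in boxs N).
Proof.
apply: (iffP mapP) => [[g _ ->] i|H].
  rewrite mxE; have := ltn_ord (g i); rewrite ltnS => gi.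
  by rewrite lerBrDr addNr lerBlDr /= -PoszD addnn lez_nat gi.
have gP i : (absz (z i ord0 + N%:Z)%R < N.*2.+1)%N.
  have /andP[a b] := H i; rewrite ltnS -lez_nat gez0_abs; last by rewrite -lerBlDr sub0r.
  by rewrite -addnn PoszD lerD2r.
exists [ffun i => Ordinal (gP i)]; first by rewrite mem_enum.
apply/matrixP => i l; rewrite !ord1 mxE ffunE /=.
have /andP[a b] := H i; rewrite gez0_abs ?addrK// -lerBlDr sub0r//.
Qed.

Lemma boxs_sub N M : (N <= M)%N -> {subset boxs N <= boxs M}.
Proof.
move=> NM z /boxsP H; apply/boxsP => i; have /andP[a b] := H i.
by rewrite (le_trans _ a) ?(le_trans b)// ?lerN2 lez_nat.
Qed.

Lemma boxs_mem z : exists N, forall M, (N <= M)%N -> z \in boxs M.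
Proof.
exists (\sum_i `|z i ord0|%N)%N => M NM; apply: (boxs_sub NM); apply/boxsP => i.
by rewrite -ler_norml -abszE lez_nat (bigD1 i)//= leq_addr.
Qed.

(** The bounds are those of integral parts between [- N] and [N], so this is exactly the union of
    the translates of the cell by the box of size [N]. *)
Definition KN (N : nat) : set 'cV[R]_n :=
  [set x | forall i, - N%:R <= crd x i ord0 < N%:R + 1].

Lemma measurable_KN N : measurable (KN N).
Proof.
rewrite (_ : KN N = crd @^-1` cube n (- N%:R) (N%:R + 1))//.
by rewrite -[X in measurable X]setTI; apply: measurable_crd => //; exact: measurable_cube.
Qed.
Hint Resolve measurable_KN : core.

Lemma KN_fl N x : KN N x <-> fl x \in boxs N.
Proof.
split=> [Kx|/boxsP H i].
  apply/boxsP => i; have /andP[a b] := Kx i; rewrite mxE.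
  apply/andP; split; first by rewrite floor_ge_int mulrNz.
  by rewrite -ltzD1 floor_lt_int rmorphD.
have := H i; rewrite mxE floor_ge_int mulrNz => /andP[-> h]/=.
by rewrite -[N%:R + 1]/((N%:Z)%:~R + 1%:~R) -rmorphD -floor_lt_int ltzD1.
Qed.

Lemma nd_KN N M : (N <= M)%N -> KN N `<=` KN M.
Proof. by move=> NM x /KN_fl xN; apply/KN_fl; exact: boxs_sub xN. Qed.

Lemma bigcup_KN : \bigcup_N KN N = setT.
Proof.
apply/seteqP; split=> // x _; have [N /(_ N (leqnn N)) H] := boxs_mem (fl x).
by exists N => //; apply/KN_fl.
Qed.

Lemma KN_lat N x z : cellB x -> KN N (x + lat z) <-> z \in boxs N.
Proof. by move=> cx; rewrite KN_fl fl_lat fl_cell0// add0r. Qed.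

Lemma tile_KN (f : 'cV[R]_n -> \bar R) N : measurable_fun setT f ->
  (forall x, 0 <= f x)%E ->
  (\int[mu]_(x in KN N) f x = \sum_(z <- boxs N) \int[mu]_(x in cellB) f (x + lat z)%R)%E.
Proof.
move=> mf f0.
have mi z : measurable_fun setT (fun x : 'cV[R]_n => (\1_cellB (x - lat z) : R)%:E).
  by apply: measurable_indic_preim => //; exact: measurable_addv.
transitivity (\int[mu]_x \sum_(z <- boxs N) (f x * (\1_cellB (x - lat z)%R)%:E))%E.
  rewrite integral_mkcond; apply: eq_integral => x _; rewrite patchE.
  have cz z : z != fl x -> (\1_cellB (x - lat z) : R) = 0.
    move=> zx; rewrite indicE memNset// => /fl_cell zE.
    by rewrite zE eqxx in zx.
  case: ifPn => [/set_mem/KN_fl xN|xN].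
    rewrite (bigD1_seq (fl x))//= ?boxs_uniq// big1 => [|z zx]; last first.
      by rewrite cz// mule0.
    by rewrite adde0 indicE mem_set ?mule1//; exact: cell_fl.
  rewrite big_seq big1// => z zN; rewrite cz ?mule0//.
  by apply: contraNN xN => /eqP zx; rewrite inE; apply/KN_fl; rewrite -zx.
rewrite ge0_integral_sum//; last 2 first.
- by move=> z; exact: emeasurable_funM.
- by move=> z x _; rewrite mule_ge0// lee_fin.
apply: eq_bigr => z _.
have := mpres_ge0_integral (D := setT) (f := fun x => f x * (\1_cellB (x - lat z)%R)%:E)%E
  (mpres_shift k (lat z)) measurableT (emeasurable_funM mf (mi z)).
rewrite preimage_setT => <-; last by move=> x _; rewrite mule_ge0// lee_fin.
rewrite [RHS]integral_mkcond; apply: eq_integral => x _.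
by rewrite patchE addrK indicE; case: ifPn => _; rewrite ?mule1 ?mule0.
Qed.

Lemma cvg_KN (f : 'cV[R]_n -> \bar R) : measurable_fun setT f -> (forall x, 0 <= f x)%E ->
  (\int[mu]_(x in KN N) f x)%E @[N --> \oo] --> (\int[mu]_x f x)%E.
Proof.
move=> mf f0; rewrite -bigcup_KN.
apply: ge0_nondecreasing_set_cvg_integral => //.
- by apply/nondecreasing_seqP => N; apply/subsetPset/nd_KN.
- by move=> N; exact: measurable_funTS.
Qed.

(** Cutting [D] along the cells and moving the pieces back covers each point of the base cell once,
    by uniqueness of the translate; the bound by [KN] makes the cutting finite. It serves for
    translated and for reflected cells. *)
Lemma periodic_domain (h : 'cV[R]_n -> \bar R) (D : set 'cV[R]_n) N :
  measurable_fun setT h -> (forall x, 0 <= h x)%E ->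
  (forall x z, h (x + lat z) = h x) -> measurable D -> D `<=` KN N ->
  (forall x, exists z, D (x + lat z) /\ forall z', D (x + lat z') -> z' = z) ->
  (\int[mu]_(x in D) h x = \int[mu]_(x in cellB) h x)%E.
Proof.
move=> mh h0 hP mD DK DP.
have mi : measurable_fun setT (fun x => h x * (\1_D x)%:E)%E.
  by apply: emeasurable_funM => //; apply/measurable_EFinP; exact: measurable_indic.
transitivity (\int[mu]_(x in KN N) (h x * (\1_D x)%:E))%E.
  rewrite integral_mkcond [RHS]integral_mkcond; apply: eq_integral => x _.
  rewrite !patchE indicE; case: (boolP (x \in D)) => xD.
    by rewrite mem_set ?mule1//; apply: DK; exact: set_mem.
  by rewrite mule0; case: ifP.
rewrite tile_KN//; last by move=> x; rewrite mule_ge0// lee_fin.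
rewrite -ge0_integral_sum//; last 2 first.
- by move=> z; apply: measurable_funTS; apply: (measurableT_comp mi); exact: measurable_addv.
- by move=> z x _; rewrite mule_ge0// lee_fin.
apply: eq_integral => x /set_mem cx.
have [z [Dz zP]] := DP x.
rewrite (bigD1_seq z)//= ?boxs_uniq//; last by apply/(KN_lat _ _ cx)/DK.
rewrite hP indicE mem_set// mule1 big1 ?adde0// => z' /eqP zz'.
by rewrite indicE memNset ?mule0// => /zP.
Qed.

Lemma bounded_KN (M : R) : exists N, forall x, (forall i, `|x i ord0| <= M) -> KN N x.
Proof.
pose C := \sum_i \sum_l `|invmx B i l| * `|M|.
have C0 : 0 <= C by apply: sumr_ge0 => i _; apply: sumr_ge0 => l _; rewrite mulr_ge0.
exists (Num.bound C) => x xM i.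
have H : `|crd x i ord0| <= C.
  rewrite mxE; apply: le_trans (ler_norm_sum _ _ _) _.
  rewrite /C [leRHS](bigD1 i)//= -[leLHS]addr0 lerD//; last first.
    by apply: sumr_ge0 => a _; apply: sumr_ge0 => l _; rewrite mulr_ge0.
  apply: ler_sum => l _; rewrite normrM ler_wpM2l//.
  by apply: le_trans (xM l) _; exact: ler_norm.
have HC : C < (Num.bound C)%:R by exact: archi_boundP.
move: H; rewrite ler_norml => /andP[a b].
by apply/andP; split; lra.
Qed.

Lemma uball_KN : exists N, uball `<=` KN N.
Proof.
have [N NP] := bounded_KN 1; exists N => x x1; apply: NP => i.
rewrite -(@ler_pXn2r _ 2)// ?nnegrE// expr1n real_normK ?num_real//.
by rewrite (le_trans (coord_sqr_le x i))// ltW.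
Qed.

Lemma cellB_bounded : exists M, forall x, cellB x -> forall i, `|x i ord0| <= M.
Proof.
exists (\sum_i \sum_l `|B i l|) => x cx i; rewrite -[x]crdK mxE.
apply: le_trans (ler_norm_sum _ _ _) _.
rewrite [leRHS](bigD1 i)//= -[leLHS]addr0 lerD//; last first.
  by apply: sumr_ge0 => a _; apply: sumr_ge0.
apply: ler_sum => l _; rewrite normrM ler_piMr//.
by have /andP[a b] := cx l; rewrite ger0_norm// ltW.
Qed.

Lemma volk_bounded (M : R) (A : set 'cV[R]_n) : measurable A ->
  (forall x, A x -> forall i, `|x i ord0| <= M) -> (mu A < +oo)%E.
Proof.
move=> mA AM; apply: (@le_lt_trans _ _ (mu (cube n (- `|M|) (`|M| + 1)))).
  apply: le_measure; rewrite ?inE//; first exact: measurable_cube.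
  move=> x Ax i; have := AM x Ax i; rewrite ler_norml => /andP[a b].
  have := ler_norm M; have := ler_norm (- M); rewrite normrN => c d.
  by apply/andP; split; lra.
by rewrite volk_cube ?ltry//; have := normr_ge0 M; lra.
Qed.

Lemma volk_cell_fin : (mu cellB < +oo)%E.
Proof. by have [M MP] := cellB_bounded; exact: volk_bounded MP. Qed.

Lemma volk_cell_gt0 : (0 < mu cellB)%E.
Proof.
rewrite lt_neqAle measure_ge0 andbT; apply/eqP => c0.
have [N NP] := uball_KN.
have : (mu (KN N) = 0)%E.
  rewrite -[mu (KN N)]mul1e -integral_cst// tile_KN//= big1// => z _.
  by rewrite integral_cst//= -c0 mule0.
move=> K0; have := volk_uball_gt0 k1 (n := n) (R := R).
rewrite ltNge -K0 le_measure ?inE//; exact: measurable_uball.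
Qed.

Definition vol : R := fine (mu cellB).
Lemma volE : mu cellB = vol%:E.
Proof. by rewrite fineK// ge0_fin_numE// volk_cell_fin. Qed.
Lemma vol_gt0 : 0 < vol.
Proof. by rewrite -lte_fin -volE volk_cell_gt0. Qed.
End lattice.

Lemma subr_eq_addr0 {R : realFieldType} (a b : R) : a - b = a + b -> b = 0.
Proof. by lra. Qed.

(** * Characters on a lattice cell and Parseval's theorem *)

Section fourier_cell.
Local Arguments conjc {R} x : simpl never.
Context {R : realType} {n : nat}.
Variables (k : nat) (B : 'M[R]_n).
Hypothesis k1 : (1 <= k)%N.
Hypothesis Bu : B \in unitmx.
Local Notation mu := (@volk R n k).
Local Notation Re := (@complex.Re R).
Local Notation Im := (@complex.Im R).
Local Notation cell := (cellB B).
Local Notation lat := (lat B).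
Local Notation dl := (dl k B).
Local Notation vol := (vol k B).
Implicit Types (x y : 'cV[R]_n) (z : 'cV[int]_n).
Let mcell : measurable cell. Proof. exact: measurable_cellB. Qed.
Hint Resolve mcell : core.
Let cfin : (mu cell < +oo)%E. Proof. exact: volk_cell_fin. Qed.

Lemma periodic_shift (h : 'cV[R]_n -> \bar R) v :
  measurable_fun setT h -> (forall x, 0 <= h x)%E ->
  (forall x z, h (x + lat z) = h x) ->
  (\int[mu]_(x in cell) h (x + v)%R = \int[mu]_(x in cell) h x)%E.
Proof.
move=> mh h0 hP; pose D := [set x | cell (x - v)].
have mD : measurable D.
  rewrite (_ : D = (fun x => x - v) @^-1` cell)// -[X in measurable X]setTI.
  by apply: measurable_addv.
have [M MP] := cellB_bounded Bu.
have [N NP] := bounded_KN B (M + \sum_i `|v i ord0|).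
rewrite -(@periodic_domain _ _ _ _ Bu h D N)//.
- have := mpres_ge0_integral (D := D) (f := h) (mpres_shift k v) mD.
  rewrite (_ : _ @^-1` D = cell).
    by apply=> [|x _]; [exact: measurable_funTS|exact: h0].
  by apply/seteqP; split => x; rewrite /D /= addrK.
- move=> x Dx; apply: NP => i; have := MP _ Dx i => H.
  have -> : x i ord0 = (x - v) i ord0 + v i ord0 by rewrite !mxE subrK.
  rewrite (le_trans (ler_normD _ _))// lerD// (bigD1 i)//= lerDl sumr_ge0//.
- move=> x; exists (- fl B (x - v)); split.
    by rewrite /D/= latN addrAC; exact: cell_fl.
  move=> z' Dz'; apply/eqP; rewrite -eqr_oppLR; apply/eqP/(fl_cell Bu).
  by rewrite latN opprK addrAC.
Qed.

Definition chr z y : R[i] := bracket k (- dl z) y.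

Lemma chr_lat z l y : chr z (y + lat l) = chr z y.
Proof.
by rewrite /chr bracketDr [X in _ * X]bracketN (bracket_dl_lat k1 Bu) invr1 mulr1.
Qed.
Lemma measurable_ipk v : measurable_fun setT (fun y : 'cV[R]_n => ipk k v y).
Proof.
apply: measurable_funM => //; apply: measurable_dotv2 => //; exact: measurable_id.
Qed.
Lemma cmeas_bracket v : cmeasurable (fun y : 'cV[R]_n => bracket k v y).
Proof. by apply: cmeas_cexpi; apply: measurable_funM => //; exact: measurable_ipk. Qed.
Lemma cmeas_chr z : cmeasurable (chr z).
Proof. exact: cmeas_bracket. Qed.
Lemma chrD z z' y : chr (z + z') y = chr z y * chr z' y.
Proof. by rewrite /chr dlD opprD bracketD. Qed.
Lemma chr0 y : chr 0 y = 1. Proof. by rewrite /chr dl0 oppr0 bracket0. Qed.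
Lemma sqnormc_chr z y : sqnormc (chr z y) = 1. Proof. exact: sqnormc_bracket. Qed.
Lemma conjc_cexpi (r : R) : conjc (cexpi r) = cexpi (- r).
Proof. by rewrite /cexpi /= cosN sinN. Qed.
Lemma conjc_chr z y : conjc (chr z y) = chr (- z) y.
Proof. by rewrite /chr /bracket conjc_cexpi dlN !ipkN opprK mulrN opprK. Qed.

(** Translation by a vector on which the character is -1 changes the sign of the integral of a
    periodic function. *)
Lemma cint_chr0 z : z != 0 -> cint mu cell (chr z) = 0.
Proof.
move=> z0.
have [i zi] : exists i, z i ord0 != 0.
  apply/existsP; apply: contraNT z0; rewrite negb_exists => /forallP H.
  apply/eqP/matrixP => i l; rewrite !ord1 mxE; apply/eqP.
  by have := H i; rewrite negbK.
(* The [i]-th basis vector of the lattice divided by [2 z_i], which gives the phase [pi]. *)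
pose v := (2 * (z i ord0)%:~R)^-1 *: lat (delta_mx i ord0).
have zi0 : (z i ord0)%:~R != 0 :> R by rewrite intr_eq0.
have vE : chr z v = -1.
  rewrite /chr /bracket ipkN ipkZr (ipk_dl _ k1) (crd_lat Bu) /dotv (bigD1 i)//= big1; last first.
    by move=> l li; rewrite !zvE mxE (negbTE li) mulr0.
  rewrite addr0 !zvE mxE !eqxx mulr1 mulrN cexpiN.
  rewrite (_ : 2 * pi * _ = pi); last by field.
  by rewrite cexpi_pi invrN1.
have mint (h : 'cV[R]_n -> R) : measurable_fun setT h -> (forall y, `|h y| <= 2) ->
    mu.-integrable cell (fun x => (h x)%:E).
  move=> mh hM; apply: measurable_bounded_integrable => //; first exact: measurable_funTS.
  exists 2; split; first exact: num_real.
  by move=> c hc y _; apply: (le_trans (hM y)); exact: ltW.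
have key (G : R[i] -> R) : (forall w, `|G w| ^+ 2 <= sqnormc w) ->
    (forall w, G (- w) = - G w) -> measurable_fun setT (fun y => G (chr z y)) ->
    \int[mu]_(y in cell) G (chr z y) = 0.
  move=> GN Gm mG; pose h y := G (chr z y).
  have h1 y : `|h y| <= 1.
    by rewrite -(@ler_pXn2r _ 2)// ?nnegrE// expr1n -(sqnormc_chr z y) GN.
  have hv y : h (y + v) = - h y.
    by rewrite /h /chr bracketDr -/(chr z v) vE mulrN1 Gm.
  have hl y l : h (y + lat l) = h y by rewrite /h chr_lat.
  have hb y : -1 <= h y <= 1 by rewrite -ler_norml.
  have E : (\int[mu]_(y in cell) (1 - h y)%:E = \int[mu]_(y in cell) (1 + h y)%:E)%E.
    rewrite -(@periodic_shift (fun y => (1 + h y)%:E) v).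
    - by apply: eq_integral => y _; rewrite hv.
    - by apply/measurable_EFinP; exact: measurable_funD.
    - by move=> y; rewrite lee_fin; have /andP[] := hb y; lra.
    - by move=> y l; rewrite hl.
  have : \int[mu]_(y in cell) (1 - h y) = \int[mu]_(y in cell) (1 + h y).
    by rewrite /Rintegral E.
  have i1 : mu.-integrable cell (EFin \o (fun=> 1 : R)).
    by apply: mint => // y; rewrite normr1 ler1n.
  have ih : mu.-integrable cell (EFin \o h).
    by apply: mint => // y; rewrite (le_trans (h1 y))// ler1n.
  rewrite RintegralB// RintegralD// => H.
  exact: subr_eq_addr0 H.
apply: complexP; apply: key.
- exact: normr_Re_le.
- exact: ReN.
- exact: (cmeas_chr z).1.
- exact: normr_Im_le.
- exact: ImN.
- exact: (cmeas_chr z).2.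
Qed.

Lemma cint_chr_orth z z' :
  cint mu cell (fun y => chr z y * conjc (chr z' y)) = if z == z' then toC vol else 0.
Proof.
under eq_cint => y _ do rewrite conjc_chr -chrD.
case: eqVneq => [->|zz']; last by rewrite cint_chr0// subr_eq0.
rewrite subrr; under eq_cint => y _ do rewrite chr0.
apply: complexP; rewrite /= Rintegral_cst//= ?mul0r// mul1r.
exact: erefl.
Qed.

Definition tsum (a : 'cV[int]_n -> R[i]) (s : seq 'cV[int]_n) y : R[i] :=
  \sum_(z <- s) a z * chr z y.

Lemma cmeas_tsum a s : cmeasurable (tsum a s).
Proof. by apply: cmeas_sum => z; apply: cmeasZ; exact: cmeas_chr. Qed.

Lemma tsum_bound a s : exists M, forall y, sqnormc (tsum a s y) <= M.
Proof.
exists ((size s)%:R * \sum_(z <- s) sqnormc (a z)) => y.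
apply: le_trans (sqnormc_sum_le _ _) _.
by under eq_bigr do rewrite sqnormcM sqnormc_chr mulr1.
Qed.

(** Parseval is only proved for bounded functions; this class is stable under products and consists
    of integrable functions on the cell. *)
Definition bmeas (h : 'cV[R]_n -> R[i]) :=
  cmeasurable h /\ exists M, forall y, sqnormc (h y) <= M.

Lemma bmeas_int h : bmeas h -> cintegrable mu cell h.
Proof. by move=> [mh [M hM]]; exact: (@cintegrable_bounded _ _ _ mu cell mcell h M). Qed.

Lemma bmeas_tsum a s : bmeas (tsum a s).
Proof. by split; [exact: cmeas_tsum|exact: tsum_bound]. Qed.

Lemma bmeas_chr z : bmeas (chr z).
Proof. by split; [exact: cmeas_chr|exists 1 => y; rewrite sqnormc_chr]. Qed.

Lemma bmeasM g h : bmeas g -> bmeas h -> bmeas (fun y => g y * h y).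
Proof.
move=> [mg [M gM]] [mh [M' hM]]; split; first exact: cmeasM.
exists (M * M') => y; rewrite sqnormcM ler_pM ?sqnormc_ge0//.
Qed.

Lemma bmeasD g h : bmeas g -> bmeas h -> bmeas (fun y => g y + h y).
Proof.
move=> [mg [M gM]] [mh [M' hM]]; split; first exact: cmeasD.
exists (2 * M + 2 * M') => y; apply: le_trans (sqnormcD_le2 _ _) _.
by rewrite lerD// ler_wpM2l.
Qed.

Lemma bmeasN g : bmeas g -> bmeas (fun y => - g y).
Proof. by move=> [mg [M gM]]; split; [exact: cmeasN|exists M => y; rewrite sqnormcN]. Qed.

Lemma bmeasB g h : bmeas g -> bmeas h -> bmeas (fun y => g y - h y).
Proof. by move=> bg bh; apply: bmeasD => //; exact: bmeasN. Qed.

Lemma sqnormc_conjc (w : R[i]) : sqnormc (conjc w) = sqnormc w.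
Proof. by case: w => a b; rewrite /sqnormc/= sqrrN. Qed.

Lemma cmeas_conjc (g : 'cV[R]_n -> R[i]) : cmeasurable g -> cmeasurable (fun y => conjc (g y)).
Proof.
move=> [g1 g2]; split.
  by apply: (eq_measurable_fun _ _ g1) => y _; case: (g y).
by apply: (eq_measurable_fun _ _ (measurable_funN g2)) => y _ /=; case: (g y).
Qed.

Lemma bmeas_conjc g : bmeas g -> bmeas (fun y => conjc (g y)).
Proof.
by move=> [mg [M gM]]; split; [exact: cmeas_conjc|exists M => y; rewrite sqnormc_conjc].
Qed.

Lemma conjc_tsum a s y : conjc (tsum a s y) = \sum_(z <- s) conjc (a z) * conjc (chr z y).
Proof. by rewrite /tsum rmorph_sum; apply: eq_bigr => z _; rewrite rmorphM. Qed.

Lemma cint_conjc_tsum h a s : bmeas h ->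
  cint mu cell (fun y => h y * conjc (tsum a s y)) =
  \sum_(z <- s) conjc (a z) * cint mu cell (fun y => h y * conjc (chr z y)).
Proof.
move=> bh; under eq_cint => y _.
  rewrite conjc_tsum mulr_sumr.
  under eq_bigr do rewrite mulrCA.
  over.
have bi z : cintegrable mu cell (fun y => h y * conjc (chr z y)).
  by apply: bmeas_int; apply: bmeasM => //; apply: bmeas_conjc; exact: bmeas_chr.
rewrite cint_sum//; last by move=> z; exact: cintegrableZ.
by apply: eq_bigr => z _; rewrite cintZ.
Qed.

Lemma nsq_pyth g h : bmeas g -> bmeas h ->
  cint mu cell (fun y => g y * conjc (h y)) = 0 ->
  (nsq mu cell (fun y => g y + h y)%R = nsq mu cell g + nsq mu cell h)%E.
Proof.
move=> [mg [M gM]] [mh [M' hM]] gh0.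
apply: (@nsq_pythagoras _ _ _ mu cell mcell g h (Num.max M M')) => //.
- by move=> x _; rewrite le_max gM.
- by move=> x _; rewrite le_max hM orbT.
- by rewrite gh0.
Qed.

Lemma cint_chr_conjc_tsum z a s :
  cint mu cell (fun y => chr z y * conjc (tsum a s y)) =
  \sum_(z' <- s) conjc (a z') * (if z == z' then toC vol else 0).
Proof.
rewrite cint_conjc_tsum; last exact: bmeas_chr.
by apply: eq_bigr => z' _; rewrite cint_chr_orth.
Qed.

Lemma nsq_chr c z : nsq mu cell (fun y => c * chr z y) = (vol * sqnormc c)%:E.
Proof.
rewrite nsqZ//; last exact: cmeas_chr.
rewrite mulrC EFinM; congr (_ * _)%E; rewrite /nsq.
under eq_integral do rewrite sqnormc_chr.
by rewrite integral_cst// mul1e; exact: (volE k Bu).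
Qed.

Lemma nsq_tsum a s : uniq s ->
  nsq mu cell (tsum a s) = (vol * \sum_(z <- s) sqnormc (a z))%:E.
Proof.
elim: s => [|z s IH] /=.
  move=> _; rewrite big_nil mulr0 -[0%:E](nsq0 mu cell); apply: eq_nsq => y _.
  by rewrite /tsum big_nil.
move=> /andP[zs us]; rewrite big_cons mulrDr EFinD -IH// -(nsq_chr (a z) z).
rewrite -nsq_pyth.
- by apply: eq_nsq => y _; rewrite /tsum big_cons.
- by apply: bmeasM; [split; [exact: cmeas_cst|exists (sqnormc (a z))]|exact: bmeas_chr].
- exact: bmeas_tsum.
under eq_cint => y _ do rewrite -mulrA.
rewrite cintZ//; last first.
  by apply: bmeas_int; apply: bmeasM; [exact: bmeas_chr|exact: bmeas_conjc (bmeas_tsum _ _)].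
rewrite cint_chr_conjc_tsum big_seq big1 ?mulr0// => z' z's.
by case: eqVneq => [zz'|]; rewrite ?mulr0//; rewrite zz' z's in zs.
Qed.

Definition coef h z : R[i] :=
  toC vol^-1 * cint mu cell (fun y => h y * conjc (chr z y)).

Lemma part_orth h s z : bmeas h -> uniq s -> z \in s ->
  cint mu cell (fun y => (h y - tsum (coef h) s y) * conjc (chr z y)) = 0.
Proof.
move=> bh us zs; have bc := bmeas_conjc (bmeas_chr z).
under eq_cint => y _ do rewrite mulrBl.
rewrite cintB//; [|exact/bmeas_int/bmeasM|by apply/bmeas_int/bmeasM => //; exact: bmeas_tsum].
have -> : cint mu cell (fun y => tsum (coef h) s y * conjc (chr z y)) = toC vol * coef h z.
  under eq_cint => y _.
    rewrite /tsum mulr_suml.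
    under eq_bigr do rewrite -mulrA.
    over.
  rewrite cint_sum//; last first.
    by move=> z'; apply: cintegrableZ => //; apply: bmeas_int; apply: bmeasM => //; exact: bmeas_chr.
  rewrite (bigD1_seq z)//= cintZ//; last by apply/bmeas_int/bmeasM => //; exact: bmeas_chr.
  rewrite (cint_chr_orth z z) eqxx big1; first by rewrite addr0 mulrC.
  move=> z' zz'.
  rewrite cintZ//; last by apply/bmeas_int/bmeasM => //; exact: bmeas_chr.
  by rewrite (cint_chr_orth z' z) (negbTE zz') mulr0.
by rewrite /coef mulrA -toCM mulfV ?mul1r ?subrr// gt_eqF// (vol_gt0 k1 Bu).
Qed.

(** The residue of the Fourier sum is orthogonal to every character of [s], so any other choice of
    coefficients adds its own norm by Pythagoras. *)
Lemma nsq_best h a s : bmeas h -> uniq s ->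
  (nsq mu cell (fun y => h y - tsum a s y)%R = nsq mu cell (fun y => h y - tsum (coef h) s y)%R
    + (vol * \sum_(z <- s) sqnormc (coef h z - a z))%:E)%E.
Proof.
move=> bh us; rewrite -nsq_tsum// -nsq_pyth.
- apply: eq_nsq => y _; rewrite -addrA; congr (_ + _).
  rewrite /tsum -!sumrN -big_split/=; apply: eq_bigr => z _; ring.
- by apply: bmeasB => //; exact: bmeas_tsum.
- exact: bmeas_tsum.
rewrite cint_conjc_tsum; last by apply: bmeasB => //; exact: bmeas_tsum.
by rewrite big_seq big1// => z zs; rewrite part_orth ?mulr0.
Qed.

Lemma nsq_bessel h s : bmeas h -> uniq s ->
  (nsq mu cell h = nsq mu cell (fun y => h y - tsum (coef h) s y)%R
    + (vol * \sum_(z <- s) sqnormc (coef h z))%:E)%E.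
Proof.
move=> bh us; have := nsq_best (fun=> 0) bh us.
under [X in (vol * X)%:E]eq_bigr do rewrite subr0.
move=> <-; apply: eq_nsq => y _; rewrite /tsum big1 ?subr0// => z _.
by rewrite mul0r.
Qed.

Definition trigpoly (u : 'cV[R]_n -> R[i]) := exists s : seq (R[i] * 'cV[int]_n),
  forall y, u y = \sum_(p <- s) p.1 * chr p.2 y.

Lemma trigpoly_chr z : trigpoly (chr z).
Proof. by exists [:: (1, z)] => y; rewrite big_seq1 mul1r. Qed.
Lemma trigpoly_add u v : trigpoly u -> trigpoly v -> trigpoly (fun y => u y + v y).
Proof. by move=> [s sE] [t tE]; exists (s ++ t) => y; rewrite big_cat/= sE tE. Qed.
Lemma trigpoly_mul u v : trigpoly u -> trigpoly v -> trigpoly (fun y => u y * v y).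
Proof.
move=> [s sE] [t tE].
exists [seq (p.1 * q.1, p.2 + q.2) | p <- s, q <- t] => y.
rewrite sE tE big_allpairs_dep/= mulr_suml; apply: eq_bigr => p _.
by rewrite mulr_sumr; apply: eq_bigr => q _; rewrite /= chrD mulrACA.
Qed.
Lemma trigpoly_cst c : trigpoly (fun=> c).
Proof. by exists [:: (c, 0)] => y; rewrite big_seq1 /= chr0 mulr1. Qed.
Lemma trigpoly_scale c u : trigpoly u -> trigpoly (fun y => c * u y).
Proof. by move=> Tu; apply: (trigpoly_mul (trigpoly_cst c) Tu). Qed.
Lemma trigpoly_exp u N : trigpoly u -> trigpoly (fun y => u y ^+ N).
Proof.
move=> Tu; elim: N => [|N IH]; first by under eq_fun do rewrite expr0; exact: trigpoly_cst.
by under eq_fun do rewrite exprS; exact: trigpoly_mul.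
Qed.
Lemma trigpoly_prod (I : Type) (s : seq I) (F : I -> 'cV[R]_n -> R[i]) :
  (forall i, trigpoly (F i)) -> trigpoly (fun y => \prod_(i <- s) F i y).
Proof.
move=> TF; elim: s => [|i s IH]; first by under eq_fun do rewrite big_nil; exact: trigpoly_cst.
by under eq_fun do rewrite big_cons; exact: trigpoly_mul.
Qed.

(* Polynomials approaching the indicator of [1/2 < t] on [0, 1]. *)
Definition qstep (N : nat) (t : R) : R := 1 - (1 - t ^+ N) ^+ (2 ^ N).

Lemma bernoulli_ge (x : R) m : 0 <= x -> 1 + m%:R * x <= (1 + x) ^+ m.
Proof.
move=> x0; elim: m => [|m IH]; first by rewrite mul0r addr0 expr0.
rewrite exprS -natr1.
apply: (@le_trans _ _ ((1 + x) * (1 + m%:R * x))); last by rewrite ler_wpM2l// addr_ge0.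
have : 0 <= m%:R * x * x by rewrite !mulr_ge0.
lra.
Qed.

Lemma bernoulli_le (x : R) m : 0 <= x <= 1 -> 1 - m%:R * x <= (1 - x) ^+ m.
Proof.
move=> /andP[x0 x1]; elim: m => [|m IH]; first by rewrite mul0r subr0 expr0.
rewrite exprS -natr1.
apply: (@le_trans _ _ ((1 - x) * (1 - m%:R * x))); last by rewrite ler_wpM2l// subr_ge0.
have : 0 <= m%:R * x * x by rewrite !mulr_ge0.
lra.
Qed.

Lemma qstep_itv N (t : R) : 0 <= t <= 1 -> 0 <= qstep N t <= 1.
Proof.
move=> /andP[t0 t1]; rewrite /qstep.
have h0 : 0 <= 1 - t ^+ N by rewrite subr_ge0 exprn_ile1.
have h1 : 1 - t ^+ N <= 1 by rewrite gerBl exprn_ge0.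
by rewrite subr_ge0 exprn_ile1//= gerBl exprn_ge0.
Qed.

Lemma cvg_expr0 (q : R) : 0 <= q < 1 -> q ^+ N @[N --> \oo] --> (0 : R).
Proof. by move=> /andP[q0 q1]; apply: cvg_expr; rewrite ger0_norm. Qed.

(** Bernoulli's inequality bounds [qstep N t] by [(2 * t) ^+ N]. *)
Lemma qstep_lt (t : R) : 0 <= t -> t < 2^-1 -> qstep N t @[N --> \oo] --> (0 : R).
Proof.
move=> t0 t1; apply: (@squeeze_cvgr _ _ _ _ (cst 0) (fun N => (2 * t) ^+ N)).
- apply: nearW => N; have t01 : 0 <= t <= 1 by apply/andP; split => //; lra.
  have /andP[-> _]/= := qstep_itv N t01.
  rewrite /qstep lerBlDr -lerBlDl; apply: le_trans (bernoulli_le _ _).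
    by rewrite natrX exprMn.
  by rewrite exprn_ge0//= exprn_ile1//; lra.
- exact: cvg_cst.
- by apply: cvg_expr0; apply/andP; split; lra.
Qed.

(** The product of [(1 - t ^+ N) ^+ (2 ^ N)] and [(1 + t ^+ N) ^+ (2 ^ N)] is at most 1, and the
    second factor is at least [(2 * t) ^+ N]. *)
Lemma qstep_gt (t : R) : t <= 1 -> 2^-1 < t -> qstep N t @[N --> \oo] --> (1 : R).
Proof.
move=> t0 t1; apply: (@squeeze_cvgr _ _ _ _ (fun N => 1 - ((2 * t)^-1) ^+ N) (cst 1)).
- apply: nearW => N; have t01 : 0 <= t <= 1 by apply/andP; split => //; lra.
  have /andP[_ ->]/= := qstep_itv N t01; rewrite andbT lerB//.
  have tN0 : 0 <= t ^+ N by rewrite exprn_ge0//; lra.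
  have tN1 : t ^+ N <= 1 by rewrite exprn_ile1//; lra.
  have t2 : 0 < (2 * t) ^+ N by rewrite exprn_gt0//; lra.
  rewrite exprVn -[leRHS]mul1r ler_pdivlMr//.
  apply: (@le_trans _ _ ((1 - t ^+ N) ^+ (2 ^ N) * (1 + t ^+ N) ^+ (2 ^ N))).
    apply: ler_wpM2l; first by rewrite exprn_ge0// subr_ge0.
    apply: le_trans (bernoulli_ge _ tN0); rewrite natrX exprMn.
    by rewrite lerDr.
  rewrite -exprMn exprn_ile1//.
    by rewrite mulr_ge0// ?subr_ge0// addr_ge0.
  have : 0 <= t ^+ N * t ^+ N by rewrite mulr_ge0.
  lra.
- rewrite -[X in _ --> X]subr0; apply: cvgB; first exact: cvg_cst.
  apply: cvg_expr0; apply/andP; split; first by rewrite invr_ge0; lra.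
  by rewrite invf_lt1; lra.
- exact: cvg_cst.
Qed.

(** A cosine centred at the middle of [(a, 1)] and shifted to be 1/2 at both ends: for [0 <= a < 1]
    and a coordinate in [[0, 1)] it exceeds 1/2 exactly inside the arc. The division by 4 keeps it
    in [[0, 1]]. *)
Definition arc (i : 'I_n) (a : R) y : R := 2^-1 +
  (cos (2 * pi * (crd B y i ord0 - (1 + a) / 2)) - cos (pi * (1 - a))) / 4.

Lemma arc_itv i a y : 0 <= arc i a y <= 1.
Proof.
rewrite /arc; set u := cos _; set v := cos _.
have := cos_le1 (2 * pi * (crd B y i ord0 - (1 + a) / 2)).
have := cos_geN1 (2 * pi * (crd B y i ord0 - (1 + a) / 2)).
have := cos_le1 (pi * (1 - a)); have := cos_geN1 (pi * (1 - a)).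
rewrite -/u -/v => h1 h2 h3 h4.
by apply/andP; split; lra.
Qed.

Lemma crd_ipk y i : crd B y i ord0 = ipk k (dl (delta_mx i ord0)) y.
Proof.
rewrite (ipk_dl _ k1) /dotv (bigD1 i)//= big1; last first.
  by move=> l li; rewrite zvE mxE (negbTE li) mul0r.
by rewrite addr0 zvE [delta_mx _ _ _ _]mxE !eqxx mul1r.
Qed.

Lemma trigpoly_arc i a : trigpoly (fun y => toC (arc i a y)).
Proof.
pose d : 'cV[int]_n := delta_mx i ord0; pose m := (1 + a) / 2.
have E y : toC (arc i a y) = toC (2^-1 - cos (pi * (1 - a)) / 4) +
    (toC (8^-1) * (cexpi (- (2 * pi * m)) * chr (- d) y) + toC (8^-1) * (cexpi (2 * pi * m) * chr d y)).
  have -> : chr (- d) y = cexpi (2 * pi * crd B y i ord0).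
    by rewrite /chr dlN opprK /bracket crd_ipk.
  have -> : chr d y = cexpi (- (2 * pi * crd B y i ord0)).
    by rewrite /chr /bracket ipkN crd_ipk mulrN.
  rewrite -!cexpiD -mulrDr /arc -/m.
  set th := 2 * pi * (_ - m).
  have -> : - (2 * pi * m) + 2 * pi * crd B y i ord0 = th by rewrite /th; ring.
  have -> : 2 * pi * m + - (2 * pi * crd B y i ord0) = - th by rewrite /th; ring.
  rewrite /cexpi cosN sinN; apply: complexP.
    by rewrite ReD Re_toCM ReD/=; field.
  by rewrite ImD Im_toCM ImD/= subrr mulr0 addr0.
apply: (_ : trigpoly (fun y => toC (2^-1 - cos (pi * (1 - a)) / 4) +
    (toC (8^-1) * (cexpi (- (2 * pi * m)) * chr (- d) y) + toC (8^-1) * (cexpi (2 * pi * m) * chr d y))) -> _).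
  by move=> [s sE]; exists s => y; rewrite E sE.
apply: trigpoly_add; first exact: trigpoly_cst.
by apply: trigpoly_add; apply/trigpoly_scale/trigpoly_scale/trigpoly_chr.
Qed.

Lemma arc_gt i a y : cell y -> 0 <= a -> a < crd B y i ord0 -> 2^-1 < arc i a y.
Proof.
move=> /(_ i)/andP[c0 c1] a0 ac; rewrite /arc ltrDl divr_gt0// subr_gt0.
set c := crd B y i ord0 in c0 c1 ac *.
have p0 := @pi_gt0 R.
(* The cosine is symmetric about the middle of the arc. *)
wlog cm : c c0 c1 ac / 0 <= c - (1 + a) / 2.
  move=> H; case: (leP 0 (c - (1 + a) / 2)) => h; first exact: H.
  pose c' := 1 + a - c.
  have := H c'; rewrite (_ : c' - (1 + a) / 2 = - (c - (1 + a) / 2)); last by rewrite /c'; field.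
  by rewrite mulrN cosN; apply; rewrite /c'; lra.
by rewrite ltr_cos ?in_itv/=; [|apply/andP; split|apply/andP; split]; nra.
Qed.

Lemma arc_lt i a y : cell y -> a < 1 -> 0 < crd B y i ord0 -> crd B y i ord0 < a -> arc i a y < 2^-1.
Proof.
move=> _ a1; set c := crd B y i ord0 => c0 ca.
rewrite /arc -/c gtrDl pmulr_llt0 ?invr_gt0// subr_lt0.
have p0 := @pi_gt0 R.
rewrite -cosN (_ : - (2 * pi * (c - (1 + a) / 2)) = pi * (1 + a - 2 * c)); last by field.
set r := 1 + a - 2 * c.
have r1 : 1 - a < r by rewrite /r; lra.
have r2 : r < 1 + a by rewrite /r; lra.
case: (leP r 1) => hr.
  by rewrite ltr_cos ?in_itv/=; [|apply/andP; split|apply/andP; split]; nra.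
(* Beyond [pi] the angle is reflected, to stay where the cosine decreases. *)
rewrite (_ : cos (pi * r) = cos (pi * (2 - r))); last first.
  rewrite -[RHS]cosN -(cosD2pi (- _)); congr cos; rewrite -mulr_natr; ring.
by rewrite ltr_cos ?in_itv/=; [|apply/andP; split|apply/andP; split]; nra.
Qed.

(** [qstep] turns the arc into an approximate indicator of [a < c] for coordinates [c] in [[0, 1)];
    for [a] outside this interval that indicator is constant. *)
Definition fac (i : 'I_n) (a : R) (N : nat) y : R :=
  if a < 0 then 1 else if 1 <= a then 0 else qstep N (arc i a y).

Lemma fac_itv i a N y : 0 <= fac i a N y <= 1.
Proof.
rewrite /fac; case: ifP => _; first by rewrite ler01 lexx.
case: ifP => _; first by rewrite ler01 lexx.
exact/qstep_itv/arc_itv.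
Qed.

Lemma trigpoly_fac i a N : trigpoly (fun y => toC (fac i a N y)).
Proof.
rewrite /fac; case: (a < 0); first exact: trigpoly_cst.
case: (1 <= a); first exact: trigpoly_cst.
have E y : toC (qstep N (arc i a y)) = 1 + (- 1) * (1 + (- 1) * toC (arc i a y) ^+ N) ^+ (2 ^ N).
  have toCX r m : toC (r ^+ m : R) = toC r ^+ m.
    by elim: m => // m IH; rewrite !exprS toCM IH.
  by rewrite /qstep toCD toCN toCX toCD toCN toCX !mulN1r.
apply: (_ : trigpoly (fun y => 1 + (- 1) * (1 + (- 1) * toC (arc i a y) ^+ N) ^+ (2 ^ N)) -> _).
  by move=> [s sE]; exists s => y; rewrite E sE.
apply: trigpoly_add; first exact: trigpoly_cst.
apply/trigpoly_scale/trigpoly_exp; apply: trigpoly_add; first exact: trigpoly_cst.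
by apply/trigpoly_scale/trigpoly_exp/trigpoly_arc.
Qed.

Lemma fac_cvg i a y : cell y -> crd B y i ord0 != 0 -> crd B y i ord0 != a ->
  fac i a N y @[N --> \oo] --> ((a < crd B y i ord0)%R%:R : R).
Proof.
move=> cy c0 ca; have /andP[y0 y1] := cy i; rewrite /fac.
case: (ltP a 0) => a0; first by rewrite (lt_le_trans a0)//; exact: cvg_cst.
case: (leP 1 a) => a1; first by rewrite ltNge (le_trans (ltW y1))//; exact: cvg_cst.
case: (ltP a (crd B y i ord0)) => h.
  apply: qstep_gt; first by have /andP[] := arc_itv i a y.
  exact: arc_gt.
apply: qstep_lt; first by have /andP[] := arc_itv i a y.
by apply: arc_lt => //; rewrite lt_neqAle ?h ?y0 ?andbT// eq_sym.
Qed.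

Lemma cvg_prodr (I : Type) (s : seq I) (F : I -> nat -> R) (l : I -> R) :
  (forall i, F i N @[N --> \oo] --> l i) ->
  \prod_(i <- s) F i N @[N --> \oo] --> \prod_(i <- s) l i.
Proof.
move=> H; elim: s => [|i s IH].
  rewrite big_nil; apply: cvg_near_cst; apply: nearW => N; rewrite big_nil//.
rewrite big_cons; under eq_cvg do rewrite big_cons.
exact: (cvgM (H i) IH).
Qed.

Lemma ae_crd_neq i a : {ae mu, forall y, crd B y i ord0 != a}.
Proof.
have d0 : k%:R *: dl (delta_mx i ord0) != 0.
  rewrite scaler_eq0 negb_or pnatr_eq0 -lt0n k1/= -(dl0 k B) (inj_eq (dl_inj k1 Bu)).
  by apply/eqP => /matrixP/(_ i ord0); rewrite !mxE !eqxx.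
exists [set y | dotv y (k%:R *: dl (delta_mx i ord0)) = a]; split.
- rewrite (_ : [set y | _] = (fun y => dotv y (k%:R *: dl (delta_mx i ord0)) : measurableTypeR R) @^-1` [set a])//.
  rewrite -[X in measurable X]setTI.
  suff : measurable_fun setT (fun y => dotv y (k%:R *: dl (delta_mx i ord0)) : measurableTypeR R) by apply => //.
  by apply: measurable_dotv2 => //; exact: measurable_id.
- exact: volk_hyperplane.
- move=> y /=; apply: contra_notP => /eqP h; rewrite crd_ipk.
  by move: h; rewrite dotvZr dotvC.
Qed.

(** Products of the functions [fac] are trigonometric polynomials converging almost everywhere on
    the cell to indicators of orthants in lattice coordinates. Hence trigonometric polynomials are
    dense, and Fourier sums approximate at least as well. *)
Lemma parseval h : bmeas h ->
  nsq mu cell (fun y => h y - tsum (coef h) (boxs N) y)%R @[N --> \oo] --> 0%E.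
Proof.
move=> bh; pose V : set ('cV[R]_n -> R[i]) := [set u | trigpoly u].
have Vmeas v : V v -> cmeasurable v.
  move=> [s sE]; rewrite (_ : v = fun y => \sum_(p <- s) p.1 * chr p.2 y); last exact/funext.
  by apply: cmeas_sum => p; apply: cmeasZ; exact: cmeas_chr.
have Vlin c u v : V u -> V v -> V (fun x => c * u x + v x).
  by move=> Vu Vv; apply: trigpoly_add => //; exact: trigpoly_scale.
have V0 : V !=set0 by exists (fun=> 0); exact: trigpoly_cst.
have Vcl := @L2closure_sub _ _ _ mu cell V Vmeas.
have cl1 : L2closure mu cell V (fun=> 1) by apply: Vcl; exact: trigpoly_cst.
have mcrd : measurable_fun setT (crd B) by exact: measurable_crd.
have corth a : L2closure mu cell V (fun x => toC (\1_(orthant a) (crd B x))).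
  pose P N y := \prod_(i < n) fac i (a i) N y.
  have toCP N y : toC (P N y) = \prod_(i < n) toC (fac i (a i) N y).
    by rewrite /P; apply: (big_morph toC) => // u v; exact: toCM.
  have VP N : V (fun y => toC (P N y)).
    rewrite /V/= (_ : (fun y => _) = (fun y => \prod_(i <- index_enum 'I_n) toC (fac i (a i) N y))).
      by apply: trigpoly_prod => i; exact: trigpoly_fac.
    by apply/funext => y; rewrite toCP.
  have P01 N y : 0 <= P N y <= 1.
    apply: (big_ind (fun r : R => 0 <= r <= 1)) => [|r r'|i _]; last exact: fac_itv.
      by rewrite ler01 lexx.
    by move=> /andP[? ?] /andP[? ?]; rewrite mulr_ge0// mulr_ile1.
  have mO : cmeasurable (fun x => toC (\1_(orthant a) (crd B x)) : R[i]).
    apply: cmeas_toC; apply: measurableT_comp => //; apply: measurable_indic.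
    exact: measurable_orthant.
  apply: (L2closure_lim mcell Vmeas (F := fun N y => toC (P N y))) => //.
    by move=> N; exact: Vcl.
  apply: (@nsq_dct _ _ _ mu cell mcell cfin _ _ 1) => //.
  - by move=> N; apply: Vmeas; exact: VP.
  - have H1 : {ae mu, forall y i, crd B y i ord0 != a i}.
      by apply: filter_forall => i; exact: ae_crd_neq.
    have H2 : {ae mu, forall y i, crd B y i ord0 != 0}.
      by apply: filter_forall => i; exact: ae_crd_neq.
    apply: filterS2 H1 H2 => y h1 h2 cy.
    have lim : P N y @[N --> \oo] --> (\1_(orthant a) (crd B y) : R).
      have -> : (\1_(orthant a) (crd B y) : R) = \prod_(i < n) ((a i < crd B y i ord0)%R%:R : R).
        rewrite indicE; case: (boolP (_ \in _)) => [/set_mem H|nH].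
          by rewrite big1// => i _; rewrite H.
        have [i hi] : exists i, ~~ (a i < crd B y i ord0)%R.
          apply/existsP; apply: contraNT nH; rewrite negb_exists => /forallP H.
          by rewrite inE => i; have := H i; rewrite negbK.
        by rewrite (bigD1 i)//= (negbTE hi) mul0r.
      by apply: cvg_prodr => i; exact: fac_cvg.
    have lim0 : P N y - \1_(orthant a) (crd B y) @[N --> \oo] --> (0 : R).
      by rewrite -(subrr (\1_(orthant a) (crd B y) : R)); apply: cvgB => //; exact: cvg_cst.
    have lim00 : (P N y - \1_(orthant a) (crd B y)) * (P N y - \1_(orthant a) (crd B y))
        @[N --> \oo] --> (0 * 0 : R) by exact: (cvgM lim0).
    rewrite mulr0 in lim00.
    apply: cvg_trans lim00; apply: near_eq_cvg; apply: nearW => N.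
    by rewrite -toCN -toCD sqnormc_toC expr2.
  - move=> N y _; rewrite -toCN -toCD sqnormc_toC.
    have /andP[p0 p1] := P01 N y.
    rewrite -real_normK ?num_real// exprn_ile1// ler_norml indicE.
    by case: (_ \in _); apply/andP; split; rewrite /=; lra.
have [mh [M hM]] := bh.
have [_ Hcl] := @L2closure_bounded _ _ _ _ mu cell mcell cfin V Vmeas Vlin (crd B) (mulmx B)
  mcrd (measurable_mulmx B) (crdK Bu) cl1 corth V0 h M mh hM.
apply/cvge0_near => [N|e e0]; first exact: nsq_ge0.
have [v [s sE] hv] := Hcl e e0.
(* Coefficients of equal frequency are gathered, to compare with a sum over a box without
   repetition. *)
pose a z := \sum_(p <- s | p.2 == z) p.1.
have [N0 N0P] : exists N0, forall M, (N0 <= M)%N -> forall p, p \in s -> p.2 \in boxs M.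
  elim: s {sE a} => [|p s [N1 H1]]; first by exists 0%N.
  have [N2 H2] := boxs_mem p.2; exists (maxn N1 N2) => L; rewrite geq_max => /andP[l1 l2] q.
  by rewrite inE => /orP[/eqP->|qs]; [exact: H2|exact: H1].
exists N0 => // N /= NN0.
have vE y : v y = tsum a (boxs N) y.
  rewrite sE /tsum /a.
  under [RHS]eq_bigr do rewrite mulr_suml big_mkcond/=.
  rewrite exchange_big/= [LHS]big_seq [RHS]big_seq; apply: eq_bigr => p ps.
  rewrite (bigD1_seq p.2)/= ?boxs_uniq ?(N0P _ NN0)// eqxx big1 ?addr0// => z zp.
  by rewrite eq_sym (negbTE zp).
apply: le_trans hv.
have -> : nsq mu cell (fun x => h x - v x) = nsq mu cell (fun x => h x - tsum a (boxs N) x).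
  by apply: eq_nsq => y _; rewrite vE.
have Hb := nsq_best a bh (boxs_uniq N); rewrite Hb leeDl// lee_fin mulr_ge0//.
  by rewrite ltW// (vol_gt0 k1 Bu).
by apply: sumr_ge0 => z _; exact: sqnormc_ge0.
Qed.
End fourier_cell.

(** * The Zak transform of a lattice and the Fourier transform *)

Section zak_L2.
Local Arguments conjc {R} x : simpl never.
Context {R : realType} {n : nat}.
Variables (k : nat) (B : 'M[R]_n).
Hypothesis k1 : (1 <= k)%N.
Hypothesis Bu : B \in unitmx.
Local Notation mu := (@volk R n k).
Local Notation Re := (@complex.Re R).
Local Notation Im := (@complex.Im R).
Local Notation cell := (cellB B).
Local Notation lat := (lat B).
Local Notation dl := (dl k B).
Local Notation chr := (chr k B).
Local Notation vol := (vol k B).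
Implicit Types (x y : 'cV[R]_n) (z l : 'cV[int]_n).
Let mcell : measurable cell. Proof. exact: measurable_cellB. Qed.
Hint Resolve mcell : core.
Let cfin : (mu cell < +oo)%E. Proof. exact: volk_cell_fin. Qed.

Lemma box_sumE (a : 'cV[int]_n -> \bar R) N :
  (\sum_(z <- boxs N) a z = \sum_(z \in [set` boxs N]) a z)%E.
Proof. by rewrite fsbig_seq// boxs_uniq. Qed.

Lemma box_sum_le (a : 'cV[int]_n -> \bar R) N M : (forall z, 0 <= a z)%E -> (N <= M)%N ->
  (\sum_(z <- boxs N) a z <= \sum_(z <- boxs M) a z)%E.
Proof.
move=> a0 NM; rewrite !box_sumE; apply: lee_fsum_nneg_subset; [exact: finite_seq|exact: finite_seq| |by []].
by move=> z; rewrite !inE; exact: boxs_sub.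
Qed.

Lemma box_cvg (a : 'cV[int]_n -> \bar R) : (forall z, 0 <= a z)%E ->
  (\sum_(z <- boxs N) a z)%E @[N --> \oo] --> (\esum_(z in setT) a z)%E.
Proof.
move=> a0.
have nd : {homo (fun N => \sum_(z <- boxs N) a z)%E : N M / (N <= M)%N >-> (N <= M)%E}.
  by move=> N M NM; exact: box_sum_le.
have := ereal_nondecreasing_cvgn nd; congr (_ --> _); apply/eqP; rewrite eq_le.
apply/andP; split.
  apply: ge_ereal_sup => _ [N _ <-]; apply: ereal_sup_ubound => /=.
  by exists [set` boxs N]; [split => //; exact: finite_seq|rewrite box_sumE].
apply: ge_ereal_sup => _ [A [Afin _] <-].
have [N NP] : exists N, A `<=` [set` boxs N].
  have /finite_seqP[s ->] := Afin.
  elim: s => [|z s [N NP]]; first by exists 0%N => z.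
  have [M MP] := boxs_mem z; exists (maxn N M) => z' /=; rewrite inE => /orP[/eqP ->|zs].
    by apply: MP; rewrite leq_maxr.
  by apply: boxs_sub (NP _ zs); rewrite leq_maxl.
apply: (@le_trans _ _ (\sum_(z <- boxs N) a z)%E); last by apply: ereal_sup_ubound; exists N.
rewrite box_sumE; apply: lee_fsum_nneg_subset => //; first exact: finite_seq.
by move=> z; rewrite !inE; exact: NP.
Qed.

Lemma tile_esum (f : 'cV[R]_n -> \bar R) : measurable_fun setT f -> (forall x, 0 <= f x)%E ->
  (\int[mu]_x f x = \esum_(z in setT) \int[mu]_(x in cell) f (x + lat z)%R)%E.
Proof.
move=> mf f0; have h1 := cvg_KN (k := k) B mf f0.
have h2 : (\int[mu]_(x in KN B N) f x)%E @[N --> \oo] -->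
    (\esum_(z in setT) \int[mu]_(x in cell) f (x + lat z)%R)%E.
  under eq_cvg do rewrite (tile_KN _ Bu)//.
  by apply: box_cvg => z; apply: integral_ge0.
exact: cvg_unique h1 h2.
Qed.

(* [I] indexes the quotient of the dual lattice by [lat], with representatives
   [dl (rp i)]; [s] is the inclusion of [lat] in its dual. *)
Variables (I : finType) (s : 'cV[int]_n -> 'cV[int]_n) (cl : 'cV[int]_n -> I)
  (rp : I -> 'cV[int]_n).
Hypothesis dl_s : forall l, dl (s l) = lat l.
Hypothesis cl_rp : forall i l, cl (rp i + s l) = i.
Hypothesis rp_cl : forall z, exists l, z = rp (cl z) + s l.

Lemma sD l l' : s (l + l') = s l + s l'.
Proof. by apply: (dl_inj k1 Bu); rewrite dl_s latD dlD !dl_s. Qed.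
Lemma s_inj : injective s.
Proof. by move=> l l' /(congr1 dl); rewrite !dl_s => /(lat_inj Bu). Qed.
Lemma cl_s z l : cl (z + s l) = cl z.
Proof. by have [l' ->] := rp_cl z; rewrite -addrA -sD !cl_rp. Qed.

Lemma rps_bij : set_bij [set: I * 'cV[int]_n] [set: 'cV[int]_n] (fun p => rp p.1 + s p.2).
Proof.
split=> //.
  move=> [i l] [i' l'] _ _ /= e.
  have ii : i = i' by rewrite -(cl_rp i l) e cl_rp.
  by move: e; rewrite ii => /addrI/s_inj ->.
by move=> z _; have [l e] := rp_cl z; exists (cl z, l).
Qed.

Lemma esum_cl (a : 'cV[int]_n -> \bar R) : (forall z, 0 <= a z)%E ->
  (\esum_(z in setT) a z = \sum_i \esum_(l in setT) a (rp i + s l)%R)%E.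
Proof.
move=> a0; rewrite (reindex_esum _ _ _ _ rps_bij).
rewrite -(@setXTT I 'cV[int]_n).
have -> : [set: I] `*` [set: 'cV[int]_n] = [set: I] `*`` (fun=> setT).
  by apply/seteqP; split=> // -[].
rewrite -(@esum_esum _ _ _ setT (fun=> setT) (fun i l => a (rp i + s l)%R))//.
rewrite esum_fset//; last by move=> i _; apply: esum_ge0.
rewrite (_ : [set: I] = [set` index_enum I]) -?fsbig_seq ?index_enum_uniq//.
  by apply/seteqP; split=> i //= _; rewrite mem_index_enum.
exact: finite_finset.
Qed.

Implicit Types (F G : I -> 'cV[R]_n -> R[i]) (psi : 'cV[R]_n * 'cV[R]_n -> R[i]).

Definition N1 F := (\sum_i nsq mu setT (F i))%E.
Lemma N1_ge0 F : (0 <= N1 F)%E.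
Proof. by apply: sume_ge0 => i _; exact: nsq_ge0. Qed.
Definition mfam F := forall i, cmeasurable (F i).
(** The squared norm of the component of class [z] on the cell moved by [dl z]; for [z] running
    through one class these cells tile the space. *)
Definition az F z := nsq mu cell (fun x => F (cl z) (x + dl z)).

Lemma az_ge0 F z : (0 <= az F z)%E. Proof. exact: nsq_ge0. Qed.

Lemma N1_esum F : mfam F -> (N1 F = \esum_(z in setT) az F z)%E.
Proof.
move=> mF; rewrite esum_cl; last exact: az_ge0.
apply: eq_bigr => i _.
have <- : nsq mu setT (fun x => F i (x + dl (rp i))) = nsq mu setT (F i).
  exact: (nsq_mpres measurableT (mpres_shift k _) (mF i)).
rewrite /nsq (tile_esum (f := fun x => (sqnormc (F i (x + dl (rp i))))%:E)); last 2 first.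
- apply/cmeas_sqnormcE/(cmeas_comp (mF i)); exact: measurable_addv.
- by move=> x; rewrite lee_fin sqnormc_ge0.
apply: eq_esum => l _; apply: eq_integral => x _.
by rewrite cl_rp dlD dl_s -!addrA (addrC (lat l)).
Qed.

Definition ph (p : 'cV[R]_n * 'cV[R]_n) : R[i] := bracket k (- (2^-1 *: p.1)) p.2.
(** A partial sum of the Zak transform composed with the finite Fourier transform: when the sum over
    Z_(k) is done first, orthogonality of characters leaves in the term of [z] only the component of
    class [z]. The agreement with the stated transform is [zakP]. *)
Definition zs (r : seq 'cV[int]_n) F p : R[i] :=
  ph p * \sum_(z <- r) F (cl z) (p.1 + dl z) * chr z p.2.

Lemma sqnormc_ph p : sqnormc (ph p) = 1. Proof. exact: sqnormc_bracket. Qed.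
Lemma cmeas_ph : cmeasurable ph.
Proof.
apply: cmeas_cexpi; apply: measurable_funM => //; apply: measurable_funM => //.
apply: measurable_dotv2 => /=; last exact: measurable_snd.
under eq_fun do rewrite -scaleNr -mul_scalar_mx.
by apply: measurableT_comp; [exact: measurable_mulmx|exact: measurable_fst].
Qed.

Lemma cmeas_zs r F : mfam F -> cmeasurable (zs r F).
Proof.
move=> mF; apply: cmeasM; first exact: cmeas_ph.
apply: cmeas_sum => z; apply: cmeasM.
  apply: (cmeas_comp (mF (cl z))).
  by apply: (measurableT_comp (measurable_addv _)); exact: measurable_fst.
exact: (cmeas_comp (cmeas_chr k B z) measurable_snd).
Qed.
Hint Resolve cmeas_zs : core.

Local Notation nu := (mu \x mu)%E.
Local Notation C2 := (cell `*` cell).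
Let mC2 : measurable C2. Proof. exact: measurableX. Qed.
Hint Resolve mC2 : core.

Lemma nsq_unimod d (T : measurableType d) (m : {measure set T -> \bar R}) (D : set T)
  (u f : T -> R[i]) : (forall t, sqnormc (u t) = 1) -> nsq m D (fun t => u t * f t) = nsq m D f.
Proof. by move=> u1; apply: eq_integral => x _; rewrite sqnormcM u1 mul1r. Qed.

(** For fixed [x], up to a phase, the sum is a trigonometric polynomial in [y] with coefficients
    [F (cl z) (x + dl z)]; orthogonality in [y] is then integrated in [x]. *)
Lemma nsq_zs r F : mfam F -> uniq r ->
  nsq nu C2 (zs r F) = (vol%:E * \sum_(z <- r) az F z)%E.
Proof.
move=> mF ur.
have [-> _] := nsq_fubini mu mu mcell mcell (cmeas_zs r mF).
have mz z : measurable_fun cell (fun x => (sqnormc (F (cl z) (x + dl z)))%:E).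
  by apply/measurable_funTS/cmeas_sqnormcE/(cmeas_comp (mF _)); exact: measurable_addv.
transitivity (\int[mu]_(x in cell)
    (vol%:E * \sum_(z <- r) (sqnormc (F (cl z) (x + dl z)))%:E))%E.
  apply: eq_integral => x _; rewrite sumEFin -EFinM -(nsq_tsum k1 Bu)//.
  by rewrite -(@nsq_unimod _ _ mu cell (fun y => ph (x, y)))// => y; exact: sqnormc_ph.
rewrite ge0_integralZl//; last 3 first.
- by apply: emeasurable_sum => z; exact: mz.
- by move=> x _; apply: sume_ge0 => z _; rewrite lee_fin sqnormc_ge0.
- by rewrite lee_fin ltW// (vol_gt0 k1 Bu).
congr (_ * _)%E; rewrite ge0_integral_sum// => z x _.
by rewrite lee_fin sqnormc_ge0.
Qed.

(* The graph of the Zak transform of the family [F], as an L^2 limit of partial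
   sums over the dual lattice. *)
Definition Zr F psi := cmeasurable psi /\
  nsq nu C2 (fun p => zs (boxs N) F p - psi p) @[N --> \oo] --> 0%E.

Lemma zsB r F G p : zs r F p - zs r G p = zs r (fun i x => F i x - G i x) p.
Proof.
rewrite /zs -mulrBr -sumrB; congr (_ * _); apply: eq_bigr => z _; by rewrite mulrBl.
Qed.

Lemma az_le F N : mfam F -> (\sum_(z <- boxs N) az F z <= N1 F)%E.
Proof.
move=> mF; rewrite N1_esum// box_sumE; apply: ereal_sup_ubound => /=.
by exists [set` boxs N] => //; split => //; exact: finite_seq.
Qed.

Lemma nsq_zs_le F N : mfam F -> (nsq nu C2 (zs (boxs N) F) <= vol%:E * N1 F)%E.
Proof.
move=> mF; rewrite nsq_zs ?boxs_uniq// lee_wpmul2l ?lee_fin ?(ltW (vol_gt0 k1 Bu))//.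
exact: az_le.
Qed.

Lemma Zr_N1 F psi : mfam F -> Zr F psi -> (nsq nu C2 psi < +oo)%E ->
  (vol%:E * N1 F = nsq nu C2 psi)%E.
Proof.
move=> mF [mpsi h] fin.
have h1 : nsq nu C2 (zs (boxs N) F) @[N --> \oo] --> nsq nu C2 psi.
  by apply: nsq_cvg => // N; exact: cmeas_zs.
have h2 : (nsq nu C2 (zs (boxs N) F)) @[N --> \oo] --> (vol%:E * N1 F)%E.
  under eq_cvg do rewrite nsq_zs ?boxs_uniq//.
  rewrite N1_esum//; apply: cvgeZl => //; exact/box_cvg/az_ge0.
exact: cvg_unique h2 h1.
Qed.

Lemma ZrB F G psi psi' : mfam F -> mfam G -> Zr F psi -> Zr G psi' ->
  Zr (fun i x => F i x - G i x) (fun p => psi p - psi' p).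
Proof.
move=> mF mG [mp Fp] [mp' Gp]; split; first exact: cmeasB.
have := nsq_cvgD mC2 (-1) (fun N => cmeas_zs (boxs N) mG) (fun N => cmeas_zs (boxs N) mF) mp' mp Gp Fp.
apply: cvg_trans; apply: near_eq_cvg; apply: nearW => N; apply: eq_nsq => p _.
by rewrite -zsB; ring.
Qed.

Lemma Zr_uniq F G psi : mfam F -> mfam G -> Zr F psi -> Zr G psi ->
  forall i, {ae mu, forall x, F i x = G i x}.
Proof.
move=> mF mG Fp Gp i; have := ZrB mF mG Fp Gp.
have mB : mfam (fun i x => F i x - G i x) by move=> i'; exact: cmeasB.
move=> /(Zr_N1 mB).
have -> : nsq nu C2 (fun p => psi p - psi p) = 0%E.
  by rewrite -[RHS](nsq0 nu C2); apply: eq_nsq => p _; rewrite subrr.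
move=> /(_ (ltry _))/eqP; rewrite mule_eq0 eqe gt_eqF ?(vol_gt0 k1 Bu)//=.
rewrite /N1 seq_psume_eq0; last by move=> ? _; exact: nsq_ge0.
move=> /allP/(_ i (mem_index_enum i))/eqP/nsq_sub0 => /(_ measurableT (mF i) (mG i)).
by apply: filterS => x; exact.
Qed.

Lemma Zr_fin F psi : mfam F -> (N1 F < +oo)%E -> Zr F psi -> (nsq nu C2 psi < +oo)%E.
Proof.
move=> mF Ffin [mp h]; apply: (nsq_fin_lim mC2 _ mp _ h) => [N|N]; first exact: cmeas_zs.
apply: le_lt_trans (nsq_zs_le N mF) _; rewrite lte_mul_pinfty ?lee_fin ?(ltW (vol_gt0 k1 Bu))//.
Qed.

Lemma N1B_fin F G : mfam F -> mfam G -> (N1 F < +oo)%E -> (N1 G < +oo)%E ->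
  (N1 (fun i x => (F i x - G i x)%R) < +oo)%E.
Proof.
move=> mF mG; rewrite /N1 => Ff Gf; apply: (@le_lt_trans _ _ (2 * N1 F + 2 * N1 G)%E).
  rewrite /N1 !ge0_sume_distrr; try by move=> *; exact: nsq_ge0.
  by rewrite -big_split; apply: lee_sum => i _; exact: nsqB_le2.
by rewrite lte_add_pinfty// lte_mul_pinfty.
Qed.

(** Partial sums are bounded in norm by [N1] uniformly in [N], so replacing [F] by [Fm m] costs an
    error independent of [N]: [m] is fixed before [N]. *)
Lemma Zr_closed (Fm : nat -> I -> 'cV[R]_n -> R[i]) psim F psi :
  (forall m, mfam (Fm m)) -> mfam F -> cmeasurable psi ->
  (forall m, Zr (Fm m) (psim m)) ->
  N1 (fun i x => Fm m i x - F i x) @[m --> \oo] --> 0%E ->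
  nsq nu C2 (fun p => psim m p - psi p) @[m --> \oo] --> 0%E ->
  Zr F psi.
Proof.
move=> mFm mF mp Zm /cvge0_near h1 /cvge0_near h2; split => //.
apply/cvge0_near; first by move=> N; exact: nsq_ge0.
move=> e e0; have v0 := vol_gt0 k1 Bu.
have mB m : mfam (fun i x => Fm m i x - F i x) by move=> i; exact: (cmeasB (mFm m i) (mF i)).
have e16 : 0 < e / 16 by rewrite divr_gt0.
have h1' := h1 (fun m => N1_ge0 _) (e / 16 / vol) (divr_gt0 e16 v0).
have h2' := h2 (fun m => nsq_ge0 nu C2 _) (e / 16) e16.
have [m [m1 m2]] : exists m, ((N1 (fun i x => Fm m i x - F i x)%R <= (e / 16 / vol)%:E) /\
    (nsq nu C2 (fun p => psim m p - psi p)%R <= (e / 16)%:E))%E.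
  by near \oo => m; exists m; split; near: m.
have [mpm /cvge0_near h3] := Zm m.
have h3' := h3 (fun N => nsq_ge0 nu C2 _) (e / 16) e16.
near=> N.
apply: le_trans (nsq_tri2 nu mC2 (cmeas_zs (boxs N) mF) (cmeas_zs (boxs N) (mFm m)) mp) _.
have a1 : (nsq nu C2 (fun p => zs (boxs N) F p - zs (boxs N) (Fm m) p)%R <= (e / 16)%:E)%E.
  rewrite nsqBC; under eq_nsq => p _ do rewrite zsB.
  apply: le_trans (nsq_zs_le N (mB m)) _.
  rewrite (_ : (e / 16)%:E = (vol%:E * (e / 16 / vol)%:E)%E).
    by apply: lee_wpmul2l; [rewrite lee_fin ltW|exact: m1].
  by rewrite -EFinM; congr EFin; field; rewrite gt_eqF.
have a2 : (nsq nu C2 (fun p => zs (boxs N) (Fm m) p - psi p)%R <= 2%:E * (e / 16)%:E + 2%:E * (e / 16)%:E)%E.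
  apply: le_trans (nsq_tri2 nu mC2 (cmeas_zs (boxs N) (mFm m)) mpm mp) _.
  by rewrite leeD ?lee_wpmul2l//; near: N.
apply: (@le_trans _ _ (2%:E * (e / 16)%:E + 2%:E * (2%:E * (e / 16)%:E + 2%:E * (e / 16)%:E))%E).
  by rewrite leeD ?lee_wpmul2l.
by rewrite -!EFinM -!EFinD lee_fin; lra.
Unshelve. all: by end_near. Qed.

Lemma Zr_lim (Fm : nat -> I -> 'cV[R]_n -> R[i]) psim F psi :
  (forall m, mfam (Fm m)) -> mfam F -> (forall m, (N1 (Fm m) < +oo)%E) ->
  (forall m, Zr (Fm m) (psim m)) -> Zr F psi -> (N1 F < +oo)%E ->
  N1 (fun i x => Fm m i x - F i x) @[m --> \oo] --> 0%E ->
  nsq nu C2 (fun p => psim m p - psi p) @[m --> \oo] --> 0%E.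
Proof.
move=> mFm mF Ffm Zm ZF Ff h.
have E m : nsq nu C2 (fun p => psim m p - psi p) = (vol%:E * N1 (fun i x => Fm m i x - F i x)%R)%E.
  have mB : mfam (fun i x => Fm m i x - F i x) by move=> i; exact: (cmeasB (mFm m i) (mF i)).
  have ZB := ZrB (mFm m) mF (Zm m) ZF.
  by rewrite (Zr_N1 mB ZB)//; apply: (Zr_fin mB _ ZB); exact: N1B_fin.
have vf : vol%:E \is a fin_num by [].
have := cvgeZl vf h; rewrite mule0; apply: cvg_trans.
by apply: near_eq_cvg; apply: nearW => m; rewrite E.
Qed.

(** For families of such functions only finitely many lattice terms are nonzero, uniformly for [x]
    in a bounded set. The series is then a genuine function, whose identities hold everywhere. *)
Definition Cc (f : 'cV[R]_n -> R[i]) :=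
  bmeas f /\ exists M, forall x, f x != 0 -> forall i, `|x i ord0| <= M.

Lemma Cc_mfam F : (forall i, Cc (F i)) -> mfam F.
Proof. by move=> CF i; have [[]] := CF i. Qed.

Lemma dl_bounded M : exists N, forall z, (forall i, `|dl z i ord0| <= M) -> z \in boxs N.
Proof.
have k0 : (k%:R : R) \is a GRing.unit by rewrite unitfE pnatr_eq0 -lt0n.
(* The dual lattice is generated by this matrix, so the bound on cells applies to it at the
   origin. *)
pose D := (k%:R)^-1 *: (invmx B)^T.
have Du : D \in unitmx by rewrite unitmxZ ?unitrV// unitmx_tr unitmx_inv.
have [N NP] := bounded_KN D M; exists N => z zM.
have E : dl z = D *m zv z by rewrite /dl /D -scalemxAl.
have := NP _ zM; rewrite E -[X in KN _ _ X]add0r; move/(KN_lat Du).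
apply => i; rewrite /crd mulmx0 mxE lexx ltr01//.
Qed.

Lemma Cc_supp F A : (forall i, Cc (F i)) -> exists N0, forall x, (forall i, `|x i ord0| <= A) ->
  forall z, z \notin boxs N0 -> F (cl z) (x + dl z) = 0.
Proof.
move=> CF; have [M MP] : exists M, forall i x, F i x != 0 -> forall a, `|x a ord0| <= M.
  have /choice[g gP] : forall i, exists M, forall x, F i x != 0 -> forall a, `|x a ord0| <= M.
    by move=> i; have [_] := CF i.
  exists (\sum_i `|g i|) => i x Fx a; apply: le_trans (gP i x Fx a) _.
  by rewrite (bigD1 i)//= (le_trans (ler_norm _))// lerDl sumr_ge0.
have [N NP] := dl_bounded (M + A); exists N => x xA z; apply: contraNeq => Fz.
apply: NP => i; have := MP _ _ Fz i; have := xA i; rewrite mxE.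
move: (x i ord0) (dl z i ord0) => a b aA abM.
by rewrite (_ : b = a + b - a) ?(le_trans (ler_normB _ _)) ?lerD//; ring.
Qed.

Definition lsum (g : 'cV[int]_n -> R[i]) : R[i] := \sum_(z \in [set: 'cV[int]_n]) g z.

Lemma lsumE g N : (forall z, z \notin boxs N -> g z = 0) -> lsum g = \sum_(z <- boxs N) g z.
Proof.
move=> g0; rewrite fsbig_seq ?boxs_uniq//; apply/esym/fsbig_widen => // z [_ /= /negP]; exact: g0.
Qed.

Lemma lsum_reindex (e : 'cV[int]_n -> 'cV[int]_n) g : bijective e -> lsum g = lsum (g \o e).
Proof.
by move=> eb; rewrite /lsum (reindex_fsbigT e)// -setTT_bijective.
Qed.

Definition zf F p : R[i] := ph p * lsum (fun z => F (cl z) (p.1 + dl z) * chr z p.2).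

Lemma zf_zs F A : (forall i, Cc (F i)) -> exists N0, forall (p : 'cV[R]_n * 'cV[R]_n) N, (forall i, `|p.1 i ord0| <= A) ->
  (N0 <= N)%N -> zf F p = zs (boxs N) F p.
Proof.
move=> CF; have [N0 NP] := Cc_supp A CF; exists N0 => p N pA NN.
congr (_ * _); apply: lsumE => z zN; rewrite NP ?mul0r//.
by apply: contra zN; exact: boxs_sub.
Qed.

Lemma cmeas_zf F : (forall i, Cc (F i)) -> cmeasurable (zf F).
Proof.
move=> CF; have mF := Cc_mfam CF.
have H p : \forall N \near \oo, zs (boxs N) F p = zf F p.
  have [N0 NP] := zf_zs (\sum_i `|p.1 i ord0|) CF; near=> N.
  rewrite (NP p N)//; last by near: N; exact: nbhs_infty_ge.
  by move=> i; rewrite (bigD1 i)//= lerDl sumr_ge0.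
apply: (@cmeas_lim _ _ _ (fun N => zs (boxs N) F)) => [N|p|p]; first exact: cmeas_zs.
  by apply: cvg_near_cst; near=> N; congr Re; near: N; exact: H.
by apply: cvg_near_cst; near=> N; congr Im; near: N; exact: H.
Unshelve. all: by end_near. Qed.

Lemma Zr_zf F : (forall i, Cc (F i)) -> Zr F (zf F).
Proof.
move=> CF; split; first exact: cmeas_zf.
have [M MP] := cellB_bounded Bu; have [N0 NP] := zf_zs M CF.
apply: cvg_near_cst; near=> N.
rewrite -[RHS](nsq0 nu C2); apply: eq_nsq => p [p1 _].
rewrite (NP p N) ?subrr//; first by move=> i; exact: MP.
by near: N; exact: nbhs_infty_ge.
Unshelve. all: by end_near. Qed.

(* The multiplier of the level [k] line bundle. *)
Definition mulk (l1 l2 x y : 'cV[R]_n) : R[i] :=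
  cexpi (pi * ipk k l1 l2) * cexpi (- pi * (ipk k x l2 - ipk k l1 y)).

Lemma sqnormc_mulk (l1 l2 x y : 'cV[R]_n) : sqnormc (mulk l1 l2 x y) = 1.
Proof. by rewrite /mulk sqnormcM !sqnormc_cexpi mulr1. Qed.

(** A shift of [x] by [lat l1] relabels the series by [s l1], which keeps the classes; the remaining
    phases differ by [2 pi] times the integral pairing of the two lattice vectors. *)
Lemma zf_lat F l1 l2 x y :
  zf F (x + lat l1, y + lat l2) = mulk (lat l1) (lat l2) x y * zf F (x, y).
Proof.
rewrite /zf /= (lsum_reindex _ (e := fun z => z - s l1)); last first.
  by exists (fun z => z + s l1) => z; rewrite ?subrK ?addrK.
have -> : lsum ((fun z => F (cl z) (x + lat l1 + dl z) * chr z (y + lat l2)) \o (fun z => z - s l1))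
    = bracket k (lat l1) y * lsum (fun z => F (cl z) (x + dl z) * chr z y).
  rewrite /lsum mulr_fsumr; apply: eq_fsbigr => z _ /=.
  rewrite (chr_lat k1 Bu) -{1}(cl_s (z - s l1) l1) subrK dlB dl_s -addrA [lat l1 + _]addrC subrK.
  by rewrite /chr dlB dl_s opprB bracketD mulrCA mulrC -!mulrA (mulrC (bracket _ _ _)).
rewrite !mulrA; congr (_ * _); rewrite /ph /mulk /bracket -!cexpiD /=.
have m : ipk k (lat l1) (lat l2) \is a Num.int by rewrite -dl_s ipk_dl_lat.
rewrite -[LHS]mulr1 -(cexpi_int m) -!cexpiD; congr cexpi.
by rewrite !(ipkN, ipkZ, ipkD, ipkDr); field.
Qed.

Lemma zf_orth F F' w (wz : 'cV[int]_n -> 'cV[int]_n) x y : w^T *m w = 1%:M -> bijective wz ->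
  (forall z, dl (wz z) = w *m dl z) -> (forall z x, F' (cl (wz z)) (w *m x) = F (cl z) x) ->
  zf F' (w *m x, w *m y) = zf F (x, y).
Proof.
move=> ow bw dw Fw; rewrite /zf /= (lsum_reindex _ bw); congr (_ * _).
  by rewrite /ph /= scalemxAr -mulmxN bracket_orth.
apply: eq_fsbigr => z _ /=.
by rewrite dw -mulmxDr Fw /chr dw -mulmxN bracket_orth.
Qed.
End zak_L2.

(** * The operator S and Poisson summation *)

Section zak_S.
Local Arguments conjc {R} x : simpl never.
Context {R : realType} {n : nat}.
Variables (k : nat) (B : 'M[R]_n).
Hypothesis k1 : (1 <= k)%N.
Hypothesis Bu : B \in unitmx.
Local Notation mu := (@volk R n k).
Local Notation Re := (@complex.Re R).
Local Notation Im := (@complex.Im R).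
Local Notation cell := (cellB B).
Local Notation lat := (lat B).
Local Notation dl := (dl k B).
Local Notation chr := (chr k B).
Local Notation vol := (vol k B).
Implicit Types (x y : 'cV[R]_n) (z l : 'cV[int]_n).
Let mcell : measurable cell. Proof. exact: measurable_cellB. Qed.
Hint Resolve mcell : core.
Let cfin : (mu cell < +oo)%E. Proof. exact: volk_cell_fin. Qed.

Lemma boxs_seq (r : seq 'cV[int]_n) : exists N, {subset r <= boxs N}.
Proof.
elim: r => [|z s [N NP]]; first by exists 0%N => z.
have [M MP] := boxs_mem z; exists (maxn N M) => z'; rewrite inE => /orP[/eqP ->|zs].
  by apply: MP; rewrite leq_maxr.
by apply: boxs_sub (NP _ zs); rewrite leq_maxl.
Qed.

Lemma lsum_seq (g : 'cV[int]_n -> R[i]) r : uniq r -> (forall z, z \notin r -> g z = 0) ->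
  lsum g = \sum_(z <- r) g z.
Proof.
move=> ur g0; rewrite fsbig_seq//; apply/esym/fsbig_widen => // z [_ /= /negP]; exact: g0.
Qed.

(** Unfolding: the translates of the cell carry the integral of a periodised function to the whole
    space. The bounded support makes the periodisation a fixed finite sum on the cell. *)
Lemma lsum_tile (K : 'cV[R]_n -> R[i]) : Cc K -> exists N0,
  (forall y, cell y -> lsum (fun l => K (y + lat l)) = \sum_(l <- boxs N0) K (y + lat l)) /\
  cint mu cell (fun y => lsum (fun l => K (y + lat l))) = cint mu setT K.
Proof.
move=> [[mK [M KM]] [A KA]]; have [N0 NP] := bounded_KN B A.
have H y : cell y -> lsum (fun l => K (y + lat l)) = \sum_(l <- boxs N0) K (y + lat l).
  move=> cy; apply: lsumE => l; apply: contraNeq => Kl; apply/(KN_lat Bu N0 l cy).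
  exact/NP/KA.
exists N0; split=> //.
have mi z : cmeasurable (fun x => toC (\1_cell (x - lat z)) : R[i]).
  split=> /=; last exact: measurable_cst.
  by apply: (measurableT_comp (measurable_indic _)) => //; exact: measurable_addv.
have KE x : K x = \sum_(z <- boxs N0) toC (\1_cell (x - lat z)) * K x.
  have [->|Kx] := eqVneq (K x) 0; first by rewrite big1// => z _; rewrite mulr0.
  have /KN_fl xN : KN B N0 x by apply: NP; exact: KA.
  rewrite (bigD1_seq (fl B x))//= ?boxs_uniq// indicE mem_set ?mul1r; last exact: cell_fl.
  rewrite big1 ?addr0// => z zx; rewrite indicE memNset ?mul0r// => /(fl_cell Bu) e.
  by rewrite e eqxx in zx.
have iK z : cintegrable mu setT (fun x => toC (\1_cell x) * K (x + lat z)).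
  apply: (cintegrable_mkcond mu mcell _).1.
  apply: (@cintegrable_bounded _ _ _ mu cell mcell _ M) => //.
  by apply: (cmeas_comp mK); exact: measurable_addv.
have iK' z : cintegrable mu setT (fun x => toC (\1_cell (x - lat z)) * K x).
  have := cintegrable_mpres (mpres_shift k (- lat z)) (iK z).
  by apply: (eq_cintegrable measurableT) => x _ /=; rewrite subrK.
transitivity (\sum_(z <- boxs N0) cint mu cell (fun y => K (y + lat z))).
  rewrite -cint_sum//; last first.
    move=> z; apply: (@cintegrable_bounded _ _ _ mu cell mcell _ M) => //.
    by apply: (cmeas_comp mK); exact: measurable_addv.
  by apply: eq_cint => y; exact: H.
under [RHS]eq_cint => x _ do rewrite KE.
rewrite cint_sum//; apply: eq_bigr => z _; rewrite cint_mkcond.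
rewrite -(cint_mpres (mpres_shift k (- lat z))); last first.
  apply: cmeasM; first by have := mi 0; rewrite (_ : (fun x => _) = fun x => toC (\1_cell x))//; apply/funext => x; rewrite lat0 subr0.
  by apply: (cmeas_comp mK); exact: measurable_addv.
by apply: eq_cint => x _; rewrite subrK.
Qed.

Variables (I : finType) (s : 'cV[int]_n -> 'cV[int]_n) (cl : 'cV[int]_n -> I)
  (rp : I -> 'cV[int]_n).
Hypothesis dl_s : forall l, dl (s l) = lat l.
Hypothesis cl_rp : forall i l, cl (rp i + s l) = i.
Hypothesis rp_cl : forall z, exists l, z = rp (cl z) + s l.
Implicit Types (F G : I -> 'cV[R]_n -> R[i]) (psi : 'cV[R]_n * 'cV[R]_n -> R[i]).

Lemma lsum_split (g : 'cV[int]_n -> R[i]) N : (forall z, z \notin boxs N -> g z = 0) ->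
  lsum g = \sum_i lsum (fun l => g (rp i + s l)).
Proof.
move=> g0; have [lz lzP] := choice rp_cl; have [N' NP] := boxs_seq (map lz (boxs N)).
have si := s_inj Bu dl_s.
have inj i l i' l' : rp i + s l = rp i' + s l' -> i = i' /\ l = l'.
  move=> e; have ii : i = i' by rewrite -(cl_rp i l) e cl_rp.
  by split=> //; move: e; rewrite ii => /addrI/si.
rewrite (@lsum_seq g [seq rp i + s l | i <- index_enum I, l <- boxs N']).
- rewrite big_allpairs_dep; apply: eq_bigr => i _; apply/esym/lsumE => l; apply: contraNeq => gl.
  have zN : rp i + s l \in boxs N by apply: contraNT gl => /g0 ->.
  have [_ ->] := inj _ _ _ _ (lzP (rp i + s l)).
  by apply: NP; apply/mapP; exists (rp i + s l).
- apply: allpairs_uniq; [exact: index_enum_uniq|exact: boxs_uniq|].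
  by move=> [i l] [i' l'] _ _ /= /inj [-> ->].
- move=> z; apply: contraNeq => gz; apply/allpairsP; exists (cl z, lz z) => /=; split.
  + exact: mem_index_enum.
  + by apply: NP; apply/mapP; exists z => //; apply: contraNT gz => /g0 ->.
  + exact: lzP.
Qed.

(** No normalising constant appears: [volk k] gives mass one to the unit cubes of [(.,.)_k], and for
    this measure the kernel is unitary. *)
Definition FT (f : 'cV[R]_n -> R[i]) x : R[i] := cint mu setT (fun y => f y * bracket k x y).
Definition SF F : I -> 'cV[R]_n -> R[i] := fun i x =>
  toC vol^-1 * \sum_i' bracket k (- dl (rp i)) (dl (rp i')) * FT (F i') x.

Lemma measurable_ipk2 d (T : measurableType d) (f g : T -> 'cV[R]_n) :
  measurable_fun setT f -> measurable_fun setT g -> measurable_fun setT (fun t => ipk k (f t) (g t)).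
Proof. by move=> mf mg; apply: measurable_funM => //; exact: measurable_dotv2. Qed.

Lemma cmeas_bracket2 d (T : measurableType d) (f g : T -> 'cV[R]_n) :
  measurable_fun setT f -> measurable_fun setT g -> cmeasurable (fun t => bracket k (f t) (g t)).
Proof. by move=> mf mg; apply: cmeas_cexpi; apply: measurable_funM => //; exact: measurable_ipk2. Qed.

Lemma cmeas_FT f : cmeasurable f -> cmeasurable (FT f).
Proof.
move=> mf; apply: (cmeas_param_cint mu (F := fun p => f p.2 * bracket k p.1 p.2)).
apply: cmeasM; first exact: (cmeas_comp mf measurable_snd).
by apply: cmeas_bracket2; [exact: measurable_fst|exact: measurable_snd].
Qed.

Lemma mfam_SF F : mfam F -> mfam (SF F).
Proof.
move=> mF i; apply: cmeasZ; apply: cmeas_sum => i'; apply: cmeasZ; exact: cmeas_FT.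
Qed.

(** The section moved by [Stilde], without its phase, as a function of [y] for fixed [x]. It is
    periodic for the lattice, and its Fourier coefficients are sampled Fourier transforms. *)
Definition hx F x y : R[i] := lsum (fun z => F (cl z) (y + dl z) * bracket k x (y + dl z)).

Lemma Stilde_zf F x y : Stilde (zf k B cl F) (x, y) = ph k (x, y) * hx F x y.
Proof.
rewrite /Stilde /zf /hx /ph /lsum /= !mulr_fsumr; apply: eq_fsbigr => z _.
rewrite /chr bracketDr !mulrA; rewrite -!mulrA ![in RHS](mulrCA _ (F _ _)) ![in LHS](mulrCA _ (F _ _)).
congr (_ * _); rewrite /bracket -!cexpiD; congr cexpi.
by move: (dl z) => d; rewrite !(ipkN, ipkNr, ipkZ) (ipkC _ y x) (ipkC _ d); field.
Qed.

Lemma Cc_shift f v : Cc f -> Cc (fun x => f (x + v)).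
Proof.
move=> [[mf [M fM]] [A fA]]; split.
  by split; [apply: (cmeas_comp mf); exact: measurable_addv|exists M].
exists (A + \sum_i `|v i ord0|) => x fx i; have := fA _ fx i; rewrite mxE => h.
rewrite -[x i ord0](addrK (v i ord0)) (le_trans (ler_normB _ _))// lerD//.
by rewrite (bigD1 i)//= lerDl sumr_ge0.
Qed.

Lemma Cc_bracket f x : Cc f -> Cc (fun y => f y * bracket k x y).
Proof.
move=> [bf [A fA]]; split.
  by apply: bmeasM => //; split; [exact: cmeas_bracket|exists 1 => y; rewrite sqnormc_bracket].
by exists A => y; rewrite mulf_eq0 negb_or => /andP[/fA].
Qed.

Lemma Cc_int f : Cc f -> cintegrable mu setT f.
Proof.
move=> [[mf [M fM]] [A fA]]; pose D := cube n (- `|A|) (`|A| + 1).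
have mD : measurable D by exact: measurable_cube.
have : cintegrable mu D f.
  apply: (@cintegrable_bounded _ _ _ mu D mD _ M) => //.
  apply: (volk_bounded k (M := `|A| + 1) mD) => x Dx i; have /andP[a b] := Dx i.
  by rewrite ler_norml (le_trans _ a) ?(ltW b)// lerN2 lerDl.
move=> /(cintegrable_mkcond mu mD); apply: (eq_cintegrable measurableT) => x _.
rewrite indicE; case: (boolP (x \in D)) => [|xD]; first by rewrite mul1r.
rewrite mul0r; apply/esym/eqP; apply: contraNT xD => /fA H; rewrite inE => i.
have := H i; rewrite ler_norml => /andP[a b]; have := ler_norm A => c.
by rewrite (le_trans _ a) ?lerN2// (le_lt_trans (le_trans b c)) ?ltrDl.
Qed.

(** Poisson summation: the dual lattice is split into classes, each class unfolds the cell to the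
    whole space, and the characters combine into the kernel at [x + dl z]. *)
Lemma cint_hx F x z : (forall i, Cc (F i)) ->
  cint mu cell (fun y => hx F x y * conjc (chr z y)) =
  \sum_i bracket k (- dl z) (dl (rp i)) * FT (F i) (x + dl z).
Proof.
move=> CF; pose K i u := F i (u + dl (rp i)) * bracket k (x + dl z) (u + dl (rp i)).
have CK i : Cc (K i) := Cc_shift (dl (rp i)) (Cc_bracket (x + dl z) (CF i)).
transitivity (cint mu cell (fun y => \sum_i bracket k (- dl z) (dl (rp i)) *
    lsum (fun l => K i (y + lat l)))).
  apply: eq_cint => y _.
  have [N0 NP] := Cc_supp k1 Bu cl (\sum_i `|y i ord0|) CF.
  rewrite /hx (@lsum_split _ N0); last first.
    move=> z' zN; rewrite NP ?mul0r// => i; by rewrite (bigD1 i)//= lerDl sumr_ge0.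
  rewrite mulr_suml; apply: eq_bigr => i _; rewrite /lsum mulr_fsumr mulr_fsuml.
  apply: eq_fsbigr => l _; rewrite cl_rp dlD dl_s /K conjc_chr /chr dlN opprK.
  have -> : y + lat l + dl (rp i) = y + (dl (rp i) + lat l) by rewrite -addrA (addrC (lat l)).
  rewrite -!mulrA [in RHS]mulrCA; congr (_ * _).
  rewrite bracketD [in RHS]mulrCA; congr (_ * _).
  rewrite !bracketDr (bracket_dl_lat k1 Bu) mulr1.
  by rewrite [RHS]mulrCA -bracketD addNr bracket0 mulr1.
have iK i : cintegrable mu cell (fun y => lsum (fun l => K i (y + lat l))).
  have [N0 [HN _]] := lsum_tile (CK i); have [[mK [M KM]] _] := CK i.
  apply: (eq_cintegrable mcell (f := fun y => \sum_(l <- boxs N0) K i (y + lat l))).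
    by move=> y cy; rewrite HN.
  apply: cintegrable_sum => // l; apply: (@cintegrable_bounded _ _ _ mu cell mcell _ M) => //.
  by apply: (cmeas_comp mK); exact: measurable_addv.
rewrite cint_sum//; last by move=> i; exact: cintegrableZ.
apply: eq_bigr => i _; rewrite cintZ//; congr (_ * _).
have [N0 [_ ->]] := lsum_tile (CK i).
have [[mf _] _] := Cc_bracket (x + dl z) (CF i).
exact: (cint_mpres (mpres_shift k (dl (rp i))) mf).
Qed.

Local Notation nu := (mu \x mu)%E.
Local Notation C2 := (cell `*` cell).
Let mC2 : measurable C2. Proof. exact: measurableX. Qed.
Hint Resolve mC2 : core.

Lemma bmeas_sum (J : Type) (r : seq J) (g : J -> 'cV[R]_n -> R[i]) :
  (forall i, bmeas (g i)) -> bmeas (fun y => \sum_(i <- r) g i y).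
Proof.
move=> bg; elim: r => [|i r IH].
  by split; [under eq_fun do rewrite big_nil; exact: cmeas_cst|
    exists 0 => y; rewrite big_nil sqnormc0].
by under eq_fun do rewrite big_cons; exact: bmeasD.
Qed.

Lemma measurable_oppv2 : measurable_fun setT (fun p : 'cV[R]_n * 'cV[R]_n => (p.2, - p.1)).
Proof.
apply/measurable_fun_pairP; split=> /=; first exact: measurable_snd.
apply: (measurableT_comp _ measurable_fst) => /=.
rewrite (_ : -%R = mulmx (- 1%:M)); first exact: measurable_mulmx.
by apply/funext => v; rewrite mulNmx mul1mx.
Qed.

Lemma cmeas_Stilde psi : cmeasurable psi -> cmeasurable (Stilde psi).
Proof. by move=> mp; exact: (cmeas_comp mp measurable_oppv2). Qed.

(** For fixed [x] the partial sums of the transform of [SF F] are, up to a phase, the Fourier sums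
    of [hx F x]. Parseval gives convergence in [y], and Bessel's inequality a constant bound that
    dominates the errors in [x]. *)
Lemma zak_S F : (forall i, Cc (F i)) -> Zr k B cl (SF F) (Stilde (zf k B cl F)).
Proof.
move=> CF; have mF := Cc_mfam CF; have mS := mfam_SF mF.
have mz := cmeas_zf k1 Bu cl CF.
split; first exact: cmeas_Stilde.
have [M MP] := cellB_bounded Bu; have [N0 NP] := Cc_supp k1 Bu cl M CF.
pose h x y := \sum_(z <- boxs N0) F (cl z) (y + dl z) * bracket k x (y + dl z).
have hE x y : cell y -> hx F x y = h x y.
  by move=> cy; apply: lsumE => z zN; rewrite NP ?mul0r//; exact: MP.
have [M1 M1P] : exists M1, forall i x, sqnormc (F i x) <= M1.
  have /choice[g gP] : forall i, exists M1, forall x, sqnormc (F i x) <= M1.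
    by move=> i; have [[_ ?] _] := CF i.
  exists (\sum_i `|g i|) => i x; apply: le_trans (gP i x) _.
  by rewrite (bigD1 i)//= (le_trans (ler_norm _))// lerDl sumr_ge0.
have bh x : bmeas (h x).
  apply: bmeas_sum => z.
  by have [] := Cc_shift (dl z) (Cc_bracket x (CF (cl z))).
pose M2 := (size (@boxs n N0))%:R * \sum_(z <- @boxs n N0) M1.
have hM x y : sqnormc (h x y) <= M2.
  apply: le_trans (sqnormc_sum_le _ _) _; rewrite ler_wpM2l//; apply: ler_sum => z _.
  by rewrite sqnormcM sqnormc_bracket mulr1.
have cE x z : coef k B (h x) z = SF F (cl z) (x + dl z).
  rewrite /coef /SF; congr (_ * _).
  rewrite -(@eq_cint _ _ _ mu cell (fun y => hx F x y * conjc (chr z y))); last by move=> y cy; rewrite hE.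
  rewrite cint_hx//; apply: eq_bigr => i _; congr (_ * _).
  have [l zE] := rp_cl z; rewrite [in LHS]zE dlD dl_s opprD bracketD -latN.
  by rewrite [X in _ * X]/bracket ipkC -/(bracket _ _ _) (bracket_dl_lat k1 Bu) mulr1.
pose D N x := nsq mu cell (fun y => zs k B cl (boxs N) (SF F) (x, y) - Stilde (zf k B cl F) (x, y)).
have DE N x : D N x = nsq mu cell (fun y => h x y - tsum k B (coef k B (h x)) (boxs N) y).
  rewrite nsqBC -(@nsq_unimod _ _ _ mu cell (fun y => ph k (x, y))); last by move=> y; exact: sqnormc_ph.
  apply: eq_nsq => y cy; rewrite Stilde_zf hE// mulrBr; congr (_ - _).
  by rewrite /zs /tsum; congr (_ * _); apply: eq_bigr => z _; rewrite cE.
have mD N : cmeasurable (fun p => zs k B cl (boxs N) (SF F) p - Stilde (zf k B cl F) p).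
  by apply: cmeasB; [exact: cmeas_zs|exact: cmeas_Stilde].
have E N : nsq nu C2 (fun p => zs k B cl (boxs N) (SF F) p - Stilde (zf k B cl F) p)
    = (\int[mu]_(x in cell) D N x)%E.
  by have [-> _] := nsq_fubini mu mu mcell mcell (mD N).
have mDN N : measurable_fun setT (D N) by have [_ []] := nsq_fubini mu mu mcell mcell (mD N).
have Dle N x : (D N x <= (M2 * vol)%:E)%E.
  rewrite DE; apply: (@le_trans _ _ (nsq mu cell (h x))).
    rewrite (nsq_bessel k1 Bu (bh x) (boxs_uniq N)) leeDl// lee_fin mulr_ge0 ?(ltW (vol_gt0 k1 Bu))//.
    by apply: sumr_ge0 => z _; exact: sqnormc_ge0.
  have [mh _] := bh x; apply: le_trans (ge0_le_integral _ _ _ _ _ _) _; last first.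
  - by rewrite EFinM -(volE k Bu) -integral_cst.
  - by move=> y _; rewrite lee_fin hM.
  - by [].
  - exact/measurable_funTS/cmeas_sqnormcE.
  - by move=> y _; rewrite lee_fin sqnormc_ge0.
  - by [].
under eq_cvg do rewrite E.
have H := @dominated_cvg _ _ R mu cell mcell D (cst 0%E) (cst (M2 * vol)%:E).
have : (\int[mu]_(x in cell) D N x)%E @[N --> \oo] --> (\int[mu]_(x in cell) cst 0%E x)%E.
  apply: H.
  - by move=> N; exact: measurable_funTS.
  - move=> x _; rewrite /cst (_ : D^~ x =
        fun N => nsq mu cell (fun y => h x y - tsum k B (coef k B (h x)) (boxs N) y)).
      exact: (parseval k1 Bu (bh x)).
    by apply/funext => N; exact: DE.
  - by [].
  - apply/integrableP; split; first exact: measurable_cst.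
    by rewrite /cst/= integral_cst// lte_mul_pinfty.
  - by move=> N x _; rewrite gee0_abs ?Dle//; exact: nsq_ge0.
by rewrite integral0.
Qed.

(** [Stilde] swaps the variables and reflects one of them. Fubini handles the swap; the modulus of a
    section being periodic, the reflected cell serves as well as the cell. *)
Lemma nsq_Stilde psi : cmeasurable psi ->
  (forall l1 l2 x y, psi (x + lat l1, y + lat l2) = mulk k (lat l1) (lat l2) x y * psi (x, y)) ->
  nsq nu C2 (Stilde psi) = nsq nu C2 psi.
Proof.
move=> mp pP; pose q x := nsq mu cell (fun y => psi (y, x)).
have mq : measurable_fun setT q.
  have [_ [mq _]] := nsq_fubini mu mu mcell mcell (cmeas_comp mp (@measurable_swap _ _ _ _)).
  exact: mq.
have q0 x : (0 <= q x)%E by exact: nsq_ge0.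
have qP x z : q (x + lat z) = q x.
  apply: eq_integral => y _; have := pP 0 z y x; rewrite lat0 addr0 => ->.
  by rewrite sqnormcM sqnormc_mulk mul1r.
have [-> _] := nsq_fubini mu mu mcell mcell (cmeas_Stilde mp).
have [_ [_ ->]] := nsq_fubini mu mu mcell mcell mp.
rewrite -/q; pose N1v : 'M[R]_n := (- 1)%:M.
have NN : N1v^T *m N1v = 1%:M by rewrite /N1v tr_scalar_mx -scalar_mxM mulrNN mulr1.
have vE x : N1v *m x = - x by rewrite /N1v mul_scalar_mx scaleN1r.
pose D := [set x | cell (- x)].
have mD : measurable D.
  have -> : D = mulmx N1v @^-1` cell by apply/seteqP; split=> x; rewrite /D /= vE.
  by rewrite -[X in measurable X]setTI; apply: measurable_mulmx.
have [M MP] := cellB_bounded Bu; have [N NP] := bounded_KN B M.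
have <- : (\int[mu]_(x in D) q x = \int[mu]_(x in cell) q x)%E.
  apply: (@periodic_domain _ _ k B Bu q D N) => //.
    by move=> x Dx; apply: NP => i; have := MP _ Dx i; rewrite mxE normrN.
  move=> x; exists (fl B (- x)); rewrite /D /= opprD; split; first exact: cell_fl.
  by move=> z'; rewrite opprD => /(fl_cell Bu).
transitivity (\int[mu]_(x in mulmx N1v @^-1` D) q (mulmx N1v x))%E; last first.
  apply: (mpres_ge0_integral (mpres_orth k1 NN) mD) => //; exact: measurable_funTS.
have -> : mulmx N1v @^-1` D = cell by apply/seteqP; split=> x; rewrite /D /= vE opprK.
by apply: eq_integral => x _; rewrite vE.
Qed.
End zak_S.

Lemma cvg_fun_eq {T : topologicalType} (u v : nat -> T) (l : T) :
  (forall m, u m = v m) -> v @ \oo --> l -> u @ \oo --> l.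
Proof. by move=> /funext ->. Qed.

(** * Plancherel's theorem and the Fourier transform on L^2 *)

Section fourier_L2.
Local Arguments conjc {R} x : simpl never.
Context {R : realType} {n : nat}.
Variable k : nat.
Hypothesis k1 : (1 <= k)%N.
Local Notation mu := (@volk R n k).
Local Notation Re := (@complex.Re R).
Local Notation Im := (@complex.Im R).
Local Notation nsqT := (nsq mu setT).
Local Notation FT := (FT k).
Implicit Types (f g : 'cV[R]_n -> R[i]) (x y : 'cV[R]_n).

(** Cutting by the Euclidean norm and by the value of [f] makes truncation commute with orthogonal
    maps, hence with the Weyl group. *)
Definition tdom (m : nat) f : set 'cV[R]_n :=
  [set x | dotv x x <= m%:R /\ sqnormc (f x) <= m%:R].
Definition trunc (m : nat) f x : R[i] := toC (\1_(tdom m f) x) * f x.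

Lemma measurable_tdom m f : cmeasurable f -> measurable (tdom m f).
Proof.
move=> mf; have mle (h : 'cV[R]_n -> R) : measurable_fun setT h -> measurable [set x | h x <= m%:R].
  move=> mh; rewrite (_ : [set x | _] = setT `&` h @^-1` `]-oo, (m%:R : R)]).
    exact: mh.
  by apply/seteqP; split=> x /=; rewrite in_itv //= => -[].
rewrite (_ : tdom m f = [set x | dotv x x <= m%:R] `&` [set x | sqnormc (f x) <= m%:R])//.
apply: measurableI; apply: mle; last exact: cmeas_sqnormc.
by apply: measurable_dotv2; exact: measurable_id.
Qed.

Lemma truncE m f x : trunc m f x = if x \in tdom m f then f x else 0.
Proof. by rewrite /trunc indicE; case: ifP; rewrite ?mul1r ?mul0r. Qed.

Lemma trunc_le m f x : sqnormc (trunc m f x) <= sqnormc (f x).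
Proof. by rewrite truncE; case: ifP => // _; rewrite sqnormc0 sqnormc_ge0. Qed.

Lemma cmeas_trunc m f : cmeasurable f -> cmeasurable (trunc m f).
Proof. by move=> mf; apply: cmeas_indic => //; exact: measurable_tdom. Qed.

Lemma Cc_trunc m f : cmeasurable f -> Cc (trunc m f).
Proof.
move=> mf; split.
  split; first exact: cmeas_trunc.
  exists m%:R => x; rewrite truncE; case: ifP => [|_]; first by rewrite inE => -[].
  by rewrite sqnormc0.
exists (1 + m%:R) => x; rewrite truncE; case: ifP => [|_]; last by rewrite eqxx.
rewrite inE => -[xc _] _ i; have := le_trans (coord_sqr_le x i) xc.
rewrite -real_normK ?num_real//; move: `|_| => r; nra.
Qed.

Lemma trunc_near f x : \forall m \near \oo, trunc m f x = f x.
Proof.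
near=> m.
have mA : dotv x x + sqnormc (f x) <= m%:R by near: m; exact: nbhs_infty_ger.
rewrite truncE; case: ifPn => // /negP []; rewrite inE.
by split; apply: le_trans mA; rewrite ?lerDl ?lerDr ?sqnormc_ge0 ?dotv_ge0.
Unshelve. all: by end_near. Qed.

Lemma trunc_orth m f f' (w : 'M[R]_n) x : w^T *m w = 1%:M ->
  f' (w *m x) = f x -> trunc m f' (w *m x) = trunc m f x.
Proof.
move=> ow e; rewrite !truncE e; suff -> : (w *m x \in tdom m f') = (x \in tdom m f) by [].
by apply/idP/idP; rewrite !inE /tdom /= dotv_orth// e.
Qed.

Lemma trunc_nsq f : L2 k f -> nsqT (fun x => trunc m f x - f x) @[m --> \oo] --> 0%E.
Proof.
move=> [mf ff].
have : (\int[mu]_(x in setT) (sqnormc (trunc m f x - f x))%:E)%E @[m --> \oo] -->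
    (\int[mu]_(x in setT) cst 0%E x)%E.
  apply: (@dominated_cvg _ _ R mu setT measurableT
    (fun m x => (sqnormc (trunc m f x - f x))%:E) _ (fun x => (sqnormc (f x))%:E)) => //.
  - by move=> m; apply/cmeas_sqnormcE/cmeasB => //; exact: cmeas_trunc.
  - move=> x _; apply: cvg_near_cst; near=> m.
    by rewrite (near (trunc_near f x) m)// subrr sqnormc0.
  - apply/integrableP; split; first exact: cmeas_sqnormcE.
    by under eq_integral do rewrite gee0_abs ?lee_fin ?sqnormc_ge0//.
  - move=> m x _; rewrite gee0_abs ?lee_fin ?sqnormc_ge0// truncE; case: ifP => _.
      by rewrite subrr sqnormc0 sqnormc_ge0.
    by rewrite sub0r sqnormcN.
by rewrite integral0.
Unshelve. all: by end_near. Qed.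

Lemma Cc_meas f : Cc f -> cmeasurable f. Proof. by move=> [[]]. Qed.

Lemma Cc_nsq f : Cc f -> (nsqT f < +oo)%E.
Proof.
move=> [[mf [M fM]] [A fA]].
have C : Cc (fun x => toC (sqnormc (f x))).
  split; last by exists A => x; rewrite toC_eq0 sqnormc_eq0 => /fA.
  split; first exact/cmeas_toC/cmeas_sqnormc.
  exists (M ^+ 2) => x; rewrite sqnormc_toC ler_pXn2r// nnegrE ?sqnormc_ge0//.
  exact: le_trans (sqnormc_ge0 (f x)) (fM x).
have [/integrableP[_]] := Cc_int k C.
by under eq_integral => x _ do rewrite gee0_abs ?lee_fin ?sqnormc_ge0//.
Qed.

Lemma Cc_L2 f : Cc f -> L2 k f.
Proof. by move=> Cf; split; [exact: Cc_meas|exact: Cc_nsq]. Qed.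

Lemma Cc_lin c f g : Cc f -> Cc g -> Cc (fun x => c * f x + g x).
Proof.
move=> [bf [A fA]] [bg [A' gA]]; split.
  apply: bmeasD => //; apply: bmeasM => //; split; first exact: cmeas_cst.
  by exists (sqnormc c).
exists (Num.max A A') => x h i; rewrite le_max.
have [f0|/fA ->//] := eqVneq (f x) 0.
by move: h; rewrite f0 mulr0 add0r => /gA ->; rewrite orbT.
Qed.

Lemma FT_lin c f g x : Cc f -> Cc g -> FT (fun x => c * f x + g x) x = c * FT f x + FT g x.
Proof.
move=> Cf Cg; rewrite /FT.
under eq_cint => y _ do rewrite mulrDl -mulrA.
have If := Cc_int k (Cc_bracket k x Cf); have Ig := Cc_int k (Cc_bracket k x Cg).
by rewrite cintD//; [rewrite cintZ|exact: cintegrableZ].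
Qed.

Definition sk : R := Num.sqrt k%:R.
Lemma sk0 : sk != 0. Proof. by rewrite gt_eqF// sqrtr_gt0 ltr0n. Qed.
Hint Resolve sk0 : core.
(** The cubic lattice of side [k^(-1/2)] is its own dual and has covolume one, so the quotient is
    trivial and families over it are single functions. *)
Definition B0 : 'M[R]_n := (sk^-1)%:M.
Lemma B0u : B0 \in unitmx.
Proof. by rewrite unitmxE /B0 det_scalar unitrX// unitrV unitfE. Qed.
Lemma invB0 : invmx B0 = sk%:M. Proof. by rewrite /B0 invmx_scalar invrK. Qed.
Lemma dl_B0 l : dl k B0 l = lat B0 l.
Proof.
rewrite /dl /lat invB0 /B0 tr_scalar_mx !mul_scalar_mx scalerA; congr (_ *: _).
have sk2 : k%:R = sk ^+ 2 by rewrite sqr_sqrtr.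
by rewrite sk2 expr2 invfM -mulrA mulVf// mulr1.
Qed.
Lemma vol_B0 : vol k B0 = 1.
Proof.
apply: EFin_inj; rewrite -(volE k B0u).
have -> : cellB B0 = cube n 0 sk^-1.
  have skp : 0 < sk by rewrite sqrtr_gt0 ltr0n.
  have E x i : (0 <= crd B0 x i ord0 < 1) = (0 <= x i ord0 < sk^-1).
    by rewrite /crd invB0 mul_scalar_mx mxE pmulr_rge0// -[sk^-1]mulr1 ltr_pdivlMl.
  by apply/seteqP; split=> x cx i; have := cx i; rewrite E.
by rewrite volk_cube ?invr_ge0 ?sqrtr_ge0// subr0 mulfV// expr1n.
Qed.

Definition cl0 (z : 'cV[int]_n) := tt.
Definition rp0 (i : unit) : 'cV[int]_n := 0.
Lemma cl_rp0 i l : cl0 (rp0 i + l) = i. Proof. by case: i. Qed.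
Lemma rp_cl0 z : exists l, z = rp0 (cl0 z) + l. Proof. by exists z; rewrite add0r. Qed.
Lemma unitsum (V : nmodType) (F : unit -> V) : \sum_i F i = F tt.
Proof. by rewrite (bigD1 tt)//= big1 ?addr0// => -[]. Qed.

Lemma SF0 f : SF k B0 rp0 (fun=> f) = fun=> FT f.
Proof.
apply/funext => i; apply/funext => x; rewrite /SF unitsum vol_B0 invr1 toC1 mul1r dl0 oppr0.
by rewrite bracket0 mul1r.
Qed.

(** The Zak transform for [B0] is isometric and turns the Fourier transform into [Stilde], which
    preserves the norm of sections. *)
Lemma plancherel_Cc f : Cc f -> nsqT (FT f) = nsqT f.
Proof.
move=> Cf; have CF : forall i : unit, Cc f by [].
have Ff : (N1 k (fun i : unit => f) < +oo)%E by rewrite /N1 unitsum; exact: Cc_nsq.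
have Z1 := Zr_zf k1 B0u cl0 CF.
have Z2 := zak_S k1 B0u dl_B0 cl_rp0 rp_cl0 CF.
have mF : mfam (fun i : unit => f) by move=> i; exact: Cc_meas.
have E : nsq (mu \x mu)%E (cellB B0 `*` cellB B0) (Stilde (zf k B0 cl0 (fun=> f))) =
    nsq (mu \x mu)%E (cellB B0 `*` cellB B0) (zf k B0 cl0 (fun=> f)).
  apply: (nsq_Stilde k1 B0u); first by case: Z1.
  by move=> l1 l2 x y; rewrite (zf_lat k1 B0u dl_B0 cl_rp0 rp_cl0).
have fin := Zr_fin k1 B0u dl_B0 cl_rp0 rp_cl0 mF Ff Z1.
have := Zr_N1 k1 B0u dl_B0 cl_rp0 rp_cl0 mF Z1 fin.
rewrite -E -(Zr_N1 k1 B0u dl_B0 cl_rp0 rp_cl0 (mfam_SF k B0 rp0 mF) Z2) ?E//.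
by rewrite SF0 /N1 !unitsum vol_B0 !mul1e.
Qed.

(** The graph of the extension to L^2, by limits of bounded functions of bounded support. Being a
    relation, it delays the choice of a representative until [FT2]. *)
Definition FTr f g := [/\ cmeasurable f, cmeasurable g & exists fm : nat -> 'cV[R]_n -> R[i],
  [/\ forall m, Cc (fm m), nsqT (fun x => fm m x - f x) @[m --> \oo] --> 0%E &
    nsqT (fun x => FT (fm m) x - g x) @[m --> \oo] --> 0%E]].

Lemma Cc0 : Cc (fun _ : 'cV[R]_n => 0 : R[i]).
Proof.
split; last by exists 0 => x; rewrite eqxx.
by split; [exact: cmeas_cst|exists 0 => y; rewrite sqnormc0].
Qed.

Lemma FTr_lin c f g f' g' : FTr f g -> FTr f' g' ->
  FTr (fun x => c * f x + f' x) (fun x => c * g x + g' x).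
Proof.
move=> [mf mg [fm [Cfm h1 h2]]] [mf' mg' [fm' [Cfm' h1' h2']]].
split; try by apply: cmeasD => //; exact: cmeasZ.
exists (fun m x => c * fm m x + fm' m x); split=> [m||]; first exact: Cc_lin.
  by apply: (nsq_cvgD measurableT c _ _ mf mf' h1 h1') => m; exact: Cc_meas.
under eq_cvg do under eq_nsq do rewrite FT_lin//.
by apply: (nsq_cvgD measurableT c _ _ mg mg' h2 h2') => m; apply/cmeas_FT/Cc_meas.
Qed.

Lemma FTr_nsq f g : FTr f g -> (nsqT f < +oo)%E -> nsqT g = nsqT f.
Proof.
move=> [mf mg [fm [Cfm h1 h2]]] ff.
have mfm m := Cc_meas (Cfm m); have mFfm m := cmeas_FT k (mfm m).
have gf : (nsqT g < +oo)%E.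
  by apply: (nsq_fin_lim measurableT mFfm mg _ h2) => m; rewrite plancherel_Cc// Cc_nsq.
have c1 := nsq_cvg measurableT mfm mf ff h1.
have := nsq_cvg measurableT mFfm mg gf h2.
by under eq_cvg do rewrite plancherel_Cc//; move=> c2; exact: cvg_unique c2 c1.
Qed.

Lemma FTr_L2 f g : FTr f g -> L2 k f /\ L2 k g.
Proof.
move=> H; have [mf mg [fm [Cfm h1 h2]]] := H.
have mfm m := Cc_meas (Cfm m); have mFfm m := cmeas_FT k (mfm m).
split; split => //.
  by apply: (nsq_fin_lim measurableT mfm mf _ h1) => m; exact: Cc_nsq.
by apply: (nsq_fin_lim measurableT mFfm mg _ h2) => m; rewrite plancherel_Cc// Cc_nsq.
Qed.

Lemma FTr_B f g f' g' : FTr f g -> FTr f' g' ->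
  nsqT (fun x => g x - g' x) = nsqT (fun x => f x - f' x).
Proof.
move=> H H'; have H2 := FTr_lin (-1) H' H.
have E (u v : 'cV[R]_n -> R[i]) : (fun x => -1 * u x + v x) = (fun x => v x - u x).
  by apply/funext => x; rewrite mulN1r addrC.
rewrite !E in H2; apply: FTr_nsq => //; by have [[]] := FTr_L2 H2.
Qed.

Lemma FTr_uniq f g f' g' : FTr f g -> FTr f' g' -> aeeq k f f' -> aeeq k g g'.
Proof.
move=> H H' ff'; have := FTr_B H H'.
have [mf mg _] := H; have [mf' mg' _] := H'.
have -> : nsqT (fun x => f x - f' x) = 0%E.
  rewrite -[RHS](nsq0 mu setT).
  apply: (@nsq_ae _ _ _ mu _ measurableT (fun x => f x - f' x) (fun=> 0) (cmeasB mf mf')).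
    exact: cmeas_cst.
  by apply: filterS ff' => x /= -> _; rewrite subrr.
by move=> /(nsq_sub0 measurableT mg mg'); apply: filterS => x; exact.
Qed.

Lemma nsq_subrr f : nsqT (fun x => f x - f x) = 0%E.
Proof. by rewrite -[RHS](nsq0 mu setT); apply: eq_nsq => x _; rewrite subrr. Qed.

Lemma FTr_Cc f : Cc f -> FTr f (FT f).
Proof.
move=> Cf; split; [exact: Cc_meas|exact/cmeas_FT/Cc_meas|exists (fun=> f)]; split=> //.
  by apply: cvg_near_cst; apply: nearW => m; exact: nsq_subrr.
by apply: cvg_near_cst; apply: nearW => m; exact: nsq_subrr.
Qed.

Lemma FTr_exists f : L2 k f -> exists g, FTr f g.
Proof.
move=> Lf; have [mf _] := Lf; have h := trunc_nsq Lf.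
have Cm m : Cc (trunc m f) by exact: Cc_trunc.
have mm m : cmeasurable (trunc m f) := Cc_meas (Cm m).
have mF m := cmeas_FT k (mm m).
have EB m p : nsqT (fun x => FT (trunc m f) x - FT (trunc p f) x) =
    nsqT (fun x => trunc m f x - trunc p f x) := FTr_B (FTr_Cc (Cm m)) (FTr_Cc (Cm p)).
have [|s [_ _ ms hs]] := riesz_fischer measurableT mF (mu := mu).
  move=> e e0; have [N NP] := nsq_cauchy measurableT mm mf h e0.
  by exists N => m p Nm Np; rewrite EB NP.
exists (flim (fun m => FT (trunc (s m) f))); split => //.
by exists (fun m => trunc m f); split.
Qed.

Definition FT2 f : 'cV[R]_n -> R[i] := xget (fun=> 0) [set g | FTr f g].

Lemma FT2P f : L2 k f -> FTr f (FT2 f).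
Proof. by move=> /FTr_exists[g fg]; rewrite /FT2; case: xgetP => [h _ //|/(_ g)/(_ fg)]. Qed.

Lemma FTr_orth f g (w : 'M[R]_n) : w^T *m w = 1%:M -> FTr f g ->
  FTr (fun x => f (w *m x)) (fun x => g (w *m x)).
Proof.
move=> ow [mf mg [fm [Cfm h1 h2]]]; have mw := measurable_mulmx w.
have pw := mpres_orth k1 ow.
split; try exact: cmeas_comp.
have ow' : w *m w^T = 1%:M := mulmx1C ow.
exists (fun m x => fm m (w *m x)); split=> [m||].
- have [[mfm [M fM]] [A fA]] := Cfm m; split.
    by split; [exact: cmeas_comp|exists M].
  exists (\sum_i \sum_l `|w^T i l| * A) => x h i.
  rewrite -[x]mul1mx -ow -mulmxA mxE; apply: le_trans (ler_norm_sum _ _ _) _.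
  rewrite [leRHS](bigD1 i)//= -[leLHS]addr0 lerD//; last first.
    apply: sumr_ge0 => a _; apply: sumr_ge0 => b _; rewrite mulr_ge0//.
    exact: le_trans (fA _ h b).
  by apply: ler_sum => l _; rewrite normrM ler_wpM2l// fA.
- under eq_cvg do rewrite (nsq_mpres measurableT pw (cmeasB (Cc_meas (Cfm _)) mf)).
  exact: h1.
- have E m x : FT (fun x => fm m (w *m x)) x = FT (fm m) (w *m x).
    rewrite /FT -[RHS](cint_mpres pw); last exact: (Cc_meas (Cc_bracket k (w *m x) (Cfm m))).
    by apply: eq_cint => y _; rewrite bracket_orth.
  apply: (cvg_fun_eq _ h2) => m.
  rewrite -(nsq_mpres measurableT pw (cmeasB (cmeas_FT k (Cc_meas (Cfm m))) mg)).
  by apply: eq_nsq => x _; rewrite E.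
Qed.

(** The truncations have transforms converging in L^2 to that of [f] and, by domination, pointwise
    to its integral; Fatou's lemma identifies the two limits. *)
Lemma FTr_L1 f : L2 k f -> cintegrable mu setT f -> FTr f (FT f).
Proof.
move=> Lf If; have [mf _] := Lf; have H := FT2P Lf; have [_ mg _] := H.
have mm m : cmeasurable (trunc m f) := cmeas_trunc m mf.
have E m : nsqT (fun x => FT (trunc m f) x - FT2 f x) = nsqT (fun x => trunc m f x - f x).
  exact: (FTr_B (FTr_Cc (Cc_trunc m mf)) H).
have mF := cmeas_FT k mf.
have L e : 0 < e -> (nsqT (fun x => FT f x - FT2 f x)%R <= e%:E)%E.
  move=> e0; apply: (nsq_fatou measurableT (F := fun m => FT (trunc m f))) => //.
  - by move=> m; exact: cmeas_FT.
  - apply: aeW => x _.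
    have [] := @cint_dominated _ _ _ mu (fun m y => trunc m f y * bracket k x y)
      (fun y => f y * bracket k x y) f.
    + by move=> m; apply: cmeasM => //; exact: cmeas_bracket.
    + by apply: cmeasM => //; exact: cmeas_bracket.
    + by [].
    + by move=> y; near=> m; rewrite (near (trunc_near f y) m).
    + by move=> m y; rewrite sqnormcM sqnormc_bracket mulr1 trunc_le.
    exact: cvg_sqnormcB.
  - have /cvge0_near := trunc_nsq Lf; move=> /(_ (fun m => nsq_ge0 mu setT _) e e0).
    by apply: filterS => m; rewrite E.
split=> //; exists (fun m => trunc m f); split=> [m||]; [exact: Cc_trunc|exact: trunc_nsq|].
apply: (nsq_lim_tri measurableT (G := fun=> FT2 f)) => //.
- by move=> m; exact: cmeas_FT.
- by under eq_cvg do rewrite E; exact: trunc_nsq.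
- apply: cvg_near_cst; near=> m; apply/eqP; rewrite eq_le nsq_ge0 andbT nsqBC.
  by apply/lee_addgt0Pr => e e0; rewrite add0e; exact: L.
Unshelve. all: by end_near. Qed.

Lemma FT2E f g : FTr f g -> aeeq k (FT2 f) g.
Proof. by move=> H; have [Lf _] := FTr_L2 H; apply: (FTr_uniq (FT2P Lf) H); exact: aeW. Qed.
End fourier_L2.

(** * S and T on square integrable families *)

Section zak_L2_ops.
Local Arguments conjc {R} x : simpl never.
Context {R : realType} {n : nat}.
Variables (k : nat) (B : 'M[R]_n).
Hypothesis k1 : (1 <= k)%N.
Hypothesis Bu : B \in unitmx.
Local Notation mu := (@volk R n k).
Local Notation nsqT := (nsq mu setT).
Local Notation cell := (cellB B).
Local Notation lat := (lat B).
Local Notation dl := (dl k B).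
Local Notation chr := (chr k B).
Local Notation vol := (vol k B).
Implicit Types (x y : 'cV[R]_n) (z l : 'cV[int]_n).
Let mcell : measurable cell. Proof. exact: measurable_cellB. Qed.
Hint Resolve mcell : core.
Variables (I : finType) (s : 'cV[int]_n -> 'cV[int]_n) (cl : 'cV[int]_n -> I)
  (rp : I -> 'cV[int]_n).
Hypothesis dl_s : forall l, dl (s l) = lat l.
Hypothesis cl_rp : forall i l, cl (rp i + s l) = i.
Hypothesis rp_cl : forall z, exists l, z = rp (cl z) + s l.
Implicit Types (f g : 'cV[R]_n -> R[i]) (F G : I -> 'cV[R]_n -> R[i]) (psi : 'cV[R]_n * 'cV[R]_n -> R[i]).
Local Notation nu := (mu \x mu)%E.
Local Notation C2 := (cell `*` cell).
Let mC2 : measurable C2. Proof. exact: measurableX. Qed.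
Hint Resolve mC2 : core.
Local Notation Zr := (Zr k B cl).
Local Notation zf := (zf k B cl).

Definition L2fam F := forall i, L2 k (F i).
Lemma L2fam_mfam F : L2fam F -> mfam F. Proof. by move=> LF i; have [] := LF i. Qed.
Hint Resolve L2fam_mfam : core.

Lemma L2fam_N1 F : L2fam F -> (N1 k F < +oo)%E.
Proof. by move=> LF; apply: lte_sum_pinfty => i _; have [] := LF i. Qed.

Definition lat_equiv psi := forall l1 l2 x y,
  psi (x + lat l1, y + lat l2) = mulk k (lat l1) (lat l2) x y * psi (x, y).

Lemma lat_equivB psi psi' : lat_equiv psi -> lat_equiv psi' -> lat_equiv (fun p => psi p - psi' p).
Proof. by move=> e e' l1 l2 x y; rewrite e e' mulrBr. Qed.

Lemma ipk_lat_int l1 l2 : ipk k (lat l1) (lat l2) \is a Num.int.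
Proof. by rewrite -dl_s ipk_dl_lat. Qed.

Lemma Stilde_equiv psi : lat_equiv psi -> lat_equiv (Stilde psi).
Proof.
move=> e l1 l2 x y; rewrite /Stilde /= opprD -latN e; congr (_ * _).
rewrite /mulk -!cexpiD -[LHS]mulr1 -(cexpi_int (ipk_lat_int l1 l2)) -cexpiD; congr cexpi.
by rewrite latN !ipkNr (ipkC _ (lat l2) (lat l1)) (ipkC _ y) (ipkC _ (lat l2) x); ring.
Qed.

Lemma N1_cvg0 (Fm : nat -> I -> 'cV[R]_n -> R[i]) :
  (forall i, nsqT (Fm m i) @[m --> \oo] --> 0%E) -> N1 k (Fm m) @[m --> \oo] --> 0%E.
Proof.
move=> h; apply/(cvge0_near (fun m => N1_ge0 _ _)) => e e0.
pose e' := e / (#|I|.+1)%:R; have e'0 : 0 < e' by rewrite divr_gt0.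
have H i : \forall m \near \oo, (nsqT (Fm m i) <= e'%:E)%E.
  by move: (h i) => /(cvge0_near (fun m => nsq_ge0 mu setT _)) /(_ e' e'0).
have HH : \forall m \near \oo, forall i, (nsqT (Fm m i) <= e'%:E)%E by apply: filter_forall.
apply: filterS HH => m Hm; apply: (@le_trans _ _ (\sum_(i : I) e'%:E)%E).
  by apply: lee_sum => i _.
rewrite sumEFin lee_fin sumr_const -mulr_natr /e' -mulrA ler_piMr ?ltW//.
by rewrite mulrC ltr_pdivrMr// mul1r ltr_nat.
Qed.

Lemma nsq_cvg_sum (J : Type) (r : seq J) (c : J -> R[i]) (Gm : nat -> J -> 'cV[R]_n -> R[i])
  (g : J -> 'cV[R]_n -> R[i]) :
  (forall m j, cmeasurable (Gm m j)) -> (forall j, cmeasurable (g j)) ->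
  (forall j, nsqT (fun x => Gm m j x - g j x) @[m --> \oo] --> 0%E) ->
  nsqT (fun x => \sum_(j <- r) c j * Gm m j x - \sum_(j <- r) c j * g j x) @[m --> \oo] --> 0%E.
Proof.
move=> mG mg h; elim: r => [|j r IH].
  apply: cvg_near_cst; apply: nearW => m; rewrite -[RHS](nsq0 mu setT).
  by apply: eq_nsq => x _; rewrite !big_nil subrr.
have ms (H : J -> 'cV[R]_n -> R[i]) : (forall j, cmeasurable (H j)) ->
    cmeasurable (fun x => \sum_(j <- r) c j * H j x).
  by move=> mH; apply: cmeas_sum => i; exact: cmeasZ.
under eq_cvg do under eq_nsq do rewrite !big_cons.
by apply: (nsq_cvgD measurableT (c j) _ _ (mg j) (ms _ mg) (h j) IH) => m //; exact: ms.
Qed.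

Definition SF2 F i x : R[i] :=
  toC vol^-1 * \sum_i' bracket k (- dl (rp i)) (dl (rp i')) * FT2 k (F i') x.

Lemma L2_lin c f g : L2 k f -> L2 k g -> L2 k (fun x => c * f x + g x).
Proof.
move=> [mf ff] [mg gg]; split; first by apply: cmeasD => //; exact: cmeasZ.
have := nsqD_le2 mu measurableT (cmeasZ c mf) mg; rewrite nsqZ//.
move=> /le_lt_trans; apply; rewrite lte_add_pinfty ?lte_mul_pinfty ?lee_fin ?sqnormc_ge0//.
Qed.

Lemma L2_0 : L2 k (fun _ : 'cV[R]_n => 0).
Proof. by apply: Cc_L2 => //; exact: Cc0. Qed.

Lemma L2_sum (J : Type) (r : seq J) (c : J -> R[i]) (f : J -> 'cV[R]_n -> R[i]) :
  (forall j, L2 k (f j)) -> L2 k (fun x => \sum_(j <- r) c j * f j x).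
Proof.
move=> Lf; elim: r => [|j r IH]; first by under eq_fun do rewrite big_nil; exact: L2_0.
by under eq_fun do rewrite big_cons; exact: L2_lin.
Qed.

Lemma L2_FT2 (f : 'cV[R]_n -> R[i]) : L2 k f -> L2 k (FT2 k f).
Proof. by move=> /(FT2P k1) H; have [] := FTr_L2 k1 H. Qed.

Lemma SF2E F i x : SF2 F i x =
  \sum_i' (toC vol^-1 * bracket k (- dl (rp i)) (dl (rp i'))) * FT2 k (F i') x.
Proof. by rewrite /SF2 mulr_sumr; apply: eq_bigr => i' _; rewrite mulrA. Qed.

Lemma L2fam_SF2 F : L2fam F -> L2fam (SF2 F).
Proof.
move=> LF i; rewrite (_ : SF2 F i = fun x =>
  \sum_i' (toC vol^-1 * bracket k (- dl (rp i)) (dl (rp i'))) * FT2 k (F i') x).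
  by apply: L2_sum => i'; exact: L2_FT2.
by apply/funext => x; exact: SF2E.
Qed.

Lemma zak_S2 F psi : L2fam F -> Zr F psi -> lat_equiv psi -> Zr (SF2 F) (Stilde psi).
Proof.
move=> LF ZF ep; have [mp _] := ZF.
pose Fm m i := trunc m (F i).
have mF i : cmeasurable (F i) by have [] := LF i.
have CFm m i : Cc (Fm m i) by exact: Cc_trunc.
have Z1 m := zak_S k1 Bu dl_s cl_rp rp_cl (CFm m).
have Zm m := Zr_zf k1 Bu cl (CFm m).
have em m : lat_equiv (zf (Fm m)).
  by move=> l1 l2 x y; rewrite (zf_lat k1 Bu dl_s cl_rp rp_cl).
have mm m : mfam (Fm m) by exact: Cc_mfam.
have h1 : N1 k (fun i x => Fm m i x - F i x) @[m --> \oo] --> 0%E.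
  by apply: N1_cvg0 => i; exact: trunc_nsq.
have h2 := Zr_lim k1 Bu dl_s cl_rp rp_cl mm (L2fam_mfam LF) (fun m => L2fam_N1 (fun i => Cc_L2 k (CFm m i))) Zm ZF (L2fam_N1 LF) h1.
apply: (Zr_closed k1 Bu dl_s cl_rp rp_cl (Fm := fun m => SF k B rp (Fm m)) (psim := fun m => Stilde (zf (Fm m)))) => //.
- by move=> m; exact: mfam_SF.
- exact/L2fam_mfam/L2fam_SF2.
- exact: cmeas_Stilde.
- apply: N1_cvg0 => i.
  have E m x : SF k B rp (Fm m) i x =
      \sum_i' (toC vol^-1 * bracket k (- dl (rp i)) (dl (rp i'))) * FT k (Fm m i') x.
    by rewrite /SF mulr_sumr; apply: eq_bigr => i' _; rewrite mulrA.
  apply: (cvg_fun_eq (v := fun m => nsqT (fun x =>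
    \sum_i' (toC vol^-1 * bracket k (- dl (rp i)) (dl (rp i'))) * FT k (Fm m i') x -
    \sum_i' (toC vol^-1 * bracket k (- dl (rp i)) (dl (rp i'))) * FT2 k (F i') x))).
    by move=> m; apply: eq_nsq => x _; rewrite E SF2E.
  apply: nsq_cvg_sum => [m i'|i'|i']; [exact/cmeas_FT/Cc_meas/CFm|by have [] := L2_FT2 (LF i')|].
  under eq_cvg do rewrite (FTr_B k1 (FTr_Cc k (CFm _ i')) (FT2P k1 (LF i'))).
  exact: trunc_nsq.
- have E m : nsq nu C2 (fun p => Stilde (zf (Fm m)) p - Stilde psi p) =
      nsq nu C2 (fun p => zf (Fm m) p - psi p).
    apply: (@nsq_Stilde _ _ k B k1 Bu (fun p => zf (Fm m) p - psi p)).
      by apply: cmeasB => //; exact: cmeas_zf.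
    exact: (lat_equivB (em m) ep).
  by under eq_cvg do rewrite E.
Qed.

Lemma cvg_sum2 (Fm : nat -> I -> 'cV[R]_n -> R[i]) F : (forall m, mfam (Fm m)) -> mfam F ->
  N1 k (fun i x => Fm m i x - F i x) @[m --> \oo] --> 0%E -> forall e, 0 < e ->
  exists N, forall m p, (N <= m)%N -> (N <= p)%N ->
    (N1 k (fun i x => (Fm m i x - Fm p i x)%R) <= e%:E)%E.
Proof.
move=> mFm mF /(cvge0_near (fun m => N1_ge0 _ _)) h e e0.
have [N _ NP] := h (e / 4) (divr_gt0 e0 (ltr0n _ 4)).
exists N => m p Nm Np; apply: (@le_trans _ _ (2%:E * (e / 4)%:E + 2%:E * (e / 4)%:E)%E).
  apply: (@le_trans _ _ (2%:E * N1 k (fun i x => (Fm m i x - F i x)%R) +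
      2%:E * N1 k (fun i x => (Fm p i x - F i x)%R))%E).
    rewrite /N1 !ge0_sume_distrr; try by move=> *; exact: nsq_ge0.
    rewrite -big_split; apply: lee_sum => i _; rewrite [X in (_ <= _ + _ * X)%E]nsqBC.
    exact: (nsq_tri2 mu measurableT (mFm m i) (mF i) (mFm p i)).
  by rewrite leeD// lee_wpmul2l// NP.
by rewrite -!EFinM -!EFinD lee_fin; lra.
Qed.

Lemma flim_mul d (T : measurableType d) (Um : nat -> T -> R[i]) t t' c : sqnormc c = 1 ->
  (forall m, Um m t' = c * Um m t) -> flim Um t' = c * flim Um t.
Proof.
move=> c1 h; have e : fsum Um t' = fsum Um t.
  by apply: eq_eseriesr => m _; rewrite !h -mulrBr sqnormcM c1 mul1r.
rewrite [LHS]/flim e; case: ifP => f1; last by rewrite /flim f1 mulr0.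
have cR := flim_cvg_Re f1; have cI := flim_cvg_Im f1.
apply: complexP; rewrite ?(cReM, cImM) /=; apply: cvg_lim => //.
  apply: (cvg_fun_eq (v := fun m => complex.Re c * complex.Re (Um m t) - complex.Im c * complex.Im (Um m t))).
    by move=> m; rewrite h cReM.
  by apply: cvgB; apply: cvgMr.
apply: (cvg_fun_eq (v := fun m => complex.Re c * complex.Im (Um m t) + complex.Im c * complex.Re (Um m t))).
  by move=> m; rewrite h cImM.
by apply: cvgD; apply: cvgMr.
Qed.

(** The section is the [flim] of a subsequence of the truncated ones, so the multiplier law and the
    invariance hold at every point and not only almost everywhere. *)
Lemma zak_exists F : L2fam F -> exists psi, [/\ Zr F psi, lat_equiv psi &
  forall w (wz : 'cV[int]_n -> 'cV[int]_n), w^T *m w = 1%:M -> bijective wz ->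
    (forall z, dl (wz z) = w *m dl z) -> (forall z x, F (cl (wz z)) (w *m x) = F (cl z) x) ->
    forall x y, psi (w *m x, w *m y) = psi (x, y)].
Proof.
move=> LF; pose Fm m i := trunc m (F i).
have mF i : cmeasurable (F i) by have [] := LF i.
have CFm m i : Cc (Fm m i) by exact: Cc_trunc.
have mm m : mfam (Fm m) by exact: Cc_mfam.
have Zm m := Zr_zf k1 Bu cl (CFm m).
have mz m := cmeas_zf k1 Bu cl (CFm m).
have LFm m : L2fam (Fm m) by move=> i; exact: Cc_L2.
have h1 : N1 k (fun i x => Fm m i x - F i x) @[m --> \oo] --> 0%E.
  by apply: N1_cvg0 => i; exact: trunc_nsq.
have v0 := vol_gt0 k1 Bu.
have [|t [tm _ mt ht]] := riesz_fischer mC2 mz (mu := nu).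
  move=> e e0; have [N NP] := cvg_sum2 mm (L2fam_mfam LF) h1 (divr_gt0 e0 v0).
  exists N => m p Nm Np; have ZB := ZrB (mm m) (mm p) (Zm m) (Zm p).
  have mB : mfam (fun i x => Fm m i x - Fm p i x) by move=> i; exact: (cmeasB (mm m i) (mm p i)).
  have fB := N1B_fin (mm m) (mm p) (L2fam_N1 (LFm m)) (L2fam_N1 (LFm p)).
  rewrite -(Zr_N1 k1 Bu dl_s cl_rp rp_cl mB ZB); last first.
    exact: (Zr_fin k1 Bu dl_s cl_rp rp_cl mB fB ZB).
  rewrite [e in (_ <= e%:E)%E](_ : e = vol * (e / vol)); last by field; rewrite gt_eqF.
  by rewrite EFinM; apply: lee_wpmul2l; [rewrite lee_fin ltW|exact: NP].
exists (flim (fun m => zf (Fm (t m)))); split.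
- exact: (Zr_closed k1 Bu dl_s cl_rp rp_cl mm (L2fam_mfam LF) mt Zm h1 ht).
- move=> l1 l2 x y; apply: flim_mul; first exact: sqnormc_mulk.
  by move=> m; rewrite (zf_lat k1 Bu dl_s cl_rp rp_cl).
- move=> w wz ow bw dw Fw x y; rewrite -[RHS]mul1r; apply: flim_mul; first exact: sqnormc1.
  move=> m; rewrite mul1r; apply: (zf_orth x y ow bw dw) => z x'.
  by apply: trunc_orth => //; exact: Fw.
Qed.

Lemma Zr_ae F F' psi : mfam F -> mfam F' -> (forall i, aeeq k (F i) (F' i)) -> Zr F psi -> Zr F' psi.
Proof.
move=> mF mF' FF Z; have [mp _] := Z.
apply: (Zr_closed k1 Bu dl_s cl_rp rp_cl (Fm := fun=> F) (psim := fun=> psi)) => //.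
  apply: N1_cvg0 => i; apply: cvg_near_cst; apply: nearW => m.
  rewrite -[RHS](nsq0 mu setT); apply: (nsq_ae measurableT (cmeasB (mF i) (mF' i))).
    exact: cmeas_cst.
  by apply: filterS (FF i) => x /= -> _; rewrite subrr.
by apply: cvg_near_cst; apply: nearW => m; rewrite -[RHS](nsq0 nu C2);
   apply: eq_nsq => p _; rewrite subrr.
Qed.

(** [Stilde] applied twice sends [(x, y)] to [(-x, -y)]; by [zf_orth] for the matrix [-1] the result
    is again a Zak transform, and uniqueness concludes. *)
Lemma zak_refl F : (forall i, Cc (F i)) ->
  forall i, aeeq k (SF2 (SF2 F) i) (fun x => F (cl (- rp i)) (- x)).
Proof.
move=> CF i; pose F' i x := F (cl (- rp i)) (- x).
have LF : L2fam F by move=> i'; exact: Cc_L2.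
have Nw : ((-1)%:M : 'M[R]_n)^T *m (-1)%:M = 1%:M.
  by rewrite tr_scalar_mx -scalar_mxM mulrNN mulr1.
have vE x : (-1)%:M *m x = - x by rewrite mul_scalar_mx scaleN1r.
have CF' i' : Cc (F' i').
  have [[mf [M fM]] [A fA]] := CF (cl (- rp i')); split.
    split; last by exists M => y; exact: fM.
    rewrite /F'; under eq_fun do rewrite -vE; apply: (cmeas_comp mf).
    exact: measurable_mulmx.
  by exists A => x /fA H a; have := H a; rewrite mxE normrN.
have e1 : lat_equiv (zf F) by move=> l1 l2 x y; rewrite (zf_lat k1 Bu dl_s cl_rp rp_cl).
have Z2 := zak_S2 (L2fam_SF2 LF) (zak_S2 LF (Zr_zf k1 Bu cl CF) e1) (Stilde_equiv e1).
have E : Stilde (Stilde (zf F)) = zf F'.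
  apply/funext => -[x y]; rewrite /Stilde /=.
  rewrite -(@zf_orth _ _ k B I cl F F' (-1)%:M -%R (-x) (-y) Nw); last 3 first.
  - by exists -%R; exact: opprK.
  - by move=> z; rewrite vE dlN.
  - move=> z x'; rewrite /F' vE opprK; congr (F _ _).
    have [l zl] := rp_cl (- z).
    have -> : - rp (cl (- z)) = z + s l by apply: (addIr (- s l)); rewrite addrK -opprD -zl opprK.
    exact: (cl_s k1 Bu dl_s cl_rp rp_cl).
  by rewrite !vE !opprK.
rewrite E in Z2.
exact: (Zr_uniq k1 Bu dl_s cl_rp rp_cl (L2fam_mfam (L2fam_SF2 (L2fam_SF2 LF))) (Cc_mfam CF') Z2 (Zr_zf k1 Bu cl CF')).
Qed.

Lemma lat_equiv_y psi : lat_equiv psi -> forall l x y,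
  psi (x, y + lat l) = cexpi (- pi * ipk k x (lat l)) * psi (x, y).
Proof.
move=> e l x y; have := e 0 l x y; rewrite lat0 addr0 => ->; congr (_ * _).
by rewrite /mulk !ipk0 mulr0 cexpi0 mul1r subr0.
Qed.

Lemma zs_y r F l x y :
  zs k B cl r F (x, y + lat l) = cexpi (- pi * ipk k x (lat l)) * zs k B cl r F (x, y).
Proof.
rewrite /zs /= mulrA; congr (_ * _).
  by rewrite /ph /bracket -cexpiD; congr cexpi; rewrite /= !ipkN !ipkZ ipkDr; field.
by apply: eq_bigr => z _; rewrite (chr_lat k1 Bu).
Qed.

Lemma measurable_addsnd : measurable_fun setT (fun p : 'cV[R]_n * 'cV[R]_n => (p.1, p.1 + p.2)).
Proof.
by apply/measurable_fun_pairP; split=> /=; [exact: measurable_fst|exact: measurable_addv2].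
Qed.

Lemma cmeas_Ttilde psi : cmeasurable psi -> cmeasurable (Ttilde psi).
Proof. by move=> mp; exact: (cmeas_comp mp measurable_addsnd). Qed.

(** For fixed [x] the operator translates [y] by [x], and the modulus of the section is periodic in
    [y]. *)
Lemma nsq_Ttilde psi : cmeasurable psi ->
  (forall l x y, psi (x, y + lat l) = cexpi (- pi * ipk k x (lat l)) * psi (x, y)) ->
  nsq nu C2 (Ttilde psi) = nsq nu C2 psi.
Proof.
move=> mp e; have [-> _] := nsq_fubini mu mu mcell mcell (cmeas_Ttilde mp).
have [-> _] := nsq_fubini mu mu mcell mcell mp.
apply: eq_integral => x _.
transitivity (\int[mu]_(y in cell) (sqnormc (psi (x, (y + x)%R)))%:E)%E.
  by apply: eq_integral => y _; rewrite /Ttilde /= addrC.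
apply: (periodic_shift k Bu (h := fun y => (sqnormc (psi (x, y)))%:E)) => //.
- by apply/cmeas_sqnormcE/(cmeas_comp mp); exact: measurable_pair1.
- by move=> y; rewrite lee_fin sqnormc_ge0.
- by move=> y z; rewrite e sqnormcM sqnormc_cexpi mul1r.
Qed.

Hypothesis lat_even : forall l, exists m : int, ipk k (lat l) (lat l) = 2 * m%:~R.

Definition qz z : R[i] := cexpi (pi * ipk k (dl z) (dl z)).

(** Evenness of the lattice makes the quadratic term a multiple of [2 pi]; for the cross term
    integrality is enough. *)
Lemma qz_s z l : qz (z + s l) = qz z.
Proof.
have [m mE] := lat_even l; have /intrP[a aE] := ipk_dl_lat k1 Bu z l.
rewrite /qz dlD dl_s ipkD !ipkDr mE (ipkC _ (lat l)) aE.
rewrite -[RHS]mulr1 -(@cexpi_int _ (a + m)%:~R) ?intr_int// -cexpiD; congr cexpi.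
by rewrite intrD; ring.
Qed.

Lemma qz_cl z : qz (rp (cl z)) = qz z.
Proof. by have [l {2}->] := rp_cl z; rewrite qz_s. Qed.

Definition Mo (f : 'cV[R]_n -> R[i]) x := cexpi (- pi * ipk k x x) * f x.
Definition TF F i x : R[i] := qz (rp i) * Mo (F i) x.

Lemma cmeas_gauss : cmeasurable (fun x : 'cV[R]_n => cexpi (- pi * ipk k x x)).
Proof.
by apply: cmeas_cexpi; apply: measurable_funM => //; apply: measurable_ipk2; exact: measurable_id.
Qed.

Lemma nsq_Mo f : nsqT (Mo f) = nsqT f.
Proof. by apply: (@nsq_unimod _ _ _ mu setT (fun x => cexpi (- pi * ipk k x x)) f) => x; exact: sqnormc_cexpi. Qed.

Lemma L2_Mo f : L2 k f -> L2 k (Mo f).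
Proof.
move=> [mf ff]; split; first by apply: cmeasM => //; exact: cmeas_gauss.
by have := nsq_Mo f; rewrite /nsq => ->.
Qed.

Lemma L2_Z c f : L2 k f -> L2 k (fun x => c * f x).
Proof. by move=> Lf; have := L2_lin c Lf L2_0; under eq_fun do rewrite addr0. Qed.

Lemma L2fam_TF F : L2fam F -> L2fam (TF F).
Proof. by move=> LF i; apply: L2_Z; exact: L2_Mo. Qed.

(** When the Gaussian at [x + dl z] is expanded, the square of [dl z] cancels against [qz z], and
    the other two terms are the changes of [ph] and of the character from [y] to [x + y]. *)
Lemma zs_T r F p : zs k B cl r (TF F) p = Ttilde (zs k B cl r F) p.
Proof.
case: p => x y; rewrite /Ttilde /zs /= !mulr_sumr; apply: eq_bigr => z _.
rewrite /TF /Mo qz_cl -!mulrA ![in LHS](mulrCA _ (F _ _)) ![in RHS](mulrCA _ (F _ _)).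
congr (_ * _); rewrite /ph /qz /chr /bracket -!cexpiD /=; congr cexpi.
move: (dl z) => d; rewrite !(ipkN, ipkZ, ipkD, ipkDr) (ipkC _ d x); by field.
Qed.

(** The multiplier changes by the phase [pi (l1, l1)_k], a multiple of [2 pi] since the lattice is
    even. *)
Lemma Ttilde_equiv psi : lat_equiv psi -> lat_equiv (Ttilde psi).
Proof.
move=> e l1 l2 x y; have [m mE] := lat_even l1; rewrite /Ttilde /=.
have -> : x + lat l1 + (y + lat l2) = x + y + lat (l1 + l2) by rewrite latD addrACA.
rewrite e; congr (_ * _); rewrite /mulk -!cexpiD -[RHS]mulr1.
rewrite -(@cexpi_int _ m%:~R) ?intr_int// -cexpiD; congr cexpi.
by rewrite latD !ipkDr mE (ipkC _ (lat l1) x); ring.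
Qed.

Lemma zak_T F psi : mfam F -> Zr F psi -> lat_equiv psi -> Zr (TF F) (Ttilde psi).
Proof.
move=> mF [mp h] e; split; first exact: cmeas_Ttilde.
apply: (cvg_fun_eq _ h) => N.
rewrite -(@nsq_Ttilde (fun p => zs k B cl (boxs N) F p - psi p)).
- by apply: eq_nsq => p _; rewrite zs_T.
- by apply: cmeasB => //; exact: cmeas_zs.
- by move=> l x y; rewrite zs_y (lat_equiv_y e) mulrBr.
Qed.
End zak_L2_ops.

(** * Relations between the Fourier transform, the Gaussian and Gauss sums *)

Section ae_eq.
Context {R : realType} {n : nat}.
Variable k : nat.
Implicit Types (f g h : 'cV[R]_n -> R[i]).
Lemma aeeq_refl f : aeeq k f f. Proof. exact: aeW. Qed.
Lemma aeeq_sym f g : aeeq k f g -> aeeq k g f.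
Proof. by apply: filterS => x ->. Qed.
Lemma aeeq_trans g f h : aeeq k f g -> aeeq k g h -> aeeq k f h.
Proof. by apply: filterS2 => x -> ->. Qed.
Lemma aeeq_Z c f g : aeeq k f g -> aeeq k (fun x => c * f x) (fun x => c * g x).
Proof. by apply: filterS => x ->. Qed.
Lemma aeeq_sum (J : Type) (r : seq J) (c : J -> R[i]) (F G : J -> 'cV[R]_n -> R[i]) :
  (forall j, aeeq k (F j) (G j)) ->
  aeeq k (fun x => \sum_(j <- r) c j * F j x) (fun x => \sum_(j <- r) c j * G j x).
Proof.
move=> h; elim: r => [|j r IH]; first by apply: aeW => x; rewrite !big_nil.
by apply: filterS2 (h j) IH => x e1 e2; rewrite !big_cons e1 e2.
Qed.
End ae_eq.

Section fourier_relations.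
Local Arguments conjc {R} x : simpl never.
Context {R : realType} {n : nat}.
Variable k : nat.
Hypothesis k1 : (1 <= k)%N.
Local Notation mu := (@volk R n k).
Local Notation nsqT := (nsq mu setT).
Local Notation FT2 := (FT2 k).
Local Notation Mo := (Mo k).
Implicit Types (f g : 'cV[R]_n -> R[i]) (x y : 'cV[R]_n).

Lemma FT2_ae f g : L2 k f -> L2 k g -> aeeq k f g -> aeeq k (FT2 f) (FT2 g).
Proof. by move=> Lf Lg; exact: (FTr_uniq k1 (FT2P k1 Lf) (FT2P k1 Lg)). Qed.

Lemma FT2_lin c f g : L2 k f -> L2 k g ->
  aeeq k (FT2 (fun x => c * f x + g x)) (fun x => c * FT2 f x + FT2 g x).
Proof. by move=> Lf Lg; apply: (FT2E k1); exact: (FTr_lin c (FT2P k1 Lf) (FT2P k1 Lg)). Qed.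

Lemma FTr0 : FTr k (fun _ : 'cV[R]_n => 0) (fun=> 0).
Proof.
have H := FTr_Cc k (@Cc0 R n); rewrite (_ : FT k (fun=> 0) = fun=> 0) // in H.
apply/funext => x; rewrite /FT; under eq_cint => y _ do rewrite mul0r.
exact: cint0.
Qed.

Lemma FTr_Z c f g : FTr k f g -> FTr k (fun x => c * f x) (fun x => c * g x).
Proof.
by move=> H; have := FTr_lin c H FTr0; congr FTr; apply/funext => x; rewrite addr0.
Qed.

Lemma FT2_Z c f : L2 k f -> aeeq k (FT2 (fun x => c * f x)) (fun x => c * FT2 f x).
Proof. by move=> Lf; apply: (FT2E k1); exact: (FTr_Z c (FT2P k1 Lf)). Qed.

Lemma FTr_sum (J : Type) (r : seq J) (c : J -> R[i]) (F G : J -> 'cV[R]_n -> R[i]) :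
  (forall j, FTr k (F j) (G j)) ->
  FTr k (fun x => \sum_(j <- r) c j * F j x) (fun x => \sum_(j <- r) c j * G j x).
Proof.
move=> H; elim: r => [|j r IH].
  by have := FTr0; congr FTr; apply/funext => x; rewrite big_nil.
by have := FTr_lin (c j) (H j) IH; congr FTr; apply/funext => x; rewrite big_cons.
Qed.

Lemma FT2_sum (J : Type) (r : seq J) (c : J -> R[i]) (F : J -> 'cV[R]_n -> R[i]) :
  (forall j, L2 k (F j)) ->
  aeeq k (FT2 (fun x => \sum_(j <- r) c j * F j x)) (fun x => \sum_(j <- r) c j * FT2 (F j) x).
Proof. by move=> LF; apply: (FT2E k1); apply: FTr_sum => j; exact: FT2P. Qed.

Lemma FT2_nsq f : L2 k f -> nsqT (FT2 f) = nsqT f.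
Proof. by move=> Lf; apply: (FTr_nsq k1 (FT2P k1 Lf)); case: Lf. Qed.

Lemma SF2_cube f : SF2 k (B0 k) rp0 (fun=> f) = fun=> FT2 f.
Proof.
apply/funext => i; apply/funext => x; rewrite /SF2 unitsum vol_B0// invr1 toC1 mul1r.
by rewrite /rp0 dl0 oppr0 bracket0 mul1r.
Qed.

Lemma FT2_refl_Cc f : Cc f -> aeeq k (FT2 (FT2 f)) (fun x => f (- x)).
Proof.
move=> Cf.
have := @zak_refl _ _ k (B0 k) k1 (B0u k1) _ id cl0 rp0 (dl_B0 k1) cl_rp0 rp_cl0 (fun=> f) (fun=> Cf) tt.
by rewrite !SF2_cube.
Qed.

Lemma mpres_opp : mpres mu (fun x => - x).
Proof.
have Nw : ((-1)%:M : 'M[R]_n)^T *m (-1)%:M = 1%:M.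
  by rewrite tr_scalar_mx -scalar_mxM mulrNN mulr1.
have := mpres_orth k1 Nw; congr mpres; apply/funext => x.
by rewrite mul_scalar_mx scaleN1r.
Qed.

Lemma nsq_opp f : cmeasurable f -> nsqT (fun x => f (- x)) = nsqT f.
Proof. by move=> mf; exact: (nsq_mpres measurableT mpres_opp mf). Qed.

Lemma FT2_refl f : L2 k f -> aeeq k (FT2 (FT2 f)) (fun x => f (- x)).
Proof.
move=> Lf; have [mf _] := Lf.
have Cm m : Cc (trunc m f) by exact: Cc_trunc.
have Lm m := Cc_L2 k (Cm m).
have mo g : cmeasurable g -> cmeasurable (fun x => g (- x)).
  by move=> mg; apply: (cmeas_comp mg); exact: (mpres_opp).1.
have mm m : cmeasurable (trunc m f) := Cc_meas (Cm m).
have [mFF _] := L2_FT2 k1 (L2_FT2 k1 Lf).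
have h := trunc_nsq Lf.
apply: (@filterS _ _ _ [set x | setT x -> FT2 (FT2 f) x = f (- x)]); first by move=> x; exact.
apply: (nsq_lim_unique measurableT (F := fun m x => trunc m f (- x))) => //.
- by move=> m; exact: mo.
- exact: mo.
- apply: (cvg_fun_eq _ h) => m.
  apply: etrans (FTr_B k1 (FT2P k1 (Lm m)) (FT2P k1 Lf)).
  apply: etrans (FTr_B k1 (FT2P k1 (L2_FT2 k1 (Lm m))) (FT2P k1 (L2_FT2 k1 Lf))).
  have [mFm _] := L2_FT2 k1 (L2_FT2 k1 (Lm m)).
  apply: (nsq_ae measurableT (cmeasB (mo _ (mm m)) mFF) (cmeasB mFm mFF)).
  by apply: filterS (FT2_refl_Cc (Cm m)) => x /= -> _.
- apply: (cvg_fun_eq _ h) => m; exact: (nsq_opp (cmeasB (mm m) mf)).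
Qed.

Lemma FT2_four f : L2 k f -> aeeq k (FT2 (FT2 (FT2 (FT2 f)))) f.
Proof.
move=> Lf; have LF := L2_FT2 k1 (L2_FT2 k1 Lf); have h := FT2_refl Lf.
apply: aeeq_trans (FT2_refl LF) _.
have [N [mN N0 Nsub]] := h; exists ((fun x => - x) @^-1` N); split.
- by rewrite -[X in measurable X]setTI; apply: (mpres_opp).1.
- by have [_ ->] := mpres_opp.
- move=> x /= Hx; apply: Nsub => /= e; apply: Hx; rewrite e opprK//.
Qed.

Lemma test_function : exists f, Cc f /\ nsqT f != 0%E.
Proof.
exists (fun x => toC (\1_(cube n 0 1) x)); have mc := @measurable_cube R n 0 1.
have E x : sqnormc (toC (\1_(cube n 0 1) x : R)) = \1_(cube n 0 1) x.
  by rewrite sqnormc_toC indicE; case: (x \in _); rewrite ?expr1n// expr0n.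
split.
  split; last first.
    exists 1 => x; rewrite indicE; case: (boolP (x \in _)) => [|_]; last by rewrite toC0 eqxx.
    by rewrite inE => xc _ i; have /andP[a b] := xc i; rewrite ger0_norm// ltW.
  split; first by apply: cmeas_toC; exact: measurable_indic.
  by exists 1 => y; rewrite E indicE; case: (_ \in _).
rewrite /nsq; under eq_integral do rewrite E.
have -> : (\int[mu]_x (\1_(cube n 0 1) x : R)%:E = ((Num.sqrt k%:R * (1 - 0)) ^+ n)%:E)%E.
  by rewrite integral_indic// setIT; exact: volk_cube.
rewrite subr0 mulr1 eqe expf_neq0// gt_eqF//.
by rewrite sqrtr_gt0 ltr0n.
Qed.

Lemma aeeq_coef c c' f : cmeasurable f -> nsqT f != 0%E ->
  aeeq k (fun x => c * f x) (fun x => c' * f x) -> c = c'.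
Proof.
move=> mf f0 h; apply/eqP; apply: contraNT f0 => cc; apply/eqP.
rewrite -[RHS](nsq0 mu setT); apply: (nsq_ae measurableT mf); first exact: cmeas_cst.
apply: filterS h => x /eqP; rewrite -subr_eq0 -mulrBl mulf_eq0 subr_eq0 (negbTE cc) /=.
by move=> /eqP.
Qed.

Lemma Mo_ae f g : aeeq k f g -> aeeq k (Mo f) (Mo g).
Proof. by apply: filterS => x; rewrite /Mo => ->. Qed.

Section lattice.
Variable (B : 'M[R]_n).
Hypothesis Bu : B \in unitmx.
Local Notation lat := (lat B).
Local Notation dl := (dl k B).
Local Notation vol := (vol k B).
Implicit Types (z l : 'cV[int]_n).
Variables (I : finType) (s : 'cV[int]_n -> 'cV[int]_n) (cl : 'cV[int]_n -> I)
  (rp : I -> 'cV[int]_n).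
Hypothesis dl_s : forall l, dl (s l) = lat l.
Hypothesis cl_rp : forall i l, cl (rp i + s l) = i.
Hypothesis rp_cl : forall z, exists l, z = rp (cl z) + s l.
Implicit Types (F G : I -> 'cV[R]_n -> R[i]) (a : I -> R[i]).
Local Notation Zr := (Zr k B cl).
Local Notation SF2 := (SF2 k B rp).
Local Notation TF := (TF k B rp).

Definition feq F G := forall i, aeeq k (F i) (G i).
Lemma feq_trans G F H : feq F G -> feq G H -> feq F H.
Proof. by move=> h1 h2 i; exact: aeeq_trans (h1 i) (h2 i). Qed.
Lemma feq_sym F G : feq F G -> feq G F.
Proof. by move=> h i; exact: aeeq_sym. Qed.

Lemma SF2_ae F G : L2fam k F -> L2fam k G -> feq F G -> feq (SF2 F) (SF2 G).
Proof.
move=> LF LG h i; have := aeeq_sum (index_enum I)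
  (fun i' => toC vol^-1 * bracket k (- dl (rp i)) (dl (rp i')))
  (fun i' => FT2_ae (LF i') (LG i') (h i')).
by apply: filterS => x; rewrite !SF2E.
Qed.

Lemma TF_ae F G : feq F G -> feq (TF F) (TF G).
Proof. by move=> h i; apply: aeeq_Z; apply: Mo_ae; exact: h. Qed.

Definition tens1 a f : I -> 'cV[R]_n -> R[i] := fun i x => a i * f x.
Definition vN a i := toC vol^-1 * \sum_i' bracket k (- dl (rp i)) (dl (rp i')) * a i'.
Definition qv a i := qz k B (rp i) * a i.

Lemma L2fam_tens1 a f : L2 k f -> L2fam k (tens1 a f).
Proof. by move=> Lf i; exact: L2_Z. Qed.

Lemma SF2_tens a f : L2 k f -> feq (SF2 (tens1 a f)) (tens1 (vN a) (FT2 f)).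
Proof.
move=> Lf i; have := aeeq_sum (index_enum I)
  (fun i' => toC vol^-1 * bracket k (- dl (rp i)) (dl (rp i'))) (fun i' => FT2_Z (a i') Lf).
apply: filterS => x; rewrite SF2E /tens1 /vN mulr_sumr mulr_suml => ->.
by apply: eq_bigr => i' _; rewrite !mulrA.
Qed.

Lemma TF_tens a f : TF (tens1 a f) = tens1 (qv a) (Mo f).
Proof.
by apply/funext => i; apply/funext => x; rewrite /TF /tens1 /qv /Mo; ring.
Qed.

(** Fourier inversion on the finite quotient, read off from [zak_refl] on the tensor of [a] with a
    nonzero test function: the factor on the space contributes exactly the reflection, and can be
    cancelled. *)
Lemma vN2 a i : vN (vN a) i = a (cl (- rp i)).
Proof.
have [f [Cf f0]] := test_function; have Lf := Cc_L2 k Cf; have mf := Cc_meas Cf.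
have CF : forall i, Cc (tens1 a f i).
  move=> i'; have := Cc_lin (a i') Cf (@Cc0 R n).
  by congr Cc; apply/funext => x; rewrite addr0.
have LF := L2fam_tens1 a Lf; have LF2 := L2_FT2 k1 Lf.
have h1 := zak_refl k1 Bu dl_s cl_rp rp_cl CF i.
have h2 := SF2_ae (L2fam_SF2 B k1 rp LF) (L2fam_tens1 (vN a) LF2) (SF2_tens a Lf) i.
have h3 := aeeq_trans h2 (SF2_tens (vN a) LF2 i).
have h4 := aeeq_trans (aeeq_trans (aeeq_sym h3) h1) (aeeq_refl _ _).
apply: (@aeeq_coef _ _ (fun x => f (- x))); first by apply: (cmeas_comp mf); exact: (mpres_opp).1.
  by rewrite nsq_opp.
apply: aeeq_trans (aeeq_sym (aeeq_Z _ (FT2_refl Lf))) _; exact: h4.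
Qed.

Lemma sum_shift (phi : 'cV[int]_n -> R[i]) v : (forall z l, phi (z + s l) = phi z) ->
  \sum_i phi (rp i + v) = \sum_i phi (rp i).
Proof.
move=> hp; have hc z : phi (rp (cl z)) = phi z by have [l {2}->] := rp_cl z; rewrite hp.
rewrite [RHS](reindex (fun i => cl (rp i + v))) /=; first by apply: eq_bigr => i _; rewrite hc.
have cls z l : cl (z + s l) = cl z := cl_s k1 Bu dl_s cl_rp rp_cl z l.
have K u i : cl (rp (cl (rp i + u)) - u) = i.
  have [l e] := rp_cl (rp i + u).
  rewrite -(cls _ l) addrAC -e addrK.
  by have := cl_rp i 0; rewrite (_ : s 0 = 0) ?addr0//; apply: (dl_inj k1 Bu); rewrite dl_s lat0 dl0.
exists (fun i => cl (rp i - v)) => i _; first exact: K.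
by rewrite -{2}(K (- v) i) opprK.
Qed.

Hypothesis lat_even : forall l, exists m : int, ipk k (lat l) (lat l) = 2 * m%:~R.

(* The normalised Gauss sum; it is the only obstruction to the braid relation. *)
Definition gamma : R[i] := toC vol^-1 * \sum_i qz k B (rp i).

(** The Gauss sum does not change when its index is shifted by [- (z + z')]; expanding the square in
    the shifted sum separates the variables. *)
Lemma vN_qv_vN a i : vN (qv (vN (qv a))) i = gamma * (qz k B (rp i))^-1 * vN a i.
Proof.
have qs := qz_s k1 Bu dl_s lat_even.
have key (z z' : 'cV[int]_n) : \sum_b bracket k (- dl z) (dl (rp b)) * qz k B (rp b) *
    bracket k (- dl (rp b)) (dl z') =
    (\sum_b qz k B (rp b)) * (qz k B z)^-1 * bracket k (- dl z) (dl z') * (qz k B z')^-1.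
  rewrite -(sum_shift (phi := qz k B) (- (z + z')))// !mulr_suml; apply: eq_bigr => b _.
  rewrite /qz /bracket -!cexpiN -!cexpiD; congr cexpi.
  rewrite dlB dlD; move: (dl (rp b)) (dl z) (dl z') => u v w.
  rewrite !(ipkN, ipkNr, ipkD, ipkDr) (ipkC _ v u) (ipkC _ w u) (ipkC _ w v); ring.
transitivity (toC vol^-1 * toC vol^-1 * \sum_c (\sum_b bracket k (- dl (rp i)) (dl (rp b)) *
    qz k B (rp b) * bracket k (- dl (rp b)) (dl (rp c))) * qv a c).
  rewrite /vN -mulrA; congr (_ * _); rewrite mulr_sumr.
  under [RHS]eq_bigr do rewrite mulr_suml mulr_sumr.
  rewrite exchange_big; apply: eq_bigr => b _; rewrite {1}/qv !mulr_sumr.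
  by apply: eq_bigr => c _; ring.
rewrite /vN !mulr_sumr; apply: eq_bigr => c _; rewrite key /qv /gamma.
have q0 : qz k B (rp c) != 0 by exact: cexpi_neq0.
have q1 : qz k B (rp i) != 0 by exact: cexpi_neq0.
move: (\sum_b _) (qz k B (rp c)) (qz k B (rp i)) q0 q1 => S q r q0 r0.
by field; rewrite ?q0 ?r0.
Qed.

Lemma vN_qv3 a i : vN (qv (vN (qv (vN (qv a))))) i = gamma * vN (vN a) i.
Proof.
rewrite [LHS]/vN [vN (vN a) i]/vN mulrCA; congr (_ * _); rewrite mulr_sumr; apply: eq_bigr => c _.
rewrite [in RHS]mulrCA; congr (_ * _); rewrite [LHS]/qv vN_qv_vN.
have q0 : qz k B (rp c) != 0 by exact: cexpi_neq0.
by move: (qz k B (rp c)) q0 => q q0; field.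
Qed.

(** On sections the relation is an identity between linear substitutions of [(x, y)]; uniqueness of
    the Zak transform brings it back to families. *)
Lemma zak_relation F : L2fam k F -> feq (SF2 (TF (SF2 (TF (SF2 (TF F)))))) (SF2 (SF2 F)).
Proof.
move=> LF; have [psi [Z e _]] := zak_exists k1 Bu dl_s cl_rp rp_cl LF.
have LT G := @L2fam_TF _ _ k B I rp G.
have LS G := @L2fam_SF2 _ _ k B k1 I rp G.
have zS G p := @zak_S2 _ _ k B k1 Bu I s cl rp dl_s cl_rp rp_cl G p.
have zT G p (LG : L2fam k G) := @zak_T _ _ k B k1 Bu I s cl rp dl_s rp_cl lat_even G p (L2fam_mfam LG).
have eS p := @Stilde_equiv _ _ k B k1 Bu _ dl_s p.
have eT p := @Ttilde_equiv _ _ k B lat_even p.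
have L1 := LS _ (LT _ LF); have L2' := LS _ (LT _ L1).
have Z1 := zS _ _ (LT _ LF) (zT _ _ LF Z e) (eT _ e).
have e1 := eS _ (eT _ e).
have Z2 := zS _ _ (LT _ L1) (zT _ _ L1 Z1 e1) (eT _ e1).
have e2 := eS _ (eT _ e1).
have Z3 := zS _ _ (LT _ L2') (zT _ _ L2' Z2 e2) (eT _ e2).
have ZS := zS _ _ (LS _ LF) (zS _ _ LF Z e) (eS _ e).
have E : Stilde (Ttilde (Stilde (Ttilde (Stilde (Ttilde psi))))) = Stilde (Stilde psi).
  apply/funext => -[x y]; rewrite /Stilde /Ttilde /=.
  have h : y - x - y = - x by rewrite addrAC subrr sub0r.
  by rewrite h opprB addrA addNr add0r.
rewrite E in Z3.
have LSS := LS _ (LS _ LF); have L3 := LS _ (LT _ L2').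
exact: (Zr_uniq k1 Bu dl_s cl_rp rp_cl (L2fam_mfam L3) (L2fam_mfam LSS) Z3 ZS).
Qed.

(** Tested on the tensor of [f] with the constant 1: [vN_qv3] produces the factor [gamma], and [vN2]
    returns the constant, so that a single component gives the relation on the space alone. *)
Lemma fourier_relation f : L2 k f ->
  aeeq k (fun x => gamma * FT2 (Mo (FT2 (Mo (FT2 (Mo f))))) x) (FT2 (FT2 f)).
Proof.
move=> Lf; pose a (i : I) : R[i] := 1; pose i := cl 0.
have LM g : L2 k g -> L2 k (Mo g) := @L2_Mo _ _ k g.
have LF g : L2 k g -> L2 k (FT2 g) := @L2_FT2 _ _ k k1 g.
have LS G := @L2fam_SF2 _ _ k B k1 I rp G.
have LT G := @L2fam_TF _ _ k B I rp G.
have LA b g (Lg : L2 k g) := L2fam_tens1 b Lg.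
have step b g : L2 k g -> feq (SF2 (TF (tens1 b g))) (tens1 (vN (qv b)) (FT2 (Mo g))).
  by move=> Lg; rewrite TF_tens; exact/SF2_tens/LM.
have ST F G : L2fam k F -> L2fam k G -> feq F G -> feq (SF2 (TF F)) (SF2 (TF G)).
  by move=> L1 L2 e; apply: SF2_ae; [exact: LT|exact: LT|exact: TF_ae].
have L1 := LF _ (LM _ Lf); have L2' := LF _ (LM _ L1).
have h1 := step a f Lf.
have h2 := feq_trans (ST _ _ (LS _ (LT _ (LA a f Lf))) (LA _ _ L1) h1) (step _ _ L1).
have h3 := feq_trans (ST _ _ (LS _ (LT _ (LS _ (LT _ (LA a f Lf))))) (LA _ _ L2') h2) (step _ _ L2').
have g1 := SF2_tens a Lf.
have g2 := feq_trans (SF2_ae (LS _ (LA a f Lf)) (LA _ _ (LF _ Lf)) g1) (SF2_tens _ (LF _ Lf)).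
have h4 := feq_trans (feq_trans (feq_sym h3) (zak_relation (LA a f Lf))) g2.
have := h4 i; apply: filterS => x; rewrite /tens1 vN_qv3 vN2 /a mul1r mulr1.
by [].
Qed.
End lattice.

(* The lattice [sqrt (2 / k) Z^n] is even, and its Gauss sum is a product of
   one-dimensional ones, equal to [1 + i]. *)
Let b1 : R := Num.sqrt (2 / k%:R).
Let b10 : 0 < b1. Proof. by rewrite sqrtr_gt0 divr_gt0// ltr0n. Qed.
Let kb1 : k%:R * b1 ^+ 2 = 2.
Proof. by rewrite sqr_sqrtr ?divr_ge0// mulrCA mulfV ?mulr1// pnatr_eq0 -lt0n. Qed.
Let B1 : 'M[R]_n := b1%:M.
Let B1u : B1 \in unitmx.
Proof. by rewrite unitmxE det_scalar unitrX// unitfE gt_eqF. Qed.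
Let invB1 : invmx B1 = b1^-1%:M. Proof. exact: invmx_scalar. Qed.
Let dlB1 z : dl k B1 z = (b1 / 2) *: zv z.
Proof.
rewrite /dl invB1 tr_scalar_mx mul_scalar_mx scalerA -kb1; congr (_ *: _).
by field; rewrite gt_eqF//= pnatr_eq0 -lt0n.
Qed.
Let latB1 z : lat B1 z = b1 *: zv z. Proof. by rewrite /lat mul_scalar_mx. Qed.
Let s1 (z : 'cV[int]_n) := z + z.
(** The lattice is twice its dual, so classes are vectors of parities. *)
Let cl1 (z : 'cV[int]_n) : {ffun 'I_n -> bool} := [ffun i => ((z i ord0 %% 2)%Z != 0)].
Let rp1 (g : {ffun 'I_n -> bool}) : 'cV[int]_n := \col_i (g i : nat)%:Z.
Let dl_s1 l : dl k B1 (s1 l) = lat B1 l.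
Proof. by rewrite dlB1 latB1 /s1 zvD scalerDr -scalerDl; congr (_ *: _); field. Qed.
Let cl_rp1 i l : cl1 (rp1 i + s1 l) = i.
Proof.
apply/ffunP => a; rewrite ffunE !mxE.
have -> : l a ord0 + l a ord0 = l a ord0 * 2 by rewrite mulr2n mulrDr mulr1.
by rewrite addrC modzMDl; case: (i a).
Qed.
Let rp_cl1 z : exists l, z = rp1 (cl1 z) + s1 l.
Proof.
exists (\col_i (z i ord0 %/ 2)%Z); apply/matrixP => i j; rewrite !ord1 !mxE ffunE.
rewrite {1}(divz_eq (z i ord0) 2) addrC mulr2n mulrDr mulr1; congr (_ + _).
have := modz_ge0 (z i ord0) (isT : (2 : int) != 0).
have := ltz_pmod (z i ord0) (isT : (0 : int) < 2).
by case: (_ %% 2)%Z => [[|[|m]]|m].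
Qed.
Let even1 l : exists m : int, ipk k (lat B1 l) (lat B1 l) = 2 * m%:~R.
Proof.
have /intrP[m mE] := dotv_zv_int (R := R) l l; exists m.
by rewrite latB1 /ipk dotvZ dotvZr mE -kb1; ring.
Qed.
Let vol1 : vol k B1 = Num.sqrt 2 ^+ n.
Proof.
apply: EFin_inj; rewrite -(volE k B1u).
have -> : cellB B1 = cube n 0 b1.
  have E x i : (0 <= crd B1 x i ord0 < 1) = (0 <= x i ord0 < b1).
    by rewrite /crd invB1 mul_scalar_mx mxE pmulr_rge0 ?invr_gt0// ltr_pdivrMl// mulr1.
  by apply/seteqP; split=> x cx i; have := cx i; rewrite E.
rewrite volk_cube ?ltW// subr0; congr (_ ^+ _)%:E.
by rewrite /b1 -sqrtrM// mulrCA mulfV ?mulr1// pnatr_eq0 -lt0n.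
Qed.

Lemma cos_pi4 : cos (pi / 4) = (Num.sqrt 2)^-1 :> R.
Proof.
have t1 := tan_piquarter R; have p0 := @pi_gt0 R.
have c0 : 0 < cos (pi / 4) :> R by apply: cos_gt0_pihalf; apply/andP; split; lra.
have sc : sin (pi / 4) = cos (pi / 4) :> R.
  by apply: (@mulIf _ (cos (pi / 4))^-1); rewrite ?invr_eq0 ?gt_eqF// mulfV ?gt_eqF.
have c2 : cos (pi / 4) ^+ 2 = 2^-1 :> R.
  by have := cos2Dsin2 (pi / 4 : R); rewrite sc; lra.
by rewrite -sqrtrV// -c2 sqrtr_sqr ger0_norm// ltW.
Qed.

Lemma sin_pi4 : sin (pi / 4) = (Num.sqrt 2)^-1 :> R.
Proof.
rewrite -cos_pi4 -[in RHS](opprK (pi / 4)) cosN -[in LHS](opprK (pi / 4)).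
rewrite (_ : - - (pi / 4) = - (pi / 4) + pi / 2 :> R); last by lra.
exact: sinDpihalf.
Qed.

Lemma gamma1 : gamma B1 rp1 = cexpi (n%:R * pi / 4).
Proof.
rewrite /gamma vol1.
have -> : \sum_i qz k B1 (rp1 i) = (cexpi (pi / 2) + 1) ^+ n.
  transitivity (\sum_(g : {ffun 'I_n -> bool}) \prod_i (if g i then cexpi (pi / 2) else 1 : R[i])).
    apply: eq_bigr => g _; rewrite /qz dlB1 /ipk dotvZ dotvZr.
    (* As [k * b1^2 = 2] and the entries are 0 or 1, each entry 1 contributes the angle [pi / 2]. *)
    have -> : pi * (k%:R * (b1 / 2 * (b1 / 2 * dotv (zv (rp1 g)) (zv (rp1 g))))) =
        \sum_i (if g i then pi / 2 else 0).
      rewrite (_ : pi * _ = pi / 4 * (k%:R * b1 ^+ 2) * dotv (zv (rp1 g)) (zv (rp1 g))); last by field.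
      rewrite kb1 /dotv mulr_sumr; apply: eq_bigr => i _; rewrite !zvE !mxE.
      by case: (g i) => /=; rewrite ?mulr0// !mulr1; field.
    elim/big_rec2: _ => [|i y1 y2 _ <-]; first by rewrite cexpi0.
    by rewrite cexpiD; case: (g i); rewrite ?cexpi0.
  rewrite -(bigA_distr_bigA (fun (i : 'I_n) (b : bool) => if b then cexpi (pi / 2) else 1)).
  under eq_bigr do rewrite big_bool /=.
  by rewrite prodr_const card_ord.
have toCXn (r : R) m : toC (r ^+ m) = toC r ^+ m.
  by elim: m => [|m IH]; rewrite ?expr0 ?toC1// !exprS toCM IH.
rewrite -exprVn toCXn -exprMn (_ : n%:R * pi / 4 = (pi / 4) *+ n) ?cexpiMn; last first.
  by rewrite -[RHS]mulr_natl mulrA.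
congr (_ ^+ _); apply: complexP; rewrite ?(cReM, cImM) /= cos_pihalf sin_pihalf.
  by rewrite cos_pi4; ring.
by rewrite sin_pi4; ring.
Qed.

Lemma fourier_cube f : L2 k f ->
  aeeq k (fun x => cexpi (n%:R * pi / 4) * FT2 (Mo (FT2 (Mo (FT2 (Mo f))))) x) (FT2 (FT2 f)).
Proof. by move=> Lf; rewrite -gamma1; exact: (fourier_relation B1u dl_s1 cl_rp1 rp_cl1 even1). Qed.

(** The relation on L^2 has the same form for all even lattices, up to its scalar, so this Gauss sum
    equals that of [B1]; the function [g] is nonzero because the Fourier transform and the Gaussian
    preserve norms. This is Milgram's formula for positive definite lattices. *)
Lemma gammaE (B : 'M[R]_n) (I : finType) (s : 'cV[int]_n -> 'cV[int]_n) (cl : 'cV[int]_n -> I)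
    (rp : I -> 'cV[int]_n) : B \in unitmx -> (forall l, dl k B (s l) = lat B l) ->
  (forall i l, cl (rp i + s l) = i) -> (forall z, exists l, z = rp (cl z) + s l) ->
  (forall l, exists m : int, ipk k (lat B l) (lat B l) = 2 * m%:~R) ->
  gamma B rp = cexpi (n%:R * pi / 4).
Proof.
move=> Bu h1 h2 h3 h4; have [f [Cf f0]] := test_function; have Lf := Cc_L2 k Cf.
pose g := FT2 (Mo (FT2 (Mo (FT2 (Mo f))))).
have LM (h : 'cV[R]_n -> R[i]) : L2 k h -> L2 k (Mo h) := @L2_Mo _ _ k h.
have LF (h : 'cV[R]_n -> R[i]) : L2 k h -> L2 k (FT2 h) := @L2_FT2 _ _ k k1 h.
have Lg : L2 k g by exact: (LF _ (LM _ (LF _ (LM _ (LF _ (LM _ Lf)))))).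
apply: (@aeeq_coef _ _ g); first by case: Lg.
  have L1 := LM _ Lf; have L3 := LM _ (LF _ L1).
  by rewrite /g (FT2_nsq (LM _ (LF _ L3))) nsq_Mo (FT2_nsq L3) nsq_Mo (FT2_nsq L1) nsq_Mo.
apply: aeeq_trans (fourier_relation Bu h1 h2 h3 h4 Lf) _.
exact/aeeq_sym/fourier_cube.
Qed.
End fourier_relations.

(** * Root systems and the affine Weyl group *)

Section finite_tools.
Context {R : realType}.

Lemma fin_argmin (T : choiceType) (E : set T) (f : T -> R) : finite_set E -> E !=set0 ->
  exists2 x, E x & forall y, E y -> f x <= f y.
Proof.
move=> /finite_seqP[s ->]; elim: s => [|x s IH]; first by case=> x; rewrite /= in_nil.
move=> _; case: s IH => [_|z s IH].
  by exists x => /=; [rewrite inE|move=> y; rewrite inE => /eqP ->].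
have [|y ys yP] := IH; first by exists z; rewrite /= inE eqxx.
case: (leP (f x) (f y)) => h.
  exists x => [|u]; first by rewrite /= inE eqxx.
  rewrite /= inE => /orP[/eqP -> //|us]; exact: le_trans h (yP u us).
exists y => [|u]; first by rewrite /= inE ys orbT.
by rewrite /= inE => /orP[/eqP ->|/yP//]; exact: ltW.
Qed.

Lemma fin_bound (T : choiceType) (E : set T) (f : T -> R) : finite_set E ->
  exists2 C, 0 <= C & forall x, E x -> f x <= C.
Proof.
move=> Ef; have [->|/set0P E0] := eqVneq E set0; first by exists 0.
have [x Ex xP] := fin_argmin (fun x => - f x) Ef E0; exists `|f x| => // y Ey.
by apply: le_trans (ler_norm _); rewrite -lerN2 xP.
Qed.

Lemma finite_int (M : R) : finite_set [set m : int | `|m%:~R| <= M].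
Proof.
pose N := Num.bound `|M|.
have [r rP] : exists r : seq nat, forall i, (i < N)%N -> i \in r.
  by exists (iota 0 N) => i iN; rewrite mem_iota.
apply: (@sub_finite_set _ _ [set` [seq Posz i | i <- r] ++ [seq Negz i | i <- r]]); last exact: finite_seq.
move=> m /= mM; have mN : (`|m| < N)%N.
  have := le_lt_trans (le_trans mM (ler_norm M)) (archi_boundP (normr_ge0 M)).
  rewrite -intr_norm -/N => h.
  have : `|m| < N%:Z by rewrite -(ltr_int R); exact: h.
  by [].
rewrite mem_cat; case: m {mM} mN => i h; apply/orP; [left|right]; apply: map_f; apply: rP.
  exact: h.
by apply: ltn_trans h.
Qed.

Lemma ncard_lt (T : choiceType) (A A' : set T) (c : T -> T) t : finite_set A ->
  A t -> (forall x, A' x -> A (c x) /\ c x != t) ->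
  (forall x y, A' x -> A' y -> c x = c y -> x = y) -> finite_set A' -> (ncard A' < ncard A)%N.
Proof.
move=> Af At AA ci Af'.
have e : ncard A' = #|` [fset c x | x in fset_set A']%fset|.
  rewrite card_in_imfset//= => x y; rewrite !in_fset_set// !inE; exact: ci.
rewrite e [X in (_ < X)%N](cardfsD1 t) in_fset_set// mem_set//= add1n ltnS.
apply: fsubset_leq_card; apply/fsubsetP => u /imfsetP[x /=].
rewrite in_fset_set// inE => /AA[Acx ct] ->.
by rewrite in_fsetD1 ct in_fset_set// inE.
Qed.
End finite_tools.

Section root_system.
Context {R : realType} {n : nat}.
Variables (Phi : set 'cV[R]_n) (Delta : 'I_n -> 'cV[R]_n).
Hypothesis hPhi : simple_root_system Phi.
Implicit Types (a b x y : 'cV[R]_n).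

Lemma dotv_neq0 a : a != 0 -> dotv a a != 0.
Proof. by move=> a0; rewrite gt_eqF// dotv_gt0. Qed.

Lemma reflE a x : refl a *m x = x - dotv x a *: coroot a.
Proof.
rewrite /refl /coroot mulmxBl mul1mx -scalemxAl -mulmxA; congr (_ - _).
have -> : a^T *m x = (dotv x a)%:M.
  apply/matrixP => i j; rewrite !ord1 !mxE eqxx mulr1n; apply: eq_bigr => l _.
  by rewrite !mxE mulrC.
by rewrite mul_mx_scalar !scalerA mulrC.
Qed.

Lemma dotv_coroot a : a != 0 -> dotv a (coroot a) = 2.
Proof. by move=> a0; rewrite /coroot dotvZr divfK// dotv_neq0. Qed.

Lemma refl_inv a x : a != 0 -> refl a *m (refl a *m x) = x.
Proof.
move=> a0; rewrite !reflE dotvB dotvZ [dotv (coroot a) a]dotvC dotv_coroot//.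
have -> : dotv x a - dotv x a * 2 = - dotv x a by ring.
by rewrite scaleNr opprK subrK.
Qed.

Lemma refl_sym a : (refl a)^T = refl a.
Proof. by rewrite /refl linearB /= trmx1 linearZ /= trmx_mul trmxK. Qed.

Lemma refl_orth a : a != 0 -> (refl a)^T *m refl a = 1%:M.
Proof.
move=> a0; rewrite refl_sym; apply/matrixP => i j.
have := refl_inv (delta_mx j (ord0 : 'I_1)) a0; rewrite mulmxA => /matrixP/(_ i ord0).
have -> : (refl a *m refl a *m delta_mx j (ord0 : 'I_1)) i ord0 = (refl a *m refl a) i j.
  rewrite mxE (bigD1 j)//= big1 => [|l lj]; last by rewrite [delta_mx _ _ _ _]mxE (negbTE lj) mulr0.
  by rewrite addr0 [delta_mx _ _ _ _]mxE !eqxx mulr1.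
by move=> ->; rewrite !mxE andbT.
Qed.

Lemma dotv_refl a x y : a != 0 -> dotv (refl a *m x) (refl a *m y) = dotv x y.
Proof. by move=> a0; apply: dotv_orth; exact: refl_orth. Qed.

Lemma coroot_orth (w : 'M[R]_n) a : w^T *m w = 1%:M -> coroot (w *m a) = w *m coroot a.
Proof. by move=> ow; rewrite /coroot dotv_orth// scalemxAr. Qed.

Lemma refl_self a : a != 0 -> refl a *m a = - a.
Proof.
move=> a0; rewrite reflE /coroot scalerA mulrCA mulfV ?dotv_neq0// mulr1 scalerDl scale1r.
by rewrite opprD addrA subrr add0r.
Qed.

(** The matrix determinant lemma: two triangular factorisations of one block matrix give
    [det (1 - u v) = 1 - v u], here [1 - 2]. *)
Lemma det_refl a : a != 0 -> \det (refl a) = -1.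
Proof.
move=> a0; pose u : 'cV[R]_n := coroot a; pose v : 'rV[R]_n := a^T.
have rE : refl a = 1%:M - u *m v by rewrite /refl /u /coroot -scalemxAl.
have vu : v *m u = 2%:M.
  apply/matrixP => i j; rewrite !ord1 !mxE eqxx mulr1n -(dotv_coroot a0); apply: eq_bigr => l _.
  by rewrite !mxE.
have e1 : block_mx (1%:M : 'M[R]_n) 0 v (1%:M : 'M[R]_1) *m block_mx 1%:M u 0 (1%:M - v *m u) = block_mx 1%:M u v 1%:M.
  by rewrite mulmx_block !mul1mx !mulmx1 !mul0mx ?mulmx0 !addr0 addrC subrK.
have e2 : block_mx (1%:M : 'M[R]_n) u 0 (1%:M : 'M[R]_1) *m block_mx (1%:M - u *m v) 0 v 1%:M = block_mx 1%:M u v 1%:M.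
  by rewrite mulmx_block !mul1mx !mulmx1 !mul0mx ?mulmx0 !add0r subrK.
have := congr1 determinant (etrans e1 (esym e2)).
rewrite !det_mulmx !det_lblock !det_ublock !det1 !mul1r !mulr1 -rE => <-.
by rewrite vu -raddfB /= det_scalar1; ring.
Qed.

Lemma root_nz a : Phi a -> a != 0. Proof. exact: (root_neq0 hPhi). Qed.

Lemma root_opp a : Phi a -> Phi (- a).
Proof. by move=> Pa; rewrite -refl_self ?root_nz//; exact: (roots_refl hPhi). Qed.

Lemma cartan_int a b : Phi a -> Phi b -> dotv b (coroot a) \is a Num.int.
Proof.
move=> Pa Pb; have := roots_int hPhi Pa Pb; rewrite /coroot dotvZr dotvC.
by rewrite mulrAC.
Qed.

Lemma cauchy_dotv a b : dotv a b ^+ 2 <= dotv a a * dotv b b.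
Proof.
have [->|b0] := eqVneq b 0; first by rewrite !dotv0 expr0n mulr0.
have B : 0 < dotv b b by rewrite dotv_gt0.
have := dotv_ge0 (dotv b b *: a - dotv a b *: b).
rewrite dotvB !dotvBr !dotvZ !dotvZr (dotvC b a).
move: (dotv a a) (dotv a b) (dotv b b) B => A c D D0 h.
have : 0 <= D * (A * D - c ^+ 2) by apply: le_trans h _; rewrite le_eqVlt; apply/orP; left; apply/eqP; ring.
by rewrite pmulr_rge0// subr_ge0.
Qed.

(** By irreducibility some long root [a] is not orthogonal to [b]. With the Cartan integers
    [p = (a, b)] and [q = 2 p / (b, b)] the ratio is [q / p]. Cauchy-Schwarz gives [p q <= 4], and
    [p^2 <= p q] holds as [b] is not longer than [a]; only cases where [p] divides [q] are left. *)
Lemma long_ratio b : Phi b -> exists m : int, 2 / dotv b b = m%:~R.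
Proof.
move=> Pb; pose A := [set c | Phi c /\ exists a, [/\ Phi a, dotv a a = 2 & dotv a c != 0]].
have AP : A = Phi.
  apply: (roots_irr hPhi).
  - by move=> c [].
  - have [a Pa a2] := roots_long hPhi; exists a; split=> //; exists a; split => //.
    by rewrite a2 pnatr_eq0.
  (* If [d] is orthogonal to [a] but not to [c], the long root obtained by reflecting [a] in [c] is
     not orthogonal to [d]. *)
  - move=> c d [Pc [a [Pa a2 ac]]] [Pd Ad]; apply: contrapT => /eqP cd; apply: Ad; split=> //.
    have [ad|ad] := eqVneq (dotv a d) 0; last by exists a.
    exists (refl c *m a); split; first exact: (roots_refl hPhi).
      by rewrite dotv_refl// root_nz.
    rewrite reflE dotvB ad sub0r oppr_eq0 dotvZ /coroot dotvZ !mulf_neq0//.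
    by rewrite invr_eq0 dotv_neq0// root_nz.
have [_ [a [Pa a2 ab]]] : A b by rewrite AP.
have /intrP[p pE] := cartan_int Pa Pb; have /intrP[q qE] := cartan_int Pb Pa.
have b0 : 0 < dotv b b by rewrite dotv_gt0 root_nz.
have b2 := roots_le2 hPhi Pb; have CS := cauchy_dotv a b.
have pE' : p%:~R = dotv a b by rewrite -pE /coroot a2 divff ?pnatr_eq0// scale1r dotvC.
have qE' : q%:~R * dotv b b = 2 * dotv a b.
  by rewrite -qE /coroot dotvZr mulrAC divfK// gt_eqF.
rewrite a2 in CS; rewrite -pE' in CS qE' ab; rewrite intr_eq0 in ab.
have h1 : (p * q)%:~R * dotv b b = 2 * p%:~R ^+ 2 :> R by rewrite intrM -mulrA qE'; ring.
have p1 : (1 <= p%:~R ^+ 2 :> R).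
  rewrite -[1]/(1%:~R) -rmorphXn /= ler_int; move: ab; case: (p) => [[|m]|m] // _; nia.
have h2 : (p * q)%:~R <= 4%:~R :> R.
  rewrite -(ler_pM2r b0) h1; have -> : 4%:~R = 4 :> R by []; lra.
have h3 : p%:~R ^+ 2 <= (p * q)%:~R :> R.
  have : 0 <= ((p * q)%:~R : R).
    by rewrite -(pmulr_lge0 _ b0) h1 mulr_ge0// sqr_ge0.
  move: h1 b2; move: ((p * q)%:~R) (p%:~R ^+ 2) (dotv b b) => r t d h1 b2 r0; nra.
move: h2 h3; rewrite -rmorphXn /= !ler_int => h2 h3.
have dq : (p %| q)%Z.
  have : p = 1 \/ p = -1 \/ p = 2 \/ p = -2 by move: ab h2 h3; clear; nia.
  case=> [->|[->|[p2|p2]]]; rewrite ?dvd1z ?dvdNz ?dvd1z//.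
    by rewrite p2; have -> : q = 2 by move: h2 h3; rewrite p2 expr2; lia.
  by rewrite p2; have -> : q = -2 by move: h2 h3; rewrite p2 expr2; lia.
have /dvdzP[m mE] := dq; exists m.
apply: (@mulIf _ (p%:~R * dotv b b)); first by rewrite mulf_neq0 ?intr_eq0// gt_eqF.
have qp : q%:~R = m%:~R * p%:~R :> R by rewrite mE intrM.
by rewrite [RHS]mulrA -qp qE'; field; rewrite gt_eqF.
Qed.

Local Notation L := (coroot_lattice Phi).

Lemma lattice_smallest (G : set 'cV[R]_n) : G 0 -> (forall u v, G u -> G v -> G (u - v)) ->
  (forall a, Phi a -> G (coroot a)) -> L `<=` G.
Proof. by move=> G0 GB Gc l; apply; split=> [|_ [a Pa <-]]; [split|exact: Gc]. Qed.

Lemma lattice0 : L 0. Proof. by move=> G [[]]. Qed.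
Lemma latticeB u v : L u -> L v -> L (u - v).
Proof. by move=> Lu Lv G hG; have [[_ GB] _] := hG; apply: GB; [exact: Lu|exact: Lv]. Qed.
Lemma lattice_coroot a : Phi a -> L (coroot a).
Proof. by move=> Pa G [_]; apply; exists a. Qed.
Lemma latticeN u : L u -> L (- u).
Proof. by move=> Lu; rewrite -sub0r; exact: latticeB lattice0 Lu. Qed.
Lemma latticeD u v : L u -> L v -> L (u + v).
Proof. by move=> Lu Lv; rewrite -[v]opprK; exact: latticeB Lu (latticeN Lv). Qed.
Lemma latticeZ (m : int) u : L u -> L (m%:~R *: u).
Proof.
move=> Lu; have Ln i : L (u *+ i).
  by elim: i => [|i IH]; rewrite ?mulr0n ?mulrS; [exact: lattice0|exact: latticeD].
by rewrite scaler_int; case: m => m; rewrite ?NegzE ?mulrNz -pmulrn //; exact: latticeN.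
Qed.

Lemma lattice_int_root l a : L l -> Phi a -> dotv l a \is a Num.int.
Proof.
move=> Ll Pa; move: l Ll; apply: lattice_smallest.
- by rewrite dot0v rpred0.
- by move=> u v hu hv; rewrite dotvB rpredB.
- by move=> b Pb; rewrite dotvC; exact: cartan_int.
Qed.

(** By [long_ratio] a coroot is an integral multiple of its root, so integrality against roots is
    enough. *)
Lemma lattice_int l l' : L l -> L l' -> dotv l l' \is a Num.int.
Proof.
move=> Ll; move: l'; apply: lattice_smallest.
- by rewrite dotv0 rpred0.
- by move=> u v hu hv; rewrite dotvBr rpredB.
- move=> b Pb; rewrite /coroot dotvZr; have [m ->] := long_ratio Pb.
  by rewrite rpredM ?intr_int// lattice_int_root.
Qed.

Lemma lattice_even l : L l -> exists m : int, dotv l l = 2 * m%:~R.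
Proof.
(* Membership is carried along, since the cross term of a difference needs an integral pairing. *)
move=> Ll; suff [] : L l /\ exists m : int, dotv l l = 2 * m%:~R by [].
move: l Ll; apply: lattice_smallest.
- by split; [exact: lattice0|exists 0; rewrite dot0v mulr0].
- move=> u v [Lu [m mE]] [Lv [m' m'E]]; split; first exact: latticeB.
  have /intrP[q qE] := lattice_int Lu Lv; exists (m - q + m').
  by rewrite dotvB !dotvBr mE m'E (dotvC v u) qE !intrD mulrNz; ring.
- move=> a Pa; split; first exact: lattice_coroot.
  have [m mE] := long_ratio Pa; exists m.
  by rewrite {1}/coroot dotvZ dotv_coroot ?root_nz// mE; ring.
Qed.

Hypothesis hDelta : simple_roots Phi Delta.
Local Notation hgt c := (\sum_i c i)%N.

Let D : 'M[R]_n := \matrix_(i, j) Delta j i ord0.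
Let comb (c : 'I_n -> R) : D *m (\col_i c i) = \sum_i c i *: Delta i.
Proof.
apply/matrixP => i l; rewrite !ord1 summxE mxE; apply: eq_bigr => a _.
by rewrite !mxE mulrC.
Qed.

Lemma simple_uniq (c c' : 'I_n -> R) : \sum_i c i *: Delta i = \sum_i c' i *: Delta i -> c =1 c'.
Proof.
rewrite -!comb => /(congr1 (mulmx (invmx D))); rewrite !mulmxA mulVmx; last exact: (simple_free hDelta).
by rewrite !mul1mx => /matrixP h i; have := h i ord0; rewrite !mxE.
Qed.

Definition corootmx : 'M[R]_n := \matrix_(i, j) coroot (Delta j) i ord0.

Lemma corootmxE (c : 'I_n -> R) : corootmx *m (\col_i c i) = \sum_i c i *: coroot (Delta i).
Proof.
apply/matrixP => i l; rewrite !ord1 summxE mxE; apply: eq_bigr => a _.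
by rewrite [RHS]mxE [corootmx _ _]mxE [(\col_i0 c i0) _ _]mxE mulrC.
Qed.

Lemma corootmx_unit : corootmx \in unitmx.
Proof.
have -> : corootmx = D *m diag_mx (\row_j (2 / dotv (Delta j) (Delta j))).
  apply/matrixP => i j; rewrite mul_mx_diag !mxE mulrC //.
rewrite unitmx_mul (simple_free hDelta) /= unitmxE det_diag unitfE prodf_seq_neq0.
apply/allP => j _ /=; rewrite mxE mulf_neq0// invr_eq0 dotv_neq0// root_nz//.
exact: (simple_in hDelta).
Qed.

Definition span_simple : set 'cV[R]_n :=
  [set l | exists c : 'I_n -> int, l = \sum_i (c i)%:~R *: coroot (Delta i)].

Lemma span_simpleB u v : span_simple u -> span_simple v -> span_simple (u - v).
Proof.
move=> [c ->] [c' ->]; exists (fun i => c i - c' i); rewrite -sumrB; apply: eq_bigr => i _.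
by rewrite intrB scalerBl.
Qed.
Lemma span_simple0 : span_simple 0.
Proof. by exists (fun=> 0); rewrite big1// => i _; rewrite scale0r. Qed.
Lemma span_simpleN u : span_simple u -> span_simple (- u).
Proof. by move=> su; rewrite -sub0r; apply: span_simpleB => //; exact: span_simple0. Qed.
Lemma span_simpleZ (m : int) i : span_simple (m%:~R *: coroot (Delta i)).
Proof.
exists (fun l => if l == i then m else 0); rewrite (bigD1 i)//= eqxx big1 ?addr0// => l /negbTE ->.
by rewrite scale0r.
Qed.

(** Induction on the height: some simple root in the support pairs positively with the root, and
    reflecting in it lowers the height, while the coroot changes by an integral multiple of a simple
    coroot. *)
Lemma coroot_span h : forall c : 'I_n -> nat, (hgt c <= h)%N ->
  Phi (\sum_i (c i)%:R *: Delta i) -> span_simple (coroot (\sum_i (c i)%:R *: Delta i)).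
Proof.
elim: h => [|h IH] c ch Pc; have a0 := root_nz Pc.
  exfalso; move: a0; rewrite big1 ?eqxx// => i _.
  by move: ch; rewrite leqn0 sum_nat_eq0 => /forallP/(_ i)/eqP ->; rewrite scale0r.
set a := \sum_i _ in Pc a0 *.
have [i ci ai] : exists2 i, (0 < c i)%N & 0 < dotv (Delta i) a.
  apply: contrapT => H; have : 0 < dotv a a by rewrite dotv_gt0.
  rewrite {1}/a dotv_suml => /lt_geF/negP; apply.
  apply: sumr_le0 => i _; rewrite dotvZ; case: (posnP (c i)) => [->|ci]; first by rewrite mul0r.
  by rewrite mulr_ge0_le0// leNgt; apply/negP => h'; apply: H; exists i.
have Pi := simple_in hDelta i.
have /intrP[N NE] := cartan_int Pi Pc.
pose c' l : R := (c l)%:R - (if l == i then N%:~R else 0).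
have bE : refl (Delta i) *m a = \sum_l c' l *: Delta l.
  rewrite reflE /coroot scalerA mulrCA -[dotv a _ * _]/(dotv a (Delta i) * _).
  rewrite (_ : _ * (dotv a (Delta i) * _) = N%:~R); last by rewrite -NE /coroot dotvZr; ring.
  rewrite /a (bigD1 i)//= [RHS](bigD1 i)//= /c' eqxx scalerBl addrAC; congr (_ + _).
  by apply: eq_bigr => l /negbTE ->; rewrite subr0.
have Pb : Phi (refl (Delta i) *m a) by exact: (roots_refl hPhi).
have N0 : (0 < N)%R.
  rewrite -(ltr_int R) -NE /coroot dotvZr mulr_gt0 1?dotvC// divr_gt0// dotv_gt0// root_nz//.
have back : coroot a = coroot (refl (Delta i) *m a) -
    (dotv (coroot (refl (Delta i) *m a)) (Delta i)) *: coroot (Delta i).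
  rewrite -reflE coroot_orth; last exact: refl_orth (root_nz Pi).
  by rewrite refl_inv// root_nz.
have /intrP[q qE] : dotv (coroot (refl (Delta i) *m a)) (Delta i) \is a Num.int.
  by rewrite dotvC; exact: cartan_int.
rewrite back qE; apply: span_simpleB; last exact: span_simpleZ.
have [d [dE|dE]] := simple_sign hDelta Pb.
  rewrite dE; apply: IH; last by rewrite -dE.
  have dc l : (d l)%:R = c' l by apply: (simple_uniq (c := fun l => (d l)%:R)); rewrite -dE bE.
  have dl l : l != i -> d l = c l.
    by move=> /negbTE li; have := dc l; rewrite /c' li subr0 => /eqP; rewrite eqr_nat => /eqP.
  have di : (d i < c i)%N.
    rewrite -(ltr_nat R) dc /c' eqxx gtrDl oppr_lt0 ltr0z//.
  move: ch; rewrite (bigD1 i)//= [X in _ -> (X <= _)%N](bigD1 i)//= => ch.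
  rewrite (eq_bigr c); last by move=> l /dl ->.
  by rewrite -ltnS; apply: leq_trans ch; rewrite ltn_add2r.
(* A negative reflected root forces [a] to be a multiple of [Delta i]. *)
have dc l : - (d l)%:R = c' l.
  apply: (simple_uniq (c := fun l => - (d l)%:R)); rewrite -bE dE -sumrN.
  by apply: eq_bigr => m _; rewrite scaleNr.
have aE : a = (c i)%:R *: Delta i.
  rewrite /a (bigD1 i)//= big1 ?addr0// => l /negbTE li.
  have := dc l; rewrite /c' li subr0 => h'.
  have : (c l)%:R <= 0 :> R by rewrite -h' oppr_le0.
  by rewrite lern0 => /eqP ->; rewrite scale0r.
have c1 : (c i)%:R = 1 :> R.
  rewrite aE in Pc; have [//|h'] := roots_reduced hPhi Pi Pc.
  by have : 0 <= (c i)%:R :> R by []; rewrite h' ler0N1.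
rewrite -[coroot _]opprK; apply: span_simpleN.
rewrite aE c1 scale1r refl_self ?root_nz// /coroot dotvN dotvNr opprK scalerN opprK.
by have := span_simpleZ 1 i; rewrite scale1r.
Qed.

Lemma lattice_span l : L l <-> exists z, l = lat corootmx z.
Proof.
have E (z : 'cV[int]_n) : lat corootmx z = \sum_i (z i ord0)%:~R *: coroot (Delta i).
  by rewrite -corootmxE /lat; congr (_ *m _); apply/matrixP => i l'; rewrite ord1 !mxE.
split=> [|[z ->]].
  move: l; apply: lattice_smallest.
  - by exists 0; rewrite lat0.
  - by move=> u v [z ->] [z' ->]; exists (z - z'); rewrite latB.
  - move=> a Pa; have [c] : span_simple (coroot a).
      have [c [aE|aE]] := simple_sign hDelta Pa.
        by rewrite aE; apply: coroot_span; [exact: leqnn|rewrite -aE].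
      rewrite aE /coroot dotvN dotvNr opprK scalerN; apply: span_simpleN.
      by apply: coroot_span; [exact: leqnn|rewrite -[X in Phi X]opprK -aE; exact: root_opp].
    by move=> ->; exists (\col_i c i); rewrite E; apply: eq_bigr => i _; rewrite mxE.
rewrite E; elim/big_rec: _ => [|i u _ Lu]; first exact: lattice0.
by apply: latticeD => //; apply: latticeZ; apply: lattice_coroot; exact: (simple_in hDelta).
Qed.

Lemma cell_cellB : cell Delta = cellB corootmx.
Proof.
have mu := corootmx_unit.
apply/seteqP; split=> [x [c c01 ->]|x cx].
  move=> i; rewrite /crd -corootmxE mulmxA mulVmx// mul1mx mxE; exact: c01.
exists (fun i => crd corootmx x i ord0) => //.
rewrite -corootmxE -[LHS](crdK mu); congr (_ *m _).
by apply/matrixP => i l; rewrite ord1 !mxE.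
Qed.
End root_system.

(** * The Weyl group, affine roots and words in the walls *)

Section weyl_group.
Context {R : realType} {n : nat}.
Variables (Phi : set 'cV[R]_n) (Delta : 'I_n -> 'cV[R]_n).
Hypothesis hPhi : simple_root_system Phi.
Hypothesis hDelta : simple_roots Phi Delta.
Implicit Types (a b x y q : 'cV[R]_n) (w u v : 'M[R]_n).
Local Notation L := (coroot_lattice Phi).
Local Notation W := (weyl Phi).

Lemma weyl_smallest (G : set 'M[R]_n) : G 1%:M -> (forall u v, G u -> G v -> G (u *m v)) ->
  (forall a, Phi a -> G (refl a)) -> W `<=` G.
Proof. by move=> G1 GM Gr w; apply; split=> [|_ [a Pa <-]]; [split|exact: Gr]. Qed.
Lemma weyl1 : W 1%:M. Proof. by move=> G [[]]. Qed.
Lemma weylM u v : W u -> W v -> W (u *m v).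
Proof. by move=> Wu Wv G hG; have [[_ GM] _] := hG; apply: GM; [exact: Wu|exact: Wv]. Qed.
Lemma weyl_refl a : Phi a -> W (refl a).
Proof. by move=> Pa G [_]; apply; exists a. Qed.

Lemma weyl_orth w : W w -> w^T *m w = 1%:M.
Proof.
move: w; apply: weyl_smallest => [|u v hu hv|a Pa].
- by rewrite trmx1 mul1mx.
- by rewrite trmx_mul mulmxA -(mulmxA _ u^T) hu mulmx1.
- exact: refl_orth (root_nz hPhi Pa).
Qed.

Lemma weyl_tr w : W w -> W w^T.
Proof.
move: w; apply: weyl_smallest => [|u v hu hv|a Pa].
- by rewrite trmx1; exact: weyl1.
- by rewrite trmx_mul; exact: weylM.
- by rewrite refl_sym; exact: weyl_refl.
Qed.

Lemma weyl_trK w : W w -> w *m w^T = 1%:M.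
Proof. by move=> /weyl_orth/mulmx1C. Qed.

Lemma weyl_root w a : W w -> Phi a -> Phi (w *m a).
Proof.
move=> Ww; move: w Ww a; apply: weyl_smallest => [a|u v hu hv a Pa|b Pb a Pa].
- by rewrite mul1mx.
- by rewrite -mulmxA; apply: hu; exact: hv.
- exact: (roots_refl hPhi).
Qed.

Lemma weyl_lattice w l : W w -> L l -> L (w *m l).
Proof.
move=> Ww; move: l; apply: lattice_smallest => [|u v hu hv|a Pa].
- by rewrite mulmx0; exact: lattice0.
- by rewrite mulmxBr; exact: latticeB.
- rewrite -coroot_orth ?weyl_orth//; apply: lattice_coroot; exact: weyl_root.
Qed.

Lemma weyl_det w : W w -> \det w = 1 \/ \det w = -1.
Proof.
move: w; apply: weyl_smallest => [|u v hu hv|a Pa].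
- by left; rewrite det1.
- rewrite det_mulmx; case: hu => ->; case: hv => ->; rewrite ?mul1r ?mulrNN ?mulr1; by [left|right].
- by right; apply: det_refl; exact: (root_nz hPhi).
Qed.

(** An element is determined by the images of the simple roots, which form a basis, and these images
    lie in the finite set of roots. *)
Lemma weyl_finite : finite_set W.
Proof.
have /finite_seqP[s sP] := roots_finite hPhi.
pose D : 'M[R]_n := \matrix_(i, j) Delta j i ord0.
have Du : D \in unitmx := simple_free hDelta.
pose M (f : {ffun 'I_n -> 'I_(size s)}) : 'M[R]_n := (\matrix_(i, j) (nth 0 s (f j)) i ord0) *m invmx D.
apply: (@sub_finite_set _ _ (M @` setT)); last by apply: finite_image; exact: finite_finset.
move=> w Ww; have wD j : w *m Delta j \in s.
  by have := weyl_root Ww (simple_in hDelta j); rewrite sP.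
have ix j : (index (w *m Delta j) s < size s)%N by rewrite index_mem.
exists [ffun j => Ordinal (ix j)] => //.
rewrite /M -[RHS]mulmx1 -(mulmxV Du) mulmxA; congr (_ *m _).
apply/matrixP => i j; rewrite mxE ffunE /= nth_index// !mxE.
by apply: eq_bigr => l _; rewrite !mxE.
Qed.

(* The pair [(a, m)] stands for the affine root [x |-> (a, x) + m]. *)
Definition ev (f : 'cV[R]_n * int) x : R := dotv x f.1 + f.2%:~R.
Definition rf (f : 'cV[R]_n * int) x := x - ev f x *: coroot f.1.
(** The affine root [f] composed with the reflection of [t], by [ev_cmp]; the floor extracts the
    Cartan integer as an element of [int]. *)
Definition cmp (f t : 'cV[R]_n * int) : 'cV[R]_n * int :=
  (refl t.1 *m f.1, f.2 - t.2 * Num.floor (dotv f.1 (coroot t.1))).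
Definition neg (f : 'cV[R]_n * int) : 'cV[R]_n * int := (- f.1, - f.2).
Implicit Types (f g h t : 'cV[R]_n * int).

Lemma ev_neg f x : ev (neg f) x = - ev f x.
Proof. by rewrite /ev /= dotvNr mulrNz opprD. Qed.

Lemma ev_cmp f t x : Phi f.1 -> Phi t.1 -> ev (cmp f t) x = ev f (rf t x).
Proof.
move=> Pf Pt; have /intrP[N NE] := cartan_int hPhi Pt Pf.
rewrite /ev /rf /cmp /= NE intrKfloor reflE dotvBr dotvZr dotvB dotvZ intrD mulrNz intrM.
rewrite (dotvC (coroot _)) NE (_ : dotv f.1 t.1 * dotv x (coroot t.1) = N%:~R * dotv x t.1).
  by rewrite /ev; ring.
by rewrite -NE /coroot !dotvZr; ring.
Qed.

Lemma cmp_root f t : Phi f.1 -> Phi t.1 -> Phi (cmp f t).1.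
Proof. by move=> Pf Pt; exact: (roots_refl hPhi). Qed.

Lemma ev_self f x : Phi f.1 -> ev f (rf f x) = - ev f x.
Proof.
move=> Pf; rewrite {1}/ev /rf dotvB dotvZ (dotvC (coroot _)) dotv_coroot ?(root_nz hPhi)//.
by rewrite /ev; ring.
Qed.

Lemma rfK f x : Phi f.1 -> rf f (rf f x) = x.
Proof. by move=> Pf; rewrite {1}/rf ev_self// scaleNr opprK /rf subrK. Qed.

Lemma rfE t x : rf t x = refl t.1 *m x - t.2%:~R *: coroot t.1.
Proof. by rewrite /rf /ev scalerDl opprD addrA reflE. Qed.

Lemma rf_comm f t x : Phi f.1 -> Phi t.1 -> rf f (rf t x) = rf t (rf (cmp f t) x).
Proof.
move=> Pf Pt; rewrite [in RHS]rfE {2}/rf mulmxBr -scalemxAr ev_cmp// coroot_orth; last first.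
  exact: refl_orth (root_nz hPhi Pt).
by rewrite refl_inv ?(root_nz hPhi)// addrAC -rfE.
Qed.

Variable p : 'cV[R]_n.
Hypothesis pA : alcove Phi Delta p.

Lemma pos_or_neg a : Phi a -> pos_roots Phi Delta a \/ pos_roots Phi Delta (- a).
Proof.
move=> Pa; have [c [e|e]] := simple_sign hDelta Pa; [left|right].
  by split=> //; exists c.
by split; [exact: root_opp|exists c; rewrite e opprK].
Qed.

(** Up to sign a root takes at [p] a value strictly between 0 and 1, which no integer cancels. *)
Lemma ev_p_neq0 f : Phi f.1 -> ev f p != 0.
Proof.
move=> Pf; apply/eqP; rewrite /ev => e.
have : `|f.2%:~R| < 1 :> R /\ dotv p f.1 != 0.
  have e' : f.2%:~R = - dotv p f.1 by apply/eqP; rewrite -addr_eq0 addrC e.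
  rewrite e' normrN; case: (pos_or_neg Pf) => /pA/andP[h1 h2].
    by rewrite gtr0_norm// h2 gt_eqF.
  by rewrite dotvNr in h1 h2; rewrite ltr0_norm ?h2 ?lt_eqF// -oppr_gt0.
move=> [h]; have : f.2 = 0.
  move: h; rewrite -intr_norm (ltr_int R _ 1); case: (f.2) => [[|m]|m] //.
by move: e => /[swap] ->; rewrite addr0 => ->; rewrite eqxx.
Qed.

Definition aff_pos f := Phi f.1 /\ 0 < ev f p.

Lemma aff_pos_or f : Phi f.1 -> aff_pos f \/ aff_pos (neg f).
Proof.
move=> Pf; have := ev_p_neq0 Pf; rewrite neq_lt => /orP[h|h]; [right|left] => //.
by split; [exact: root_opp|rewrite ev_neg oppr_gt0].
Qed.

Lemma fin_aff (M : R) : finite_set [set f | Phi f.1 /\ `|f.2%:~R| <= M].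
Proof.
apply: (@sub_finite_set _ _ (Phi `*` [set m : int | `|m%:~R| <= M])); first by move=> f [].
by apply: finite_setX; [exact: roots_finite|exact: finite_int].
Qed.

Lemma fin_negs q : finite_set [set f | aff_pos f /\ ev f q < 0].
Proof.
have [Cp Cp0 CpP] := fin_bound (fun a => `|dotv p a|) (roots_finite hPhi).
have [Cq Cq0 CqP] := fin_bound (fun a => `|dotv q a|) (roots_finite hPhi).
apply: sub_finite_set (fin_aff (Cp + Cq)) => f [[Pf h1] h2]; split=> //.
move: h1 h2; have := CpP _ Pf; have := CqP _ Pf; rewrite /ev !ler_norml.
move=> /andP[? ?] /andP[? ?] ? ?; apply/andP; split; lra.
Qed.

Lemma fin_low c : finite_set [set f | aff_pos f /\ ev f p < c].
Proof.
have [Cp Cp0 CpP] := fin_bound (fun a => `|dotv p a|) (roots_finite hPhi).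
apply: sub_finite_set (fin_aff (Cp + `|c|)) => f [[Pf h1] h2]; split=> //.
move: h1 h2; have := CpP _ Pf; have := ler_norm c; rewrite /ev !ler_norml.
move=> ? /andP[? ?] ? ?; have := normr_ge0 c => ?; apply/andP; split; lra.
Qed.

Lemma aff_pos_prop f g (r : R) : aff_pos f -> aff_pos g -> g.1 = r *: f.1 -> ev g p = r * ev f p -> g = f.
Proof.
move=> [Pf f0] [Pg g0] e e'.
have r1 : r = 1.
  rewrite e in Pg; have [//|h] := roots_reduced hPhi Pf Pg.
  by move: g0; rewrite e' h; lra.
move: e e'; rewrite r1 scale1r mul1r /ev => e; rewrite e => /addrI/intr_inj e2.
by rewrite [f]surjective_pairing [g]surjective_pairing e e2.
Qed.

(* The positive affine roots whose reflection crosses no other wall when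
   applied to [p]: the walls of the alcove. *)
Definition wall f := aff_pos f /\ forall g, aff_pos g -> g <> f -> 0 < ev g (rf f p).

(* If [f] is not a wall, some [g] gives [N f = g + h] with [g], [h] positive; a
   root minimising [ev f q / ev f p], and among these maximising the norm of
   the linear part of [f / ev f p], has no such decomposition. *)
Lemma wall_exists f q : aff_pos f -> ev f q < 0 -> exists t, wall t /\ ev t q < 0.
Proof.
move=> Pf fq; pose E := [set g | aff_pos g /\ ev g q < 0].
have [f0 [Pf0 f0q] f0P] := fin_argmin (fun g => ev g q / ev g p) (fin_negs q) (ex_intro _ f (conj Pf fq) : E !=set0).
pose E' := [set g | E g /\ ev g q / ev g p = ev f0 q / ev f0 p].
have fE' : finite_set E' by apply: sub_finite_set (fin_negs q) => g [].
have [f1 [[Pf1 f1q] f1l] f1P] := fin_argmin (fun g => - (dotv g.1 g.1 / ev g p ^+ 2)) fE'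
  (ex_intro _ f0 (conj (conj Pf0 f0q) erefl) : E' !=set0).
exists f1; split=> //; split=> // g Pg gf1; apply: contrapT => /negP; rewrite -leNgt => gle.
have [Pf1r F0] := Pf1; have [Pgr U0] := Pg.
(* With this choice [g + h] is [N] times [f1], both as functions and in the linear parts. *)
pose h := neg (cmp g f1); have cr := cmp_root Pgr Pf1r.
have Ph : aff_pos h.
  case: (aff_pos_or cr) => // -[_]; rewrite ev_cmp// => /lt_le_trans/(_ gle); by rewrite ltxx.
have [_ V0] := Ph; set N := dotv g.1 (coroot f1.1).
have evh x : ev g x + ev h x = N * ev f1 x.
  rewrite /h ev_neg ev_cmp// {2}/ev /rf dotvB dotvZ (dotvC (coroot _)) -/N /ev; ring.
have vec : g.1 + h.1 = N *: f1.1.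
  rewrite /h /neg /cmp /= reflE opprB addrCA subrr addr0 /N /coroot dotvZr scalerA.
  by congr (_ *: _); ring.
have key e : aff_pos e -> ev f0 q / ev f0 p * ev e p <= ev e q.
  move=> [Pe e0]; case: (ltP (ev e q) 0) => eq.
    by rewrite -ler_pdivlMr//; exact: f0P.
  apply: le_trans eq; rewrite nmulr_rle0 ?ltW// pmulr_llt0// invr_gt0; exact: Pf0.2.
set m0 := ev f0 q / ev f0 p in f1l key f1P.
have eqq := evh q; have eqp := evh p; have kg := key _ Pg; have kh := key _ Ph.
have f1q' : ev f1 q = m0 * ev f1 p by rewrite -f1l divfK// gt_eqF.
have m0n : m0 < 0 by rewrite -f1l pmulr_llt0 ?invr_gt0.
have gq : ev g q = m0 * ev g p.
  by apply/eqP; rewrite eq_le kg andbT; move: eqq; rewrite f1q' mulrCA -eqp mulrDr => ?; lra.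
have hq : ev h q = m0 * ev h p.
  by apply/eqP; rewrite eq_le kh andbT; move: eqq; rewrite f1q' mulrCA -eqp mulrDr => ?; lra.
have E'g e : aff_pos e -> ev e q = m0 * ev e p -> E' e.
  move=> Pe ee; have [_ e0] := Pe; split; last by rewrite ee mulfK// gt_eqF.
  by split=> //; rewrite ee nmulr_rlt0.
have Kg := f1P _ (E'g _ Pg gq); have Kh := f1P _ (E'g _ Ph hq).
have sq : dotv g.1 g.1 + dotv h.1 h.1 + 2 * dotv g.1 h.1 = N ^+ 2 * dotv f1.1 f1.1.
  have := congr1 (fun v : 'cV[R]_n => dotv v v) vec; rewrite dotvZ dotvZr dotvD !dotvDr (dotvC h.1 g.1) => ?; lra.
(* Divided by its value at [p], the linear part of [f1] is a weighted mean of those of [g] and [h],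
   divided likewise, and neither of these is longer: by strict convexity they coincide. *)
have : dotv (ev h p *: g.1 - ev g p *: h.1) (ev h p *: g.1 - ev g p *: h.1) <= 0.
  rewrite dotvB !dotvBr !dotvZ !dotvZr (dotvC h.1 g.1).
  move: Kg Kh; rewrite !lerN2.
  set K := dotv f1.1 f1.1 / _; have : dotv f1.1 f1.1 = K * ev f1 p ^+ 2.
    by rewrite /K divfK// expf_neq0// gt_eqF.
  move=> KE Kg Kh; move: KE Kg Kh sq eqp F0 U0 V0.
  move: K (dotv f1.1 f1.1) (dotv g.1 g.1) (dotv h.1 h.1) (dotv g.1 h.1) (ev f1 p) (ev g p) (ev h p).
  clear; move=> K D G H C F U V -> Kg Kh sq eqp F0 U0 V0.
  rewrite ler_pdivrMr ?exprn_gt0// in Kg; rewrite ler_pdivrMr ?exprn_gt0// in Kh.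
  have sq' : G + H + 2 * C = K * (U + V) ^+ 2 by rewrite sq eqp; ring.
  have -> : V * (V * G) - V * (U * C) - (U * (V * C) - U * (U * H)) =
      V * (U + V) * G + U * (U + V) * H - U * V * (G + H + 2 * C) by ring.
  rewrite sq'.
  have h1 : V * (U + V) * G <= V * (U + V) * (K * U ^+ 2) by rewrite ler_wpM2l// mulr_ge0 ?addr_ge0 ?ltW.
  have h2 : U * (U + V) * H <= U * (U + V) * (K * V ^+ 2) by rewrite ler_wpM2l// mulr_ge0 ?addr_ge0 ?ltW.
  apply: le_trans (lerB (lerD h1 h2) (lexx _)) _.
  by rewrite le_eqVlt; apply/orP; left; apply/eqP; ring.
rewrite le_eqVlt ltNge dotv_ge0 orbF dotv_eq0 subr_eq0 => /eqP prop.
apply: gf1; apply: (@aff_pos_prop _ _ (ev g p / ev f1 p)) => //; last by rewrite divfK// gt_eqF.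
have N0 : N * ev f1 p != 0 by rewrite -eqp gt_eqF// addr_gt0.
apply: (@scalerI _ _ (N * ev f1 p)) => //.
rewrite scalerA (_ : N * ev f1 p * (ev g p / ev f1 p) = ev g p * N); last by field; rewrite gt_eqF.
by rewrite -[RHS]scalerA -vec -eqp scalerDl scalerDr prop.
Qed.

Implicit Types s : seq ('cV[R]_n * int).
Fixpoint act s x := if s is t :: s' then rf t (act s' x) else x.
Definition wall_word s := forall t, t \in s -> wall t.

Lemma wall_root t : wall t -> Phi t.1. Proof. by move=> [[]]. Qed.
Lemma wall_word_cons t s : wall_word (t :: s) -> wall t /\ wall_word s.
Proof. by move=> h; split=> [|u uw]; apply: h; rewrite inE ?eqxx// uw orbT. Qed.
Lemma wall_word_consI t s : wall t -> wall_word s -> wall_word (t :: s).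
Proof. by move=> h h' u; rewrite inE => /orP[/eqP ->//|]; exact: h'. Qed.

Lemma ev_act s f : wall_word s -> Phi f.1 -> exists g, Phi g.1 /\ forall x, ev g x = ev f (act s x).
Proof.
elim: s f => [|t s IH] f; first by move=> _ Pf; exists f.
move=> /wall_word_cons[Tt Tw] Pf; have Pt := wall_root Tt.
have [g [Pg gE]] := IH (cmp f t) Tw (cmp_root Pf Pt); exists g; split=> // x.
by rewrite gE ev_cmp.
Qed.

(** Compose [f] with the letters one by one. The letter that first makes it negative must be equal
    to it at that stage, as the reflection in a wall keeps every other positive root positive at
    [p]; this letter can be struck out. *)
Lemma deletion s f : wall_word s -> aff_pos f -> ev f (act s p) < 0 ->
  exists s', [/\ wall_word s', (size s' < size s)%N & forall x, rf f (act s x) = act s' x].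
Proof.
elim: s f => [|t s IH] f; first by move=> _ [_ f0] /= /lt_trans/(_ f0); rewrite ltxx.
move=> /wall_word_cons[Tt Tw] Pf; have [Pfr f0] := Pf; have Pt := wall_root Tt.
have [<-|tf] := eqVneq t f.
  by move=> _; exists s; split=> // x; rewrite /= rfK.
have P' : aff_pos (cmp f t).
  by split; [exact: cmp_root|rewrite ev_cmp//; apply: Tt.2 => // /eqP; rewrite eq_sym (negbTE tf)].
rewrite /= -ev_cmp// => /(IH _ Tw P')[s' [Ts' ss' s'E]]; exists (t :: s'); split=> //.
  exact: wall_word_consI.
by move=> x /=; rewrite rf_comm// s'E.
Qed.

Definition Abar x := forall f, aff_pos f -> 0 <= ev f x.

Lemma word_neg s t x : wall_word s -> wall t -> ev t (act s p) < 0 ->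
  exists2 g, aff_pos g & forall y, ev t (act s y) = - ev g y.
Proof.
move=> Tw Tt h; have [g [Pg gE]] := ev_act Tw (wall_root Tt).
exists (neg g); last by move=> y; rewrite ev_neg opprK gE.
by split; [exact: root_opp|rewrite ev_neg oppr_gt0 gE].
Qed.

Lemma closed_uniq m : forall s x y, (size s <= m)%N -> wall_word s -> Abar x -> Abar y -> act s x = y -> x = y.
Proof.
elim: m => [|m IH] [|t s] x y //= sw Twt Ax Ay e.
have [Tt Tw] := wall_word_cons Twt; have Pt := wall_root Tt.
have [g [Pg gE]] := ev_act Twt Pt; have := ev_p_neq0 Pg; rewrite neq_lt gE => /orP[h|h].
  have [g' Pg' g'E] := word_neg x Twt Tt h.
  have t0 : ev t y = 0.
    apply/eqP; rewrite eq_le (Ay _ Tt.1) andbT -e -/(act (t :: s) x) g'E oppr_le0; exact: Ax.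
  apply: (IH s) => //; rewrite -[act s x](rfK (f := t))// e /rf t0 scale0r subr0//.
move: h; rewrite /= ev_self// oppr_gt0 => h.
have [s' [Ts' ss' s'E]] := deletion Tw Tt.1 h.
apply: (IH s') => //; first by rewrite (leq_trans (ltnW ss')).
by rewrite -s'E.
Qed.

(** The argument of [closed_uniq], where the strict positivity of [x] excludes the first case. *)
Lemma open_stab m : forall s x, (size s <= m)%N -> wall_word s -> (forall f, aff_pos f -> 0 < ev f x) ->
  Abar (act s x) -> forall z, act s z = z.
Proof.
elim: m => [|m IH] [|t s] x //= sw Twt Ax Ay z.
have [Tt Tw] := wall_word_cons Twt; have Pt := wall_root Tt.
have [g [Pg gE]] := ev_act Twt Pt; have := ev_p_neq0 Pg; rewrite neq_lt gE => /orP[h|h].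
  have [g' Pg' g'E] := word_neg x Twt Tt h.
  have := Ay _ Tt.1; by rewrite -/(act (t :: s) x) g'E oppr_ge0 leNgt Ax.
move: h; rewrite /= ev_self// oppr_gt0 => h.
have [s' [Ts' ss' s'E]] := deletion Tw Tt.1 h.
rewrite s'E; apply: (IH s' x) => //; first by rewrite (leq_trans (ltnW ss')).
by rewrite -s'E.
Qed.

Lemma cmp_inj f g t : Phi f.1 -> Phi g.1 -> Phi t.1 -> cmp f t = cmp g t -> f = g.
Proof.
move=> Pf Pg Pt e; have t0 := root_nz hPhi Pt.
have e1 : f.1 = g.1 by rewrite -(refl_inv f.1 t0) -(refl_inv g.1 t0); have [-> _] := e.
have := ev_cmp (rf t 0) Pf Pt; rewrite e ev_cmp// rfK// /ev e1 => /addrI/intr_inj e2.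
by rewrite [f]surjective_pairing [g]surjective_pairing e1 e2.
Qed.

(** Composition with the reflection of [t] sends the roots counted at the new point injectively to
    those counted at [q], and misses [t]. *)
Lemma negs_lt q t : wall t -> ev t q < 0 ->
  (ncard [set f | aff_pos f /\ (ev f (rf t q) < 0)%R] < ncard [set f | aff_pos f /\ (ev f q < 0)%R])%N.
Proof.
move=> Tt tq; have Pt := wall_root Tt.
apply: (@ncard_lt _ _ _ (cmp^~ t) t); [exact: fin_negs|by split; [exact: Tt.1|]| | |exact: fin_negs].
  move=> g [Pg gq]; have Pgr := Pg.1.
  have gt : g <> t.
    by move=> e; move: gq; rewrite e ev_self// oppr_lt0 => /lt_trans/(_ tq); rewrite ltxx.
  split; first split; [split; [exact: cmp_root|]|..].
  - by rewrite ev_cmp//; exact: Tt.2.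
  - by rewrite ev_cmp.
  apply/eqP => e; have := ev_cmp (rf t p) Pgr Pt; rewrite e ev_self// rfK// => h.
  by have := Pg.2; rewrite -h oppr_gt0 => /lt_trans/(_ Tt.1.2); rewrite ltxx.
by move=> x y [[Px _] _] [[Py _] _]; exact: cmp_inj.
Qed.

Lemma word_exists q : exists s, wall_word s /\ Abar (act s q).
Proof.
have [m] := ubnP (ncard [set f | aff_pos f /\ ev f q < 0]); elim: m q => // m IH q qm.
have [Aq|] := pselect (Abar q); first by exists [::].
move=> /existsNP[f /not_implyP[Pf /negP]]; rewrite -ltNge => fq.
have [t [Tt tq]] := wall_exists Pf fq.
have [|s [Ts As]] := IH (rf t q); first by rewrite -ltnS (leq_ltn_trans _ qm)//; exact: negs_lt.
exists (rcons s t); split=> [u|].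
  by rewrite mem_rcons inE => /orP[/eqP ->//|]; exact: Ts.
by rewrite (_ : act (rcons s t) q = act s (rf t q))//; elim: (s) => //= v s' ->.
Qed.

Definition affine_weyl (g : 'cV[R]_n -> 'cV[R]_n) := exists2 s, wall_word s & forall x, act s x = g x.

Lemma act_cat s s' x : act (s ++ s') x = act s (act s' x).
Proof. by elim: s => //= t s ->. Qed.

Lemma affine_weyl_comp (g g' : 'cV[R]_n -> 'cV[R]_n) : affine_weyl g -> affine_weyl g' -> affine_weyl (fun x => g (g' x)).
Proof.
move=> [s Ts sE] [s' Ts' s'E]; exists (s ++ s') => [t|x]; last by rewrite act_cat s'E sE.
by rewrite mem_cat => /orP[]; [exact: Ts|exact: Ts'].
Qed.

Lemma affine_weyl_inv (g g' : 'cV[R]_n -> 'cV[R]_n) : affine_weyl g -> (forall x, g (g' x) = x) -> affine_weyl g'.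
Proof.
move=> [s Ts sE] gg; exists (rev s) => [t|x]; first by rewrite mem_rev; exact: Ts.
rewrite -[x in LHS]gg -sE; elim: s Ts {sE} (g' x) => //= t s IH Tts y.
have [Tt Ts] := wall_word_cons Tts.
by rewrite rev_cons -cats1 act_cat /= rfK ?IH//; exact: wall_root.
Qed.

Lemma rf_neg f x : rf (neg f) x = rf f x.
Proof. by rewrite /rf ev_neg /neg /coroot /= dotvN dotvNr opprK !scalerN scaleNr opprK. Qed.

(** Induction on the number of positive affine roots with a smaller value at [p]: a wall [t] that is
    negative at the mirror image of [p] conjugates [f] to [cmp f t], whose value at [p] is
    smaller. *)
Lemma affine_weyl_rf f : Phi f.1 -> affine_weyl (rf f).
Proof.
move=> Pf0; wlog Pf : f Pf0 / aff_pos f.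
  move=> H; case: (aff_pos_or Pf0) => h; first exact: H.
  have [s Ts sE] := H _ h.1 h; exists s => // x; by rewrite sE rf_neg.
have [m] := ubnP (ncard [set g | aff_pos g /\ ev g p < ev f p]).
elim: m f Pf0 Pf => // m IH f Pf0 Pf fm.
have : ev f (rf f p) < 0 by rewrite ev_self// oppr_lt0; exact: Pf.2.
have := ev_self p Pf0; move=> _ h0.
have [t [Tt tq]] := wall_exists Pf h0; have Pt := wall_root Tt.
have isw1 (u : 'cV[R]_n * int) : wall u -> affine_weyl (rf u).
  by move=> Tu; exists [:: u] => // v; rewrite inE => /eqP ->.
have [e|tf] := eqVneq t f; first by rewrite -e; exact: isw1.
have Pc : aff_pos (cmp f t).
  by split; [exact: cmp_root|rewrite ev_cmp//; apply: Tt.2 => // /eqP; rewrite eq_sym (negbTE tf)].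
have lt : ev (cmp f t) p < ev f p.
  rewrite ev_cmp// /ev /rf dotvB dotvZ -/(ev t p); rewrite ltrD2r gtrBl pmulr_rgt0 ?Tt.1.2//.
  move: tq; rewrite {1}/ev /rf dotvB dotvZ addrAC -/(ev t p) subr_lt0 => h.
  have : 0 < ev f p * dotv (coroot f.1) t.1 by apply: lt_trans h; exact: Tt.1.2.
  rewrite pmulr_rgt0 ?Pf.2// /coroot !dotvZ (dotvC t.1).
  rewrite pmulr_rgt0 ?divr_gt0 ?dotv_gt0 ?(root_nz hPhi Pf0)// => h'.
  by rewrite pmulr_rgt0 ?divr_gt0 ?dotv_gt0 ?(root_nz hPhi Pt).
have [|s Ts sE] := IH (cmp f t) Pc.1 Pc.
  rewrite -ltnS (leq_ltn_trans _ fm)//; apply: (@ncard_lt _ _ _ id (cmp f t)) => //; try exact: fin_low.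
  by move=> g [Pg gl]; split; [split => //; exact: lt_trans gl lt|apply/eqP => e; move: gl; rewrite e ltxx].
have H := affine_weyl_comp (affine_weyl_comp (isw1 _ Tt) (ex_intro2 _ _ s Ts sE)) (isw1 _ Tt).
have [s' Ts' s'E] := H; exists s' => // x; rewrite s'E -rf_comm// rfK//.
Qed.

Lemma affine_weyl_weyl w l : W w -> L l -> affine_weyl (fun x => w *m x + l).
Proof.
move=> Ww Ll.
have h1 : affine_weyl (fun x => w *m x).
  move: w Ww; apply: weyl_smallest => [|u v hu hv|a Pa].
  - by exists [::] => // x; rewrite /= mul1mx.
  - by have [s Ts sE] := affine_weyl_comp hu hv; exists s => // x; rewrite sE mulmxA.
  - by have [s Ts sE] := @affine_weyl_rf (a, 0) Pa; exists s => // x; rewrite sE rfE scale0r subr0.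
have h2 : affine_weyl (fun x => x + l).
  move: l Ll; apply: lattice_smallest => [|u v hu hv|a Pa].
  - by exists [::] => // x; rewrite addr0.
  - have hv' := affine_weyl_inv hv (fun x => subrK v x).
    by have [s Ts sE] := affine_weyl_comp hu hv'; exists s => // x; rewrite sE addrA addrAC.
  - have [s Ts sE] := affine_weyl_comp (@affine_weyl_rf (a, -1) Pa) (@affine_weyl_rf (a, 0) Pa).
    exists s => // x; rewrite sE !rfE scale0r subr0 refl_inv ?(root_nz hPhi)//.
    by rewrite scaleN1r opprK.
by have [s Ts sE] := affine_weyl_comp h2 h1; exists s => // x; rewrite sE.
Qed.

Lemma act_weyl s : wall_word s -> exists w l, [/\ W w, L l & forall x, act s x = w *m x + l].
Proof.
elim: s => [|t s IH].
  by move=> _; exists 1%:M, 0; split; [exact: weyl1|exact: lattice0|move=> x; rewrite mul1mx addr0].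
move=> /wall_word_cons[Tt Ts]; have [w [l [Ww Ll sE]]] := IH Ts; have Pt := wall_root Tt.
exists (refl t.1 *m w), (refl t.1 *m l - t.2%:~R *: coroot t.1); split.
- by apply: weylM => //; exact: weyl_refl.
- apply: latticeB; first by apply: weyl_lattice => //; exact: weyl_refl.
  by apply: latticeZ; exact: lattice_coroot.
- by move=> x; rewrite /= rfE sE mulmxDr mulmxA addrA.
Qed.

(** The values of positive roots at [p] being strictly between 0 and 1, an affine root positive at
    [p] has a constant term at least 0 over a positive root and at least 1 over a negative one. *)
Lemma AbarP x : Abar x <-> forall a, pos_roots Phi Delta a -> 0 <= dotv x a <= 1.
Proof.
split=> [Ax a Pa|h f [Pf f0]].
  have /andP[p0 p1] := pA Pa; have Pa1 := Pa.1.
  have := Ax (a, 0); have := Ax (- a, 1); rewrite /aff_pos /ev /= !dotvNr !addr0.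
  move=> h1 h2; rewrite h2//=; have : 0 <= - dotv x a + 1 by apply: h1; split; [exact: root_opp|lra].
  by lra.
have intge (m : int) (r : R) : r < m%:~R -> -1 <= r -> 0 <= m%:~R :> R.
  move=> h1 h2; rewrite ler0z; have : (-1)%:~R < m%:~R :> R by apply: le_lt_trans h1.
  by rewrite ltr_int; lia.
case: (pos_or_neg Pf) => Pa; have /andP[p0 p1] := pA Pa; have /andP[x0 x1] := h _ Pa.
  have := intge f.2 (- dotv p f.1); rewrite /ev in f0 *; lra.
rewrite /ev !dotvNr in f0 p0 p1 x0 x1 *.
have : 1 <= f.2%:~R :> R.
  rewrite -[1]/(1%:~R) ler_int; have : 0%:~R < f.2%:~R :> R by rewrite mulr0z; lra.
  by rewrite ltr_int; lia.
lra.
Qed.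

Lemma openP x : alcove Phi Delta x -> forall f, aff_pos f -> 0 < ev f x.
Proof.
move=> xA f Pf; have := (AbarP x).2; rewrite /Abar => H.
have h0 : 0 <= ev f x by apply: H => // a Pa; have /andP[a0 a1] := xA a Pa; rewrite !ltW.
have : ev f x != 0.
  have Pfr := Pf.1; apply/eqP => e.
  case: (pos_or_neg Pfr) => Pa; have /andP[p0 p1] := pA Pa; have /andP[x0 x1] := xA _ Pa.
    have [_ f0] := Pf; rewrite /ev in e f0.
    have e1 : f.2%:~R = - dotv x f.1 by apply/eqP; rewrite -addr_eq0 addrC e.
    have : (-1)%:~R < f.2%:~R :> R by rewrite e1; lra.
    have : f.2%:~R < 0%:~R :> R by rewrite e1; lra.
    by rewrite !ltr_int; lia.
  rewrite dotvNr in x0 x1 p0 p1; have [_ f0] := Pf; rewrite /ev in e f0.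
  have e1 : f.2%:~R = - dotv x f.1 by apply/eqP; rewrite -addr_eq0 addrC e.
  have : 0%:~R < f.2%:~R :> R by rewrite e1; lra.
  have : f.2%:~R < 1%:~R :> R by rewrite e1; lra.
  by rewrite !ltr_int; lia.
by move=> n0; rewrite lt_neqAle eq_sym n0.
Qed.
End weyl_group.

(** * The alcove and the chamber as fundamental domains *)

Section alcoves.
Context {R : realType} {n : nat}.
Variables (Phi : set 'cV[R]_n) (Delta : 'I_n -> 'cV[R]_n).
Hypothesis hPhi : simple_root_system Phi.
Hypothesis hDelta : simple_roots Phi Delta.
Implicit Types (a b x y q : 'cV[R]_n) (w u v : 'M[R]_n).
Local Notation L := (coroot_lattice Phi).
Local Notation W := (weyl Phi).
Local Notation pos := (pos_roots Phi Delta).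

Lemma pos_gt0 x a : chamber Delta x -> pos a -> 0 < dotv x a.
Proof.
move=> xC [Pa [c aE]]; rewrite lt0r; apply/andP; split; last first.
  rewrite aE dotv_sumr; apply: sumr_ge0 => i _; rewrite dotvZr mulr_ge0// ltW//; exact: xC.
apply/eqP => e; have := root_nz hPhi Pa; rewrite aE big1 ?eqxx// => i _.
have := e; rewrite aE dotv_sumr => /eqP; rewrite psumr_eq0 => [/allP/(_ i (mem_index_enum i))|l _].
  by rewrite dotvZr mulf_eq0 (gt_eqF (xC i)) orbF => /eqP ->; rewrite scale0r.
by rewrite dotvZr mulr_ge0// ltW//; exact: xC.
Qed.

Lemma chamber_scale x : chamber Delta x ->
  exists2 e : R, 0 < e & forall d, 0 < d <= e -> alcove Phi Delta (d *: x).
Proof.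
move=> xC; have [C C0 CP] := fin_bound (fun a => dotv x a) (roots_finite hPhi).
exists (C + 1)^-1; first by rewrite invr_gt0 ltr_wpDl.
move=> d /andP[d0 dC] a Pa; rewrite dotvZ mulr_gt0 ?pos_gt0//=.
have xa := CP _ Pa.1; have C1 : 0 < C + 1 by rewrite ltr_wpDl.
apply: (@le_lt_trans _ _ (d * C)); first by rewrite ler_wpM2l// ltW.
by apply: (@le_lt_trans _ _ ((C + 1)^-1 * C)); [rewrite ler_wpM2r|rewrite mulrC ltr_pdivrMr// mul1r ltrDl].
Qed.

Lemma chamber_nonempty : exists x, chamber Delta x.
Proof.
pose D : 'M[R]_n := \matrix_(i, j) Delta j i ord0.
have Dt : D^T \in unitmx by rewrite unitmx_tr; exact: (simple_free hDelta).
exists (invmx D^T *m const_mx 1) => i.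
have := mulKVmx Dt (const_mx 1 : 'cV[R]_n) => /matrixP/(_ i ord0).
rewrite [RHS]mxE mxE => e; rewrite (_ : dotv _ _ = 1)// -[RHS]e.
by apply: eq_bigr => l _; rewrite !mxE mulrC.
Qed.

Lemma alcove_nonempty : exists x, alcove Phi Delta x.
Proof.
have [x xC] := chamber_nonempty; have [e e0 eP] := chamber_scale xC.
by exists (e *: x); apply: eP; rewrite e0 lexx.
Qed.

(** For the converse, a point satisfying the weak inequalities is approached along the segment
    towards an interior point. *)
Lemma closure_alcove x : closure (alcove Phi Delta) x <-> forall a, pos a -> 0 <= dotv x a <= 1.
Proof.
have [p pA] := alcove_nonempty.
split=> [cx a Pa|h].
  pose C : R := 1 + \sum_i `|a i ord0|.
  have C0 : 0 < C by rewrite ltr_pwDl// sumr_ge0.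
  have near (e : R) : 0 < e -> exists2 y, alcove Phi Delta y & `|dotv x a - dotv y a| <= e.
    move=> e0; have [y [yA yx]] := cx _ (nbhsx_ballx x (e / C) (divr_gt0 e0 C0)).
    exists y => //; rewrite -dotvB /dotv; apply: le_trans (ler_norm_sum _ _ _) _.
    apply: (@le_trans _ _ (\sum_i e / C * `|a i ord0|)).
      apply: ler_sum => i _; rewrite normrM ler_wpM2r//.
      by have := yx.2 i ord0; rewrite /ball /= !mxE => /ltW.
    by rewrite -mulr_sumr mulrAC ler_pdivrMr// ler_pM2l// /C lerDr.
  apply/andP; split; rewrite leNgt; apply/negP => lt.
    have [|y /(_ _ Pa)/andP[y0 _]] := near (- dotv x a / 2); first by rewrite divr_gt0// oppr_gt0.
    rewrite ler_norml => /andP[]; lra.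
  have [|y /(_ _ Pa)/andP[_ y1]] := near ((dotv x a - 1) / 2); first by rewrite divr_gt0// subr_gt0.
  rewrite ler_norml => /andP[]; lra.
move=> B /nbhs_ballP[e /= e0 eB].
pose C : R := 1 + \sum_i `|p i ord0 - x i ord0|.
have C0 : 0 < C by rewrite ltr_pwDl// sumr_ge0.
pose d := Num.min 1 (e / 2 / C).
have d0 : 0 < d by rewrite lt_min ltr01 !divr_gt0.
have d1 : d <= 1 by rewrite ge_min lexx.
have dC : d * C < e.
  apply: (@le_lt_trans _ _ (e / 2)); last by rewrite ltr_pdivrMr// ltr_pMr// ltr1n.
  by rewrite -ler_pdivlMr// ge_min lexx orbT.
exists (x + d *: (p - x)); split.
  move=> a Pa; rewrite dotvD dotvZ dotvB; have /andP[x0 x1] := h a Pa; have /andP[p0 p1] := pA a Pa.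
  move: (dotv x a) (dotv p a) x0 x1 p0 p1 => r t; clear -d0 d1; nra.
apply: eB; split=> // i j; rewrite ord1 /ball /= !mxE opprD addrA subrr sub0r normrN normrM gtr0_norm//.
apply: le_lt_trans dC; rewrite ler_pM2l// /C (bigD1 i)//= addrCA lerDl.
by rewrite addr_ge0// sumr_ge0.
Qed.

Lemma alcove_uniq x y w l : closure (alcove Phi Delta) x -> closure (alcove Phi Delta) y ->
  W w -> L l -> w *m x + l = y -> x = y.
Proof.
have [p pA] := alcove_nonempty.
move=> /closure_alcove/(AbarP hPhi hDelta pA) Ax /closure_alcove/(AbarP hPhi hDelta pA) Ay Ww Ll e.
have [s Ts sE] := affine_weyl_weyl hPhi hDelta pA Ww Ll.
by apply: (closed_uniq hPhi hDelta pA (leqnn (size s)) Ts Ax Ay); rewrite sE.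
Qed.

Lemma alcove_stab x y w l : alcove Phi Delta x -> closure (alcove Phi Delta) y ->
  W w -> L l -> w *m x + l = y -> w = 1%:M.
Proof.
have [p pA] := alcove_nonempty.
move=> /(openP hPhi hDelta pA) Ax /closure_alcove/(AbarP hPhi hDelta pA) Ay Ww Ll e.
have [s Ts sE] := affine_weyl_weyl hPhi hDelta pA Ww Ll.
have H : forall z, w *m z + l = z.
  move=> z; rewrite -sE; apply: (open_stab hPhi hDelta pA (leqnn (size s)) Ts Ax).
  by rewrite sE e.
have l0 : l = 0 by have := H 0; rewrite mulmx0 add0r.
apply/matrixP => i j; have := H (delta_mx j ord0); rewrite l0 addr0 => /matrixP/(_ i ord0).
rewrite mxE (bigD1 j)//= big1 => [|u uj]; last by rewrite [delta_mx _ _ _ _]mxE (negbTE uj) mulr0.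
by rewrite addr0 [delta_mx _ _ _ _]mxE !eqxx mulr1 => ->; rewrite !mxE andbT.
Qed.

Lemma alcove_exists x : exists w y, [/\ W w, closure (alcove Phi Delta) y & L (x - w *m y)].
Proof.
have [p pA] := alcove_nonempty.
have [s [Ts As]] := word_exists hPhi hDelta pA x; have [w [l [Ww Ll sE]]] := act_weyl hPhi Ts.
exists w^T, (act s x); split; first exact: weyl_tr.
  by apply/closure_alcove/(AbarP hPhi hDelta pA).
rewrite sE mulmxDr mulmxA (weyl_orth hPhi Ww) mul1mx opprD addrA subrr sub0r.
by apply: latticeN; apply: weyl_lattice => //; exact: weyl_tr.
Qed.

(** Such a point satisfies [(x, a) = 0] or [(x, a) = 1] for a positive root, and the linear
    reflection in [a] moves it by an integral multiple of the coroot. *)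
Lemma alcove_boundary x : closure (alcove Phi Delta) x -> ~ alcove Phi Delta x ->
  exists w, [/\ W w, \det w = -1 & L (w *m x - x)].
Proof.
move=> /closure_alcove cx /existsNP[a /not_implyP[Pa /negP]].
have /andP[a0 a1] := cx a Pa; rewrite negb_and -!leNgt => h.
exists (refl a); split; [exact: weyl_refl Pa.1|exact: det_refl (root_nz hPhi Pa.1)|].
rewrite reflE addrAC subrr sub0r; apply: latticeN.
have [m ->] : exists m : int, dotv x a = m%:~R.
  by case/orP: h => h; [exists 0|exists 1]; apply/eqP; rewrite eq_le ?a0 ?a1 ?h.
by apply: latticeZ; apply: lattice_coroot; case: Pa.
Qed.

(** The element maximising the pairing of [w *m x] with a point of the chamber works: a negative
    pairing with a simple root could be reflected away, increasing it. *)
Lemma chamber_exists x : (forall a, Phi a -> dotv x a != 0) -> exists2 w, W w & chamber Delta (w *m x).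
Proof.
move=> xr; have [p pC] := chamber_nonempty.
have [w Ww wP] := fin_argmin (fun w => - dotv (w *m x) p) (weyl_finite hPhi hDelta)
  (ex_intro _ _ (@weyl1 _ _ Phi) : W !=set0).
exists w => // i; have Pi := simple_in hDelta i.
have := wP _ (weylM (weyl_refl Pi) Ww); rewrite lerN2 -mulmxA reflE dotvB dotvZ gerBl.
have Dp : 0 < dotv (coroot (Delta i)) p.
  by rewrite /coroot dotvZ mulr_gt0 ?divr_gt0 ?dotv_gt0 ?(root_nz hPhi)// dotvC; exact: pC.
rewrite pmulr_lge0// le0r => /orP[/eqP e|//].
have : dotv x (w^T *m Delta i) = 0 by rewrite -e dotvC dotv_mulmx trmxK dotvC.
by move=> /eqP; rewrite (negbTE (xr _ (weyl_root hPhi (weyl_tr Ww) Pi))).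
Qed.

(** Rescaling brings both points into the alcove, where [alcove_stab] applies with a zero
    translation. *)
Lemma chamber_uniq x w : chamber Delta x -> W w -> chamber Delta (w *m x) -> w = 1%:M.
Proof.
move=> xC Ww wC; have [e e0 eP] := chamber_scale xC; have [e' e'0 eP'] := chamber_scale wC.
pose d := Num.min e e'; have d0 : 0 < d by rewrite lt_min e0 e'0.
have A1 : alcove Phi Delta (d *: x) by apply: eP; rewrite d0 ge_min lexx.
have A2 : alcove Phi Delta (d *: (w *m x)) by apply: eP'; rewrite d0 ge_min lexx orbT.
apply: (alcove_stab A1 (subset_closure A2) Ww (@lattice0 _ _ Phi)).
by rewrite addr0 -scalemxAr.
Qed.
End alcoves.

(** * Density of the Schwartz functions *)

Section bumps.
Context {R : realType} {n : nat}.
Implicit Types (f g : 'cV[R]_n -> R) (x y v : 'cV[R]_n).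

(** An integrable weight with a known integral; multiples of its products over the coordinates
    dominate the Schwartz functions and the approximations of boxes. *)
Definition cauw (t : R) : R := (1 + t ^+ 2)^-1.

Lemma cauw_gt0 t : 0 < cauw t.
Proof. by rewrite invr_gt0 ltr_pwDl// sqr_ge0. Qed.

Lemma cauw_le1 t : cauw t <= 1.
Proof. by rewrite invf_le1 ?ltr_pwDl ?sqr_ge0// lerDl sqr_ge0. Qed.

Lemma continuous_cauw : continuous cauw.
Proof. exact: continuous_oneDsqrV. Qed.

Lemma integral_cauw : (\int[@lebesgue_measure R]_t (cauw t)%:E < +oo)%E.
Proof.
rewrite ge0_symfun_integralT.
- rewrite (_ : [set x : R | 0 <= x] = `[0, +oo[%classic).
    by rewrite (integral0y_oneDsqr R) -EFinM ltry.
  by apply/seteqP; split => x /=; rewrite in_itv/= andbT.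
- by move=> t; rewrite ltW// cauw_gt0.
- exact: continuous_cauw.
- by move=> t; rewrite /= /cauw sqrrN.
Qed.

Definition cauws m (x : 'cV[R]_m) : R := \prod_i cauw (x i ord0).

Lemma cauws_gt0 m (x : 'cV[R]_m) : 0 < cauws x.
Proof. by apply: prodr_gt0 => i _; exact: cauw_gt0. Qed.

Lemma cauws_le1 m (x : 'cV[R]_m) : cauws x <= 1.
Proof. by apply: prodr_ile1 => i _; rewrite cauw_le1 ltW// cauw_gt0. Qed.

Lemma measurable_cauws m : measurable_fun setT (@cauws m).
Proof.
apply: measurable_prod => i _; apply: measurableT_comp (measurable_cV_coord i).
exact: continuous_measurable_fun continuous_cauw.
Qed.

Lemma cauws_cons m (t : R) (v : 'cV[R]_m) : cauws (cV_cons (t, v)) = cauw t * cauws v.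
Proof.
rewrite /cauws big_ord_recl; congr (cauw _ * _).
  by have /(congr1 fst) /= -> := cV_consK (t, v).
apply: eq_bigr => i _; congr (cauw _).
have := @col_mxEd R 1 m 1 (t%:M) v i ord0 => <-.
by rewrite /cV_cons/=; congr (col_mx _ _ _ _); exact: val_inj.
Qed.

Lemma integral_cauws m : (\int[lebesgue_cV m]_x (cauws x)%:E < +oo)%E.
Proof.
have mE p : measurable_fun setT (fun x : 'cV[R]_p => (cauws x)%:E).
  by apply/measurable_EFinP; exact: measurable_cauws.
elim: m => [|m IH] /=.
  rewrite integral_dirac; last exact: mE.
    by rewrite diracE mem_setT mul1e ltry.
  by [].
have -> : (\int[leb_step (lebesgue_cV m)]_x (cauws x)%:E =
    \int[(@lebesgue_measure R \x lebesgue_cV m)%E]_p ((cauw p.1 : R)%:E * (cauws p.2)%:E))%E.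
  rewrite /leb_step ge0_integral_pushforward//=.
  - by rewrite preimage_setT; apply: eq_integral => -[t v] _; rewrite /= cauws_cons EFinM.
  - exact: measurable_cV_cons.
  - exact: mE.
  - by move=> y _; rewrite lee_fin ltW// cauws_gt0.
have m1 : measurable_fun setT (fun t : measurableTypeR R => (cauw t)%:E).
  by apply/measurable_EFinP; exact: continuous_measurable_fun continuous_cauw.
rewrite fubini_tonelli1/=.
- rewrite /fubini_F /=.
  under eq_integral => t _.
    rewrite ge0_integralZl//=; last 3 first.
    + exact: mE.
    + by move=> v _; rewrite lee_fin ltW// cauws_gt0.
    + by rewrite lee_fin ltW// cauw_gt0.
    over.
  rewrite ge0_integralZr//=.
  + rewrite lte_mul_pinfty//.
      by apply: integral_ge0 => t _; rewrite lee_fin ltW// cauw_gt0.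
    rewrite ge0_fin_numE ?integral_cauw//.
    by apply: integral_ge0 => t _; rewrite lee_fin ltW// cauw_gt0.
  + by move=> t _; rewrite lee_fin ltW// cauw_gt0.
  + by apply: integral_ge0 => v _; rewrite lee_fin ltW// cauws_gt0.
- apply: emeasurable_funM; first exact: (measurableT_comp m1 measurable_fst).
  exact: (measurableT_comp (mE m) measurable_snd).
- by move=> p; rewrite mule_ge0// lee_fin ltW// ?cauw_gt0 ?cauws_gt0.
Qed.

Lemma integral_volk_cauws k : (\int[@volk R n k]_x (cauws x)%:E < +oo)%E.
Proof.
rewrite /volk ge0_integral_mscale//=; last 2 first.
- by apply/measurable_EFinP; exact: measurable_cauws.
- by move=> x _; rewrite lee_fin ltW// cauws_gt0.
rewrite lte_mul_pinfty ?lee_fin ?exprn_ge0//; exact: integral_cauws.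
Qed.

Lemma dotv_cauws x : (cauws x)^-1 <= (1 + dotv x x) ^+ n.
Proof.
rewrite /cauws -prodfV (_ : (1 + dotv x x) ^+ n = \prod_(i < n) (1 + dotv x x)); last first.
  by rewrite prodr_const card_ord.
apply: ler_prod => i _; rewrite /cauw invrK addr_ge0 ?sqr_ge0//= lerD2l; exact: coord_sqr_le.
Qed.

Lemma dotv_prod x N : (1 + dotv x x) ^+ N <= \prod_i (1 + x i ord0 ^+ 2) ^+ N.
Proof.
rewrite prodrXl lerXn2r ?nnegrE ?addr_ge0 ?dotv_ge0//.
  by apply: prodr_ge0 => i _; rewrite addr_ge0 ?sqr_ge0.
rewrite /dotv; elim: (index_enum _) => [|i s IH]; first by rewrite !big_nil addr0.
rewrite !big_cons; set A := \prod_(_ <- _) _ in IH *; set C := \sum_(_ <- _) _ in IH *.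
have C0 : 0 <= C by apply: sumr_ge0 => l _; rewrite -expr2 sqr_ge0.
rewrite -expr2; have := sqr_ge0 (x i ord0); move: (x i ord0 ^+ 2) => a a0; nra.
Qed.

Lemma is_derive_line f x v d : is_derive (0 : R) (1 : R) (fun t => f (t *: v + x)) d ->
  is_derive x v f d.
Proof.
move=> [H1 H2].
have E : (fun h : R => h^-1 *: (((fun t => f (t *: v + x)) \o shift 0) (h *: (1 : R)) - f (0 *: v + x))) =
    (fun h : R => h^-1 *: ((f \o shift x) (h *: v) - f x)).
  by apply/funext => h; rewrite /= addr0 scale0r add0r [h *: 1]mulr1.
split; first by move: H1; rewrite /derivable /= E.
by rewrite -H2 /derive E.
Qed.

Lemma derivable_line f x v t : derivable f (t *: v + x) v ->
  is_derive t (1 : R) (fun t => f (t *: v + x)) ('D_v f (t *: v + x)).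
Proof.
move=> H.
have E : (fun h : R => h^-1 *: (((fun t => f (t *: v + x)) \o shift t) (h *: (1 : R)) - f (t *: v + x))) =
    (fun h : R => h^-1 *: ((f \o shift (t *: v + x)) (h *: v) - f (t *: v + x))).
  by apply/funext => h; rewrite /= scalerDl [h *: 1]mulr1 addrA.
split; first by rewrite /derivable /= E.
by rewrite /derive E.
Qed.

Lemma line_lipschitz f v (M : R) : (forall x, derivable f x v) -> (forall x, `|'D_v f x| <= M) ->
  forall x t, `|f (t *: v + x) - f x| <= M * `|t|.
Proof.
move=> df fM x t.
pose g := fun t => f (t *: v + x).
have dg s : is_derive s (1 : R) g ('D_v f (s *: v + x)) by exact: derivable_line.
have key (a b : R) : a < b -> `|g b - g a| <= M * `|b - a|.
  move=> ab; have [|c _ ->] := @MVT R g (fun s => 'D_v f (s *: v + x)) a b ab (fun s _ => dg s).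
    by apply: continuous_subspaceT => s; apply/differentiable_continuous/derivable1_diffP; exact: ex_derive.
  by rewrite normrM ler_wpM2r.
have -> : f x = g 0 by rewrite /g scale0r add0r.
have [t0|t0|->] := ltgtP t 0; last by rewrite subrr normr0 mulr0.
- by have := key _ _ t0; rewrite distrC sub0r normrN.
- by have := key _ _ t0; rewrite subr0.
Qed.

Lemma coord_lipschitz f (M : R) : (forall i x, derivable f x (delta_mx i ord0)) ->
  (forall i x, `|'D_(delta_mx i ord0) f x| <= M) ->
  forall x y, `|f x - f y| <= M * \sum_i `|x i ord0 - y i ord0|.
Proof.
move=> df fM x y.
pose z (s : seq 'I_n) := \sum_(i <- s) (x i ord0 - y i ord0) *: (delta_mx i ord0 : 'cV[R]_n) + y.
have -> : x = z (index_enum 'I_n).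
  rewrite /z; apply/matrixP => i l; rewrite ord1 mxE summxE (bigD1 i)//= big1.
    by rewrite !mxE !eqxx mulr1 addr0 subrK.
  by move=> l' l'i; rewrite !mxE eq_sym (negbTE l'i) mulr0.
have -> : \sum_i `|z (index_enum 'I_n) i ord0 - y i ord0| = \sum_(i <- index_enum 'I_n) `|x i ord0 - y i ord0|.
  apply: eq_bigr => i _; rewrite /z mxE addrK summxE (bigD1 i)//= big1 ?addr0.
    by rewrite !mxE !eqxx mulr1.
  by move=> l li; rewrite !mxE eq_sym (negbTE li) mulr0.
elim: (index_enum _) => [|i s IH]; first by rewrite /z !big_nil add0r subrr normr0 mulr0.
rewrite /z !big_cons -addrA -/(z s) mulrDr -(subrK (f (z s)) (f _)) -addrA.
apply: le_trans (ler_normD _ _) _; apply: lerD => //; exact: line_lipschitz.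
Qed.

(** Schwartz functions are given through partial derivatives, whose bounds yield this estimate; then
    [f] is the limit of its values at the corners of ever finer cubes. *)
Lemma lipschitz_measurable f (M : R) :
  (forall x y, `|f x - f y| <= M * \sum_i `|x i ord0 - y i ord0|) -> measurable_fun setT f.
Proof.
move=> fM.
pose B (m : nat) : 'M[R]_n := (m.+1%:R^-1)%:M.
have Bu m : B m \in unitmx by rewrite unitmxE det_scalar unitfE expf_neq0// invr_eq0.
apply: (@measurable_fun_cvg _ _ _ setT (fun m x => f (lat (B m) (fl (B m) x)))).
  move=> m _ Y mY; rewrite setTI.
  rewrite (_ : _ @^-1` Y = \bigcup_z [set x | fl (B m) x = z /\ Y (f (lat (B m) z))]); last first.
    by apply/seteqP; split => [x Yx|x [z _ /= [<- Yz]]]//; exists (fl (B m) x).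
  apply: countable_bigcupT_measurable => [|z]; first exact: countableP.
  have [Yz|nYz] := pselect (Y (f (lat (B m) z))); last first.
    by rewrite (_ : [set _ | _] = set0)//; apply/seteqP; split => x // -[].
  rewrite (_ : [set _ | _] = (fun x => x - lat (B m) z) @^-1` cellB (B m)).
    by rewrite -[X in measurable X]setTI; apply: measurable_addv => //; exact: measurable_cellB.
  apply/seteqP; split => x /=; first by move=> [<- _]; exact: cell_fl.
  by move=> H; rewrite -(fl_cell (Bu m) H); split.
move=> x _; apply/cvgrPdist_le => e e0.
near=> m.
apply: le_trans (fM _ _) _.
apply: (@le_trans _ _ (`|M| * \sum_i `|x i ord0 - lat (B m) (fl (B m) x) i ord0|)).
  by rewrite ler_wpM2r ?ler_norm// sumr_ge0.
apply: (@le_trans _ _ (`|M| * \sum_(i < n) m.+1%:R^-1)).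
  rewrite ler_wpM2l//; apply: ler_sum => i _.
  have /(_ i) := cell_fl (Bu m) x.
  have iB : invmx (B m) = (m.+1%:R)%:M.
    by rewrite /B invmx_scalar invrK.
  rewrite /crd iB mul_scalar_mx mxE => /andP[h1 h2].
  move: h1 h2; rewrite pmulr_rge0// mulrC -ltr_pdivlMr// div1r => h1 h2.
  by move: h1 h2; move: (lat _ _) => u; rewrite !mxE => h1 h2; rewrite ger0_norm//; exact: ltW.
rewrite sumr_const card_ord -[_ *+ n]mulr_natl mulrA ler_pdivrMr// -ler_pdivrMl//.
apply: le_trans (_ : m%:R <= _); last by rewrite ler_nat.
by near: m; exact: nbhs_infty_ger.
Unshelve. all: by end_near. Qed.

Lemma schwartzR_der f s : schwartzR f -> schwartzR (pderiv s f).
Proof.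
move=> H s'; have E : pderiv s' (pderiv s f) = pderiv (s' ++ s) f by rewrite /pderiv foldr_cat.
by rewrite E; exact: H.
Qed.

Lemma schwartzR_bound f N : schwartzR f -> exists M, forall x, (1 + dotv x x) ^+ N * `|f x| <= M.
Proof. by move=> /(_ [::])[_ /(_ N)]. Qed.

Lemma schwartzR_measurable f : schwartzR f -> measurable_fun setT f.
Proof.
move=> sf.
have : forall i, exists M, forall x, `|'D_(delta_mx i ord0) f x| <= M.
  move=> i; have [M HM] := schwartzR_bound 0 (schwartzR_der [:: i] sf).
  by exists M => x; have := HM x; rewrite expr0 mul1r.
move=> /choice[M HM].
apply: (@lipschitz_measurable f (\sum_i `|M i|)); apply: coord_lipschitz.
  by move=> i x; have [+ _] := sf [::]; exact.
move=> i x; apply: le_trans (HM i x) _; apply: le_trans (ler_norm _) _.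
by rewrite (bigD1 i)//= lerDl sumr_ge0.
Qed.

Lemma schwartzR_cauws f : schwartzR f -> exists M, forall x, `|f x| <= M * cauws x.
Proof.
move=> /(schwartzR_bound n)[M HM]; exists M => x.
rewrite -ler_pdivrMr ?cauws_gt0// mulrC; apply: le_trans (HM x).
by rewrite ler_wpM2r// dotv_cauws.
Qed.

Lemma schwartzR_lin (a b : R) f g : schwartzR f -> schwartzR g ->
  schwartzR (fun x => a * f x + b * g x).
Proof.
move=> sf sg.
have E s : pderiv s (fun x => a * f x + b * g x) = (fun x => a * pderiv s f x + b * pderiv s g x).
  elim: s => [//|i s IH] /=; apply/funext => x; rewrite IH.
  have [/(_ i x) df _] := sf s; have [/(_ i x) dg _] := sg s.
  have -> : (fun x => a * pderiv s f x + b * pderiv s g x) = (a *: pderiv s f + b *: pderiv s g) by [].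
  have df' := is_deriveZ a (DeriveDef df erefl); have dg' := is_deriveZ b (DeriveDef dg erefl).
  by have [_ ->] := is_deriveD df' dg'.
move=> s; rewrite E; split=> [i x|N].
  have [/(_ i x) df _] := sf s; have [/(_ i x) dg _] := sg s.
  by apply: derivableD; exact: derivableZ.
have [_ /(_ N)[M1 H1]] := sf s; have [_ /(_ N)[M2 H2]] := sg s.
exists (`|a| * M1 + `|b| * M2) => x.
apply: (@le_trans _ _ ((1 + dotv x x) ^+ N * (`|a| * `|pderiv s f x| + `|b| * `|pderiv s g x|))).
  rewrite ler_wpM2l ?exprn_ge0 ?addr_ge0 ?dotv_ge0//.
  by apply: le_trans (ler_normD _ _) _; rewrite !normrM.
by rewrite mulrDr lerD// mulrCA ler_wpM2l.
Qed.

Lemma schwartz_lin c (F G : 'cV[R]_n -> R[i]) : schwartz F -> schwartz G ->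
  schwartz (fun x => c * F x + G x).
Proof.
move=> [F1 F2] [G1 G2]; case: c => a b; split.
  have := schwartzR_lin 1 1 (schwartzR_lin a (- b) F1 F2) G1.
  congr schwartzR; apply/funext => x; case: (F x) => u v; case: (G x) => u' v'.
  by rewrite /= !mul1r mulNr.
have := schwartzR_lin 1 1 (schwartzR_lin a b F2 F1) G2.
congr schwartzR; apply/funext => x; case: (F x) => u v; case: (G x) => u' v'.
by rewrite /= !mul1r.
Qed.

Lemma schwartz_cmeas (F : 'cV[R]_n -> R[i]) : schwartz F -> cmeasurable F.
Proof. by move=> [F1 F2]; split; exact: schwartzR_measurable. Qed.

Lemma schwartzR_int k f : schwartzR f -> (@volk R n k).-integrable setT (EFin \o f).
Proof.
move=> sf; have [M HM] := schwartzR_cauws sf.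
apply: (@le_integrable _ _ _ _ _ measurableT _ (fun x => (M%:E * (cauws x)%:E)%E)).
- by apply/measurable_EFinP; exact: schwartzR_measurable.
- move=> x _; rewrite /= lee_fin; apply: le_trans (HM x) _; exact: ler_norm.
apply: integrableZl => //; apply/integrableP; split.
  by apply/measurable_EFinP; exact: measurable_cauws.
under eq_integral do rewrite gee0_abs ?lee_fin ?(ltW (cauws_gt0 _))//.
exact: integral_volk_cauws.
Qed.

Lemma schwartz_int k (F : 'cV[R]_n -> R[i]) : schwartz F -> cintegrable (@volk R n k) setT F.
Proof. by move=> [F1 F2]; split; exact: schwartzR_int. Qed.

Lemma cauws_L2 k : (nsq (@volk R n k) setT (fun x => toC (cauws x)) < +oo)%E.
Proof.
apply: le_lt_trans (integral_volk_cauws k); apply: ge0_le_integral => //.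
- by move=> x _; rewrite lee_fin sqnormc_ge0.
- by apply: cmeas_sqnormcE; apply: cmeas_toC; exact: measurable_cauws.
- by apply/measurable_EFinP; exact: measurable_cauws.
move=> x _; rewrite lee_fin sqnormc_toC expr2 ler_piMr// ?cauws_le1//; exact/ltW/cauws_gt0.
Qed.

Lemma schwartz_L2 k (F : 'cV[R]_n -> R[i]) : schwartz F -> L2 k F.
Proof.
move=> sF; split; first exact: schwartz_cmeas.
have [[M1 H1] [M2 H2]] := (schwartzR_cauws sF.1, schwartzR_cauws sF.2).
have mi : cmeasurable (fun x : 'cV[R]_n => toC (cauws x)) by apply: cmeas_toC; exact: measurable_cauws.
have : (nsq (@volk R n k) setT (fun x => (toC (`|M1| + `|M2|) * toC (cauws x))%R) < +oo)%E.
  rewrite nsqZ// lte_mul_pinfty ?lee_fin ?sqnormc_ge0//; exact: cauws_L2.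
apply: le_lt_trans; apply: le_nsq => //; first exact: schwartz_cmeas.
  exact: cmeasZ.
move=> x _; rewrite sqnormcM !sqnormc_toC /sqnormc.
have h1 := le_trans (H1 x) (ler_wpM2r (ltW (cauws_gt0 x)) (ler_norm M1)).
have h2 := le_trans (H2 x) (ler_wpM2r (ltW (cauws_gt0 x)) (ler_norm M2)).
rewrite -[complex.Re _ ^+ 2]real_normK ?num_real// -[complex.Im _ ^+ 2]real_normK ?num_real//.
have := normr_ge0 (complex.Re (F x)); have := normr_ge0 (complex.Im (F x)).
have := normr_ge0 M1; have := normr_ge0 M2; have := ltW (cauws_gt0 x).
move: h1 h2; move: `|M1| `|M2| (cauws x) `|complex.Re (F x)| `|complex.Im (F x)| => c d t a b.
move=> h1 h2 t0 d0 c0 b0 a0.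
have h1' : a ^+ 2 <= (c * t) ^+ 2 by rewrite lerXn2r ?nnegrE ?mulr_ge0.
have h2' : b ^+ 2 <= (d * t) ^+ 2 by rewrite lerXn2r ?nnegrE ?mulr_ge0.
have : 0 <= c * d * t ^+ 2 by rewrite !mulr_ge0// sqr_ge0.
move: h1' h2'; rewrite !exprMn; lra.
Qed.

Lemma expR_poly_bound (j : nat) (y : R) : 0 <= y -> (1 + y) ^+ j * expR (- y) <= j.+1%:R ^+ j.
Proof.
move=> y0; rewrite expRN ler_pdivrMr ?expR_gt0//.
have h : 1 + y <= j.+1%:R * expR (y / j.+1%:R).
  apply: le_trans (_ : j.+1%:R * (1 + y / j.+1%:R) <= _); last by rewrite ler_pM2l ?expR_ge1Dx.
  by rewrite mulrDr mulr1 mulrC divfK// lerD2r ler1n.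
apply: (@le_trans _ _ ((j.+1%:R * expR (y / j.+1%:R)) ^+ j)).
  by rewrite lerXn2r ?nnegrE ?mulr_ge0 ?expR_ge0// addr_ge0.
rewrite exprMn ler_wpM2l ?exprn_ge0// -expRM_natl ler_expR mulrCA ler_piMr//.
by rewrite ler_pdivrMr// mul1r ler_nat.
Qed.

Lemma poly_exp_bound (p : {poly R}) m : (0 < m)%N -> exists M, forall u : R,
  `|p.[u]| * expR (- u ^+ m.*2) <= M.
Proof.
move=> m0; exists (\sum_(j < size p) `|p`_j| * j.+1%:R ^+ j) => u.
rewrite horner_coef.
apply: le_trans (_ : (\sum_(j < size p) `|p`_j * u ^+ j|) * expR (- u ^+ m.*2) <= _).
  by rewrite ler_wpM2r ?expR_ge0//; exact: ler_norm_sum.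
rewrite mulr_suml; apply: ler_sum => j _; rewrite normrM -mulrA ler_wpM2l//.
have y0 : 0 <= u ^+ m.*2 by rewrite -muln2 exprM sqr_ge0.
apply: le_trans (expR_poly_bound j y0); rewrite ler_wpM2r ?expR_ge0//.
rewrite normrX lerXn2r ?nnegrE ?addr_ge0//.
have -> : u ^+ m.*2 = `|u| ^+ m.*2.
  by rewrite -muln2 mulnC !exprM real_normK ?num_real.
have := normr_ge0 u; move: `|u| => t t0.
have [t1|t1] := leP t 1; first by rewrite (le_trans t1)// lerDl exprn_ge0.
apply: le_trans (_ : t ^+ m.*2 <= _); last by rewrite lerDr.
by rewrite -{1}(expr1 t) ler_weXn2l ?(ltW t1)// double_gt0.
Qed.

(** These functions are stable under derivation, which acts on the polynomial factor by [dpexp]. *)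
Definition pexp (p q : {poly R}) (t : R) : R := p.[t] * expR (- q.[t]).

Definition dpexp (q p : {poly R}) : {poly R} := p^`() - p * q^`().

Lemma is_derive_pexp p q t : is_derive t (1 : R) (pexp p q) (pexp (dpexp q p) q t).
Proof.
have h1 := is_derive_poly p t.
have h2 : is_derive t (1 : R) (fun t => - q.[t]) (- q^`().[t]) by exact: is_deriveN (is_derive_poly q t).
have h3 := @is_derive1_comp _ expR (fun t => - q.[t]) t _ _ (is_derive_expR (- q.[t])) h2.
have h4 := is_deriveM h1 h3; rewrite (_ : pexp (dpexp q p) q t = p.[t] *: (expR (- q.[t]) * - q^`().[t]) + expR (- q.[t]) *: p^`().[t]); first exact: h4.
rewrite /pexp /dpexp !hornerE /=.
rewrite -[RHS]/(p.[t] * (expR (- q.[t]) * - q^`().[t]) + expR (- q.[t]) * p^`().[t]).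
by ring.
Qed.

Definition bumpf (q P : 'I_n -> {poly R}) (x : 'cV[R]_n) : R := \prod_i pexp (P i) (q i) (x i ord0).

Lemma is_derive_bumpf q P i x : is_derive x (delta_mx i ord0) (bumpf q P)
  (bumpf q (fun l => if l == i then dpexp (q i) (P i) else P l) x).
Proof.
apply: is_derive_line.
have E (t : R) : bumpf q P (t *: delta_mx i ord0 + x) =
    (\prod_(l | l != i) pexp (P l) (q l) (x l ord0)) * pexp (P i) (q i) (t + x i ord0).
  rewrite /bumpf (bigD1 i)//= mulrC !mxE !eqxx mulr1; congr (_ * _).
  by apply: eq_bigr => l li; rewrite !mxE (negbTE li) mulr0 add0r.
rewrite (_ : (fun t => _) = (fun t => (\prod_(l | l != i) pexp (P l) (q l) (x l ord0)) *: pexp (P i) (q i) (t + x i ord0))); last exact/funext.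
rewrite (_ : bumpf _ _ x = (\prod_(l | l != i) pexp (P l) (q l) (x l ord0)) *: (pexp (dpexp (q i) (P i)) (q i) (0 + x i ord0) * 1)).
  apply: is_deriveZ; apply: (@is_derive1_comp _ (pexp (P i) (q i)) (fun t => t + x i ord0)).
    exact: is_derive_pexp.
  by apply: is_derive_eq; rewrite addr0.
rewrite /bumpf (bigD1 i)//= eqxx mulrC add0r mulr1; congr (_ * _).
by apply: eq_bigr => l /negbTE ->.
Qed.

Lemma pderiv_bumpf q P s : exists P', pderiv s (bumpf q P) = bumpf q P'.
Proof.
elim: s => [|i s [P' IH]]; first by exists P.
exists (fun l => if l == i then dpexp (q i) (P' i) else P' l).
by rewrite /= IH; apply/funext => x; have [] := is_derive_bumpf q P' i x.
Qed.

(** With [u = (x - c) / r], the function [exp (- u^(2m))] tends to the indicator of [|u| < 1] as [m]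
    grows, except where [|u| = 1]. *)
Definition boxq (c r : 'I_n -> R) (m : nat) (i : 'I_n) : {poly R} := ((r i)^-1 *: ('X - (c i)%:P)) ^+ m.*2.

Lemma pexp_bound (p : {poly R}) (c r : 'I_n -> R) m i : (0 < m)%N -> r i != 0 ->
  exists M, forall t, `|pexp p (boxq c r m i) t| <= M.
Proof.
move=> m0 r0; have [M HM] := poly_exp_bound (p \Po (r i *: 'X + (c i)%:P)) m0.
exists M => t; have -> : t = r i * ((t - c i) / r i) + c i by rewrite mulrC divfK// subrK.
move: (_ / _) => u; apply: le_trans (HM u).
rewrite /pexp /boxq normrM (ger0_norm (expR_ge0 _)) horner_comp !hornerE /=.
by rewrite addrK mulrA mulVf// mul1r.
Qed.

Lemma schwartzR_bumpf (c r : 'I_n -> R) m P : (0 < m)%N -> (forall i, r i != 0) ->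
  schwartzR (bumpf (boxq c r m) P).
Proof.
move=> m0 r0 s; have [P' ->] := pderiv_bumpf (boxq c r m) P s; split=> [i x|N].
  by have [] := is_derive_bumpf (boxq c r m) P' i x.
have /choice[M HM] : forall i, exists M, forall t, `|pexp (P' i * (1 + 'X^2) ^+ N) (boxq c r m i) t| <= M.
  by move=> i; exact: pexp_bound.
exists (\prod_i M i) => x.
apply: le_trans (ler_wpM2r (normr_ge0 _) (dotv_prod x N)) _.
rewrite /bumpf normr_prod -big_split/=; apply: ler_prod => i _.
rewrite mulr_ge0 ?exprn_ge0 ?addr_ge0 ?sqr_ge0//=.
apply: le_trans (HM i (x i ord0)); rewrite /pexp !hornerE !normrM.
by rewrite (ger0_norm (exprn_ge0 _ _)) ?addr_ge0 ?sqr_ge0// mulrCA mulrA.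
Qed.
End bumps.

Section schwartz_density.
Context {R : realType} {n : nat}.
Variable k : nat.
Hypothesis k1 : (1 <= k)%N.
Local Notation mu := (@volk R n k).
Local Notation nsqT := (nsq mu setT).
Local Notation cls := (L2closure mu setT (@schwartz R n)).
Implicit Types (f : 'cV[R]_n -> R[i]) (x y : 'cV[R]_n).

Let Slin c (u v : 'cV[R]_n -> R[i]) : schwartz u -> schwartz v -> schwartz (fun x => c * u x + v x).
Proof. exact: schwartz_lin. Qed.

Lemma schwartz_toC (f : 'cV[R]_n -> R) : schwartzR f -> schwartz (fun x => toC (f x)).
Proof.
move=> sf; split => //.
have := schwartzR_lin 0 0 sf sf; congr schwartzR.
by apply/funext => x; rewrite /= !mul0r addr0.
Qed.

Definition obox (a b : 'I_n -> R) : set 'cV[R]_n := [set x | forall i, a i < x i ord0 < b i].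

Lemma measurable_obox a b : measurable (obox a b).
Proof.
have -> : obox a b = \big[setI/setT]_(i <- index_enum 'I_n)
    ((fun x : 'cV[R]_n => x i ord0 : measurableTypeR R) @^-1` `]a i, b i[%classic).
  rewrite -bigcap_seq; apply/seteqP; split => x /= H i.
    by move=> _; rewrite /= in_itv/=; exact: H.
  by have := H i; rewrite /= mem_index_enum in_itv/=; exact.
apply: bigsetI_measurable => i _; rewrite -[X in measurable X]setTI.
exact: (measurable_cV_coord i).
Qed.

Lemma cvg_exp_pow (u : R) : `|u| != 1 ->
  expR (- u ^+ m.+1.*2) @[m --> \oo] --> ((`|u| < 1)%R%:R : R).
Proof.
move=> u1; have E m : u ^+ m.+1.*2 = (`|u| ^+ 2) ^+ m.+1.
  by rewrite -exprM mul2n -muln2 mulnC !exprM real_normK ?num_real.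
under eq_fun do rewrite E.
have [lt|ge] := ltP `|u| 1.
  have q1 : 0 <= `|u| ^+ 2 < 1 by rewrite sqr_ge0/= expr_lt1.
  have c0 : (`|u| ^+ 2) ^+ m.+1 @[m --> \oo] --> (0 : R).
    by have := cvg_expr0 q1; rewrite -(cvg_shiftS (fun m => (`|u| ^+ 2) ^+ m)).
  have c1 : - (`|u| ^+ 2) ^+ m.+1 @[m --> \oo] --> (- 0 : R) by exact: cvgN c0.
  have := @continuous_cvg _ _ _ _ _ _ expR _ (@continuous_expR R _) c1.
  by move=> H; have := H _; rewrite oppr0 expR0; apply.
have gt : 1 < `|u| by rewrite lt_neqAle eq_sym u1.
have q1 : 0 <= (`|u| ^+ 2)^-1 < 1.
  by rewrite invr_ge0 sqr_ge0/= invf_lt1 ?exprn_egt1// exprn_gt0// (lt_trans ltr01).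
have c0 : ((`|u| ^+ 2)^-1) ^+ m.+1 @[m --> \oo] --> (0 : R).
  by have := cvg_expr0 q1; rewrite -(cvg_shiftS (fun m => ((`|u| ^+ 2)^-1) ^+ m)).
apply: squeeze_cvgr (cvg_cst (0 : R)) c0; apply: nearW => m.
have y0 : 0 < (`|u| ^+ 2) ^+ m.+1 by rewrite !exprn_gt0// (lt_trans ltr01).
rewrite expR_ge0/= exprVn expRN lef_pV2 ?posrE ?expR_gt0//.
by apply: le_trans (expR_ge1Dx _); rewrite lerDr.
Qed.

Lemma cauw_scale (c r u : R) : (1 + u ^+ 2)^-1 <= (1 + 2 * c ^+ 2 + 2 * r ^+ 2) * cauw (r * u + c).
Proof.
rewrite /cauw ler_pdivlMr ?ltr_pwDl ?sqr_ge0// mulrC ler_pdivrMr ?ltr_pwDl ?sqr_ge0//.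
have := sqr_ge0 (r * u - c); have := sqr_ge0 u; have := sqr_ge0 c; have := sqr_ge0 r.
have := mulr_ge0 (sqr_ge0 c) (sqr_ge0 u); rewrite !expr2; nra.
Qed.

Section box.
Variables a b : 'I_n -> R.
Hypothesis ab : forall i, a i < b i.
Let c i := (a i + b i) / 2.
Let r i := (b i - a i) / 2.
Let r0 i : 0 < r i. Proof. by rewrite divr_gt0// subr_gt0. Qed.
Let Fm m x : R := bumpf (boxq c r m.+1) (fun=> 1) x.
Let u i x := (x i ord0 - c i) / r i.
Let C := \prod_(i < n) (2 * (1 + 2 * c i ^+ 2 + 2 * r i ^+ 2)).

Let FmE m x : Fm m x = \prod_i expR (- (u i x) ^+ m.+1.*2).
Proof.
apply: eq_bigr => i _; rewrite /pexp hornerC mul1r /boxq horner_exp hornerZ hornerXsubC.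
by rewrite /u [_^-1 * _]mulrC.
Qed.

Let boxE x : (\1_(obox a b) x : R) = \prod_i ((`|u i x| < 1)%R%:R : R).
Proof.
have H i : (`|u i x| < 1) = (a i < x i ord0 < b i).
  rewrite /u normrM normfV (gtr0_norm (r0 i)) ltr_pdivrMr// mul1r ltr_norml /c /r.
  by apply/andP/andP => -[h1 h2]; split; lra.
rewrite indicE; case: (boolP (x \in obox a b)) => [/set_mem h|nh].
  by rewrite big1// => i _; rewrite H h.
have [i hi] : exists i, ~~ (a i < x i ord0 < b i).
  apply/existsP; apply: contraNT nh; rewrite negb_exists => /forallP h.
  by rewrite inE => i; have := h i; rewrite negbK.
by rewrite (bigD1 i)//= H (negbTE hi) mul0r.
Qed.

Let scaled x i : (1 + u i x ^+ 2)^-1 <= (1 + 2 * c i ^+ 2 + 2 * r i ^+ 2) * cauw (x i ord0).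
Proof.
apply: le_trans (cauw_scale (c i) (r i) (u i x)) _.
by rewrite /u [r i * _]mulrC divfK ?gt_eqF// subrK.
Qed.

Let C_ge0 : 0 <= C.
Proof. by apply: prodr_ge0 => i _; rewrite mulr_ge0// !addr_ge0// mulr_ge0// sqr_ge0. Qed.

Let Fm_le m x : 0 <= Fm m x <= C * cauws x.
Proof.
rewrite FmE prodr_ge0/=; last by move=> i _; exact: expR_ge0.
rewrite /C /cauws -big_split/=; apply: ler_prod => i _; rewrite expR_ge0/= -mulrA.
apply: le_trans (_ : 2 * (1 + u i x ^+ 2)^-1 <= _); last by rewrite ler_pM2l.
have y0 : 0 <= u i x ^+ 2 by exact: sqr_ge0.
rewrite -muln2 mulnC exprM; move: (u i x ^+ 2) y0 => y y0.
have e0 : 0 < 1 + y ^+ m.+1 by rewrite ltr_pwDl// exprn_ge0.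
rewrite expRN; apply: le_trans (_ : (1 + y ^+ m.+1)^-1 <= _).
  by rewrite lef_pV2 ?posrE ?expR_gt0// expR_ge1Dx.
(* The factor 2 covers [y <= 1], where [1 + y] may exceed [1 + y ^+ m.+1]. *)
rewrite ler_pdivlMr ?ltr_pwDl// mulrC ler_pdivrMr//.
have [y1|y1] := leP y 1; first by have := exprn_ge0 m.+1 y0; lra.
have : y <= y ^+ m.+1 by rewrite -{1}(expr1 y) ler_weXn2l// ltW.
lra.
Qed.

Let box_le x : 0 <= (\1_(obox a b) x : R) <= C * cauws x.
Proof.
rewrite boxE prodr_ge0//=; rewrite /C /cauws -big_split/=; apply: ler_prod => i _.
rewrite ler0n/= -mulrA; apply: le_trans (_ : 2 * (1 + u i x ^+ 2)^-1 <= _); last by rewrite ler_pM2l// scaled.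
case: ltP => h; last by rewrite mulr_ge0// invr_ge0 addr_ge0// sqr_ge0.
rewrite ler_pdivlMr ?ltr_pwDl ?sqr_ge0// mul1r.
have : `|u i x| ^+ 2 <= 1 by rewrite expr_le1// ltW.
rewrite real_normK ?num_real//; lra.
Qed.

(** The bumps of growing exponent converge off the faces, which are null, and [C * cauws] bounds
    them together with the indicator. *)
Lemma closure_obox : cls (fun x => toC (\1_(obox a b) x)).
Proof.
have mi : cmeasurable (fun x => toC (\1_(obox a b) x : R)).
  by apply: cmeas_toC; apply: measurable_indic; exact: measurable_obox.
have sF m : schwartz (fun x => toC (Fm m x)).
  by apply: schwartz_toC; apply: schwartzR_bumpf => // i; rewrite gt_eqF.
apply: (L2closure_lim _ _ (F := fun m x => toC (Fm m x))) => //.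
- exact: schwartz_cmeas.
- by move=> m; apply: L2closure_sub => //; exact: schwartz_cmeas.
have [|||||_ _] := @dominated_convergence _ _ R mu setT measurableT
    (fun m x => (sqnormc (toC (Fm m x) - toC (\1_(obox a b) x)))%:E) (cst 0%E)
    (fun x => ((C ^+ 2)%:E * (cauws x)%:E)%E) => //.
  - by move=> m; apply/cmeas_sqnormcE/cmeasB => //; exact: schwartz_cmeas.
  - have H1 : {ae mu, forall y i, crd 1%:M y i ord0 != a i}.
      by apply: filter_forall => i; apply: ae_crd_neq => //; exact: unitmx1.
    have H2 : {ae mu, forall y i, crd 1%:M y i ord0 != b i}.
      by apply: filter_forall => i; apply: ae_crd_neq => //; exact: unitmx1.
    apply: filterS2 H1 H2 => y h1 h2 _; apply: cvg_EFin; first exact: nearW.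
    have lim : Fm m y @[m --> \oo] --> (\1_(obox a b) y : R).
      rewrite boxE; under eq_fun do rewrite FmE.
      apply: cvg_prodr => i; apply: cvg_exp_pow.
      have := h1 i; have := h2 i; rewrite /crd invmx1 mul1mx => {}h2 {}h1.
      have yE : y i ord0 = r i * u i y + c i by rewrite /u [r i * _]mulrC divfK ?gt_eqF// subrK.
      apply/eqP => /eqP; rewrite eqr_norml ler01 andbT => /orP[]/eqP e.
        by move/eqP: h2; apply; rewrite yE e /c /r; lra.
      by move/eqP: h1; apply; rewrite yE e /c /r; lra.
    have lim0 : Fm m y - \1_(obox a b) y @[m --> \oo] --> (0 : R).
      by rewrite -(subrr (\1_(obox a b) y : R)); apply: cvgB => //; exact: cvg_cst.
    have lim2 : (Fm m y - \1_(obox a b) y) * (Fm m y - \1_(obox a b) y) @[m --> \oo] --> (0 : R).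
      by rewrite -(mulr0 (0 : R)); exact: cvgM.
    by apply: cvg_fun_eq lim2 => m; rewrite /= -toCN -toCD sqnormc_toC expr2.
  - apply: integrableZl => //; apply/integrableP; split.
      by apply/measurable_EFinP; exact: measurable_cauws.
    under eq_integral do rewrite gee0_abs ?lee_fin ?(ltW (cauws_gt0 _))//.
    exact: integral_volk_cauws.
  - apply: aeW => x m _; rewrite gee0_abs ?lee_fin ?sqnormc_ge0// -toCN -toCD sqnormc_toC.
    apply: le_trans (_ : (C * cauws x) ^+ 2 <= _).
      rewrite -[X in X <= _]real_normK ?num_real// lerXn2r ?nnegrE ?mulr_ge0 ?(ltW (cauws_gt0 _))//.
      have /andP[f0 f1] := Fm_le m x; have /andP[g0 g1] := box_le x.
      by rewrite ler_norml; apply/andP; split; lra.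
    rewrite exprMn ler_wpM2l ?sqr_ge0// expr2 ler_piMr ?cauws_le1//; exact/ltW/cauws_gt0.
by rewrite integral0.
Qed.
End box.

(** Truncation reduces to a bounded function supported in an open box [Q]. The functions whose cut
    to [Q] is approximable include the indicators of orthants, whose traces on [Q] are boxes or
    empty; hence they approximate every bounded function on [Q]. *)
Lemma schwartz_dense f : L2 k f -> exists Fm : nat -> 'cV[R]_n -> R[i],
  (forall m, schwartz (Fm m)) /\ nsqT (fun x => Fm m x - f x) @[m --> \oo] --> 0%E.
Proof.
move=> L2f.
suff cf : cls f.
  have /choice[G HG] : forall m : nat, exists v, schwartz v /\ (nsqT (fun x => (f x - v x)%R) <= (m.+1%:R^-1)%:E)%E.
    by move=> m; have [|v sv vm] := cf.2 (m.+1%:R^-1); [rewrite invr_gt0|exists v].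
  exists G; split; first by move=> m; have [] := HG m.
  apply/cvge0_near; first by move=> m; exact: nsq_ge0.
  move=> e e0; near=> m; rewrite nsqBC; apply: le_trans (HG m).2 _; rewrite lee_fin.
  rewrite -(invrK e) lef_pV2 ?posrE ?invr_gt0//; apply: le_trans (_ : m%:R <= _); last by rewrite ler_nat.
  by near: m; exact: nbhs_infty_ger.
have [mf _] := L2f.
apply: (L2closure_lim _ _ (F := fun m => trunc m f)) => //; first exact: schwartz_cmeas; last exact: trunc_nsq.
move=> m; have [[mt [M1 tM]] [A tA]] := Cc_trunc m mf.
pose b := `|A| + 1; pose Q := obox (fun=> - b) (fun=> b).
have b0 : 0 < b by rewrite ltr_wpDl.
have mQ : measurable Q by exact: measurable_obox.
have Qfin : (mu Q < +oo)%E.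
  apply: (@volk_bounded _ _ _ b) => // x Qx i.
  by have /andP[h1 h2] := Qx i; rewrite ler_norml !ltW.
pose V := [set v : 'cV[R]_n -> R[i] | cmeasurable v /\ cls (fun x => toC (\1_Q x) * v x)].
have Vlin c (u v : 'cV[R]_n -> R[i]) : V u -> V v -> V (fun x => c * u x + v x).
  move=> [mu_ cu] [mv cv]; split; first by apply: cmeasD => //; exact: cmeasZ.
  have := L2closure_lin measurableT (@schwartz_cmeas _ _) Slin c cu cv.
  by congr L2closure; apply/funext => x; rewrite mulrDr mulrCA.
have V1 : V (fun=> 1).
  split; first exact: cmeas_cst.
  have bb : - b < b by lra.
  have := @closure_obox (fun=> - b) (fun=> b) (fun=> bb).
  by congr L2closure; apply/funext => x; rewrite mulr1.
have mtoC (D : set 'cV[R]_n) : measurable D -> cmeasurable (fun x => toC (\1_D x : R)).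
  by move=> mD; apply: cmeas_toC; exact: measurable_indic.
have VO a : V (fun x => toC (\1_(orthant a) x)).
  split; first by apply: mtoC; exact: measurable_orthant.
  rewrite (_ : (fun x => _) = (fun x => toC (\1_(obox (fun i => Num.max (a i) (- b)) (fun=> b)) x))); last first.
    apply/funext => x; rewrite -toCM; congr toC; rewrite !indicE -natrM mulnb; congr ((_ : bool)%:R).
    apply/andP/idP; rewrite !inE.
      by move=> [h1 h2] i; have /andP[h3 h4] := h1 i; rewrite gt_max h2 h3.
    by move=> h; split=> i; have := h i; rewrite gt_max => /andP[/andP[h1 h2] h3]; rewrite ?h2.
  have [|/existsNP[i hi]] := pselect (forall i, Num.max (a i) (- b) < b); first exact: closure_obox.
  rewrite (_ : (fun x => _) = (fun=> 0)); last first.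
    apply/funext => x; rewrite indicE memNset//= => h; apply: hi.
    by have /andP[] := h i; exact: lt_trans.
  apply: L2closure0 => //; first exact: schwartz_cmeas.
  exists (fun x => toC (0 * bumpf (boxq (fun=> 0) (fun=> 1) 1) (fun=> 1) x + 0 * bumpf (boxq (fun=> 0) (fun=> 1) 1) (fun=> 1) x)).
  apply: schwartz_toC; apply: schwartzR_lin; apply: schwartzR_bumpf => // l; exact: oner_neq0.
have Vm (v : 'cV[R]_n -> R[i]) : V v -> cmeasurable v by case.
have [_ H] := L2closure_bounded mQ Qfin Vm Vlin (phi := id) (psi := id)
  (@measurable_id _ _ setT) (@measurable_id _ _ setT) (fun x => erefl)
  (@L2closure_sub _ _ _ mu Q V Vm _ V1) (fun a => @L2closure_sub _ _ _ mu Q V Vm _ (VO a))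
  (ex_intro _ _ V1) mt tM.
split => // e e0.
have e4 : 0 < e / 4 by rewrite divr_gt0.
have [v [mv [_ cv]] ve] := H _ e4; have [w sw we] := cv _ e4.
exists w => //.
have mQv : cmeasurable (fun x => toC (\1_Q x) * v x) by exact: cmeas_indic.
apply: le_trans (nsq_tri2 _ measurableT mt mQv (schwartz_cmeas sw)) _.
have -> : nsqT (fun x => trunc m f x - toC (\1_Q x) * v x) = nsq mu Q (fun x => trunc m f x - v x).
  rewrite /nsq [RHS]integral_mkcond; apply: eq_integral => x _; rewrite patchE indicE.
  case: ifPn => xQ; first by rewrite mul1r.
  suff -> : trunc m f x = 0 by rewrite mul0r subrr sqnormc0.
  apply/eqP; apply: contraNT xQ => /tA h; rewrite inE => i.
  have := h i; rewrite -ltr_norml /b => hi; apply: le_lt_trans hi _.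
  by rewrite ltr_pwDr// ler_norm.
apply: le_trans (leeD (lee_wpmul2l _ ve) (lee_wpmul2l _ we)) _ => //.
by rewrite -!EFinM -EFinD lee_fin; lra.
Unshelve. all: by end_near. Qed.
End schwartz_density.

(** * The Zak transform on functions with values in C^Z_(k) *)

Section lattice_sums.
Context {R : realType} {n : nat}.
Local Notation Re := (@complex.Re R).
Local Notation Im := (@complex.Im R).

(** Positive and negative parts converge separately along the boxes, which ties the unordered sums
    of the definitions to partial sums. *)
Lemma rsum_cvg (a : 'cV[int]_n -> R) : (\esum_(z in setT) (`|a z|)%:E < +oo)%E ->
  \sum_(z <- boxs N) a z @[N --> \oo] --> rsum setT a.
Proof.
move=> fin.
have pos (b : 'cV[int]_n -> R) : (forall z, `|b z| <= `|a z|) ->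
    \sum_(z <- boxs N) Num.max (b z) 0 @[N --> \oo] --> fine (\esum_(z in setT) (Num.max (b z) 0)%:E)%E.
  move=> ba; pose c z := Num.max (b z) 0.
  have c0 z : (0 <= (c z)%:E)%E by rewrite lee_fin le_max lexx orbT.
  have cb : (\esum_(z in setT) (c z)%:E < +oo)%E.
    apply: le_lt_trans fin; apply: le_esum => z _; rewrite lee_fin; apply: le_trans (ba z).
    by rewrite ge_max ler_norm normr_ge0.
  have := box_cvg c0; rewrite -[X in _ --> X](@fineK _ (\esum_(z in setT) (c z)%:E)%E); last first.
    by rewrite ge0_fin_numE//; apply: esum_ge0 => z _.
  move=> /fine_cvg; apply: cvg_fun_eq => N; rewrite /= sumEFin//.
have h1 := pos a (fun=> lexx _); have h2 := pos (fun z => - a z) (fun z => ltac:(by rewrite normrN)).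
have E : (fun N => \sum_(z <- boxs N) a z) =
    (fun N => \sum_(z <- boxs N) Num.max (a z) 0 - \sum_(z <- boxs N) Num.max (- a z) 0).
  apply/funext => N; rewrite -sumrB; apply: eq_bigr => z _ /=.
  by case: (leP (a z) 0); case: (leP (- a z) 0) => ? ?; lra.
rewrite E; exact: (cvgB h1 h2).
Qed.

Definition ccvg (u : nat -> R[i]) (l : R[i]) :=
  Re (u m) @[m --> \oo] --> Re l /\ Im (u m) @[m --> \oo] --> Im l.

Lemma ccvg_eq (u v : nat -> R[i]) l : (forall m, u m = v m) -> ccvg v l -> ccvg u l.
Proof. by move=> /funext ->. Qed.

Lemma ccvgZ c u l : ccvg u l -> ccvg (fun m => c * u m) (c * l).
Proof.
move=> [h1 h2]; case: c => a b; case: l h1 h2 => x y /= h1 h2; split.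
  apply: (cvg_fun_eq (v := fun m => a * Re (u m) - b * Im (u m))); first by move=> m; case: (u m).
  by apply: cvgB; apply: cvgMr.
apply: (cvg_fun_eq (v := fun m => a * Im (u m) + b * Re (u m))); first by move=> m; case: (u m).
by apply: cvgD; apply: cvgMr.
Qed.

Lemma ccvg_sum (J : Type) (r : seq J) (u : J -> nat -> R[i]) (l : J -> R[i]) :
  (forall i, ccvg (u i) (l i)) -> ccvg (fun m => \sum_(i <- r) u i m) (\sum_(i <- r) l i).
Proof.
move=> H; elim: r => [|i r [h1 h2]].
  split; apply: (cvg_fun_eq (v := fun=> 0)) => [m|]; rewrite !big_nil//; exact: cvg_cst.
have [g1 g2] := H i; rewrite big_cons; split; rewrite raddfD.
  by apply: (cvg_fun_eq _ (cvgD g1 h1)) => m; rewrite big_cons raddfD.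
by apply: (cvg_fun_eq _ (cvgD g2 h2)) => m; rewrite big_cons raddfD.
Qed.

Lemma csum_cvg (a : 'cV[int]_n -> R[i]) : (\esum_(z in setT) (`|Re (a z)| + `|Im (a z)|)%:E < +oo)%E ->
  ccvg (fun N => \sum_(z <- boxs N) a z) (csum setT a).
Proof.
move=> fin.
have part (b : 'cV[int]_n -> R) : (forall z, `|b z| <= `|Re (a z)| + `|Im (a z)|) ->
    (\esum_(z in setT) (`|b z|)%:E < +oo)%E.
  by move=> h; apply: le_lt_trans fin; apply: le_esum => z _; rewrite lee_fin.
split.
  have := rsum_cvg (part (fun z => Re (a z)) (fun z => ltac:(by rewrite lerDl))).
  by apply: cvg_fun_eq => N; rewrite raddf_sum.
have := rsum_cvg (part (fun z => Im (a z)) (fun z => ltac:(by rewrite lerDr))).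
by apply: cvg_fun_eq => N; rewrite raddf_sum.
Qed.

Lemma measurable_rsum d (T : measurableType d) (a : 'cV[int]_n -> T -> R) :
  (forall z, measurable_fun setT (a z)) -> measurable_fun setT (fun t => rsum setT (a^~ t)).
Proof.
move=> ma.
have pos (b : 'cV[int]_n -> T -> R) : (forall z, measurable_fun setT (b z)) ->
    measurable_fun setT (fun t => fine (\esum_(z in setT) (Num.max (b z t) 0)%:E)%E).
  move=> mb; apply: measurableT_comp; first by [].
  apply: (@emeasurable_fun_cvg _ _ _ setT (fun N t => (\sum_(z <- boxs N) (Num.max (b z t) 0)%:E)%E)).
    move=> N; apply: emeasurable_sum => z; apply/measurable_EFinP.
    by apply: measurable_maxr => //; exact: measurable_cst.
  by move=> t _; apply: box_cvg => z; rewrite lee_fin le_max lexx orbT.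
by apply: measurable_funB; apply: pos => // z; exact: measurableT_comp.
Qed.

Lemma cmeas_csum d (T : measurableType d) (a : 'cV[int]_n -> T -> R[i]) :
  (forall z, cmeasurable (a z)) -> cmeasurable (fun t => csum setT (a^~ t)).
Proof. by move=> ma; split; apply: measurable_rsum => z; have [] := ma z. Qed.
End lattice_sums.

(** * Pointwise convergence of the Zak series *)

Section pointwise.
Context {R : realType} {n : nat}.
Variables (k : nat) (B : 'M[R]_n).
Hypothesis k1 : (1 <= k)%N.
Hypothesis Bu : B \in unitmx.
Local Notation mu := (@volk R n k).
Local Notation nu := (mu \x mu)%E.
Local Notation lat := (lat B).
Local Notation dl := (dl k B).
Local Notation cell := (cellB B).
Local Notation C2 := (cell `*` cell).
Local Notation chr := (chr k B).
Local Notation vol := (vol k B).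
Let mcell : measurable cell. Proof. exact: measurable_cellB. Qed.
Let mC2 : measurable C2. Proof. exact: measurableX. Qed.
Variables (I : finType) (s : 'cV[int]_n -> 'cV[int]_n) (cl : 'cV[int]_n -> I)
  (rp : I -> 'cV[int]_n).
Hypothesis dl_s : forall l, dl (s l) = lat l.
Hypothesis cl_rp : forall i l, cl (rp i + s l) = i.
Hypothesis rp_cl : forall z, exists l, z = rp (cl z) + s l.
Local Notation Zr := (Zr k B cl).
Implicit Types (F : I -> 'cV[R]_n -> R[i]).

(** A transform exists as an L^2 limit; by Fatou's lemma it agrees with any almost everywhere limit
    of the same partial sums. *)
Lemma Zr_pointwise F psi : L2fam k F -> cmeasurable psi ->
  {ae nu, forall p, C2 p -> ccvg (fun N => zs k B cl (boxs N) F p) (psi p)} ->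
  Zr F psi.
Proof.
move=> LF mp H; have [psi0 [Z0 _ _]] := zak_exists k1 Bu dl_s cl_rp rp_cl LF.
have [m0 c0] := Z0.
have mF := L2fam_mfam LF.
have E : nsq nu C2 (fun p => psi p - psi0 p) = 0%E.
  apply/eqP; rewrite eq_le nsq_ge0 andbT; apply/lee_addgt0Pr => e e0; rewrite add0e.
  apply: (nsq_fatou mC2 (F := fun N => zs k B cl (boxs N) F)) => //.
  - by move=> N; exact: cmeas_zs.
  - by apply: filterS H => p H Cp; have [h1 h2] := H Cp; exact: cvg_sqnormcB.
  by have /cvge0_near := c0; apply => // m; exact: nsq_ge0.
split => //; apply: (nsq_lim_tri mC2 (G := fun=> psi0)) => //.
- by move=> N; exact: cmeas_zs.
by apply: cvg_near_cst; apply: nearW => m; rewrite nsqBC.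
Qed.

Lemma ae_fst (P : 'cV[R]_n -> Prop) : {ae mu, forall x, P x} -> {ae nu, forall p, P p.1}.
Proof.
move=> [N [mN N0 PN]]; exists (N `*` setT); split; first exact: measurableX.
  by rewrite /= product_measure1E// [X in (X * _)%E]N0 mul0e.
by move=> p /= np; split => //; exact: PN.
Qed.

(** The integral of the sum over the cell is the integral of [h] over the space, once per class,
    hence finite. The square root makes [h] a squared norm, for which [N1_esum] has done the
    tiling. *)
Lemma ae_summable (h : 'cV[R]_n -> R) : measurable_fun setT h -> (forall x, 0 <= h x) ->
  (\int[mu]_x (h x)%:E < +oo)%E ->
  {ae mu, forall x, cell x -> (\esum_(z in setT) (h (x + dl z)%R)%:E < +oo)%E}.
Proof.
move=> mh h0 fin; pose g x := toC (Num.sqrt (h x)).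
have gE x : sqnormc (g x) = h x by rewrite sqnormc_toC sqr_sqrtr.
have mg : cmeasurable g.
  by apply: cmeas_toC; apply: measurableT_comp => //; exact: continuous_measurable_fun (@sqrt_continuous R).
have mS z : measurable_fun setT (fun x : 'cV[R]_n => (h (x + dl z)%R)%:E).
  by apply/measurable_EFinP; apply: measurableT_comp => //; exact: measurable_addv.
pose S (x : 'cV[R]_n) : \bar R := (\esum_(z in setT) (h (x + dl z)%R)%:E)%E.
have S0 x : (0 <= S x)%E by apply: esum_ge0 => z _; rewrite lee_fin.
have cS (x : 'cV[R]_n) : (\sum_(z <- boxs N) (h (x + dl z)%R)%:E)%E @[N --> \oo] --> S x.
  by apply: box_cvg => z; rewrite lee_fin.
have mSS : measurable_fun setT S.
  apply: (@emeasurable_fun_cvg _ _ _ setT (fun N (x : 'cV[R]_n) => (\sum_(z <- boxs N) (h (x + dl z)%R)%:E)%E)) => //.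
  by move=> N; exact: emeasurable_sum.
have N1E : (\int[mu]_(x in cell) S x = \esum_(z in setT) az k B cl (fun=> g) z)%E.
  have E1 : (\int[mu]_(x in cell) S x = \int[mu]_(x in cell) limn (fun N => \sum_(z <- boxs N) (h (x + dl z)%R)%:E))%E.
    by apply: eq_integral => x _; apply/esym/cvg_lim => //; exact: cS.
  rewrite E1 monotone_convergence//.
  - apply: cvg_lim => //; have := @box_cvg R n (az k B cl (fun=> g)) (fun z => az_ge0 _ _ _ _ _).
    apply: cvg_fun_eq => N; rewrite ge0_integral_sum//.
    + by apply: eq_bigr => z _; apply: eq_integral => x _; rewrite gE.
    + by move=> z; apply: measurable_funTS.
    + by move=> z x _; rewrite lee_fin.
  - by move=> N; apply: measurable_funTS; exact: emeasurable_sum.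
  - by move=> N x _; apply: sume_ge0 => z _; rewrite lee_fin.
  - by move=> x _ a b ab; apply: box_sum_le => // z; rewrite lee_fin.
have : (\int[mu]_(x in cell) S x < +oo)%E.
  rewrite N1E -(N1_esum Bu dl_s cl_rp rp_cl); last by move=> i.
  rewrite /N1; apply: lte_sum_pinfty => i _; rewrite /nsq.
  by under eq_integral do rewrite gE.
move=> fS; have : mu.-integrable cell S.
  apply/integrableP; split; first exact: measurable_funTS.
  by under eq_integral do rewrite gee0_abs//.
move=> /(integrable_ae mcell); apply: filterS => x H /H; rewrite ge0_fin_numE//.
Qed.

Definition lterm (h : 'cV[R]_n -> R[i]) v (p : 'cV[R]_n * 'cV[R]_n) z : R[i] :=
  h (p.1 + dl z) * bracket k (- dl z) p.2 * bracket k (- dl z) v.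

Lemma cmeas_lterm h v z : cmeasurable h -> cmeasurable (fun p => lterm h v p z).
Proof.
move=> mh; apply: cmeasM; last exact: cmeas_cst.
apply: cmeasM.
  apply: (cmeas_comp mh (phi := fun p : 'cV[R]_n * 'cV[R]_n => p.1 + dl z)).
  by apply: (measurableT_comp (measurable_addv _)); exact: measurable_fst.
by apply: (cmeas_comp (cmeas_chr k B z)); exact: measurable_snd.
Qed.

Lemma lterm_cvg h v : schwartz h -> {ae nu, forall p, C2 p ->
  ccvg (fun N => \sum_(z <- boxs N) lterm h v p z) (csum setT (lterm h v p))}.
Proof.
move=> sh; have mh := schwartz_cmeas sh.
pose g x : R := 2 * (`|complex.Re (h x)| + `|complex.Im (h x)|).
have mg : measurable_fun setT g.
  apply: measurable_funM; first exact: measurable_cst.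
  by apply: measurable_funD; apply: measurableT_comp => //; [exact: mh.1|exact: mh.2].
have g0 x : 0 <= g x by rewrite mulr_ge0// addr_ge0.
have fin : (\int[mu]_x (g x)%:E < +oo)%E.
  have [/integrableP[m1 i1] /integrableP[m2 i2]] := schwartz_int k sh.
  rewrite (_ : (\int[mu]_x _) = \int[mu]_x (2%:E * ((`|complex.Re (h x)|)%:E + (`|complex.Im (h x)|)%:E)))%E; last first.
    by apply: eq_integral => x _; rewrite -EFinD -EFinM.
  have n1 : measurable_fun setT (fun x => (`|complex.Re (h x)|)%:E).
    by apply/measurable_EFinP; apply: measurableT_comp => //; exact: mh.1.
  have n2 : measurable_fun setT (fun x => (`|complex.Im (h x)|)%:E).
    by apply/measurable_EFinP; apply: measurableT_comp => //; exact: mh.2.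
  rewrite ge0_integralZl//; last by move=> x _; rewrite -EFinD lee_fin addr_ge0.
    rewrite ge0_integralD// lte_mul_pinfty//; last by apply: lte_add_pinfty.
  by apply: emeasurable_funD.
have := ae_summable mg g0 fin.
move=> /(ae_fst (P := fun x => cell x -> (\esum_(z in setT) (g (x + dl z)%R)%:E < +oo)%E)).
apply: filterS => p H Cp.
have /H fp : cell p.1 by have [] := Cp.
apply: csum_cvg; apply: le_lt_trans fp; apply: le_esum => z _; rewrite lee_fin /lterm /g /bracket.
rewrite -mulrA -cexpiD; move: (_ + _) (h _) => r [a b] /=.
have := cos_max r; have := sin_max r.
move: (cos r) (sin r) => x y y1 x1.
apply: (@le_trans _ _ ((`|a| + `|b|) + (`|a| + `|b|))); last by rewrite mulr2n mulrDl !mul1r.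
by apply: lerD; (apply: le_trans (ler_normD _ _) _); rewrite ?normrN !normrM;
   apply: lerD; rewrite ler_piMr.
Qed.
End pointwise.

Lemma fsum_finType (R : nmodType) (T : choiceType) (I : finType) (h : I -> T) (F : T -> R) :
  bijective h -> \sum_(c \in [set: T]) F c = \sum_i F (h i).
Proof.
move=> bh; rewrite (reindex_fsbigT h)//.
have fin : finite_set [set: I] by exact: finite_finset.
rewrite fsbig_finite//=.
rewrite (perm_big (index_enum I))//=; apply: uniq_perm; rewrite ?fset_uniq ?index_enum_uniq//.
by move=> i; rewrite mem_index_enum in_fset_set// mem_setT.
Qed.

(** * The group Z_(k) and representatives of its classes *)

Section Zk_classes.
Context {R : realType} {n : nat}.
Variables (Phi : set 'cV[R]_n) (Delta : 'I_n -> 'cV[R]_n) (k : nat).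
Hypothesis hPhi : simple_root_system Phi.
Hypothesis hDelta : simple_roots Phi Delta.
Hypothesis k1 : (1 <= k)%N.
Local Notation L := (coroot_lattice Phi).
Local Notation W := (weyl Phi).
Local Notation Lw := (weight_lattice Phi k).
Local Notation Z := (Zk Phi k).
Definition rB := corootmx Delta.
Local Notation B := rB.
Local Notation lat := (lat B).
Local Notation dl := (dl k B).

Lemma rB_unit : B \in unitmx. Proof. exact: (corootmx_unit hPhi hDelta). Qed.

Lemma latP l : L l <-> exists z, l = lat z. Proof. exact: lattice_span. Qed.

Lemma lat_L z : L (lat z). Proof. by apply/latP; exists z. Qed.

Lemma ipk_LL l l' : L l -> L l' -> ipk k l l' \is a Num.int.
Proof. by move=> Ll Ll'; rewrite /ipk; apply: rpredM; [exact: rpred_nat|exact: (lattice_int hPhi)]. Qed.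

Lemma weightP g : Lw g <-> exists z, g = dl z.
Proof.
split=> [H|[z ->] l /latP[z' ->]]; last exact: (ipk_dl_lat k1 rB_unit).
by apply: dlP => // [|z]; [exact: rB_unit|apply: H; exact: lat_L].
Qed.

Lemma dl_Lw z : Lw (dl z). Proof. by apply/weightP; exists z. Qed.

Lemma L_Lw l : L l -> Lw l.
Proof. by move=> Ll l' Ll'; exact: ipk_LL. Qed.

Lemma weyl_Lw w g : W w -> Lw g -> Lw (w *m g).
Proof.
move=> Ww Hg l Ll; rewrite /ipk dotv_mulmx; apply: Hg.
exact: (weyl_lattice hPhi (weyl_tr Ww)).
Qed.

Lemma LwB g g' : Lw g -> Lw g' -> Lw (g - g').
Proof. by move=> /weightP[z ->] /weightP[z' ->]; apply/weightP; exists (z - z'); rewrite dlB. Qed.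

Lemma LwN g : Lw g -> Lw (- g).
Proof. by move=> /weightP[z ->]; apply/weightP; exists (- z); rewrite dlN. Qed.

Lemma cosetP g g' : coset Phi g = coset Phi g' <-> L (g' - g).
Proof.
split=> [e|Ll].
  have : coset Phi g' g' by exists 0; [exact: lattice0|rewrite addr0].
  by rewrite -e => -[l Ll <-]; rewrite addrAC subrr add0r.
apply/seteqP; split => _ [l Ll' <-].
  by exists (l - (g' - g)); [exact: latticeB|rewrite opprB addrCA [g' + _]addrC subrK addrC].
exists (l + (g' - g)); first exact: latticeD.
by rewrite addrCA [g + _]addrC subrK addrC.
Qed.

Definition clsz (g : 'cV[R]_n) (Hg : Lw g) : Z := SigSub (mem_set (ex_intro2 _ _ g Hg erefl : Z (coset Phi g))).

Lemma rep_in (c : Z) : Lw (rep c) /\ val c = coset Phi (rep c).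
Proof.
have [g Hg vc] := set_mem (valP c).
have vg : val c g by rewrite -vc; exists 0; [exact: lattice0|rewrite addr0].
have : val c (rep c) by apply: xgetI vg.
rewrite -vc => -[l Ll e]; split.
  by rewrite -e -[l]opprK; apply: LwB => //; apply: LwN; exact: L_Lw.
by apply/cosetP; rewrite -e addrAC subrr add0r.
Qed.

Lemma clsz_rep (c : Z) g (Hg : Lw g) : c = clsz Hg <-> L (g - rep c).
Proof.
have [_ vc] := rep_in c; split=> [e|h].
  by apply/cosetP; rewrite -vc e.
by apply: val_inj; rewrite vc; apply/cosetP.
Qed.

Lemma Zk_eq (c c' : Z) : L (rep c - rep c') -> c = c'.
Proof.
have [_ vc] := rep_in c; have [_ vc'] := rep_in c'.
by move=> h; apply: val_inj; rewrite vc vc'; apply/esym/cosetP.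
Qed.

Lemma wact_coset w (c : Z) : W w -> wact w c = coset Phi (w *m rep c).
Proof.
move=> Ww; rewrite /wact; have [_ ->] := rep_in c.
apply/seteqP; split => [_ [_ [l Ll <-] <-]|_ [l Ll <-]].
  by exists (w *m l); [exact: weyl_lattice|rewrite mulmxDr].
exists (rep c + w^T *m l); last by rewrite mulmxDr mulmxA (weyl_trK hPhi)// mul1mx.
by exists (w^T *m l) => //; apply: weyl_lattice => //; exact: weyl_tr.
Qed.

Definition wc w (Ww : W w) (c : Z) : Z := clsz (weyl_Lw Ww (rep_in c).1).

Lemma wactP w (c c' : Z) (Ww : W w) : val c' = wact w c <-> c' = wc Ww c.
Proof.
rewrite wact_coset//; split=> [e|->//]; exact: val_inj.
Qed.

Lemma exists_s l : exists z, dl z = lat l.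
Proof.
have /L_Lw/weightP[z ->] := lat_L l; by exists z.
Qed.

Definition sl := projT1 (choice exists_s).
Lemma dl_sl l : dl (sl l) = lat l.
Proof. exact: (projT2 (choice exists_s)). Qed.

Definition clz z : Z := clsz (dl_Lw z).

Lemma exists_rz (c : Z) : exists z, dl z = rep c.
Proof. by have [/weightP[z ->] _] := rep_in c; exists z. Qed.

Definition rz := projT1 (choice exists_rz).
Lemma dl_rz c : dl (rz c) = rep c.
Proof. exact: (projT2 (choice exists_rz)). Qed.

Lemma clz_rz c l : clz (rz c + sl l) = c.
Proof.
apply/esym/clsz_rep; rewrite dlD dl_rz dl_sl addrAC subrr add0r; exact: lat_L.
Qed.

Lemma rz_clz z : exists l, z = rz (clz z) + sl l.
Proof.
have /latP[l e] : L (dl z - rep (clz z)) by apply/(clsz_rep _ (dl_Lw z)).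
exists l; apply: (dl_inj k1 rB_unit); rewrite dlD dl_rz dl_sl -e addrCA subrr addr0 //.
Qed.

(** Each class has a representative in the cell, which is bounded and so contains finitely many dual
    vectors. *)
Lemma Zk_finite : finite_set Z.
Proof.
have [M HM] := cellB_bounded rB_unit.
have [N HN] := dl_bounded k1 rB_unit M.
apply: (@sub_finite_set _ _ ((fun z => coset Phi (dl z)) @` [set` boxs N])); last first.
  by apply: finite_image; exact: finite_seq.
move=> _ [g /weightP[z ->] <-].
exists (z - sl (fl B (dl z))); last first.
  by apply/cosetP; rewrite dlB dl_sl opprB addrCA subrr addr0; exact: lat_L.
apply: HN => i; apply: HM; rewrite dlB dl_sl; exact: cell_fl rB_unit _.
Qed.

Definition ZI : finType := fset_sub_type (fset_set Z).
Lemma ZI_proof (i : ZI) : val i \in Z.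
Proof. by have := valP i; rewrite in_fset_set//; exact: Zk_finite. Qed.
Definition iz (i : ZI) : Z := SigSub (ZI_proof i).
Lemma Zk_proof (c : Z) : val c \in fset_set Z.
Proof. by rewrite in_fset_set ?(valP c)//; exact: Zk_finite. Qed.
Definition zi (c : Z) : ZI := FSetSub (Zk_proof c).
Lemma izK : cancel iz zi. Proof. by move=> i; apply: val_inj. Qed.
Lemma ziK : cancel zi iz. Proof. by move=> c; apply: val_inj. Qed.
Lemma iz_bij : bijective iz. Proof. by exists zi; [exact: izK|exact: ziK]. Qed.

Lemma sumZ (V : nmodType) (F : Z -> V) : \sum_(c \in [set: Z]) F c = \sum_i F (iz i).
Proof. by apply: fsum_finType; exact: iz_bij. Qed.

Lemma card_ZI : #|ZI| = ncard Z. Proof. by rewrite /ncard cardfE. Qed.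

Definition rp i := rz (iz i).
Definition cl z := zi (clz z).
Lemma cl_rp i l : cl (rp i + sl l) = i.
Proof. by rewrite /cl /rp clz_rz izK. Qed.
Lemma rp_cl z : exists l, z = rp (cl z) + sl l.
Proof. by rewrite /rp /cl ziK; exact: rz_clz. Qed.
Lemma dl_rp i : dl (rp i) = rep (iz i). Proof. exact: dl_rz. Qed.

Lemma lat_even l : exists m : int, ipk k (lat l) (lat l) = 2 * m%:~R.
Proof.
have [m e] := lattice_even hPhi (lat_L l); exists (k%:Z * m).
by rewrite /ipk e intrM mulrCA.
Qed.
End Zk_classes.

(** * Comparison of the two forms of the Zak transform *)

Section zak_equivalence.
Context {R : realType} {n : nat}.
Variables (Phi : set 'cV[R]_n) (Delta : 'I_n -> 'cV[R]_n) (k : nat).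
Hypothesis hPhi : simple_root_system Phi.
Hypothesis hDelta : simple_roots Phi Delta.
Hypothesis k1 : (1 <= k)%N.
Local Notation L := (coroot_lattice Phi).
Local Notation Lw := (weight_lattice Phi k).
Local Notation Z := (Zk Phi k).
Local Notation B := (rB Delta).
Local Notation Bu := (rB_unit hPhi hDelta).
Local Notation lat := (lat B).
Local Notation dl := (dl k B).
Local Notation I := (ZI Phi k).
Local Notation iz := (iz hPhi hDelta k1).
Local Notation zi := (zi hPhi hDelta k1).
Local Notation rp := (rp hPhi hDelta k1).
Local Notation cl := (cl hPhi hDelta k1).
Local Notation sl := (sl hPhi hDelta k1).
Local Notation dl_sl := (dl_sl hPhi hDelta k1).
Local Notation cl_rp := (cl_rp hPhi hDelta k1).
Local Notation rp_cl := (rp_cl hPhi hDelta k1).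
Local Notation dl_rp := (dl_rp hPhi hDelta k1).
Local Notation mu := (@volk R n k).
Local Notation nu := (mu \x mu)%E.
Local Notation cellb := (cellB B).
Local Notation C2 := (cellb `*` cellb).
Local Notation vol := (vol k B).
Local Notation vN := (vN k B rp).
Local Notation Zr := (Zr k B cl).
Local Notation nsqT := (nsq mu setT).
Implicit Types (F G H : 'cV[R]_n -> Z -> R[i]).

Lemma cl_repL z : L (dl z - rep (iz (cl z))).
Proof. by rewrite /cl ziK; apply/(clsz_rep hPhi hDelta k1 _ (dl_Lw hPhi hDelta k1 z)). Qed.

Lemma cl_eq z z' : L (dl z - dl z') -> cl z = cl z'.
Proof.
move=> h; apply: (can_inj (izK hPhi hDelta k1)); apply: (Zk_eq hPhi hDelta k1).
have := latticeD (latticeB h (cl_repL z)) (cl_repL z'); congr L.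
move: (dl z) (dl z') (rep _) (rep _) => a b c d.
by apply/matrixP => i i'; rewrite !mxE; ring.
Qed.

Lemma bracket_LN l x : L l -> bracket k l (dl x) = 1.
Proof.
move=> /(latP hPhi hDelta)[z ->]; rewrite bracketC bracket_dl_lat//; exact: Bu.
Qed.

Lemma bracket_dl_rp z x : bracket k (- dl (rp (cl z))) (dl x) = bracket k (- dl z) (dl x).
Proof.
have -> : - dl (rp (cl z)) = (dl z - dl (rp (cl z))) - dl z by rewrite addrAC subrr add0r.
by rewrite bracketD bracket_LN ?mul1r// dl_rp; exact: cl_repL.
Qed.

(** Fourier inversion [vN2] for the delta function of the zero class, evaluated at that class, reads
    [#|I| / vol ^+ 2 = 1]. *)
Lemma vol_card : vol = Num.sqrt #|I|%:R.
Proof.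
have v0 : 0 < vol by exact: vol_gt0 k1 Bu.
suff e : #|I|%:R = vol ^+ 2 by rewrite e sqrtr_sqr gtr0_norm.
pose i0 := cl 0.
have Li0 : L (dl (rp i0)) by have := latticeN (cl_repL 0); rewrite dl0 sub0r opprK dl_rp.
have br x : bracket k (- dl (rp i0)) (dl x) = 1 by apply: bracket_LN; exact: latticeN.
have br' i : bracket k (- dl (rp i)) (dl (rp i0)) = 1.
  by rewrite bracketNC bracketC -dlN; apply: bracket_LN; rewrite dlN; exact: latticeN.
have := vN2 k1 Bu dl_sl cl_rp rp_cl (fun i => (i == i0)%:R) i0.
have -> : cl (- rp i0) = i0 by apply: cl_eq; rewrite dlN dl0 subr0; exact: latticeN.
rewrite eqxx.
have E i : vN (fun i => (i == i0)%:R) i = toC vol^-1.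
  rewrite /vN (bigD1 i0)//= eqxx mulr1 br' big1 ?addr0 ?mulr1// => j /negbTE ->.
  by rewrite mulr0.
rewrite /vN; under eq_bigr => i _ do rewrite -/(vN _ i) E br mul1r.
rewrite sumr_const -[X in _ * X = _]mulr_natr mulrA -toCM => /(congr1 (@complex.Re R)).
have -> : (#|I|%:R : R[i]) = toC #|I|%:R by rewrite toC_nat.
rewrite -toCM /= => h.
have vv : vol != 0 by rewrite gt_eqF.
have hN (N : R) : vol^-1 / vol * N = 1 -> N = vol ^+ 2.
  by move=> e; rewrite -[RHS]mulr1 -e; field.
exact: hN h.
Qed.

Lemma vol_cardZ : vol = Num.sqrt (ncard Z)%:R.
Proof. by rewrite vol_card card_ZI. Qed.

Definition negI i := cl (- rp i).

Lemma negIK : involutive negI.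
Proof.
move=> i; rewrite /negI -[RHS](cl_rp i 0) (_ : sl 0 = 0) ?addr0; last first.
  by apply: (dl_inj k1 Bu); rewrite dl_sl lat0 dl0.
apply: cl_eq; have := cl_repL (- rp i); by rewrite -dl_rp !dlN addrC.
Qed.

Lemma sum_negI (V : nmodType) (f : I -> V) : \sum_i f (negI i) = \sum_i f i.
Proof. by rewrite [RHS](reindex negI)//; exists negI => i _; rewrite negIK. Qed.

Lemma bracket_negI i i' : bracket k (- dl (rp i)) (dl (rp (negI i'))) = bracket k (dl (rp i)) (dl (rp i')).
Proof.
rewrite bracketC -[dl (rp (negI i'))]opprK bracketN -bracketNr opprK /negI bracket_dl_rp.
by rewrite dlN opprK bracketC.
Qed.

(** [fourierZ] has the opposite sign in its character; relabelling the classes by [negI] turns it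
    into [vN], which is thereby its inverse. *)
Lemma fourierZE F t i : fourierZ F t (iz i) = vN (fun i' => F t (iz (negI i'))) i.
Proof.
rewrite /fourierZ /vN -vol_cardZ (sumZ hPhi hDelta k1); congr (_ * _).
rewrite -[LHS]sum_negI; apply: eq_bigr => i' _; rewrite mulrC; congr (_ * _).
by rewrite -!dl_rp -bracket_negI negIK.
Qed.

Lemma vN_fourierZ F t i : vN (fun i' => fourierZ F t (iz i')) i = F t (iz i).
Proof.
have -> : (fun i' => fourierZ F t (iz i')) = vN (fun i' => F t (iz (negI i'))).
  by apply/funext => i'; rewrite fourierZE.
by rewrite (vN2 k1 Bu dl_sl cl_rp rp_cl) -/(negI i) negIK.
Qed.

Definition famZ F i x := F x (iz i).
(** The inverse finite Fourier transform: it is what the sum over Z_(k) inside [zakS] performs. *)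
Definition invF H i x := vN (fun i' => H x (iz i')) i.

Lemma invF_fourierZ F : invF (fourierZ F) = famZ F.
Proof. by apply/funext => i; apply/funext => x; exact: vN_fourierZ. Qed.

Lemma invFE H i x : invF H i x = \sum_i' (toC vol^-1 * bracket k (- dl (rp i)) (dl (rp i'))) * H x (iz i').
Proof. by rewrite /invF /vN mulr_sumr; apply: eq_bigr => i' _; rewrite mulrA. Qed.

Lemma csum_dl (f : 'cV[R]_n -> R[i]) : csum Lw f = csum setT (f \o dl).
Proof.
have E (g : 'cV[R]_n -> R) : rsum Lw g = rsum setT (g \o dl).
  have bij : set_bij setT Lw dl.
    split=> [z _|z z' _ _|g' /(weightP hPhi hDelta k1)[z ->]]; last by exists z.
      exact: dl_Lw.
    exact: dl_inj k1 Bu _ _.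
  by rewrite /rsum !(reindex_esum _ _ _ _ bij).
by rewrite /csum !E.
Qed.

Lemma zakSE H p : zakS H p = toC vol^-1 * ph k p *
  \sum_i csum setT (lterm k B (fun x => H x (iz i)) (dl (rp i)) p).
Proof.
rewrite /zakS -vol_cardZ (sumZ hPhi hDelta k1); congr (_ * _); apply: eq_bigr => i _.
by rewrite csum_dl dl_rp.
Qed.

Lemma cmeas_zakS H : (forall c, cmeasurable (fun x => H x c)) -> cmeasurable (zakS H).
Proof.
move=> mH; rewrite (_ : zakS H = fun p => toC vol^-1 * ph k p *
  \sum_i csum setT (lterm k B (fun x => H x (iz i)) (dl (rp i)) p)); last exact/funext/zakSE.
apply: cmeasM; first by apply: cmeasZ; exact: cmeas_ph.
by apply: cmeas_sum => i; apply: (cmeas_csum (a := fun z p => lterm k B (fun x => H x (iz i)) (dl (rp i)) p z)) => z; apply: cmeas_lterm.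
Qed.

Lemma L2_invF H : L2Z Phi k H -> L2fam k (invF H).
Proof.
move=> LH i; have := @L2_sum R n k I (index_enum I)
  (fun i' => toC vol^-1 * bracket k (- dl (rp i)) (dl (rp i'))) (fun i' x => H x (iz i')) (fun i' => LH _).
by congr L2; apply/funext => x; rewrite invFE.
Qed.

Lemma L2_fourierZ F : L2Z Phi k F -> L2Z Phi k (fourierZ F).
Proof.
move=> LF c; rewrite -[c](ziK hPhi hDelta k1).
have := @L2_sum R n k I (index_enum I)
  (fun i' => toC vol^-1 * bracket k (- dl (rp (zi c))) (dl (rp i'))) (fun i' x => F x (iz (negI i'))) (fun i' => LF _).
congr L2; apply/funext => x; rewrite fourierZE /vN mulr_sumr; apply: eq_bigr => i' _.
by rewrite mulrA.
Qed.

Lemma Zr_zakS H : (forall c, schwartz (fun x => H x c)) -> Zr (invF H) (zakS H).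
Proof.
move=> sH; have LH : L2Z Phi k H by move=> c; exact: schwartz_L2.
have mH c : cmeasurable (fun x => H x c) by exact: schwartz_cmeas.
apply: (Zr_pointwise k1 Bu dl_sl cl_rp rp_cl (L2_invF LH) (cmeas_zakS mH)).
have : {ae nu, forall p i, C2 p -> ccvg (fun N => \sum_(z <- boxs N) lterm k B (fun x => H x (iz i)) (dl (rp i)) p z)
   (csum setT (lterm k B (fun x => H x (iz i)) (dl (rp i)) p))}.
  have Hi i := lterm_cvg Bu dl_sl cl_rp rp_cl (dl (rp i)) (sH (iz i)).
  by apply: filter_forall => i; exact: Hi.
apply: filterS => p Hp Cp; rewrite zakSE.
have := ccvgZ (toC vol^-1 * ph k p) (ccvg_sum (index_enum I) (fun i => Hp i Cp)).
apply: ccvg_eq => N; rewrite /zs [toC _ * _]mulrC -mulrA; congr (_ * _).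
rewrite exchange_big mulr_sumr; apply: eq_bigr => z _ /=.
rewrite invFE mulr_suml mulr_sumr; apply: eq_bigr => i _.
rewrite bracket_dl_rp /lterm /chr; ring.
Qed.

(** The two transforms agree on Schwartz functions and are both closed, so density identifies them;
    the finite Fourier transform cancels against the sum over Z_(k). *)
Lemma zakP F psi : L2Z Phi k F -> level_section Phi k Delta psi ->
  (zak Delta (fourierZ F) psi <-> Zr (famZ F) psi).
Proof.
move=> LF Lpsi; have mpsi : cmeasurable psi by case: Lpsi.
have LFF := L2_fourierZ LF; have LfF : L2fam k (famZ F) by move=> i; exact: LF.
have mfF := L2fam_mfam LfF.
have Ec : cell Delta = cellb := cell_cellB hPhi hDelta.
have N1lim (Fm : nat -> 'cV[R]_n -> Z -> R[i]) : (forall m c, schwartz (fun x => Fm m x c)) ->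
    (forall c, nsqT (fun x => Fm m x c - fourierZ F x c) @[m --> \oo] --> 0%E) ->
    N1 k (fun i x => invF (Fm m) i x - famZ F i x) @[m --> \oo] --> 0%E.
  move=> sF hF; rewrite -invF_fourierZ; apply: N1_cvg0 => i.
  have := nsq_cvg_sum (index_enum I) (fun i' => toC vol^-1 * bracket k (- dl (rp i)) (dl (rp i')))
    (Gm := fun m i' x => Fm m x (iz i')) (g := fun i' x => fourierZ F x (iz i'))
    (fun m i' => schwartz_cmeas (sF m _)) (fun i' => (LFF _).1) (fun i' => hF _).
  by apply: cvg_fun_eq => m; apply: eq_nsq => x _; rewrite !invFE.
split=> [[_ _ [Fm [sF hF hz]]]|Zpsi].
  apply: (Zr_closed k1 Bu dl_sl cl_rp rp_cl (Fm := fun m => invF (Fm m)) (psim := fun m => zakS (Fm m))) => //.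
  - by move=> m; apply: L2fam_mfam; apply: L2_invF => c; exact: schwartz_L2.
  - by move=> m; exact: Zr_zakS.
  - exact: N1lim.
  - by move: hz; rewrite Ec.
have /choice[Fm HFm] : forall c, exists Fm : nat -> 'cV[R]_n -> R[i], (forall m, schwartz (Fm m)) /\
    nsqT (fun x => Fm m x - fourierZ F x c) @[m --> \oo] --> 0%E.
  by move=> c; exact: schwartz_dense.
split=> //; exists (fun m x c => Fm c m x); split.
- by move=> m c; have [] := HFm c.
- by move=> c; have [] := HFm c.
rewrite Ec; apply: (Zr_lim k1 Bu dl_sl cl_rp rp_cl (Fm := fun m => invF (fun x c => Fm c m x)) (F := famZ F)) => //.
- by move=> m; apply: L2fam_mfam; apply: L2_invF => c; apply: schwartz_L2; have [] := HFm c.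
- move=> m; apply: L2fam_N1; apply: L2_invF => c; apply: schwartz_L2; have [] := HFm c => //.
- by move=> m; apply: Zr_zakS => c; have [] := HFm c.
- exact: L2fam_N1.
- by apply: (N1lim (fun m x c => Fm c m x)) => [m c|c]; have [] := HFm c.
Qed.
End zak_equivalence.

(** * The two representations and the splitting *)

Section weyl_sums.
Context {R : realType} {n : nat}.
Variables (Phi : set 'cV[R]_n) (Delta : 'I_n -> 'cV[R]_n) (k : nat).
Hypothesis hPhi : simple_root_system Phi.
Hypothesis hDelta : simple_roots Phi Delta.
Hypothesis k1 : (1 <= k)%N.
Local Notation L := (coroot_lattice Phi).
Local Notation W := (weyl Phi).
Local Notation Z := (Zk Phi k).
Local Notation mu := (@volk R n k).

Definition WI : finType := fset_sub_type (fset_set W).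

Lemma WI_W (i : WI) : W (val i).
Proof. by have := valP i; rewrite in_fset_set ?inE//; exact: (weyl_finite hPhi hDelta). Qed.

Lemma sumW (V : nmodType) (f : 'M[R]_n -> V) : \sum_(w \in W) f w = \sum_(i : WI) f (val i).
Proof.
rewrite fsbig_finite/=; last exact: (weyl_finite hPhi hDelta).
by rewrite big_seq_fsetE.
Qed.

Lemma card_WI : #|WI| = ncard W. Proof. by rewrite /ncard cardfE. Qed.

Lemma card_W_gt0 : (0 < ncard W)%N.
Proof.
rewrite -card_WI; apply/card_gt0P.
have W1 : (1%:M : 'M[R]_n) \in fset_set W.
  by rewrite in_fset_set ?inE; [exact: weyl1|exact: (weyl_finite hPhi hDelta)].
by exists (FSetSub W1).
Qed.

Lemma sumW_mulr (V : nmodType) (f : 'M[R]_n -> V) v : W v ->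
  \sum_(w \in W) f (w *m v) = \sum_(w \in W) f w.
Proof.
move=> Wv; apply/esym; apply: reindex_fsbig; split.
- by move=> w Ww; exact: weylM.
- move=> w w' _ _ /(congr1 (mulmx^~ v^T)).
  by rewrite -!mulmxA (weyl_trK hPhi)// !mulmx1.
- move=> w Ww; exists (w *m v^T); first by apply: weylM => //; exact: weyl_tr.
  by rewrite -mulmxA (weyl_orth hPhi)// mulmx1.
Qed.

Lemma sumW_tr (V : nmodType) (f : 'M[R]_n -> V) : \sum_(w \in W) f w^T = \sum_(w \in W) f w.
Proof.
apply/esym; apply: reindex_fsbig; split.
- by move=> w Ww; exact: weyl_tr.
- by move=> w w' _ _ /trmx_inj.
- by move=> w Ww; exists w^T; [exact: weyl_tr|rewrite trmxK].
Qed.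

Lemma sumW_mull (V : nmodType) (f : 'M[R]_n -> V) v : W v ->
  \sum_(w \in W) f (v *m w) = \sum_(w \in W) f w.
Proof.
move=> Wv; rewrite -sumW_tr -[RHS]sumW_tr -(sumW_mulr (fun w => f w^T) (weyl_tr Wv)).
by apply: eq_fsbigr => w _; rewrite trmx_mul trmxK.
Qed.

Lemma eq_sumW (V : nmodType) (f g : 'M[R]_n -> V) : (forall w, W w -> f w = g w) ->
  \sum_(w \in W) f w = \sum_(w \in W) g w.
Proof. by move=> fg; rewrite !sumW; apply: eq_bigr => i _; apply: fg; exact: WI_W. Qed.

Lemma mulr_sumW (a : R[i]) (f : 'M[R]_n -> R[i]) :
  a * \sum_(w \in W) f w = \sum_(w \in W) a * f w.
Proof. by rewrite !sumW mulr_sumr. Qed.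

Lemma mulr_sumWl (a : R[i]) (f : 'M[R]_n -> R[i]) :
  (\sum_(w \in W) f w) * a = \sum_(w \in W) f w * a.
Proof. by rewrite !sumW mulr_suml. Qed.

Lemma sumW_const (a : R[i]) : \sum_(w \in W) a = (ncard W)%:R * a.
Proof. by rewrite sumW sumr_const -card_WI mulr_natl. Qed.

Lemma W_neq0 : ((ncard W)%:R : R[i]) != 0.
Proof. by rewrite pnatr_eq0 -lt0n card_W_gt0. Qed.

Lemma chiM eps (w v : 'M[R]_n) : chi eps (w *m v) = chi eps w * chi eps v.
Proof. by rewrite /chi det_mulmx exprMn toCM. Qed.

Lemma chi_tr eps (w : 'M[R]_n) : chi eps w^T = chi eps w.
Proof. by rewrite /chi det_tr. Qed.

Lemma chi_1 eps : chi eps (1%:M : 'M[R]_n) = 1.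
Proof. by rewrite /chi det1 expr1n toC1. Qed.

Lemma chi_sq eps w : W w -> chi eps w * chi eps w = 1.
Proof.
move=> Ww; rewrite -toCM -exprMn -[RHS]toC1; congr toC.
have -> : \det w * \det w = 1.
  by case: (weyl_det hPhi Ww) => ->; rewrite ?mulrNN mul1r.
by rewrite expr1n.
Qed.

Lemma chi_false (w : 'M[R]_n) : chi false w = 1.
Proof. by rewrite /chi expr0 toC1. Qed.

(** Extended by the identity outside W, so that the action is a plain function of the matrix. *)
Definition wca (w : 'M[R]_n) (c : Z) : Z :=
  if pselect (W w) is left Ww then wc hPhi hDelta k1 Ww c else c.

Lemma wcaP w (c c' : Z) : W w -> val c' = wact w c <-> c' = wca w c.
Proof.
move=> Ww; rewrite /wca; case: pselect => // Ww'; exact: wactP.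
Qed.

Lemma rep_wca w c : W w -> L (w *m rep c - rep (wca w c)).
Proof.
move=> Ww; rewrite /wca; case: pselect => // Ww'.
exact/(clsz_rep hPhi hDelta k1 _ (weyl_Lw hPhi Ww' (rep_in hPhi hDelta k1 c).1)).
Qed.

Lemma wca_eq w c c' : W w -> L (w *m rep c - rep c') -> wca w c = c'.
Proof.
move=> Ww h; apply: (Zk_eq hPhi hDelta k1).
have := latticeB h (rep_wca c Ww); congr L.
by move: (w *m rep c) (rep (wca w c)) (rep c') => a b d; apply/matrixP => i i'; rewrite !mxE; ring.
Qed.

Lemma wca1 c : wca 1%:M c = c.
Proof. by apply: wca_eq; [exact: weyl1|rewrite mul1mx subrr; exact: lattice0]. Qed.

Lemma wcaM w v c : W w -> W v -> wca (w *m v) c = wca w (wca v c).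
Proof.
move=> Ww Wv; apply: wca_eq; first exact: weylM.
have := latticeD (weyl_lattice hPhi Ww (rep_wca c Wv)) (rep_wca (wca v c) Ww); congr L.
by rewrite mulmxBr mulmxA addrA subrK.
Qed.

Lemma wca_bij w : W w -> bijective (wca w).
Proof.
move=> Ww; have Wt := weyl_tr Ww; exists (wca w^T) => c.
  by rewrite -wcaM// (weyl_orth hPhi)// wca1.
by rewrite -wcaM// (weyl_trK hPhi)// wca1.
Qed.

Lemma L2ZWP (F : 'cV[R]_n -> Z -> R[i]) : L2ZW Phi k F <-> L2Z Phi k F /\
  forall w, W w -> forall c, aeeq k (fun x => F (w *m x) (wca w c)) (fun x => F x c).
Proof.
split=> -[LF H]; split=> // w Ww c; first by apply: H => //; exact/wcaP.
by move=> c' /(wcaP _ _ Ww) ->; exact: H.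
Qed.

Lemma CkP eps (x : Z -> R[i]) : Ck Phi k eps x <-> forall w, W w -> forall c, x (wca w c) = chi eps w * x c.
Proof.
split=> H w Ww c; first by apply: H => //; exact/wcaP.
by move=> c' /(wcaP _ _ Ww) ->; exact: H.
Qed.
End weyl_sums.

(** * The conjugated operators *)

Section rho_hat.
Context {R : realType} {n : nat}.
Variables (Phi : set 'cV[R]_n) (Delta : 'I_n -> 'cV[R]_n) (k : nat).
Hypothesis hPhi : simple_root_system Phi.
Hypothesis hDelta : simple_roots Phi Delta.
Hypothesis k1 : (1 <= k)%N.
Local Notation L := (coroot_lattice Phi).
Local Notation W := (weyl Phi).
Local Notation Z := (Zk Phi k).
Local Notation B := (rB Delta).
Local Notation Bu := (rB_unit hPhi hDelta).
Local Notation lat := (lat B).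
Local Notation dl := (dl k B).
Local Notation I := (ZI Phi k).
Local Notation iz := (iz hPhi hDelta k1).
Local Notation zi := (zi hPhi hDelta k1).
Local Notation rp := (rp hPhi hDelta k1).
Local Notation cl := (cl hPhi hDelta k1).
Local Notation sl := (sl hPhi hDelta k1).
Local Notation dl_sl := (dl_sl hPhi hDelta k1).
Local Notation cl_rp := (cl_rp hPhi hDelta k1).
Local Notation rp_cl := (rp_cl hPhi hDelta k1).
Local Notation dl_rp := (dl_rp hPhi hDelta k1).
Local Notation mu := (@volk R n k).
Local Notation nu := (mu \x mu)%E.
Local Notation cellb := (cellB B).
Local Notation C2 := (cellb `*` cellb).
Local Notation vol := (vol k B).
Local Notation Zr := (Zr k B cl).
Local Notation famZ := (famZ hPhi hDelta k1).
Local Notation wca := (wca hPhi hDelta k1).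
Local Notation level := (level_section Phi k Delta).
Implicit Types (F G H : 'cV[R]_n -> Z -> R[i]).

Lemma levelP psi : level psi <-> [/\ cmeasurable psi, lat_equiv k B psi & (nsq nu C2 psi < +oo)%E].
Proof.
have E : (\int[nu]_(p in cell Delta `*` cell Delta) (sqnormc (psi p - 0))%:E = nsq nu C2 psi)%E.
  by rewrite (cell_cellB hPhi hDelta); apply: eq_nsq => p _; rewrite subr0.
split=> -[h1 h2 h3]; split => //.
- by move=> l1 l2 x y; rewrite h2//; exact: (lat_L hPhi hDelta).
- by rewrite -E.
- by move=> l1 l2 /(latP hPhi hDelta)[z1 ->] /(latP hPhi hDelta)[z2 ->] x y; rewrite h2.
- by rewrite E.
Qed.

(** The average is invariant at every point, where [F] is so only almost everywhere; thus the
    section built from it is invariant at every point, as [Hk] demands. *)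
Definition symZ F t c : R[i] := ((ncard W)%:R)^-1 * \sum_(w \in W) F (w *m t) (wca w c).

Lemma symZ_inv F w t c : W w -> symZ F (w *m t) (wca w c) = symZ F t c.
Proof.
move=> Ww; rewrite /symZ; congr (_ * _).
rewrite -[RHS](sumW_mulr hPhi (fun v => F (v *m t) (wca v c)) Ww).
by apply: (eq_sumW hPhi hDelta) => v Wv; rewrite mulmxA wcaM.
Qed.

Lemma symZ_ae F : L2ZW Phi k F -> eqZ F (symZ F).
Proof.
move=> /(L2ZWP hPhi hDelta k1)[LF HF] c.
have := aeeq_sum (index_enum (WI Phi)) (fun=> 1 : R[i])
  (fun i => HF _ (WI_W hPhi hDelta i) c).
apply: filterS => t; rewrite /symZ (sumW hPhi hDelta).
under eq_bigr do rewrite mul1r.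
move=> ->; under eq_bigr do rewrite mul1r.
have W0 : ((ncard W)%:R : R[i]) != 0 by exact: (W_neq0 hPhi hDelta).
by rewrite sumr_const card_WI -[X in _ = _ * X]mulr_natl mulrA mulVf// mul1r.
Qed.

Lemma L2_orth f w : W w -> L2 k f -> L2 k (fun x => f (w *m x)).
Proof.
move=> Ww [mf ff]; have ow := weyl_orth hPhi Ww; split.
  by apply: (cmeas_comp mf); exact: measurable_mulmx.
by have := nsq_mpres measurableT (mpres_orth k1 ow) mf; rewrite preimage_setT /nsq => ->.
Qed.

Lemma L2_symZ F : L2Z Phi k F -> L2Z Phi k (symZ F).
Proof.
move=> LF c; have := @L2_Z R n k (((ncard W)%:R)^-1) _ (@L2_sum R n k _ (index_enum (WI Phi)) (fun=> 1 : R[i])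
  (fun i x => F (val i *m x) (wca (val i) c)) (fun i => L2_orth (WI_W hPhi hDelta i) (LF _))).
congr L2; apply/funext => x; rewrite /symZ (sumW hPhi hDelta); congr (_ * _).
by apply: eq_bigr => i _; rewrite mul1r.
Qed.

Lemma exists_wz w : W w -> exists wz : 'cV[int]_n -> 'cV[int]_n, bijective wz /\ forall z, dl (wz z) = w *m dl z.
Proof.
have ex v : W v -> exists wz : 'cV[int]_n -> 'cV[int]_n, forall z, dl (wz z) = v *m dl z.
  move=> Wv; suff /choice[f fE] : forall z, exists z', dl z' = v *m dl z by exists f.
  move=> z.
  have /(weightP hPhi hDelta k1)[z' ->] := weyl_Lw hPhi Wv (dl_Lw hPhi hDelta k1 z).
  by exists z'.
move=> Ww; have [f fE] := ex _ Ww; have [g gE] := ex _ (weyl_tr Ww).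
exists f; split=> //; exists g => z; apply: (dl_inj k1 Bu).
  by rewrite gE fE mulmxA (weyl_orth hPhi)// mul1mx.
by rewrite fE gE mulmxA (weyl_trK hPhi)// mul1mx.
Qed.

Lemma iz_cl_wz w wz z : W w -> dl (wz z) = w *m dl z -> iz (cl (wz z)) = wca w (iz (cl z)).
Proof.
move=> Ww e; apply/esym; apply: wca_eq => //.
have h1 := cl_repL hPhi hDelta k1 z; have h2 := cl_repL hPhi hDelta k1 (wz z).
have := latticeB h2 (weyl_lattice hPhi Ww h1); congr L.
rewrite e mulmxBr; move: (w *m dl z) (w *m rep _) (rep _) => a b d.
by apply/matrixP => i i'; rewrite !mxE; ring.
Qed.

Lemma famZ_L2 F : L2Z Phi k F -> L2fam k (famZ F). Proof. by move=> LF i; exact: LF. Qed.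

Lemma Hk_exists F : L2ZW Phi k F -> exists psi, Hk Phi k Delta psi /\ Zr (famZ F) psi.
Proof.
move=> LF; have [LF0 _] := LF; have LS := L2_symZ LF0.
have [psi [Zpsi lpsi wpsi]] := zak_exists k1 Bu dl_sl cl_rp rp_cl (famZ_L2 LS).
have mS := L2fam_mfam (famZ_L2 LS).
have ZF : Zr (famZ F) psi.
  apply: (Zr_ae k1 Bu dl_sl cl_rp rp_cl mS _ _ Zpsi); first exact: L2fam_mfam (famZ_L2 LF0).
  by move=> i; apply: aeeq_sym; exact: symZ_ae.
exists psi; split=> //; split.
  apply/levelP; split=> //; first by case: Zpsi.
  exact: (Zr_fin k1 Bu dl_sl cl_rp rp_cl mS (L2fam_N1 (famZ_L2 LS)) Zpsi).
move=> w Ww; have [wz [bwz wzE]] := exists_wz Ww.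
apply: (wpsi w wz) => //; first exact: weyl_orth hPhi _ Ww.
by move=> z x; rewrite /famZ (iz_cl_wz Ww (wzE z)) symZ_inv.
Qed.

(** [AF] is the counterpart on families of the operator [A] on sections. Existence of an invariant
    section gives one direction, uniqueness of the transform the other. *)
Lemma rho_hatP (A : ('cV[R]_n * 'cV[R]_n -> R[i]) -> ('cV[R]_n * 'cV[R]_n -> R[i]))
    (AF : (I -> 'cV[R]_n -> R[i]) -> I -> 'cV[R]_n -> R[i]) F G :
  (forall f psi, L2fam k f -> Zr f psi -> lat_equiv k B psi -> Zr (AF f) (A psi)) ->
  (forall f, L2fam k f -> L2fam k (AF f)) -> (forall psi, level psi -> level (A psi)) ->
  L2ZW Phi k F -> L2Z Phi k G ->
  (rho_hat Phi k Delta A F G <-> forall i, aeeq k (famZ G i) (AF (famZ F) i)).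
Proof.
move=> hA LA levA LFW LG; have [LF _] := LFW.
have LfF := famZ_L2 LF; have LfG := famZ_L2 LG.
have mAF := L2fam_mfam (LA _ LfF); have mG := L2fam_mfam LfG.
split=> [[psi [[lpsi _] z1 z2]]|H].
  have lA := levA _ lpsi; have [_ ll _] := (levelP psi).1 lpsi.
  have /(zakP hPhi hDelta k1 LF lpsi) Z1 := z1.
  have /(zakP hPhi hDelta k1 LG lA) Z2 := z2.
  exact: (Zr_uniq k1 Bu dl_sl cl_rp rp_cl mG mAF Z2 (hA _ _ LfF Z1 ll)).
have [psi [hpsi Zpsi]] := Hk_exists LFW; have [lpsi _] := hpsi.
have [_ ll _] := (levelP psi).1 lpsi.
exists psi; split=> //; first exact/(zakP hPhi hDelta k1 LF lpsi).
apply/(zakP hPhi hDelta k1 LG (levA _ lpsi)).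
apply: (Zr_ae k1 Bu dl_sl cl_rp rp_cl mAF mG _ (hA _ _ LfF Zpsi ll)).
by move=> i; apply: aeeq_sym.
Qed.

Lemma rho_S F G : L2ZW Phi k F -> L2Z Phi k G ->
  (rho_hat Phi k Delta Stilde F G <-> forall i, aeeq k (famZ G i) (SF2 k B rp (famZ F) i)).
Proof.
apply: rho_hatP.
- by move=> F' psi LF Z ll; exact: (zak_S2 k1 Bu dl_sl cl_rp rp_cl).
- by move=> F' LF; exact: L2fam_SF2.
- move=> psi /levelP[h1 h2 h3]; apply/levelP; split; first exact: cmeas_Stilde.
    exact: (Stilde_equiv k1 Bu dl_sl).
  by rewrite nsq_Stilde//; exact: Bu.
Qed.

Lemma rho_T F G : L2ZW Phi k F -> L2Z Phi k G ->
  (rho_hat Phi k Delta Ttilde F G <-> forall i, aeeq k (famZ G i) (TF k B rp (famZ F) i)).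
Proof.
have ev := lat_even k hPhi hDelta.
apply: rho_hatP.
- by move=> F' psi LF Z ll; apply: (zak_T k1 Bu dl_sl rp_cl ev) => //; exact: L2fam_mfam.
- by move=> F' LF; exact: L2fam_TF.
- move=> psi /levelP[h1 h2 h3]; apply/levelP; split; first exact: cmeas_Ttilde.
    exact: Ttilde_equiv ev _ h2.
  by rewrite (nsq_Ttilde Bu h1 (lat_equiv_y h2)).
Qed.
End rho_hat.

(** * The representations on functions on the Lie algebra of the torus *)

Section infinite_operators.
Context {R : realType} {n : nat}.
Variables (Phi : set 'cV[R]_n) (Delta : 'I_n -> 'cV[R]_n) (k : nat) (j om : R[i]).
Hypothesis hPhi : simple_root_system Phi.
Hypothesis hDelta : simple_roots Phi Delta.
Hypothesis k1 : (1 <= k)%N.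
Hypothesis hj : j ^+ 4 = 1.
Hypothesis hom : om ^+ 3 = cexpi (n%:R * pi / 4) * j^-1.
Local Notation W := (weyl Phi).
Local Notation mu := (@volk R n k).
Local Notation nsqT := (nsq mu setT).
Implicit Types (f g : 'cV[R]_n -> R[i]).

Lemma j_neq0 : j != 0.
Proof. by apply/eqP => e; move/eqP: hj; rewrite e expr0n eq_sym oner_eq0. Qed.

Lemma om_neq0 : om != 0.
Proof.
apply/eqP => e; move/eqP: hom; rewrite e expr0n /= eq_sym mulf_eq0 invr_eq0 (negbTE j_neq0) orbF.
by rewrite (negbTE (cexpi_neq0 _)).
Qed.

Lemma sqnormc_exp (z : R[i]) m : sqnormc (z ^+ m) = sqnormc z ^+ m.
Proof. by elim: m => [|m IH]; rewrite ?expr0 ?exprS ?sqnormcM ?IH// -toC1 sqnormc_toC expr1n. Qed.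

Lemma sqnormc_j : sqnormc j = 1.
Proof.
have : sqnormc j ^+ 4 = 1 by rewrite -sqnormc_exp hj -toC1 sqnormc_toC expr1n.
by move/eqP; rewrite pexprn_eq1 ?sqnormc_ge0// => /eqP.
Qed.

Lemma sqnormc_om : sqnormc om = 1.
Proof.
have h : sqnormc j^-1 = 1.
  by have := sqnormcM j j^-1; rewrite mulfV ?j_neq0// sqnormc_j mul1r -toC1 sqnormc_toC expr1n.
have : sqnormc om ^+ 3 = 1 by rewrite -sqnormc_exp hom sqnormcM sqnormc_cexpi h mulr1.
by move/eqP; rewrite pexprn_eq1 ?sqnormc_ge0// => /eqP.
Qed.

Definition rS f : 'cV[R]_n -> R[i] := fun x => j * FT2 k f x.
Definition rT f : 'cV[R]_n -> R[i] := fun x => om * Mo k f x.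

Lemma L2_rS f : L2 k f -> L2 k (rS f).
Proof. by move=> Lf; apply: L2_Z; exact: L2_FT2. Qed.

Lemma L2_rT f : L2 k f -> L2 k (rT f).
Proof. by move=> Lf; apply: L2_Z; exact: L2_Mo. Qed.

Lemma FT2_weyl f w : W w -> L2 k f -> aeeq k (FT2 k (fun x => f (w *m x))) (fun x => FT2 k f (w *m x)).
Proof.
move=> Ww Lf; have ow := weyl_orth hPhi Ww.
exact: (FTr_uniq k1 (FT2P k1 (L2_orth hPhi k1 Ww Lf)) (FTr_orth k1 ow (FT2P k1 Lf)) (aeeq_refl _ _)).
Qed.

Lemma L2W_Z eps c f : L2W Phi k eps f -> L2W Phi k eps (fun x => c * f x).
Proof.
move=> [Lf Hf]; split; first exact: L2_Z.
by move=> w Ww; apply: filterS (Hf w Ww) => x ->; rewrite mulrCA.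
Qed.

Lemma L2W_FT2 eps f : L2W Phi k eps f -> L2W Phi k eps (FT2 k f).
Proof.
move=> [Lf Hf]; split; first exact: L2_FT2.
move=> w Ww; have h1 := FT2_ae k1 (L2_orth hPhi k1 Ww Lf) (L2_Z (chi eps w) Lf) (Hf w Ww).
exact: aeeq_trans (aeeq_sym (FT2_weyl Ww Lf)) (aeeq_trans h1 (FT2_Z k1 _ Lf)).
Qed.

Lemma L2W_Mo eps f : L2W Phi k eps f -> L2W Phi k eps (Mo k f).
Proof.
move=> [Lf Hf]; split; first exact: L2_Mo.
move=> w Ww; apply: filterS (Hf w Ww) => x e.
have E : ipk k (w *m x) (w *m x) = ipk k x x by rewrite /ipk (dotv_orth _ _ (weyl_orth hPhi Ww)).
by rewrite /Mo e E mulrCA.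
Qed.

(** Tracks the scalar in front of a word in Fourier transforms and Gaussians, so that the relations
    come down to powers of [j] and [om]. *)
Definition aeZ c f g := [/\ L2 k f, L2 k g & aeeq k f (fun x => c * g x)].

Lemma aeZ_S c f g : aeZ c f g -> aeZ (j * c) (rS f) (FT2 k g).
Proof.
move=> [Lf Lg e]; split; [exact: L2_rS|exact: L2_FT2|].
have h := aeeq_trans (FT2_ae k1 Lf (L2_Z c Lg) e) (FT2_Z k1 c Lg).
by apply: filterS h => x; rewrite /rS => ->; rewrite mulrA.
Qed.

Lemma aeZ_T c f g : aeZ c f g -> aeZ (om * c) (rT f) (Mo k g).
Proof.
move=> [Lf Lg e]; split; [exact: L2_rT|exact: L2_Mo|].
by apply: filterS (Mo_ae e) => x; rewrite /rT => ->; rewrite /Mo; ring.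
Qed.

Lemma rS_rT_rep eps : SL2Z_rep (L2W Phi k eps) (aeeq k) rS rT.
Proof.
split.
- by move=> f Vf; split; apply: L2W_Z; [exact: L2W_FT2|exact: L2W_Mo].
- move=> f g [Lf _] [Lg _] fg; split; apply: aeeq_Z; [exact: FT2_ae|exact: Mo_ae].
- move=> a f g [Lf _] [Lg _]; split.
    by apply: filterS (FT2_lin k1 a Lf Lg) => x; rewrite /rS => ->; rewrite mulrDr mulrCA.
  apply: filterS (aeeq_refl k f) => x _; rewrite /rT /Mo; ring.
- move=> f [Lf _].
  have h0 : aeZ 1 f f by split=> //; apply: filterS (aeeq_refl k f) => x _; rewrite mul1r.
  have [_ _ hS] := aeZ_S (aeZ_S h0).
  have [_ _ hT] := aeZ_S (aeZ_T (aeZ_S (aeZ_T (aeZ_S (aeZ_T h0))))).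
  have hc := fourier_cube k1 Lf.
  apply: (aeeq_trans hS); apply: aeeq_sym; apply: (aeeq_trans hT).
  apply: filterS hc => x <-; rewrite !mulr1 [RHS]mulrA; congr (_ * _).
  (* The word for (ST)^3 carries [(j * om) ^+ 3] and that for S^2 carries [j ^+ 2]; the prescribed
     cube of [om] makes up for the Gauss sum. *)
  transitivity (j ^+ 3 * om ^+ 3); first by ring.
  by rewrite hom; field; exact: j_neq0.
- move=> f [Lf _].
  have h0 : aeZ 1 f f by split=> //; apply: filterS (aeeq_refl k f) => x _; rewrite mul1r.
  have [_ _ hS] := aeZ_S (aeZ_S (aeZ_S (aeZ_S h0))).
  apply: filterS2 hS (FT2_four k1 Lf) => x -> ->.
  by rewrite mulr1 (_ : j * (j * (j * j)) = 1) ?mul1r// -[RHS]hj; ring.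
Qed.

Lemma rS_isometry eps : L2_isometry k (L2W Phi k eps) rS.
Proof.
move=> f [Lf _]; rewrite -/(nsqT (rS f)) /rS nsqZ//; last by have [] := L2_FT2 k1 Lf.
by rewrite sqnormc_j mul1e FT2_nsq.
Qed.

Lemma rT_isometry eps : L2_isometry k (L2W Phi k eps) rT.
Proof.
move=> f [Lf _]; rewrite -/(nsqT (rT f)) /rT nsqZ//; last by have [] := L2_Mo Lf.
by rewrite sqnormc_om mul1e nsq_Mo.
Qed.
End infinite_operators.

(** * The representations on functions on Z_(k) *)

Section finite_operators.
Context {R : realType} {n : nat}.
Variables (Phi : set 'cV[R]_n) (Delta : 'I_n -> 'cV[R]_n) (k : nat) (j om : R[i]).
Hypothesis hPhi : simple_root_system Phi.
Hypothesis hDelta : simple_roots Phi Delta.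
Hypothesis k1 : (1 <= k)%N.
Hypothesis hj : j ^+ 4 = 1.
Hypothesis hom : om ^+ 3 = cexpi (n%:R * pi / 4) * j^-1.
Local Notation L := (coroot_lattice Phi).
Local Notation Lw := (weight_lattice Phi k).
Local Notation W := (weyl Phi).
Local Notation Z := (Zk Phi k).
Local Notation B := (rB Delta).
Local Notation Bu := (rB_unit hPhi hDelta).
Local Notation dl := (dl k B).
Local Notation I := (ZI Phi k).
Local Notation iz := (iz hPhi hDelta k1).
Local Notation zi := (zi hPhi hDelta k1).
Local Notation rp := (rp hPhi hDelta k1).
Local Notation dl_sl := (dl_sl hPhi hDelta k1).
Local Notation cl_rp := (cl_rp hPhi hDelta k1).
Local Notation rp_cl := (rp_cl hPhi hDelta k1).
Local Notation dl_rp := (dl_rp hPhi hDelta k1).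
Local Notation vN := (vN k B rp).
Local Notation qv := (qv k B rp).
Local Notation wca := (wca hPhi hDelta k1).
Local Notation vol := (vol k B).
Implicit Types (x : Z -> R[i]).

(** The sign in the character is the one that Poisson summation produces, opposite to the sign in
    the kernel of [FT]. *)
Definition mS x : Z -> R[i] := fun c => j^-1 * (toC (Num.sqrt (ncard Z)%:R)^-1 *
  \sum_(c' \in [set: Z]) bracket k (- rep c) (rep c') * x c').
Definition mT x : Z -> R[i] := fun c => om^-1 * cexpi (pi * ipk k (rep c) (rep c)) * x c.

Lemma mSE x : mS x \o iz = fun i => j^-1 * vN (x \o iz) i.
Proof.
apply/funext => i; rewrite /mS /= /vN -(vol_cardZ hPhi hDelta k1); congr (_ * (_ * _)).
by rewrite (sumZ hPhi hDelta k1); apply: eq_bigr => i' _; rewrite -!dl_rp.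
Qed.

Lemma mTE x : mT x \o iz = fun i => om^-1 * qv (x \o iz) i.
Proof. by apply/funext => i; rewrite /mT /= /qv /qz /= dl_rp -mulrA. Qed.

Lemma mS_scale a x (b : I -> R[i]) : x \o iz = (fun i => a * b i) ->
  mS x \o iz = fun i => j^-1 * a * vN b i.
Proof.
move=> e; rewrite mSE e; apply/funext => i; rewrite /vN -mulrA; congr (_ * _).
by rewrite mulrCA; congr (_ * _); rewrite mulr_sumr; apply: eq_bigr => i' _; rewrite mulrCA.
Qed.

Lemma mT_scale a x (b : I -> R[i]) : x \o iz = (fun i => a * b i) ->
  mT x \o iz = fun i => om^-1 * a * qv b i.
Proof. by move=> e; rewrite mTE e; apply/funext => i; rewrite /qv -mulrA; congr (_ * _); rewrite mulrCA. Qed.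

Lemma comp_iz_inj x y : x \o iz = y \o iz -> x = y.
Proof.
by move=> e; apply/funext => c; have := congr1 (@^~ (zi c)) e; rewrite /= (ziK hPhi hDelta k1).
Qed.

Lemma bracket_rep g g' (c c' : Z) : Lw g -> Lw g' -> L (g - rep c) -> L (g' - rep c') ->
  bracket k g g' = bracket k (rep c) (rep c').
Proof.
move=> Hg Hg' l1 l2.
rewrite -[in LHS](subrK (rep c) g) bracketD bracket_int ?mul1r; last first.
  by rewrite ipkC; exact: Hg'.
rewrite -[in LHS](subrK (rep c') g') bracketDr bracket_int ?mul1r//.
by have [+ _] := rep_in hPhi hDelta k1 c; apply.
Qed.

Lemma bracket_wca w (c c' : Z) : W w -> bracket k (rep (wca w c)) (rep (wca w c')) = bracket k (rep c) (rep c').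
Proof.
move=> Ww; rewrite -[RHS](bracket_orth _ _ _ (weyl_orth hPhi Ww)); apply/esym/bracket_rep.
- by apply: (weyl_Lw hPhi Ww); have [] := rep_in hPhi hDelta k1 c.
- by apply: (weyl_Lw hPhi Ww); have [] := rep_in hPhi hDelta k1 c'.
- exact: rep_wca.
- exact: rep_wca.
Qed.

(** Coroot vectors have even square for [(.,.)_1] and integral pairing with the weight lattice, so
    the phase depends on the class only. *)
Lemma quad_rep g (c : Z) : Lw g -> L (g - rep c) ->
  cexpi (pi * ipk k (rep c) (rep c)) = cexpi (pi * ipk k g g).
Proof.
move=> Hg Ll; have [Hc _] := rep_in hPhi hDelta k1 c.
have [m mE] := lattice_even hPhi Ll; have /intrP[a aE] := Hc _ Ll.
have -> : g = (g - rep c) + rep c by rewrite subrK.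
move: (g - rep c) mE aE => l mE aE.
have lE : ipk k l l = k%:R * (2 * m%:~R) by rewrite /ipk mE.
rewrite ipkD !ipkDr (ipkC _ l (rep c)) aE lE.
rewrite -[LHS]mulr1 -(@cexpi_int _ (k%:Z * m + a)%:~R) ?intr_int// -cexpiD; congr cexpi.
rewrite intrD intrM; ring.
Qed.

Lemma quad_wca w (c : Z) : W w ->
  cexpi (pi * ipk k (rep (wca w c)) (rep (wca w c))) = cexpi (pi * ipk k (rep c) (rep c)).
Proof.
move=> Ww; rewrite (quad_rep (weyl_Lw hPhi Ww (rep_in hPhi hDelta k1 c).1) (rep_wca hPhi hDelta k1 c Ww)).
by rewrite /ipk (dotv_orth _ _ (weyl_orth hPhi Ww)).
Qed.

Lemma Ck_mS eps x : Ck Phi k eps x -> Ck Phi k eps (mS x).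
Proof.
move=> /(CkP hPhi hDelta k1) H; apply/(CkP hPhi hDelta k1) => w Ww c.
rewrite /mS [RHS]mulrCA; congr (_ * _); rewrite [RHS]mulrCA; congr (_ * _).
rewrite [LHS](reindex_fsbigT (wca w)) /=; last exact: (wca_bij hPhi hDelta k1 Ww).
rewrite !(sumZ hPhi hDelta k1) mulr_sumr.
apply: eq_bigr => i _; rewrite H// mulrCA; congr (_ * (_ * _)).
by rewrite !bracketN bracket_wca.
Qed.

Lemma Ck_mT eps x : Ck Phi k eps x -> Ck Phi k eps (mT x).
Proof.
move=> /(CkP hPhi hDelta k1) H; apply/(CkP hPhi hDelta k1) => w Ww c.
by rewrite /mT quad_wca// H// mulrCA.
Qed.

Lemma mS_mT_rep eps : SL2Z_rep (Ck Phi k eps) eq mS mT.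
Proof.
have j0 := j_neq0 hj; have o0 := om_neq0 hj hom.
have v2 := vN2 k1 Bu dl_sl cl_rp rp_cl.
split.
- by move=> x Hx; split; [exact: Ck_mS|exact: Ck_mT].
- by move=> x y _ _ ->.
- move=> a x y _ _; split; last by apply/funext => c; rewrite /mT; ring.
  apply/funext => c; rewrite /mS !(sumZ hPhi hDelta k1).
  rewrite (_ : \sum_i _ * (a * _ + _) = a * (\sum_i bracket k (- rep c) (rep (iz i)) * x (iz i)) +
    \sum_i bracket k (- rep c) (rep (iz i)) * y (iz i)); first by ring.
  by rewrite mulr_sumr -big_split /=; apply: eq_bigr => i _; rewrite mulrDr mulrCA.
- move=> x _; apply: comp_iz_inj.
  have h0 : x \o iz = (fun i => 1 * (x \o iz) i) by apply/funext => i; rewrite mul1r.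
  rewrite (mS_scale (mS_scale h0)) (mS_scale (mT_scale (mS_scale (mT_scale (mS_scale (mT_scale h0)))))).
  apply/funext => i.
  rewrite (vN_qv3 k1 Bu dl_sl cl_rp rp_cl (lat_even k hPhi hDelta)).
  rewrite (gammaE k1 Bu dl_sl cl_rp rp_cl (lat_even k hPhi hDelta)).
  rewrite [RHS]mulrA; congr (_ * _).
  have e0 : cexpi (n%:R * pi / 4 : R) = om ^+ 3 * j by rewrite hom mulfVK.
  by rewrite e0; field; rewrite j0 o0.
- move=> x _; apply: comp_iz_inj.
  have h0 : x \o iz = (fun i => 1 * (x \o iz) i) by apply/funext => i; rewrite mul1r.
  rewrite (mS_scale (mS_scale (mS_scale (mS_scale h0)))); apply/funext => i.
  rewrite !v2 -/(negI hPhi hDelta k1 _) -/(negI hPhi hDelta k1 _) negIK.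
  have -> : j^-1 * (j^-1 * (j^-1 * (j^-1 * 1))) = (j ^+ 4)^-1 by field.
  by rewrite hj invr1 mul1r.
Qed.
End finite_operators.

(** * The splitting into tensor products *)

Section tensors.
Context {R : realType} {n : nat}.
Variables (Phi : set 'cV[R]_n) (Delta : 'I_n -> 'cV[R]_n) (k : nat) (j om : R[i]).
Hypothesis hPhi : simple_root_system Phi.
Hypothesis hDelta : simple_roots Phi Delta.
Hypothesis k1 : (1 <= k)%N.
Hypothesis hj : j ^+ 4 = 1.
Hypothesis hom : om ^+ 3 = cexpi (n%:R * pi / 4) * j^-1.
Local Notation L := (coroot_lattice Phi).
Local Notation W := (weyl Phi).
Local Notation Z := (Zk Phi k).
Local Notation B := (rB Delta).
Local Notation I := (ZI Phi k).
Local Notation iz := (iz hPhi hDelta k1).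
Local Notation zi := (zi hPhi hDelta k1).
Local Notation rp := (rp hPhi hDelta k1).
Local Notation wca := (wca hPhi hDelta k1).
Local Notation vol := (vol k B).
Local Notation famZ := (famZ hPhi hDelta k1).
Implicit Types (x : Z -> R[i]) (F G : 'cV[R]_n -> Z -> R[i]).

Lemma L2Z_tens m (f : 'I_m -> 'cV[R]_n -> R[i]) (x : 'I_m -> Z -> R[i]) :
  (forall a, L2 k (f a)) -> L2Z Phi k (tens f x).
Proof.
move=> Lf c; have := L2_sum (index_enum 'I_m) (fun a => x a c) Lf.
by congr L2; apply/funext => t; apply: eq_bigr => a _; rewrite mulrC.
Qed.

Lemma L2ZW_tens eps m (f : 'I_m -> 'cV[R]_n -> R[i]) (x : 'I_m -> Z -> R[i]) :
  (forall a, L2W Phi k eps (f a) /\ Ck Phi k eps (x a)) -> L2ZW Phi k (tens f x).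
Proof.
move=> H; apply/(L2ZWP hPhi hDelta k1); split.
  by apply: L2Z_tens => a; have [[]] := H a.
move=> w Ww c.
have Hf a : aeeq k (fun t => f a (w *m t)) (fun t => chi eps w * f a t).
  by have [[_ h] _] := H a; exact: h.
have := aeeq_sum (index_enum 'I_m) (fun a => x a (wca w c)) Hf.
apply: filterS => t e; rewrite /tens.
transitivity (\sum_a x a (wca w c) * f a (w *m t)); first by apply: eq_bigr => a _; rewrite mulrC.
rewrite e; apply: eq_bigr => a _.
have [_ /(CkP hPhi hDelta k1) ->//] := H a.
by rewrite mulrACA (chi_sq hPhi)// mul1r mulrC.
Qed.

Lemma L2ZW_add F G : L2ZW Phi k F -> L2ZW Phi k G -> L2ZW Phi k (fun t c => F t c + G t c).
Proof.
move=> /(L2ZWP hPhi hDelta k1)[LF HF] /(L2ZWP hPhi hDelta k1)[LG HG]; apply/(L2ZWP hPhi hDelta k1); split.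
  move=> c; have := L2_lin 1 (LF c) (LG c).
  by congr L2; apply/funext => t; rewrite mul1r.
by move=> w Ww c; apply: filterS2 (HF w Ww c) (HG w Ww c) => t -> ->.
Qed.

(** Concatenation makes a sum of two tensors one tensor, so that a single formula serves both
    summands. *)
Definition joinf {T : Type} m0 m1 (a : 'I_m0 -> T) (b : 'I_m1 -> T) (i : 'I_(m0 + m1)) : T :=
  match fintype.split i with inl i0 => a i0 | inr i1 => b i1 end.

Lemma joinf_map {T U : Type} m0 m1 (h : T -> U) (a : 'I_m0 -> T) (b : 'I_m1 -> T) i :
  h (joinf a b i) = joinf (fun i => h (a i)) (fun i => h (b i)) i.
Proof. by rewrite /joinf; case: fintype.split. Qed.

Lemma tens_join m0 m1 (f0 : 'I_m0 -> 'cV[R]_n -> R[i]) (x0 : 'I_m0 -> Z -> R[i])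
    (f1 : 'I_m1 -> 'cV[R]_n -> R[i]) (x1 : 'I_m1 -> Z -> R[i]) :
  (fun t c => tens f0 x0 t c + tens f1 x1 t c) = tens (joinf f0 f1) (joinf x0 x1).
Proof.
apply/funext => t; apply/funext => c; rewrite /tens big_split_ord /=; congr (_ + _).
  by apply: eq_bigr => i _; rewrite /joinf (unsplitK (inl i)).
by apply: eq_bigr => i _; rewrite /joinf (unsplitK (inr i)).
Qed.

(** The transform factors over pure tensors, and the scalars [j] and [j^-1] of the two factors
    cancel. *)
Lemma SF2_tensZ m (f : 'I_m -> 'cV[R]_n -> R[i]) (x : 'I_m -> Z -> R[i]) i :
  (forall a, L2 k (f a)) ->
  aeeq k (SF2 k B rp (famZ (tens f x)) i) (fun t => tens (fun a => rS k j (f a)) (fun a => mS j (x a)) t (iz i)).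
Proof.
move=> Lf; have j0 := j_neq0 hj.
have h i' : aeeq k (FT2 k (famZ (tens f x) i')) (fun t => \sum_a x a (iz i') * FT2 k (f a) t).
  have := FT2_sum k1 (index_enum 'I_m) (fun a => x a (iz i')) Lf.
  suff -> : famZ (tens f x) i' = (fun t => \sum_a x a (iz i') * f a t) by [].
  by apply/funext => t; rewrite /famZ /tens; apply: eq_bigr => a _; rewrite mulrC.
have := aeeq_sum (index_enum I) (fun i' => toC vol^-1 *
  bracket k (- dl k B (rp i)) (dl k B (rp i'))) h.
apply: filterS => t; rewrite SF2E => ->; rewrite /tens.
under eq_bigr => i' _ do rewrite mulr_sumr.
rewrite exchange_big; apply: eq_bigr => a _ /=.
have -> : mS j (x a) (iz i) = j^-1 * vN k B rp (x a \o iz) i.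
  by have := congr1 (@^~ i) (mSE j hPhi hDelta k1 (x a)).
rewrite /rS mulrACA mulfV// mul1r /vN [RHS]mulrC -[RHS]mulrA mulr_suml mulr_sumr.
by apply: eq_bigr => i' _ /=; ring.
Qed.

Lemma TF_tensZ m (f : 'I_m -> 'cV[R]_n -> R[i]) (x : 'I_m -> Z -> R[i]) i t :
  TF k B rp (famZ (tens f x)) i t = tens (fun a => rT k om (f a)) (fun a => mT om (x a)) t (iz i).
Proof.
have o0 := om_neq0 hj hom.
rewrite /TF /Mo /famZ /tens !mulr_sumr; apply: eq_bigr => a _.
rewrite /rT /Mo /mT /qz (dl_rp hPhi hDelta k1) mulrACA.
by rewrite (mulrACA om) !mulrA; field.
Qed.

Lemma eqZ_fam G H : eqZ (k := k) G H <-> forall i, aeeq k (famZ G i) (famZ H i).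
Proof. by split=> h c; [exact: h|rewrite -[c](ziK hPhi hDelta k1); exact: h]. Qed.

Lemma rho_tens m0 (f0 : 'I_m0 -> 'cV[R]_n -> R[i]) (x0 : 'I_m0 -> Z -> R[i])
    m1 (f1 : 'I_m1 -> 'cV[R]_n -> R[i]) (x1 : 'I_m1 -> Z -> R[i]) :
  (forall i, L2W Phi k false (f0 i) /\ Ck Phi k false (x0 i)) ->
  (forall i, L2W Phi k true (f1 i) /\ Ck Phi k true (x1 i)) ->
  forall G, L2Z Phi k G ->
  (rho_hat Phi k Delta Stilde (fun t c => tens f0 x0 t c + tens f1 x1 t c) G <->
    eqZ (k := k) G (fun t c => tens (fun i => rS k j (f0 i)) (fun i => mS j (x0 i)) t c +
      tens (fun i => rS k j (f1 i)) (fun i => mS j (x1 i)) t c)) /\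
  (rho_hat Phi k Delta Ttilde (fun t c => tens f0 x0 t c + tens f1 x1 t c) G <->
    eqZ (k := k) G (fun t c => tens (fun i => rT k om (f0 i)) (fun i => mT om (x0 i)) t c +
      tens (fun i => rT k om (f1 i)) (fun i => mT om (x1 i)) t c)).
Proof.
move=> h0 h1 G LG.
have LF : L2ZW Phi k (fun t c => tens f0 x0 t c + tens f1 x1 t c).
  by apply: L2ZW_add; exact: L2ZW_tens.
have Lj a : L2 k (joinf f0 f1 a).
  by rewrite /joinf; case: fintype.split => i; [have [[]] := h0 i|have [[]] := h1 i].
split.
  rewrite (rho_S hPhi hDelta k1 LF LG) eqZ_fam !tens_join.
  have E i : aeeq k (SF2 k B rp (famZ (tens (joinf f0 f1) (joinf x0 x1))) i)
    (famZ (tens (joinf (fun i => rS k j (f0 i)) (fun i => rS k j (f1 i)))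
      (joinf (fun i => mS j (x0 i)) (fun i => mS j (x1 i)))) i).
    have := SF2_tensZ (joinf x0 x1) i Lj; congr aeeq; apply/funext => t.
    by rewrite /famZ /tens; apply: eq_bigr => a _; rewrite (joinf_map (rS k j)) (joinf_map (mS j)).
  by split=> h i; [exact: aeeq_trans (h i) (E i)|exact: aeeq_trans (h i) (aeeq_sym (E i))].
rewrite (rho_T hPhi hDelta k1 LF LG) eqZ_fam !tens_join.
have E : TF k B rp (famZ (tens (joinf f0 f1) (joinf x0 x1))) =
  famZ (tens (joinf (fun i => rT k om (f0 i)) (fun i => rT k om (f1 i)))
    (joinf (fun i => mT om (x0 i)) (fun i => mT om (x1 i)))).
  apply/funext => i; apply/funext => t; rewrite TF_tensZ.
  by rewrite /famZ /tens; apply: eq_bigr => a _; rewrite (joinf_map (rT k om)) (joinf_map (mT om)).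
by rewrite E.
Qed.

(** The projection onto the functions of character [eps]. *)
Definition projC eps x c : R[i] := (ncard W)%:R^-1 * \sum_(u \in W) chi eps u * x (wca u c).

(** Multiplication by a reflection permutes the group and changes the sign of every determinant. *)
Lemma sum_chi : \sum_(u \in W) chi true u = 0 :> R[i].
Proof.
have [a Pa] := roots_neq0 hPhi.
have := sumW_mulr hPhi (@chi R n true) (weyl_refl Pa).
under (eq_sumW hPhi hDelta) => u _ do rewrite chiM [X in _ * X]/chi det_refl ?(root_nz hPhi Pa)//.
rewrite -(mulr_sumWl hPhi hDelta) expr1 (_ : toC (-1) = -1); last by rewrite toCN toC1.
by rewrite mulrN1 => /eqP; rewrite eq_sym -addr_eq0 -mulr2n mulrn_eq0 /= => /eqP.
Qed.

Lemma projC_id eps x0 x1 : Ck Phi k false x0 -> Ck Phi k true x1 ->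
  projC eps (fun c => x0 c + x1 c) = if eps then x1 else x0.
Proof.
move=> /(CkP hPhi hDelta k1) H0 /(CkP hPhi hDelta k1) H1; apply/funext => c.
have W0 : ((ncard W)%:R : R[i]) != 0 by exact: (W_neq0 hPhi hDelta).
have E : \sum_(u \in W) chi eps u * (x0 (wca u c) + x1 (wca u c)) =
    (\sum_(u \in W) chi eps u) * x0 c + (\sum_(u \in W) chi eps u * chi true u) * x1 c.
  rewrite !(sumW hPhi hDelta) !mulr_suml -big_split /=; apply: eq_bigr => i _.
  rewrite H0 ?H1 ?chi_false; try exact: (WI_W hPhi hDelta).
  by rewrite mul1r mulrDr mulrA.
rewrite /projC E; case: eps E => _.
  rewrite sum_chi mul0r add0r (eq_sumW hPhi hDelta (g := fun=> 1)); last exact: (chi_sq hPhi).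
  by rewrite (sumW_const hPhi hDelta) mulr1 mulKf.
rewrite (eq_sumW hPhi hDelta (g := fun=> 1)); last by move=> u _; rewrite chi_false.
rewrite (sumW_const hPhi hDelta) mulr1.
rewrite (eq_sumW hPhi hDelta (g := chi true)); last by move=> u _; rewrite chi_false mul1r.
by rewrite sum_chi mul0r addr0 mulKf.
Qed.

Lemma Ck_lin m (a : 'I_m -> R[i]) eps (x : 'I_m -> Z -> R[i]) : (forall i, Ck Phi k eps (x i)) ->
  Ck Phi k eps (fun c => \sum_i a i * x i c).
Proof.
move=> H; apply/(CkP hPhi hDelta k1) => w Ww c; rewrite mulr_sumr; apply: eq_bigr => i _.
by have /(CkP hPhi hDelta k1) -> := H i; rewrite 1?mulrCA.
Qed.

(** For almost every [t] the sum vanishes on all of the finitely many classes, and [projC] recovers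
    each summand from these values. *)
Lemma sum_unique (F0 F1 : 'cV[R]_n -> Z -> R[i]) : L2W_Ck Phi k false F0 -> L2W_Ck Phi k true F1 ->
  eqZ (k := k) (fun t c => F0 t c + F1 t c) (fun _ _ => 0) ->
  eqZ (k := k) F0 (fun _ _ => 0) /\ eqZ (k := k) F1 (fun _ _ => 0).
Proof.
move=> [m0 [f0 [x0 [h0 ->]]]] [m1 [f1 [x1 [h1 ->]]]] E.
have C0 t : Ck Phi k false (tens f0 x0 t) by apply: Ck_lin => i; have [] := h0 i.
have C1 t : Ck Phi k true (tens f1 x1 t) by apply: Ck_lin => i; have [] := h1 i.
have : {ae volk k, forall t, forall i, tens f0 x0 t (iz i) + tens f1 x1 t (iz i) = 0}.
  by apply: filter_forall => i; exact: E.
move=> H; have key eps c : {ae volk k, forall t, (if eps then tens f1 x1 t else tens f0 x0 t) c = 0}.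
  apply: filterS H => t H; rewrite -(projC_id eps (C0 t) (C1 t)) /projC (sumW hPhi hDelta) big1 ?mulr0// => i _.
  by rewrite -[wca _ _](ziK hPhi hDelta k1) H mulr0.
by split=> c; [exact: (key false)|exact: (key true)].
Qed.

(** The class [i] indexes the tensors: its delta function and the component of [F] there are both
    averaged with character [eps]. *)
Definition projf eps F i t : R[i] := (ncard W)%:R^-1 * \sum_(w \in W) chi eps w * F (w *m t) (iz i).
Definition projx eps i (c : Z) : R[i] := projC eps (fun c' => (c' == iz i)%:R) c.

Lemma projC_Ck eps x : Ck Phi k eps (projC eps x).
Proof.
apply/(CkP hPhi hDelta k1) => w Ww c; rewrite /projC mulrCA; congr (_ * _).
rewrite -(sumW_mulr hPhi _ (weyl_tr Ww)) (mulr_sumW hPhi hDelta).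
apply: (eq_sumW hPhi hDelta) => u Wu; rewrite chiM chi_tr -wcaM//; last by apply: weylM => //; exact: weyl_tr.
by rewrite -mulmxA (weyl_orth hPhi)// mulmx1 mulrAC mulrC mulrA.
Qed.

Lemma projf_L2W eps F i : L2Z Phi k F -> L2W Phi k eps (projf eps F i).
Proof.
move=> LF; split.
  have := @L2_Z R n k (((ncard W)%:R)^-1) _ (@L2_sum R n k _ (index_enum (WI Phi)) (fun i => chi eps (val i))
    (fun a t => F (val a *m t) (iz i)) (fun a => L2_orth hPhi k1 (WI_W hPhi hDelta a) (LF _))).
  by congr L2; apply/funext => x; rewrite /projf (sumW hPhi hDelta).
move=> w Ww; apply: aeW => t; rewrite /projf mulrCA; congr (_ * _).
rewrite -(sumW_mulr hPhi _ (weyl_tr Ww)) (mulr_sumW hPhi hDelta).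
apply: (eq_sumW hPhi hDelta) => u Wu; rewrite chiM chi_tr mulmxA -[u *m _ *m _]mulmxA.
by rewrite (weyl_orth hPhi)// mulmx1 mulrAC mulrC mulrA.
Qed.

Lemma projC_split F eps t c : \sum_i projf eps F i t * projx eps i c =
  (ncard W)%:R^-1 * \sum_(v \in W) chi eps v * ((ncard W)%:R^-1 * \sum_(w \in W) chi eps w * F (w *m t) (wca v c)).
Proof.
rewrite (sumW hPhi hDelta) mulr_sumr.
under eq_bigr => i _ do rewrite /projx /projC (sumW hPhi hDelta) !mulr_sumr.
rewrite exchange_big; apply: eq_bigr => v _ /=.
rewrite (bigD1 (zi (wca (val v) c)))//= big1 ?addr0.
  by rewrite /projf (ziK hPhi hDelta k1) eqxx mulr1; ring.
move=> i ne; rewrite (_ : (_ == _) = false) ?mulr0//.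
by apply/eqP => e; move/eqP: ne; apply; rewrite e (izK hPhi hDelta k1).
Qed.

(** The component [Fe eps] averages [F] over W with character [eps] on points and on classes. For an
    invariant [F] this is [projC eps] of the values of [F], and the assumption on these values says
    that the two projections add up to [F]. *)
Lemma decomposition F : L2Z Phi k F ->
  (L2ZW Phi k F /\ {ae volk k, forall t, exists x0 x1,
     [/\ Ck Phi k false x0, Ck Phi k true x1 & forall c, F t c = x0 c + x1 c]}) <->
  (exists F0 F1, [/\ L2W_Ck Phi k false F0, L2W_Ck Phi k true F1 &
     eqZ (k := k) F (fun t c => F0 t c + F1 t c)]).
Proof.
move=> LF; split=> [[/(L2ZWP hPhi hDelta k1)[_ HF] Hx]|].
  pose Fe eps t c := \sum_(i < #|I|) projf eps F (enum_val i) t * projx eps (enum_val i) c.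
  have FeE eps t c : Fe eps t c = \sum_i projf eps F i t * projx eps i c.
    by rewrite /Fe -(big_enum_val (fun i => projf eps F i t * projx eps i c)); apply: eq_bigl.
  have FeC eps : L2W_Ck Phi k eps (Fe eps).
    exists #|I|, (fun i => projf eps F (enum_val i)), (fun i => projx eps (enum_val i)).
    by split=> // i; split; [exact: projf_L2W|exact: projC_Ck].
  exists (Fe false), (Fe true); split=> //.
  move=> c.
  have inv : {ae volk k, forall t, forall (w : WI Phi) (i : I), F (val w *m t) (wca (val w) (iz i)) = F t (iz i)}.
    by apply: filter_forall => w; apply: filter_forall => i; apply: HF; exact: (WI_W hPhi hDelta).
  apply: filterS2 Hx inv => t [x0 [x1 [C0 C1 E]]] inv.
  have key eps : Fe eps t c = projC eps (F t) c.
    rewrite FeE projC_split /projC; congr (_ * _).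
    have W0 : ((ncard W)%:R : R[i]) != 0 by exact: (W_neq0 hPhi hDelta).
    transitivity ((ncard W)%:R^-1 * \sum_(w \in W) \sum_(v \in W) chi eps v * (chi eps w * F (w *m t) (wca v c))).
      rewrite !(sumW hPhi hDelta) mulr_sumr; under eq_bigr do rewrite (sumW hPhi hDelta) !mulr_sumr.
      rewrite exchange_big; apply: eq_bigr => w _ /=; rewrite (sumW hPhi hDelta) mulr_sumr.
      by apply: eq_bigr => v _; rewrite mulrCA.
    rewrite (eq_sumW hPhi hDelta (g := fun=> \sum_(u \in W) chi eps u * F t (wca u c))); last first.
      move=> w Ww; rewrite -(sumW_mull hPhi _ Ww); apply: (eq_sumW hPhi hDelta) => u Wu.
      rewrite chiM wcaM// mulrACA (chi_sq hPhi eps Ww) mul1r; congr (_ * _).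
      have wP : w \in fset_set W by rewrite in_fset_set ?inE//; exact: (weyl_finite hPhi hDelta).
      by have := inv (FSetSub wP) (zi (wca u c)); rewrite (ziK hPhi hDelta k1).
    by rewrite (sumW_const hPhi hDelta) mulKf.
  have Ft : F t = (fun c => x0 c + x1 c) by apply/funext.
  by rewrite !key Ft !projC_id.
move=> [F0 [F1 [[m0 [f0 [x0 [h0 E0]]]] [m1 [f1 [x1 [h1 E1]]]] E]]].
have LS : L2ZW Phi k (fun t c => F0 t c + F1 t c).
  by rewrite E0 E1; apply: L2ZW_add; exact: L2ZW_tens.
split.
  have /(L2ZWP hPhi hDelta k1)[_ HS] := LS; apply/(L2ZWP hPhi hDelta k1); split=> // w Ww c.
  have h := mpres_ae (mpres_orth k1 (weyl_orth hPhi Ww)) (E (wca w c)).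
  exact: aeeq_trans h (aeeq_trans (HS w Ww c) (aeeq_sym (E c))).
have H : {ae volk k, forall t, forall i, F t (iz i) = F0 t (iz i) + F1 t (iz i)}.
  by apply: filter_forall => i; exact: E.
apply: filterS H => t H; exists (F0 t), (F1 t); split.
- by rewrite E0; apply: Ck_lin => i; have [] := h0 i.
- by rewrite E1; apply: Ck_lin => i; have [] := h1 i.
- by move=> c; rewrite -[c](ziK hPhi hDelta k1).
Qed.
End tensors.

Lemma cintegrable_ae {R : realType} d (T : measurableType d) (mu : {measure set T -> \bar R}) (f g : T -> R[i]) :
  cmeasurable f -> cmeasurable g -> {ae mu, forall x, f x = g x} -> cintegrable mu setT g -> cintegrable mu setT f.
Proof.
move=> [f1 f2] [g1 g2] fg [/integrableP[i1 h1] /integrableP[i2 h2]].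
split; apply/integrableP; split; try exact/measurable_EFinP.
  rewrite (ae_eq_integral (fun x => `|(complex.Re (g x))%:E|)%E)//.
  - by apply/measurableT_comp => //; exact/measurable_EFinP.
  - by apply/measurableT_comp => //; exact/measurable_EFinP.
  - by apply: filterS fg => x e _; rewrite e.
rewrite (ae_eq_integral (fun x => `|(complex.Im (g x))%:E|)%E)//.
- by apply/measurableT_comp => //; exact/measurable_EFinP.
- by apply/measurableT_comp => //; exact/measurable_EFinP.
- by apply: filterS fg => x e _; rewrite e.
Qed.

(** * Integrals over the Weyl chamber *)

Section chamber_integral.
Context {R : realType} {n : nat}.
Variables (Phi : set 'cV[R]_n) (Delta : 'I_n -> 'cV[R]_n) (k : nat).
Hypothesis hPhi : simple_root_system Phi.
Hypothesis hDelta : simple_roots Phi Delta.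
Hypothesis k1 : (1 <= k)%N.
Local Notation W := (weyl Phi).
Local Notation C := (chamber Delta).
Local Notation mu := (@volk R n k).
Implicit Types (f g : 'cV[R]_n -> R[i]).

Lemma measurable_chamber : measurable C.
Proof.
have -> : C = \big[setI/setT]_(i <- index_enum 'I_n)
    ((fun x : 'cV[R]_n => dotv x (Delta i) : measurableTypeR R) @^-1` `]0, +oo[%classic).
  rewrite -bigcap_seq; apply/seteqP; split => x /= H i.
    by move=> _; rewrite /= in_itv/= andbT; exact: H.
  by have := H i; rewrite /= mem_index_enum in_itv/= andbT; exact.
apply: bigsetI_measurable => i _; rewrite -[X in measurable X]setTI.
suff : measurable_fun setT (fun y : 'cV[R]_n => dotv y (Delta i) : measurableTypeR R) by apply.
by apply: measurable_dotv2 => //; exact: measurable_id.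
Qed.

Lemma regular_ae : {ae mu, forall x, forall a, Phi a -> dotv x a != 0}.
Proof.
have H (a : fset_sub_type (fset_set Phi)) : {ae mu, forall x, dotv x (val a) != 0}.
  have Pa : Phi (val a) by have := valP a; rewrite in_fset_set ?inE//; exact: roots_finite.
  exists [set y | dotv y (val a) = 0]; split.
  - rewrite (_ : [set y | _] = (fun y => dotv y (val a) : measurableTypeR R) @^-1` [set 0])//.
    rewrite -[X in measurable X]setTI.
    suff : measurable_fun setT (fun y : 'cV[R]_n => dotv y (val a) : measurableTypeR R) by apply => //.
    by apply: measurable_dotv2 => //; exact: measurable_id.
  - by apply: volk_hyperplane; exact: root_nz hPhi _ Pa.
  - by move=> y /= h; apply: contrapT => /eqP.
have H2 : {ae mu, forall x, forall a : fset_sub_type (fset_set Phi), dotv x (val a) != 0}.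
  by apply: filter_forall.
apply: filterS H2 => x H2 a Pa.
have aP : a \in fset_set Phi by rewrite in_fset_set ?inE//; exact: roots_finite.
exact: (H2 (FSetSub aP)).
Qed.

(** Off the root hyperplanes exactly one element of W brings [x] into the chamber, so the moved
    chambers form a partition of unity. *)
Lemma chamber_sum x : (forall a, Phi a -> dotv x a != 0) ->
  \sum_(i : WI Phi) toC (\1_C (val i *m x)) = 1 :> R[i].
Proof.
move=> reg; have [w Ww Cw] := chamber_exists hPhi hDelta reg.
have wP : w \in fset_set W by rewrite in_fset_set ?inE//; exact: (weyl_finite hPhi hDelta).
rewrite (bigD1 (FSetSub wP))//= big1; first by rewrite addr0 indicE mem_set// toC1.
move=> i ne; rewrite indicE memNset// => Ci; move/eqP: ne; apply; apply: val_inj => /=.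
have Wi := WI_W hPhi hDelta i.
have e : val i *m w^T = 1%:M.
  apply: (chamber_uniq hPhi hDelta Cw); first by apply: weylM => //; exact: weyl_tr.
  by rewrite mulmxA -(mulmxA (val i)) (weyl_orth hPhi)// mulmx1.
by rewrite -[LHS]mulmx1 -(weyl_orth hPhi Ww) mulmxA e mul1mx.
Qed.

Lemma cint_chamber g : cmeasurable g ->
  (forall i : WI Phi, cintegrable mu C (fun y => g ((val i)^T *m y))) ->
  cintegrable mu setT g /\
  cint mu setT g = \sum_(i : WI Phi) cint mu C (fun y => g ((val i)^T *m y)).
Proof.
move=> mg ig; have mC := measurable_chamber.
pose h (i : WI Phi) y := toC (\1_C y) * g ((val i)^T *m y).
have mh i : cmeasurable (h i).
  by apply: cmeas_indic => //; apply: (cmeas_comp mg); exact: measurable_mulmx.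
have ih i : cintegrable mu setT (h i) by apply/(cintegrable_mkcond _ mC); exact: ig.
have ow (i : WI Phi) : (val i)^T *m val i = 1%:M by exact: (weyl_orth hPhi (WI_W hPhi hDelta i)).
have ihw i := cintegrable_mpres (mpres_orth k1 (ow i)) (ih i).
have hE i x : h i (val i *m x) = toC (\1_C (val i *m x)) * g x.
  by rewrite /h mulmxA ow mul1mx.
have gE : {ae mu, forall x, g x = \sum_(i : WI Phi) h i (val i *m x)}.
  apply: filterS regular_ae => x /chamber_sum e.
  by rewrite -[LHS]mul1r -e mulr_suml; apply: eq_bigr => i _; rewrite hE.
have iS := cintegrable_sum measurableT (index_enum (WI Phi)) ihw.
have mS : cmeasurable (fun x => \sum_(i : WI Phi) h i (val i *m x)).
  by apply: cmeas_sum => i; apply: (cmeas_comp (mh i)); exact: measurable_mulmx.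
split; first exact: cintegrable_ae gE iS.
rewrite (cint_ae measurableT mg mS); last by apply: filterS gE => x e _.
rewrite (cint_sum measurableT _ ihw); apply: eq_bigr => i _.
by rewrite (cint_mpres (mpres_orth k1 (ow i)) (mh i)) [RHS]cint_mkcond.
Qed.

(** By the symmetry of [f], integrability on the chamber extends to the space, so the L^2 transform
    is the integral by [FTr_L1]; folding that integral onto the chamber gathers the kernel over
    W. *)
Lemma rS_chamber eps f j : L2W Phi k eps f -> cintegrable mu C f ->
  {ae mu, forall t, C t -> rS k j f t = j * cint mu C (fun u =>
     f u * \sum_(w \in W) chi eps w * bracket k (w *m t) u)}.
Proof.
move=> [Lf Hf] iC; have mC := measurable_chamber; have [mf _] := Lf.
have Hi (i : WI Phi) : {ae mu, forall y, f ((val i)^T *m y) = chi eps (val i) * f y}.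
  by have := Hf _ (weyl_tr (WI_W hPhi hDelta i)); rewrite chi_tr.
have mfw (i : WI Phi) : cmeasurable (fun y => f ((val i)^T *m y)).
  by apply: (cmeas_comp mf); exact: measurable_mulmx.
have ifw (i : WI Phi) : cintegrable mu C (fun y => f ((val i)^T *m y)).
  apply/(cintegrable_mkcond _ mC).
  apply: (@cintegrable_ae _ _ _ mu _ (fun y => toC (\1_C y) * (chi eps (val i) * f y))).
  - by apply: cmeas_indic.
  - by apply: cmeas_indic => //; exact: cmeasZ.
  - by apply: filterS (Hi i) => y ->.
  - by apply/(cintegrable_mkcond _ mC); exact: cintegrableZ.
have [iT _] := cint_chamber mf ifw.
have E := FTr_uniq k1 (FT2P k1 Lf) (FTr_L1 k1 Lf iT) (aeeq_refl _ _).
apply: filterS E => t e _; rewrite /rS e; congr (_ * _).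
rewrite /FT.
have mb x : cmeasurable (fun y => f y * bracket k x y) by apply: cmeasM => //; exact: cmeas_bracket.
have ib x : cintegrable mu C (fun y => f y * bracket k x y).
  by apply: (cintegrable_le mC (mb x) iC) => y _; rewrite sqnormcM sqnormc_bracket mulr1.
have bw (i : WI Phi) y : bracket k t ((val i)^T *m y) = bracket k (val i *m t) y.
  rewrite -(bracket_orth k t _ (weyl_orth hPhi (WI_W hPhi hDelta i))) mulmxA.
  by rewrite (weyl_trK hPhi) ?mul1mx//; exact: (WI_W hPhi hDelta).
have mbw (i : WI Phi) : cmeasurable (fun y => f ((val i)^T *m y) * bracket k (val i *m t) y).
  by apply: cmeasM => //; exact: cmeas_bracket.
have [|_ ->] := cint_chamber (mb t).
  move=> i; rewrite (_ : (fun y => _) = (fun y => f ((val i)^T *m y) * bracket k (val i *m t) y)).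
    by apply: (cintegrable_le mC (mbw i) (ifw i)) => y _; rewrite sqnormcM sqnormc_bracket mulr1.
  by apply/funext => y; rewrite bw.
have -> : cint mu C (fun u => f u * \sum_(w \in W) chi eps w * bracket k (w *m t) u) =
    cint mu C (fun u => \sum_(i : WI Phi) chi eps (val i) * (f u * bracket k (val i *m t) u)).
  by apply: eq_cint => u _; rewrite (sumW hPhi hDelta) mulr_sumr; apply: eq_bigr => i _; rewrite mulrCA.
rewrite (cint_sum mC); last by move=> i; apply: cintegrableZ.
apply: eq_bigr => i _; apply: cint_ae => //.
- by apply: (cmeas_comp (mb t)); exact: measurable_mulmx.
- exact: cmeasZ.
- by apply: filterS (Hi i) => y ey _; rewrite ey bw mulrA.
Qed.
End chamber_integral.

Lemma fsum_single (T : choiceType) (V : nmodType) (J : set T) (y : T) (F : T -> V) :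
  (forall a, J a -> a <> y -> F a = 0) -> (~ J y -> F y = 0) -> \sum_(a \in J) F a = F y.
Proof.
move=> h h'.
have [Jy|nJy] := pselect (J y).
  have <- : \sum_(a \in [set y]) F a = F y by exact: fsbig_set1.
  apply/esym; apply: fsbig_widen; first by move=> _ ->.
  by move=> a [Ja ne]; exact: h.
rewrite h'//; apply: fsbig1 => a Ja; apply: h => // e; apply: nJy; by rewrite -e.
Qed.

(** * Matrix entries in the alcove bases *)

Section entries.
Context {R : realType} {n : nat}.
Variables (Phi : set 'cV[R]_n) (Delta : 'I_n -> 'cV[R]_n) (k : nat) (j om : R[i]).
Hypothesis hPhi : simple_root_system Phi.
Hypothesis hDelta : simple_roots Phi Delta.
Hypothesis k1 : (1 <= k)%N.
Local Notation L := (coroot_lattice Phi).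
Local Notation Lw := (weight_lattice Phi k).
Local Notation W := (weyl Phi).
Local Notation Z := (Zk Phi k).
Local Notation A := (alcove Phi Delta).
Local Notation E := (ebasis Phi k).
Implicit Types (c : Z) (g a b : 'cV[R]_n).

Lemma deltaE g c : delta (k := k) g c = (`[< L (g - rep c) >])%:R :> R[i].
Proof.
rewrite /delta indicE -toC_nat; congr (toC (_ : bool)%:R).
have [_ ->] := rep_in hPhi hDelta k1 c.
apply/idP/asboolP; rewrite inE.
  by move=> [l Ll <-]; rewrite addrAC subrr add0r.
by move=> h; exists (g - rep c) => //; rewrite addrCA subrr addr0.
Qed.

Lemma ebasisE eps a c : E eps a c = toC (Num.sqrt (ncard W)%:R)^-1 *
  \sum_(w \in W) chi eps w * (`[< L (w *m a - rep c) >])%:R.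
Proof. by congr (_ * _); apply: (eq_sumW hPhi hDelta) => w _; rewrite deltaE. Qed.

Lemma mT_entries (J : set 'cV[R]_n) eps : J `<=` Lw ->
  mx_entries J (E eps) (@mT _ _ Phi k om)
    (fun a b => om^-1 * cexpi (pi * ipk k a a) * (a == b)%:R).
Proof.
move=> JL b Jb c; rewrite (fsum_single (y := b)); last 2 first.
- by move=> a _ /eqP/negbTE ->; rewrite mulr0 mul0r.
- by move=> /(_ Jb).
rewrite eqxx mulr1 /mT -!mulrA; congr (_ * _); rewrite !ebasisE mulrCA [RHS]mulrCA; congr (_ * _).
rewrite !(mulr_sumW hPhi hDelta); apply: (eq_sumW hPhi hDelta) => w Ww; rewrite mulrCA [RHS]mulrCA; congr (_ * _).
case: asboolP => [h|]; last by rewrite !mulr0.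
rewrite (quad_rep hPhi hDelta k1 (weyl_Lw hPhi Ww (JL _ Jb)) h).
by rewrite /ipk (dotv_orth _ _ (weyl_orth hPhi Ww)).
Qed.

(** The unnormalised image of [ebasis eps b]: the entries are read off by comparing it, class by
    class, with the basis vector of the alcove representative. *)
Definition orbit_sum eps b g : R[i] := \sum_(w \in W) chi eps w * bracket k (- g) (w *m b).

Lemma orbit_sum_weyl eps b g w : W w -> orbit_sum eps b (w *m g) = chi eps w * orbit_sum eps b g.
Proof.
move=> Ww; rewrite /orbit_sum -(sumW_mull hPhi _ Ww) (mulr_sumW hPhi hDelta).
apply: (eq_sumW hPhi hDelta) => u Wu; rewrite chiM -mulrA; congr (_ * (_ * _)).
by rewrite -mulmxA -mulmxN (bracket_orth _ _ _ (weyl_orth hPhi Ww)).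
Qed.

Lemma orbit_sum_L eps b g l : Lw b -> L l -> orbit_sum eps b (g + l) = orbit_sum eps b g.
Proof.
move=> Hb Ll; apply: (eq_sumW hPhi hDelta) => w Ww; congr (_ * _).
rewrite opprD bracketD [X in _ * X]bracket_int ?mulr1//.
rewrite ipkC; apply: (weyl_Lw hPhi Ww Hb); exact: latticeN.
Qed.

Lemma orbit_sumE eps a b : \sum_(w \in W) chi eps w * bracket k (- (w *m a)) b = orbit_sum eps b a.
Proof.
rewrite -sumW_tr; apply: (eq_sumW hPhi hDelta) => w Ww; rewrite chi_tr; congr (_ * _).
rewrite -(bracket_orth k _ b (weyl_orth hPhi Ww)); congr bracket.
by rewrite mulmxN mulmxA (weyl_trK hPhi)// mul1mx.
Qed.

Lemma mS_ebasis eps b c : Lw b -> mS j (E eps b) c =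
  j^-1 * toC (Num.sqrt (ncard Z)%:R)^-1 * (toC (Num.sqrt (ncard W)%:R)^-1 * orbit_sum eps b (rep c)).
Proof.
move=> Hb; rewrite /mS mulrA; congr (_ * _).
transitivity (\sum_(c' \in [set: Z]) toC (Num.sqrt (ncard W)%:R)^-1 *
    \sum_(w \in W) chi eps w * (bracket k (- rep c) (rep c') * (`[< L (w *m b - rep c') >])%:R)).
  rewrite !(sumZ hPhi hDelta k1); apply: eq_bigr => i _; rewrite ebasisE mulrCA; congr (_ * _).
  by rewrite (mulr_sumW hPhi hDelta); apply: (eq_sumW hPhi hDelta) => w _; rewrite mulrCA.
rewrite (sumZ hPhi hDelta k1) -mulr_sumr; congr (_ * _).
under eq_bigr do rewrite (sumW hPhi hDelta).
rewrite exchange_big /orbit_sum (sumW hPhi hDelta); apply: eq_bigr => w _ /=.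
rewrite -mulr_sumr; congr (_ * _); have Ww := WI_W hPhi hDelta w.
have Hwb := weyl_Lw hPhi Ww Hb.
pose c0 := clsz Hwb; have Lc0 : L (val w *m b - rep c0) by apply/(clsz_rep hPhi hDelta k1 c0 Hwb).
rewrite (bigD1 (zi hPhi hDelta k1 c0))//= big1 ?addr0.
  rewrite (ziK hPhi hDelta k1) asboolT// mulr1 !bracketN; congr (_^-1).
  apply/esym/(bracket_rep hPhi hDelta k1) => //; last by rewrite subrr; exact: lattice0.
  by have [] := rep_in hPhi hDelta k1 c.
move=> i ne; rewrite asboolF ?mulr0// => h; move/eqP: ne; apply.
apply: (can_inj (izK hPhi hDelta k1)); rewrite (ziK hPhi hDelta k1).
by apply/(clsz_rep hPhi hDelta k1).
Qed.

Lemma alcove_rep c : exists w y, [/\ W w, closure A y, Lw y & L (rep c - w *m y)].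
Proof.
have [w [y [Ww Ay Ly]]] := alcove_exists hPhi hDelta (rep c).
exists w, y; split=> //.
have [Hc _] := rep_in hPhi hDelta k1 c.
have : Lw (w *m y).
  by have := LwB hPhi hDelta k1 Hc (L_Lw k hPhi Ly); rewrite opprB addrCA subrr addr0.
move=> /(weyl_Lw hPhi (weyl_tr Ww)); rewrite mulmxA (weyl_orth hPhi)// mul1mx //.
Qed.

Lemma alcove_rep_uniq c w y v a : W w -> closure A y -> L (rep c - w *m y) ->
  W v -> closure A a -> L (v *m a - rep c) -> a = y.
Proof.
move=> Ww Ay Ly Wv Aa La; have Wt := weyl_tr Ww.
apply: (alcove_uniq hPhi hDelta (w := w^T *m v) (l := w^T *m (- (rep c - w *m y) - (v *m a - rep c)))) => //.
- exact: weylM.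
- by apply: weyl_lattice => //; apply: latticeB => //; exact: latticeN.
rewrite -mulmxA -mulmxDr (_ : v *m a + _ = w *m y) ?mulmxA ?(weyl_orth hPhi)// ?mul1mx//.
by move: (v *m a) (rep c) (w *m y) => p q r; apply/matrixP => i i'; rewrite !mxE; ring.
Qed.

(** The elements carrying [y] into the class [c] form the left coset by [w] of the stabilizer of the
    class of [y]. *)
Lemma sum_stab eps c w y : W w -> L (rep c - w *m y) ->
  \sum_(v \in W) chi eps v * (`[< L (v *m y - rep c) >])%:R =
  chi eps w * \sum_(v \in W) chi eps v * (`[< L (v *m y - y) >])%:R :> R[i].
Proof.
move=> Ww Ly; rewrite -(sumW_mull hPhi _ Ww) (mulr_sumW hPhi hDelta).
apply: (eq_sumW hPhi hDelta) => v Wv; rewrite chiM -mulrA; congr (_ * (_ * (_ : bool)%:R)).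
apply/asboolP/asboolP => h.
  have := weyl_lattice hPhi (weyl_tr Ww) (latticeD h Ly); congr L.
  by rewrite addrA subrK mulmxBr !mulmxA (weyl_orth hPhi)// !mul1mx.
have := latticeB (weyl_lattice hPhi Ww h) Ly; congr L.
by rewrite mulmxBr mulmxA opprB addrA subrK.
Qed.

(** Only the alcove representative [y] of a class contributes. The value of its basis vector there
    is the order of the stabilizer divided by [sqrt |W|]; the division by [ncard (stab Phi a)]
    compensates that order, which exceeds 1 only on the boundary. *)
Lemma mS_entries0 : mx_entries (Ikbar Phi Delta k) (E false) (@mS _ _ Phi k j)
  (fun a b => j^-1 / toC (Num.sqrt (ncard Z)%:R) / toC (ncard (stab Phi a))%:R *
    \sum_(w \in W) bracket k (- (w *m a)) b).
Proof.
move=> b [Hb _] c; have [w [y [Ww Ay Hy Ly]]] := alcove_rep c.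
rewrite (mS_ebasis _ _ Hb) (fsum_single (y := y)); last 2 first.
- move=> a [_ Aa] ne; suff -> : E false a c = 0 by rewrite mulr0.
  rewrite ebasisE (eq_sumW hPhi hDelta (g := fun=> 0)).
    by rewrite (sumW hPhi hDelta) big1// mulr0.
  move=> v Wv; rewrite asboolF ?mulr0// => La; apply: ne.
  exact: (alcove_rep_uniq Ww Ay Ly Wv Aa La).
- by move=> h; exfalso; apply: h; split.
have -> : \sum_(u \in W) bracket k (- (u *m y)) b = orbit_sum false b y.
  by rewrite -orbit_sumE; apply: (eq_sumW hPhi hDelta) => u _; rewrite chi_false mul1r.
have -> : orbit_sum false b (rep c) = orbit_sum false b y.
  rewrite -(subrK (w *m y) (rep c)) addrC orbit_sum_L// orbit_sum_weyl//.
  by rewrite chi_false mul1r.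
rewrite ebasisE (sum_stab _ Ww Ly) chi_false mul1r.
have fs : finite_set (stab Phi y).
  by apply: sub_finite_set (weyl_finite hPhi hDelta) => u [].
have s0 : ((ncard (stab Phi y))%:R : R[i]) != 0.
  rewrite pnatr_eq0 /ncard cardfs_eq0; apply/eqP => e.
  have : (1%:M : 'M[R]_n) \in fset_set (stab Phi y).
    by rewrite in_fset_set// inE; split; [exact: weyl1|rewrite mul1mx subrr; exact: lattice0].
  by rewrite e inE.
have -> : \sum_(v \in W) chi false v * (`[< L (v *m y - y) >])%:R = (ncard (stab Phi y))%:R :> R[i].
  rewrite (_ : stab Phi y = W `&` [set v | L (v *m y - y)]); last by [].
  transitivity (\sum_(v \in W `&` [set v | L (v *m y - y)]) (1 : R[i])).
    rewrite [RHS]fsbig_mkcondr; apply: (eq_sumW hPhi hDelta) => v _; rewrite chi_false mul1r.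
    by case: asboolP => h; [rewrite mem_set|rewrite memNset].
  rewrite fsbig_finite/=; last exact: fs.
  by rewrite big_const_seq count_predT iter_addr_0 /ncard.
rewrite -toCV toC_nat; move: (j^-1) => j'; field; exact: s0.
Qed.

(** If the representative is on the boundary, a reflection of determinant -1 fixes the class and
    makes the image vanish there, and no basis vector lives on that class. In the interior the
    stabilizer is trivial, so no division occurs. *)
Lemma mS_entries1 : mx_entries (Ik Phi Delta k) (E true) (@mS _ _ Phi k j)
  (fun a b => j^-1 / toC (Num.sqrt (ncard Z)%:R) *
    \sum_(w \in W) chi true w * bracket k (- (w *m a)) b).
Proof.
move=> b [Hb _] c; have [w [y [Ww Ay Hy Ly]]] := alcove_rep c.
have oc : orbit_sum true b (rep c) = chi true w * orbit_sum true b y.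
  by rewrite -(subrK (w *m y) (rep c)) addrC orbit_sum_L// orbit_sum_weyl.
have out a : closure A a -> a <> y -> E true a c = 0.
  move=> Aa ne; rewrite ebasisE (eq_sumW hPhi hDelta (g := fun=> 0)).
    by rewrite (sumW hPhi hDelta) big1// !mulr0.
  move=> v Wv; rewrite asboolF ?mulr0// => La; apply: ne.
  exact: (alcove_rep_uniq Ww Ay Ly Wv Aa La).
have subA a : A a -> closure A a by exact: subset_closure.
rewrite (mS_ebasis _ _ Hb) oc.
have [Iy|nIy] := pselect (A y).
  rewrite (fsum_single (y := y)); last 2 first.
  - by move=> a [_ Aa] ne; rewrite out ?mulr0//; exact: subA.
  - by move=> h; exfalso; apply: h; split.
  rewrite orbit_sumE ebasisE (sum_stab _ Ww Ly).
  have -> : \sum_(v \in W) chi true v * (`[< L (v *m y - y) >])%:R = 1 :> R[i].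
    rewrite (fsum_single (y := 1%:M)).
    - by rewrite chi_1 mul1r mul1mx subrr asboolT//; exact: lattice0.
    - move=> v Wv ne; rewrite asboolF ?mulr0// => h; apply: ne.
      apply: (alcove_stab hPhi hDelta Iy Ay Wv (latticeN h)).
      by rewrite opprB addrCA subrr addr0.
    - by move=> h; exfalso; apply: h; exact: weyl1.
  by rewrite mulr1 -toCV; ring.
have [r [Wr dr Lr]] := alcove_boundary hPhi hDelta Ay nIy.
have -> : orbit_sum true b y = 0.
  have := orbit_sum_weyl true b y Wr.
  rewrite -[r *m y](subrK y) addrC orbit_sum_L// /chi dr expr1 toCN toC1 mulN1r.
  by move=> /eqP; rewrite -addr_eq0 -mulr2n mulrn_eq0 /= => /eqP.
rewrite !mulr0; apply/esym; apply: fsbig1 => a [_ Aa].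
rewrite out ?mulr0//; first exact: subA.
by move=> e; apply: nIy; rewrite -e.
Qed.
End entries.

Theorem theorem1 (R : realType) (n : nat)
    (Phi : set 'cV[R]_n) (Delta : 'I_n -> 'cV[R]_n) (k : nat) (j om : R[i])
    (hPhi : simple_root_system Phi) (hDelta : simple_roots Phi Delta)
    (hk : (1 <= k)%N)
    (hj : j ^+ 4 = 1) (hom : om ^+ 3 = cexpi (n%:R * pi / 4) * j^-1) :
  (* the direct sum decomposition *)
  (forall F, L2Z Phi k F ->
     (L2ZW Phi k F /\
      {ae volk k, forall t, exists x0 x1,
         [/\ Ck Phi k false x0, Ck Phi k true x1 &
             forall c, F t c = x0 c + x1 c]}) <->
     (exists F0 F1, [/\ L2W_Ck Phi k false F0, L2W_Ck Phi k true F1 &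
        eqZ F (fun t c => F0 t c + F1 t c)])) /\
  (forall F0 F1, L2W_Ck Phi k false F0 -> L2W_Ck Phi k true F1 ->
     eqZ (fun t c => F0 t c + F1 t c) (fun _ _ => 0) ->
     eqZ F0 (fun _ _ => 0) /\ eqZ F1 (fun _ _ => 0)) /\
  (* rho'_{k,eps} = (rS eps, rT eps) and rho''_{k,eps} = (mS eps, mT eps) *)
  exists (rS rT : bool -> ('cV[R]_n -> R[i]) -> ('cV[R]_n -> R[i]))
         (mS mT : bool -> (Zk Phi k -> R[i]) -> (Zk Phi k -> R[i])),
  (forall eps : bool,
     [/\ SL2Z_rep (L2W Phi k eps) (aeeq k) (rS eps) (rT eps),
         L2_isometry k (L2W Phi k eps) (rS eps),
         L2_isometry k (L2W Phi k eps) (rT eps) &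
         SL2Z_rep (Ck Phi k eps) eq (mS eps) (mT eps)]) /\
  (* rho_hat = (rho'_0 (x) rho''_0) (+) (rho'_1 (x) rho''_1) *)
  (forall m0 (f0 : 'I_m0 -> 'cV[R]_n -> R[i]) (x0 : 'I_m0 -> Zk Phi k -> R[i])
          m1 (f1 : 'I_m1 -> 'cV[R]_n -> R[i]) (x1 : 'I_m1 -> Zk Phi k -> R[i]),
     (forall i, L2W Phi k false (f0 i) /\ Ck Phi k false (x0 i)) ->
     (forall i, L2W Phi k true (f1 i) /\ Ck Phi k true (x1 i)) ->
     forall G, L2Z Phi k G ->
     (rho_hat Phi k Delta Stilde
        (fun t c => tens f0 x0 t c + tens f1 x1 t c) G <->
      eqZ G (fun t c =>
        tens (fun i => rS false (f0 i)) (fun i => mS false (x0 i)) t c +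
        tens (fun i => rS true (f1 i)) (fun i => mS true (x1 i)) t c)) /\
     (rho_hat Phi k Delta Ttilde
        (fun t c => tens f0 x0 t c + tens f1 x1 t c) G <->
      eqZ G (fun t c =>
        tens (fun i => rT false (f0 i)) (fun i => mT false (x0 i)) t c +
        tens (fun i => rT true (f1 i)) (fun i => mT true (x1 i)) t c))) /\
  (* formulas for rho'_{k,eps} *)
  (forall (eps : bool) f, L2W Phi k eps f ->
     cintegrable (volk k) (chamber Delta) f ->
     {ae volk k, forall t, chamber Delta t ->
        rS eps f t = j * cint (volk k) (chamber Delta) (fun u =>
          f u * \sum_(w \in weyl Phi) chi eps w * bracket k (w *m t) u)}) /\
  (forall (eps : bool) f, L2W Phi k eps f ->
     {ae volk k, forall t, chamber Delta t ->
        rT eps f t = om * cexpi (- pi * ipk k t t) * f t}) /\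
  (* formulas for rho''_{k,0} *)
  mx_entries (Ikbar Phi Delta k) (ebasis Phi k false) (mS false)
    (fun a b => j^-1 / toC (Num.sqrt (ncard (Zk Phi k))%:R)
                / toC (ncard (stab Phi a))%:R *
                \sum_(w \in weyl Phi) bracket k (- (w *m a)) b) /\
  mx_entries (Ikbar Phi Delta k) (ebasis Phi k false) (mT false)
    (fun a b => om^-1 * cexpi (pi * ipk k a a) * (a == b)%:R) /\
  (* formulas for rho''_{k,1} *)
  mx_entries (Ik Phi Delta k) (ebasis Phi k true) (mS true)
    (fun a b => j^-1 / toC (Num.sqrt (ncard (Zk Phi k))%:R) *
                \sum_(w \in weyl Phi) chi true w * bracket k (- (w *m a)) b) /\
  mx_entries (Ik Phi Delta k) (ebasis Phi k true) (mT true)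
    (fun a b => om^-1 * cexpi (pi * ipk k a a) * (a == b)%:R).
Proof.
split; first by move=> F; exact: (decomposition hPhi hDelta hk).
split; first exact: (sum_unique hPhi hDelta hk).
exists (fun _ => rS k j), (fun _ => rT k om), (fun _ => @mS _ _ Phi k j), (fun _ => @mT _ _ Phi k om).
split.
  move=> eps; split.
  - exact: rS_rT_rep.
  - exact: rS_isometry.
  - exact: (rT_isometry (j := j)).
  - exact: (mS_mT_rep hPhi hDelta).
split; first by move=> *; exact: rho_tens.
split; first by move=> eps f; exact: rS_chamber.
split; first by move=> eps f _; apply: aeW => t _; rewrite /rT mulrA.
split; first exact: mS_entries0.
split; first by apply: (mT_entries om hPhi hDelta hk) => a [].
split; first exact: mS_entries1.
by apply: (mT_entries om hPhi hDelta hk) => a [].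
Qed.
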